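(* Let assumptions (a) and (b) of the context hold and let $\mu=\rho\,dx$ and $\mathbb{M}$ be as in the context. Let $r\in[q,\infty]$, $t>0$ and let $B$ be an open ball in $\mathbb{R}^d$. (i) For any $f\in L^r(\mathbb{R}^d,\mu)$, $$\sup_{x\in\overline{B}}\mathbb{E}_x\Big[\int_0^t|f|(X_s)\,ds\Big]\le e^tc_{B,r}\|f\|_{L^r(\mathbb{R}^d,\mu)},$$ where $c_{B,r}>0$ is independent of $f$ and $t>0$. In particular, if $\rho\in L^\infty(\mathbb{R}^d)$, then for any $f\in L^r(\mathbb{R}^d)$ (Lebesgue measure), $$\sup_{x\in\overline{B}}\mathbb{E}_x\Big[\int_0^t|f|(X_s)\,ds\Big]\le e^tc_{B,r}\|\rho\|_{L^\infty(\mathbb{R}^d)}\|f\|_{L^r(\mathbb{R}^d)}.$$ (ii) Let $V$ be an open ball in $\mathbb{R}^d$. Then for any $f\in L^q(\mathbb{R}^d)$ with $\mathrm{supp}(f)\subset V$, $$\sup_{x\in\overline{B}}\mathbb{E}_x\Big[\int_0^t|f|(X_s)\,ds\Big]\le e^tc_{B,q}\|\rho\|_{L^\infty(V)}\|f\|_{L^q(\mathbb{R}^d)},$$ where $c_{B,q}>0$ is a constant as in (i) (for $r=q$).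
   Context: Let $d\ge2$, $p\in(d,\infty)$, $q=\frac{pd}{p+d}$. For a matrix $B=(b_{ij})$ of functions, $\nabla B$ is the vector field with $i$-th component $\sum_j\partial_jb_{ij}$. Assumption (a): $A=(a_{ij})$ with $a_{ji}=a_{ij}\in H^{1,2}_{loc}(\mathbb{R}^d)\cap C(\mathbb{R}^d)$, such that for every relatively compact $V$ there is $\nu_V>0$ with $\nu_V^{-1}\|\xi\|^2\le\langle A(x)\xi,\xi\rangle\le\nu_V\|\xi\|^2$ for all $\xi\in\mathbb{R}^d$, $x\in V$; $C=(c_{ij})$ with $-c_{ji}=c_{ij}\in H^{1,2}_{loc}(\mathbb{R}^d)\cap C(\mathbb{R}^d)$; $\mathbf{H}\in L^p_{loc}(\mathbb{R}^d,\mathbb{R}^d)$. Put $\mathbf{G}=(g_1,\dots,g_d)=\tfrac12\nabla(A+C^T)+\mathbf{H}$ and $Lf=\tfrac12\sum_{i,j}a_{ij}\partial_{ij}f+\sum_ig_i\partial_if$, $f\in C^2(\mathbb{R}^d)$. Assumption (b): $\mathbf{G}\in L^q_{loc}(\mathbb{R}^d,\mathbb{R}^d)$. Measure: $\mu=\rho\,dx$, where $\rho\in H^{1,p}_{loc}(\mathbb{R}^d)\cap C(\mathbb{R}^d)$, $\rho>0$ everywhere, and $\int Lf\,d\mu=0$ for all $f\in C_0^\infty(\mathbb{R}^d)$ (such $\rho$ exists under (a); one is fixed). Semigroup: put $\beta^{\rho,A}_i=\tfrac12\sum_j(\partial_ja_{ij}+a_{ij}\tfrac{\partial_j\rho}\rho)$,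 $\mathbf{B}=\mathbf{G}-\beta^{\rho,A}$. For relatively compact open $V$ let $(L^{0,V},D(L^{0,V}))$ be the self-adjoint generator on $L^2(V,\mu)$ of the closure of $\tfrac12\int_V\langle A\nabla u,\nabla v\rangle d\mu$, $u,v\in C_0^\infty(V)$. The operator $L^{0,V}u+\langle\mathbf{B},\nabla u\rangle$ on bounded $u\in D(L^{0,V})$ is closable in $L^1(V,\mu)$ and its closure generates a sub-Markovian $C_0$-semigroup of contractions, with resolvent $\overline{G}^V_\alpha$; put $\overline{G}^V_\alpha f:=\overline{G}^V_\alpha(f1_V)$ (zero outside $V$) for $f\in L^1(\mathbb{R}^d,\mu)$. For relatively compact open $V_n\uparrow\mathbb{R}^d$ the limits $\overline{G}_\alpha f=\lim_n\overline{G}^{V_n}_\alpha f$ exist in $L^1(\mathbb{R}^d,\mu)$, do not depend on $(V_n)$, and form the resolvent of a sub-Markovian $C_0$-semigroup of contractions $(\overline{T}_t)_{t>0}$ on $L^1(\mathbb{R}^d,\mu)$, whose generator extends $(L,C_0^\infty(\mathbb{R}^d))$. $(T_t)_{t>0}$ denotes the sub-Markovian semigroup on every $L^s(\mathbb{R}^d,\mu)$, $s\in[1,\infty]$, obtained by restricting $(\overline{T}_t)$ to $L^1\cap L^\infty$ and extending. For $f\in\bigcup_{s\in[1,\infty]}L^s(\mathbb{R}^d,\mu)$ and $t>0$, $T_tf$ has a continuous $\mu$-version, denoted $P_tf$; $P_0=\mathrm{id}$. Process: under (a) and (b), $\mathbb{M}=(\Omega,\mathcal{F},(\mathcal{F}_t)_{t\ge0},(X_t)_{t\ge0},(\mathbb{P}_x)_{x\in\mathbb{R}^d\cup\{\Delta\}})$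 is the Hunt process with state space $\mathbb{R}^d$, with continuous sample paths on the one-point compactification $\mathbb{R}^d_\Delta$ (absorbed at $\Delta$ after the lifetime $\zeta=\inf\{t\ge0:X_t=\Delta\}$), such that $P_tf(x)=\mathbb{E}_x[f(X_t)]$ for all $t\ge0$, $x\in\mathbb{R}^d$, $f$ bounded Borel, with $f(\Delta):=0$; $\mathbb{E}_x$ is the expectation with respect to $\mathbb{P}_x$.
   Formalization: In (ii) the constant, which also satisfies (i) for r=q, may depend on V: with the first power of the L^∞(V) norm of ρ, one constant for all balls V is false in general (e.g. d=2, A=(1+|x|²)^{k/2}I, ρ=(1+|x|²)^{-k/2}, G=0, k>2). *)

(* Defs.v *)
From HB Require Import structures.
From mathcomp Require Import all_boot all_order all_algebra.
From mathcomp Require Import all_classical all_reals all_analysis.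
From mathcomp Require Import measurable_realfun one_point_compactification.

Set Implicit Arguments.
Unset Strict Implicit.
Unset Printing Implicit Defensive.
Import Order.TTheory GRing.Theory Num.Theory.
Import numFieldNormedType.Exports.
Local Open Scope classical_set_scope.
Local Open Scope ring_scope.

(* R^d is 'rV[R]_d: its library topology is the usual one (its library norm,
   not used below, is the sup norm); it carries the Borel sigma-algebra. *)
Section borel_rV.
Variables (R : realType) (n : nat).

HB.instance Definition _ := @isMeasurable.Build
  (sigma_display (@open 'rV[R]_n)) 'rV[R]_n <<s (@open 'rV[R]_n) >>
  (@sigma_algebra0 _ setT _) (@sigma_algebraC _ _)
  (@sigma_algebra_bigcup _ setT _).

End borel_rV.

Section borel_compactification.
Variable T : topologicalType.
Local Notation TD := (one_point_compactification T).

HB.instance Definition _ := @isMeasurable.Build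
  (sigma_display (@open TD)) TD <<s (@open TD) >>
  (@sigma_algebra0 _ setT _) (@sigma_algebraC _ _)
  (@sigma_algebra_bigcup _ setT _).

End borel_compactification.

(* Lebesgue measure on R^n: the n-fold product of the one-dimensional Lebesgue
   measure, built on n.-tuple R and transported to 'rV[R]_n. *)
Section lebesgue_step.
Variables (R : realType) (n : nat).
Local Notation TR := (measurableTypeR R).
Variable m : {sigma_finite_measure set (n.-tuple TR) -> \bar R}.
Local Open Scope ereal_scope.

Definition consT (x : TR * n.-tuple TR) : n.+1.-tuple TR := [tuple of x.1 :: x.2].

Lemma measurable_consT : measurable_fun [set: TR * n.-tuple TR] consT.
Proof. exact: (measurable_cons measurable_fst measurable_snd). Qed.

Definition leb_step : set (n.+1.-tuple TR) -> \bar R :=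
  pushforward (@lebesgue_measure R \x m) consT.

Let leb_step0 : leb_step set0 = 0.
Proof. by rewrite /leb_step /pushforward preimage_set0 measure0. Qed.

Let leb_step_ge0 A : 0 <= leb_step A.
Proof. by rewrite /leb_step /pushforward. Qed.

Let mpre (A : set (n.+1.-tuple TR)) : measurable A -> measurable (consT @^-1` A).
Proof. by move=> mA; rewrite -[X in measurable X]setTI; exact: measurable_consT. Qed.

Let leb_step_sigma_additive : semi_sigma_additive leb_step.
Proof.
move=> F mF tF mUF; rewrite /leb_step /pushforward preimage_bigcup.
apply: measure_semi_sigma_additive.
- by move=> k; exact: mpre.
- apply/trivIsetP => /= i j _ _ ij; rewrite -preimage_setI.
  by move/trivIsetP : tF => /(_ _ _ _ _ ij) ->//; rewrite preimage_set0.
- by rewrite -preimage_bigcup; exact: mpre.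
Qed.

HB.instance Definition _ := isMeasure.Build _ _ _ leb_step
  leb_step0 leb_step_ge0 leb_step_sigma_additive.

Let leb_step_sigma_finite : sigma_finite setT leb_step.
Proof.
have /sigma_finiteP[F [TF ndF Foo]] := sigma_finiteT (@lebesgue_measure R).
have /sigma_finiteP[G [TG ndG Goo]] := sigma_finiteT m.
pose h (t : n.+1.-tuple TR) : TR * n.-tuple TR := (thead t, [tuple of behead t]).
have hK : cancel consT h.
  by move=> [x t]; rewrite /h /consT theadE; congr pair; exact/val_inj.
have mh : measurable_fun [set: n.+1.-tuple TR] h.
  apply/measurable_fun_pair => /=; last exact: measurable_behead.
  exact: measurable_tnth.
exists (fun k => h @^-1` (F k `*` G k)).
  apply/esym/seteqP; split=> // t _.
  have [i _ Fi] : (\bigcup_i F i) (h t).1 by rewrite -TF.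
  have [j _ Gj] : (\bigcup_i G i) (h t).2 by rewrite -TG.
  exists (maxn i j) => //; split.
  - by move: Fi; exact/subsetPset/ndF/leq_maxl.
  - by move: Gj; exact/subsetPset/ndG/leq_maxr.
move=> k; have [mFk Fkoo] := Foo k; have [mGk Gkoo] := Goo k; split.
  rewrite -[X in measurable X]setTI; apply: mh => //.
  exact: measurableX.
rewrite /leb_step /pushforward (_ : _ @^-1` _ = F k `*` G k).
  by rewrite product_measure1E// lte_mul_pinfty// ge0_fin_numE.
by rewrite -comp_preimage (_ : h \o consT = id) ?preimage_id//; exact/funext.
Qed.

HB.instance Definition _ := Measure_isSigmaFinite.Build _ _ _ leb_step
  leb_step_sigma_finite.

End lebesgue_step.

Section lebesgue_rV.
Variable R : realType.
Local Notation TR := (measurableTypeR R).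
Local Open Scope ereal_scope.

Fixpoint leb_tuple n : {sigma_finite_measure set (n.-tuple TR) -> \bar R} :=
  match n with
  | 0%N => dirac [tuple]
  | n'.+1 => leb_step (leb_tuple n')
  end.

Definition row_of n (t : n.-tuple TR) : 'rV[R]_n := \row_i tnth t i.

Lemma measurable_row_of n : measurable_fun [set: n.-tuple TR] (@row_of n).
Proof.
apply: (@measurability _ _ (n.-tuple TR) 'rV[R]_n _ _ (@open 'rV[R]_n)) => //.
move=> _ [U oU <-]; rewrite setTI.
pose near_rat (p : 'rV[rat]_n * nat) (w : 'I_n -> R) :=
  forall i, (`|ratr (p.1 ord0 i) - w i| < p.2.+1%:R^-1)%R.
pose D := [set p | forall v : 'rV[R]_n, near_rat p (v ord0) -> U v].
pose box p := [set t : n.-tuple TR | near_rat p (tnth t)].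
have mbox p : measurable (box p).
  have -> : box p = \bigcap_(i in [set: 'I_n])
      ((fun t : n.-tuple TR => tnth t i) @^-1`
        [set y : TR | (`|ratr (p.1 ord0 i) - (y : R)| < p.2.+1%:R^-1)%R]).
    by apply/seteqP; split=> [t tp i _|t tp i]; exact: tp.
  apply: fin_bigcap_measurable => // i _.
  rewrite -[X in measurable X]setTI; apply: measurable_tnth => //.
  rewrite (_ : [set y | _] = [set` `](ratr (p.1 ord0 i) - p.2.+1%:R^-1)%R,
      (ratr (p.1 ord0 i) + p.2.+1%:R^-1)%R[]); first exact: measurable_itv.
  by apply/seteqP; split=> y; rewrite /= in_itv /= -ltr_distlC.
pose F (k : nat) := if unpickle k is Some p then
  (if `[< D p >] then box p else set0) else set0.
rewrite (_ : _ @^-1` U = \bigcup_k F k); last first.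
  apply/seteqP; split=> [t Ut|t [k _]].
    have /nbhs_ballP[e /= e0 eU] : nbhs (row_of t) U by exact: open_nbhs_nbhs.
    have e20 : (0 < e / 2)%R by rewrite divr_gt0.
    have [k _ /(_ k (leqnn k)) ke] := near_infty_natSinv_lt (PosNum e20).
    have /boolp.choice[q qP] : forall i, exists r : rat,
        (`|ratr r - tnth t i| < k.+1%:R^-1)%R.
      move=> i; have /rat_in_itvoo[r] :
          (tnth t i - k.+1%:R^-1 < tnth t i + k.+1%:R^-1 :> R)%R.
        by rewrite ltrD2l gtrN// invr_gt0.
      by rewrite in_itv /= -ltr_distlC distrC => rP; exists r.
    exists (pickle (\row_i q i, k)) => //; rewrite /F pickleK.
    case: asboolP => [_ i /=|nD]; first by rewrite mxE.
    case: nD => v /= vq; apply: eU; split=> // i j.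
    rewrite (ord1 i) mxE /ball /= [e]splitr.
    rewrite -[X in (X - _)%R](subrK (ratr (q j))) -addrA.
    apply: (le_lt_trans (ler_normD _ _)); apply: ltrD.
      by rewrite distrC; exact: lt_trans (qP j) ke.
    by apply: lt_trans ke; have := vq j; rewrite /= mxE.
  rewrite /F; case: unpickle => // p; case: asboolP => // Dp tp.
  by apply: Dp => i; rewrite mxE; exact: tp.
apply: bigcupT_measurable => k; rewrite /F.
by case: unpickle => // p; case: ifP.
Qed.

Section leb.
Variable n : nat.

Definition leb : set 'rV[R]_n -> \bar R := pushforward (leb_tuple n) (@row_of n).

Let leb0 : leb set0 = 0.
Proof. by rewrite /leb /pushforward preimage_set0 measure0. Qed.

Let leb_ge0 A : 0 <= leb A.
Proof. by rewrite /leb /pushforward. Qed.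

Let mpre (A : set 'rV[R]_n) : measurable A -> measurable (@row_of n @^-1` A).
Proof.
by move=> mA; rewrite -[X in measurable X]setTI; exact: measurable_row_of.
Qed.

Let leb_sigma_additive : semi_sigma_additive leb.
Proof.
move=> F mF tF mUF; rewrite /leb /pushforward preimage_bigcup.
apply: measure_semi_sigma_additive.
- by move=> k; exact: mpre.
- apply/trivIsetP => /= i j _ _ ij; rewrite -preimage_setI.
  by move/trivIsetP : tF => /(_ _ _ _ _ ij) ->//; rewrite preimage_set0.
- by rewrite -preimage_bigcup; exact: mpre.
Qed.

HB.instance Definition _ := isMeasure.Build _ _ _ leb
  leb0 leb_ge0 leb_sigma_additive.

End leb.

End lebesgue_rV.

Section analysis.
Variables (R : realType) (d : nat).
Local Notation E := 'rV[R]_d.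
Local Notation leb := (@leb R d).

Definition dotv (x y : E) : R := \sum_i x 0 i * y 0 i.

Definition eball (z : E) (b : R) : set E :=
  [set x | dotv (x - z) (x - z) < b ^+ 2].

(* the vector A xi, with vectors stored as rows *)
Definition mulv (A : 'M[R]_d) (xi : E) : E := xi *m A^T.

Definition partial (i : 'I_d) (f : E -> R) (x : E) : R :=
  'D_(delta_mx 0 i) f x.

Definition grad (f : E -> R) (x : E) : E := \row_i partial i f x.

Fixpoint Ck (k : nat) (f : E -> R) : Prop :=
  continuous f /\
  if k is k'.+1 then forall i, (forall x, derivable f x (delta_mx 0 i)) /\
                               Ck k' (partial i f)
  else True.

Definition supp (f : E -> R) : set E := closure [set x | f x != 0].

(* C_0^oo(U) *)
Definition test_fun (U : set E) (f : E -> R) : Prop :=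
  [/\ forall k, Ck k f, compact (supp f) & supp f `<=` U].

Definition relcompact_open (V : set E) : Prop :=
  open V /\ compact (closure V).

(* L^s_loc(U) *)
Definition Lploc (U : set E) (s : R) (f : E -> R) : Prop :=
  measurable_fun U f /\
  forall K, compact K -> K `<=` U -> (f \_ K) \in Lfun leb s%:E.

Definition is_weak_partial (U : set E) (i : 'I_d) (f g : E -> R) : Prop :=
  [/\ Lploc U 1 f, Lploc U 1 g &
   forall phi, test_fun U phi ->
     \int[leb]_(x in U) (f x * partial i phi x) =
     - \int[leb]_(x in U) (g x * phi x)].

(* the i-th weak partial derivative on U, defined up to a Lebesgue null set;
   0 by convention if there is none *)
Definition weakD (U : set E) (i : 'I_d) (f : E -> R) : E -> R :=
  xget (fun=> 0) [set g | is_weak_partial U i f g].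

(* H^{1,s}_loc(R^d) *)
Definition H1loc (s : R) (f : E -> R) : Prop :=
  Lploc setT s f /\
  forall i, exists2 g, is_weak_partial setT i f g & Lploc setT s g.

(* the vector field with i-th component sum_j d_j b_ij *)
Definition nabla_mx (B : E -> 'M[R]_d) (x : E) : E :=
  \row_i \sum_j weakD setT j (fun y => B y i j) x.

Record assumption_a (p : R) (A C : E -> 'M[R]_d) (H : E -> E) : Prop := {
  a_sym : forall x i j, A x j i = A x i j ;
  a_sobolev : forall i j, H1loc 2 (fun x => A x i j) ;
  a_continuous : forall i j, continuous (fun x => A x i j) ;
  a_elliptic : forall V, compact (closure V) ->
    exists2 nu : R, 0 < nu & forall x xi, V x ->
      nu^-1 * dotv xi xi <= dotv (mulv (A x) xi) xi <= nu * dotv xi xi ;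
  c_antisym : forall x i j, - C x j i = C x i j ;
  c_sobolev : forall i j, H1loc 2 (fun x => C x i j) ;
  c_continuous : forall i j, continuous (fun x => C x i j) ;
  h_Lploc : forall i, Lploc setT p (fun x => H x 0 i) }.

Definition drift (A C : E -> 'M[R]_d) (H : E -> E) (x : E) : E :=
  2^-1 *: nabla_mx (fun y => A y + (C y)^T) x + H x.

Definition assumption_b (q : R) (G : E -> E) : Prop :=
  forall i, Lploc setT q (fun x => G x 0 i).

Definition Lop (A : E -> 'M[R]_d) (G : E -> E) (f : E -> R) (x : E) : R :=
  2^-1 * (\sum_i \sum_j A x i j * partial i (partial j f) x) +
  \sum_i G x 0 i * partial i f x.

(* mu = rho dx is an infinitesimally invariant measure for L *)
Record invariant_density (p : R) (A : E -> 'M[R]_d) (G : E -> E)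
    (rho : E -> R) (mu : set E -> \bar R) : Prop := {
  rho_sobolev : H1loc p rho ;
  rho_continuous : continuous rho ;
  rho_gt0 : forall x, 0 < rho x ;
  mu_density : forall U, measurable U ->
    mu U = (\int[leb]_(x in U) (rho x)%:E)%E ;
  mu_invariant : forall f, test_fun setT f ->
    (\int[mu]_x (Lop A G f x)%:E = 0)%E }.

Definition log_drift (A : E -> 'M[R]_d) (rho : E -> R) (x : E) : E :=
  \row_i (2^-1 * \sum_j (weakD setT j (fun y => A y i j) x +
                          A x i j * (weakD setT j rho x / rho x))).

End analysis.

Section semigroup.
Variables (R : realType) (d : nat).
Local Notation E := 'rV[R]_d.
Variables (mu : {measure set E -> \bar R}) (A : E -> 'M[R]_d) (B : E -> E).

(* Elements of L^s(V, mu) are represented by functions on R^d, whose values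
   outside V are irrelevant. *)
Definition inL (s : \bar R) (V : set E) (f : E -> R) : Prop :=
  (f \_ V) \in Lfun mu s.

Definition distL (s : \bar R) (V : set E) (f g : E -> R) : \bar R :=
  'N[mu]_s[EFin \o ((f \- g) \_ V)].

Definition dform (V : set E) (u v : E -> R) : R :=
  2^-1 * \int[mu]_(x in V) dotv (mulv (A x) (grad u x)) (grad v x).

(* the sequences whose limits form the domain of the closure of the form *)
Definition form_approx (V : set E) (u : E -> R) (un : nat -> E -> R) : Prop :=
  [/\ inL 2%:E V u, forall n, test_fun V (un n),
      distL 2%:E V (un n) u @[n --> \oo] --> 0%E &
      forall e : R, 0 < e -> exists N, forall m n, (N <= m)%N -> (N <= n)%N ->
        dform V (un m \- un n) (un m \- un n) < e].

Definition form_dom (V : set E) (u : E -> R) : Prop :=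
  exists un, form_approx V u un.

(* the closed form takes the value c at (u, v) *)
Definition form_value (V : set E) (u v : E -> R) (c : R) : Prop :=
  exists un vn, [/\ form_approx V u un, form_approx V v vn &
                    dform V (un n) (vn n) @[n --> \oo] --> c].

(* u is in D(L^{0,V}) and w = L^{0,V} u *)
Definition gen0 (V : set E) (u w : E -> R) : Prop :=
  [/\ form_dom V u, inL 2%:E V w &
   forall v, form_dom V v ->
     form_value V u v (- \int[mu]_(x in V) (w x * v x))].

(* u is a bounded element of D(L^{0,V}) and w = L^{0,V} u + <B, grad u> *)
Definition gen_bounded (V : set E) (u w : E -> R) : Prop :=
  (exists M : R, \forall x \ae mu, V x -> `|u x| <= M) /\
  exists2 w0, gen0 V u w0 &
    \forall x \ae mu, V x ->
      w x = w0 x + dotv (B x) (\row_i weakD V i u x).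

(* the graph of its closure in L^1(V, mu) *)
Definition gen_closure (V : set E) (u w : E -> R) : Prop :=
  [/\ inL 1 V u, inL 1 V w & exists un wn,
    [/\ forall n, [/\ inL 1 V (un n), inL 1 V (wn n) &
                      gen_bounded V (un n) (wn n)],
        distL 1 V (un n) u @[n --> \oo] --> 0%E &
        distL 1 V (wn n) w @[n --> \oo] --> 0%E]].

(* u is the resolvent of order alpha on V of f 1_V: (alpha - closure) u = f *)
Definition resolventV (V : set E) (alpha : R) (f u : E -> R) : Prop :=
  inL 1 V f /\ gen_closure V u (fun x => alpha * u x - f x).

Definition exhaustion (Vn : nat -> set E) : Prop :=
  [/\ forall n, relcompact_open (Vn n),
      forall m n, (m <= n)%N -> Vn m `<=` Vn n & \bigcup_n Vn n = setT].

(* g is the resolvent of order alpha on R^d of f *)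
Definition resolvent (alpha : R) (f g : E -> R) : Prop :=
  [/\ inL 1 setT f, inL 1 setT g &
   forall Vn, exhaustion Vn -> exists un,
     (forall n, resolventV (Vn n) alpha f (un n)) /\
     distL 1 setT ((un n) \_ (Vn n)) g @[n --> \oo] --> 0%E].

(* A family (S_t)_{t > 0} of operators on L^1(R^d, mu) is represented by a
   function on functions, compatible with almost everywhere equality. *)
Record subMarkov_C0_contractions (S : R -> (E -> R) -> E -> R) : Prop := {
  S_L1 : forall (t : R) f, 0 < t -> inL 1 setT f -> inL 1 setT (S t f) ;
  S_ae : forall (t : R) f g, 0 < t -> inL 1 setT f -> inL 1 setT g ->
    (\forall x \ae mu, f x = g x) -> \forall x \ae mu, S t f x = S t g x ;
  S_linear : forall (t k : R) f g, 0 < t -> inL 1 setT f -> inL 1 setT g ->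
    \forall x \ae mu, S t (fun y => k * f y + g y) x = k * S t f x + S t g x ;
  S_semigroup : forall (s t : R) f, 0 < s -> 0 < t -> inL 1 setT f ->
    \forall x \ae mu, S (s + t) f x = S s (S t f) x ;
  S_contraction : forall (t : R) f, 0 < t -> inL 1 setT f ->
    ('N[mu]_1[EFin \o S t f] <= 'N[mu]_1[EFin \o f])%E ;
  S_continuous : forall f, inL 1 setT f ->
    distL 1 setT (S t f) f @[t --> 0^'+] --> 0%E ;
  S_subMarkov : forall (t : R) f, 0 < t -> inL 1 setT f ->
    (\forall x \ae mu, 0 <= f x <= 1) ->
    \forall x \ae mu, 0 <= S t f x <= 1 }.

(* u is in the domain of the generator of S, which maps u to w *)
Definition generator (S : R -> (E -> R) -> E -> R) (u w : E -> R) : Prop :=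
  [/\ inL 1 setT u, inL 1 setT w &
      distL 1 setT (fun x => t^-1 * (S t u x - u x)) w @[t --> 0^'+] --> 0%E].

(* the resolvents (alpha - generator)^-1 of S are the operators above *)
Definition has_resolvent (S : R -> (E -> R) -> E -> R) : Prop :=
  forall (alpha : R) f g, 0 < alpha -> inL 1 setT f -> inL 1 setT g ->
    resolvent alpha f g <-> generator S g (fun x => alpha * g x - f x).

(* g is the image of f under the extension to L^s(R^d, mu) of the restriction
   of S_t to L^1 /\ L^oo: by density for s < oo, and for s = oo by monotone
   limits, applied here to the truncations of f^+ and f^- to growing balls. *)
Definition Ls_extension (S : R -> (E -> R) -> E -> R) (s : \bar R) (t : R)
    (f g : E -> R) : Prop :=
  inL s setT f /\
  if s == +oo%E then
    \forall x \ae mu, S t (f \_ (eball 0 n%:R)) x @[n --> \oo] --> g x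
  else
    inL s setT g /\ exists fn : nat -> E -> R,
      [/\ forall n, inL 1 setT (fn n) /\ inL +oo%E setT (fn n),
          distL s setT (fn n) f @[n --> \oo] --> 0%E &
          distL s setT (S t (fn n)) g @[n --> \oo] --> 0%E].

(* P_t f is the continuous version of T_t f for f in some L^s, and P_0 = id *)
Definition continuous_version (S P : R -> (E -> R) -> E -> R) : Prop :=
  (forall f, P 0 f = f) /\
  forall (s : \bar R) (t : R) f, (1 <= s)%E -> 0 < t -> inL s setT f ->
    continuous (P t f) /\ Ls_extension S s t f (P t f).

End semigroup.

Section process.
Variables (R : realType) (d : nat) (dO : measure_display)
  (Omega : measurableType dO).
Local Notation E := 'rV[R]_d.
Local Notation ED := (one_point_compactification 'rV[R]_d).

(* None is the cemetery point Delta; only times t >= 0 are relevant *)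
Record process := Process {
  filt : R -> set (set Omega) ;
  traj : R -> Omega -> ED ;
  law : ED -> probability Omega R }.

Variable M : process.

Definition stopping_time (tau : Omega -> \bar R) : Prop :=
  (forall w, 0 <= tau w)%E /\
  forall t : R, 0 <= t -> filt M t [set w | (tau w <= t%:E)%E].

Definition stopped_events (tau : Omega -> \bar R) : set (set Omega) :=
  [set F | measurable F /\
    forall t : R, 0 <= t -> filt M t (F `&` [set w | (tau w <= t%:E)%E])].

(* a Hunt process on R^d with continuous paths on the compactification *)
Record hunt_process : Prop := {
  filt_sigma : forall t : R, 0 <= t -> sigma_algebra setT (filt M t) ;
  filt_le : forall s t : R, 0 <= s -> s <= t -> filt M s `<=` filt M t ;
  filt_measurable : forall t : R, 0 <= t -> filt M t `<=` measurable ;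
  filt_right_continuous : forall s : R, 0 <= s ->
    \bigcap_(t in [set t | s < t]) filt M t `<=` filt M s ;
  traj_adapted : forall (t : R) (D : set ED), 0 <= t -> measurable D ->
    filt M t (traj M t @^-1` D) ;
  law_measurable : forall (t : R) (D : set ED), 0 <= t -> measurable D ->
    measurable_fun [set: ED]
      (fun x => law M x (traj M t @^-1` D)) ;
  law_start : forall x, law M x [set w | traj M 0 w = x] = 1%E ;
  traj_continuous : forall w,
    {within [set t : R | 0 <= t], continuous (fun t => traj M t w)} ;
  traj_absorbed : forall w (s t : R), 0 <= s -> s <= t ->
    traj M s w = None -> traj M t w = None ;
  strong_markov : forall tau (x : ED) (t : R) F (D : set ED), stopping_time tau -> 0 <= t ->
    stopped_events tau F -> measurable D ->
    law M x (F `&` [set w | (tau w < +oo)%E /\ D (traj M (fine (tau w) + t) w)])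
    = (\int[law M x]_(w in F `&` [set w | tau w < +oo])
         law M (traj M (fine (tau w)) w) (traj M t @^-1` D))%E ;
  quasi_left_continuous : forall (taun : nat -> Omega -> \bar R) tau x,
    (forall n, stopping_time (taun n)) -> stopping_time tau ->
    (forall n w, taun n w <= taun n.+1 w)%E ->
    (forall w, taun n w @[n --> \oo] --> tau w) ->
    \forall w \ae law M x, (tau w < +oo)%E ->
      traj M (fine (taun n w)) w @[n --> \oo] --> traj M (fine (tau w)) w }.

(* f(Delta) := 0 *)
Definition ext0 (f : E -> R) (y : ED) : R := if y is Some x then f x else 0.

Definition transition_function (P : R -> (E -> R) -> E -> R) : Prop :=
  forall (t : R) (x : E) (f : E -> R), 0 <= t -> measurable_fun setT f ->
    (exists K : R, forall y, `|f y| <= K) ->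
    ('E_(law M (Some x))[fun w => ext0 f (traj M t w)] = (P t f x)%:E)%E.

(* E_x [int_0^t |f|(X_s) ds] *)
Definition occupation (t : R) (f : E -> R) (x : E) : \bar R :=
  (\int[law M (Some x)]_w \int[lebesgue_measure]_(s in `[0%R, t])
     (ext0 (fun y => `|f y|%R) (traj M s w))%:E)%E.

Definition sup_occupation (B : set E) (t : R) (f : E -> R) : \bar R :=
  ereal_sup [set occupation t f x | x in closure B].

Variable mu : {measure set E -> \bar R}.

(* c depends on B and r, but neither on t nor on f *)
Definition occupation_constant (B : set E) (r : \bar R) (c : R) : Prop :=
  0 < c /\ forall (t : R) f, 0 < t -> f \in Lfun mu r ->
    (sup_occupation B t f <= (expR t * c)%:E * 'N[mu]_r[EFin \o f])%E.

End process.

(* the closed support of the class of f modulo Lebesgue null sets *)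
Definition ess_support (R : realType) (d : nat) (f : 'rV[R]_d -> R) :
    set 'rV[R]_d :=
  [set x | forall U, nbhs x U -> ~ \forall y \ae @leb R d, U y -> f y = 0].

(* Main.v *)
(* For f >= 0 put u(x) = E_x[int_0^oo e^(-s) f(X_s) ds].  The occupation time up to t is at most
   e^t u(x), and u is the resolvent of order 1 of f: being a Laplace transform of the semigroup, it
   lies in the domain of its generator, hence it is an L^1 limit of solutions of Dirichlet problems
   on an exhaustion by relatively compact open sets.  Given a bound for u on a ball, subtract a
   smooth barrier W which vanishes on a smaller ball and dominates u near the boundary of the first
   one.  Invariance of mu cancels the drift term <B, grad> when tested against functions of u - W,
   so that the truncations of u - W satisfy energy estimates for the symmetric form alone, with
   source f + L W in L^q.  Together with a Faber-Krahn inequality for functions of small support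
   and Stampacchia's lemma on the measure of level sets, these bound u on the smaller ball; since
   q > d/2, the bound on the larger ball enters with a small factor and is absorbed along a sequence
   of growing balls.  The constant depends only on the L^1 and L^q norms of f.  For f in L^r with
   r >= q only the part of f where |f| > 1 matters, and its L^1 and L^q norms are controlled by the
   L^r norm. *)

From HB Require Import structures.
Require Import Defs.
From mathcomp Require Import finmap.
From mathcomp Require Import all_boot all_order all_algebra.
From mathcomp Require Import all_classical all_reals all_analysis.
From mathcomp Require Import measurable_realfun one_point_compactification.
From mathcomp Require Import ring lra.

Set Implicit Arguments.
Unset Strict Implicit.
Unset Printing Implicit Defensive.
Import Order.TTheory GRing.Theory Num.Theory.
Import numFieldNormedType.Exports.
Local Open Scope classical_set_scope.
Local Open Scope ring_scope.

(** * Lebesgue measure and integrals *)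

(** Two features of the data shape the argument. The field B is only locally square integrable, so
    <B, grad u> cannot be treated as a lower-order term; it can only be cancelled, and this requires
    Phi(u - W) grad(u - W) to be the gradient of a compactly supported function. Hence a subtracted
    barrier instead of a multiplied cutoff, and truncations given together with their primitives.
    What survives, <B, grad W>, completes the symmetric part to L W, where only G occurs, and G is
    in L^q. Moreover u is reached through several nested limits, so the energy estimates are made
    for test functions close to u in L^1(mu), and the limit is taken only in the resulting
    inequality for level sets. The exponents: Faber-Krahn gives m^(2/d), Hoelder's inequality for a
    source in L^q gives m^(1 - 1/q), and 2/d - 1/q = 1/d - 1/p > 0 is the gain required by
    Stampacchia's lemma. A global bound of u only starts the absorption and leaves no trace in the
    constant. Almost everywhere bounds of u hold at every point because P_s f is continuous for s >
    0 and Fatou's lemma applies to the time integral. *)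

Section measurable_monotone_class.
Context d (T : measurableType d) (R : realType).
Local Open Scope ereal_scope.
Import HBNNSimple.

(** A nonnegative measurable function is an increasing limit of simple functions, and each of these
    is a finite sum of nonnegative multiples of indicators. The principle serves the density
    formula, the joint measurability of the transition operators and their semigroup identity. *)
Lemma ge0_measurable_ind (P : (T -> \bar R) -> Prop) :
  (forall D, measurable D -> P (fun x => (\1_D x)%:E)) ->
  (forall (k : R) f, (0 <= k)%R -> measurable_fun setT f -> (forall x, 0 <= f x) ->
     P f -> P (fun x => k%:E * f x)) ->
  (forall f g, measurable_fun setT f -> measurable_fun setT g ->
     (forall x, 0 <= f x) -> (forall x, 0 <= g x) -> P f -> P g ->
     P (fun x => f x + g x)) ->
  (forall (fn : (T -> \bar R)^nat) f, (forall n, measurable_fun setT (fn n)) ->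
     (forall n x, 0 <= fn n x) ->
     (forall x, {homo fn^~ x : n m / (n <= m)%N >-> (n <= m)%E}) ->
     (forall x, fn n x @[n --> \oo] --> f x) -> (forall n, P (fn n)) -> P f) ->
  forall f, measurable_fun setT f -> (forall x, 0 <= f x) -> P f.
Proof.
move=> P1 Pk PD Pl f mf f0.
pose h := nnsfun_approx measurableT mf.
apply: (Pl (fun n => EFin \o h n)).
- by move=> n; exact/measurable_EFinP.
- by move=> n x; rewrite lee_fin.
- by move=> x a b ab; rewrite lee_fin; exact/lefP/nd_nnsfun_approx.
- by move=> x; exact: cvg_nnsfun_approx.
move=> n.
have -> : EFin \o h n = fun x => \sum_(y \in range (h n))
    (y * \1_(h n @^-1` [set y]) x)%:E.
  by apply/funext => x; rewrite /= fimfunE -fsumEFin.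
pose g (y : R) (x : T) : \bar R := (y * \1_(h n @^-1` [set y]) x)%:E.
rewrite -/(g _ _).
have mpre y : measurable (h n @^-1` [set y]) by exact: measurable_funPTI.
have g0 y x : (0 <= y)%R -> 0 <= g y x.
  by move=> y0; rewrite lee_fin mulr_ge0.
have mg y : measurable_fun setT (g y).
  by apply/measurable_EFinP; apply: measurable_funM => //; exact: measurable_indic.
have Pg y : (0 <= y)%R -> P (g y).
  move=> y0; have := Pk y (fun x => (\1_(h n @^-1` [set y]) x)%:E) y0.
  rewrite /g; under [X in _ -> P X]eq_fun do rewrite EFinM.
  apply => //.
  - exact/measurable_EFinP/measurable_indic.
  - by apply: P1; exact: mpre.
have P0 : P (fun=> 0).
  have := P1 set0 measurable0; congr (P _); apply/funext => x.
  by rewrite indic0.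
have rge : forall y, y \in fset_set (range (h n)) -> (0 <= y)%R.
  by move=> y; rewrite in_fset_set// inE => -[x _ <-].
have {}rge : forall y, y \in (fset_set (range (h n)) : seq R) -> (0 <= y)%R by [].
have -> : (fun x => \sum_(y \in range (h n)) (y * \1_(h n @^-1` [set y]) x)%:E)
   = fun x => \sum_(y <- fset_set (range (h n))) g y x.
  by apply/funext => x; rewrite fsbig_finite.
elim: (enum_fset _) rge => [|a s ih] rge.
  by under eq_fun do rewrite big_nil.
under eq_fun do rewrite big_cons.
have rs y : y \in s -> (0 <= y)%R by move=> ys; apply: rge; rewrite in_cons ys orbT.
apply: PD => //.
- by apply: emeasurable_sum => y; exact: mg.
- by move=> x; apply: g0; apply: rge; rewrite in_cons eqxx.
- by move=> x; rewrite big_seq; apply: sume_ge0 => y /rs; exact: g0.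
- by apply: Pg; apply: rge; rewrite in_cons eqxx.
- exact: ih.
Qed.

End measurable_monotone_class.

(** * Borel measurability on R^d *)

Section borel_rV.
Context {R : realType}.
Local Notation E n := 'rV[R]_n.

Lemma measurable_open_rV n (U : set (E n)) : open U -> measurable U.
Proof. exact: sub_sigma_algebra. Qed.

Lemma measurable_closed_rV n (F : set (E n)) : closed F -> measurable F.
Proof.
move=> cF; rewrite -(setCK F); apply: measurableC; apply: measurable_open_rV.
exact: closed_openC.
Qed.

Lemma measurable_compact_rV n (K : set (E n)) : compact K -> measurable K.
Proof.
move=> cK; apply: measurable_closed_rV; apply: compact_closed cK.
exact: (@norm_hausdorff R 'rV[R]_n).
Qed.

Lemma continuous_measurable_rV n (f : E n -> R) :
  continuous f -> measurable_fun setT f.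
Proof.
move=> /continuousP cf; apply: (measurability _ (RGenOpens.measurableE R)) => //.
move=> _ [_ [a [b ->] <-]]; rewrite setTI; apply: measurable_open_rV; apply: cf.
exact: interval_open.
Qed.

Lemma measurable_coord n i : measurable_fun setT (fun x : E n => x 0 i).
Proof. by apply: continuous_measurable_rV => x; exact: coord_continuous. Qed.

Lemma measurable_coord_comp d (T : measurableType d) n (f : T -> E n) i :
  measurable_fun setT f -> measurable_fun setT (fun t => f t 0 i).
Proof. by move=> mf; exact: measurableT_comp (measurable_coord _) mf. Qed.

(** The map factors through tuples, whose sigma-algebra is generated by the coordinates, and
    [row_of] is measurable. *)
Lemma measurable_to_rV d (T : measurableType d) n (f : T -> E n) :
  (forall i, measurable_fun setT (fun t => f t 0 i)) -> measurable_fun setT f.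
Proof.
move=> mf; have -> : f = @row_of R n \o (fun t => [tuple f t 0 i | i < n]).
  apply/funext => t /=; apply/rowP => i.
  by rewrite mxE tnth_mktuple.
apply: measurableT_comp; first exact: measurable_row_of.
apply/measurable_fun_tnthP => i; rewrite /comp.
by under eq_fun do rewrite tnth_mktuple; exact: mf.
Qed.

Lemma measurable_addrV d (T : measurableType d) n (f g : T -> E n) :
  measurable_fun setT f -> measurable_fun setT g ->
  measurable_fun setT (fun t => f t + g t).
Proof.
move=> mf mg; apply: measurable_to_rV => i; under eq_fun do rewrite mxE.
by apply: measurable_funD; exact: measurable_coord_comp.
Qed.

Lemma measurable_opprV d (T : measurableType d) n (f : T -> E n) :
  measurable_fun setT f -> measurable_fun setT (fun t => - f t).
Proof.
move=> mf; apply: measurable_to_rV => i; under eq_fun do rewrite mxE.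
by apply: measurable_funN; exact: measurable_coord_comp.
Qed.

Lemma measurable_scalerV d (T : measurableType d) n (k : T -> R) (f : T -> E n) :
  measurable_fun setT k -> measurable_fun setT f ->
  measurable_fun setT (fun t => k t *: f t).
Proof.
move=> mk mf; apply: measurable_to_rV => i; under eq_fun do rewrite mxE.
by apply: measurable_funM => //; exact: measurable_coord_comp.
Qed.

End borel_rV.

(** * Translation invariance of Lebesgue measure and the volume of cubes *)

Section lebesgue_rV_theory.
Context {R : realType}.
Local Notation TR := (measurableTypeR R).
Local Notation E n := 'rV[R]_n.
Local Open Scope ereal_scope.

Lemma leb_sigma_finite n : sigma_finite setT (@leb R n).
Proof.
have /sigma_finiteP[F [TF ndF Foo]] := sigma_finiteT (leb_tuple R n).
have mrow : measurable_fun setT (fun x : E n => [tuple x 0%R i | i < n] : n.-tuple TR).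
  apply/measurable_fun_tnthP => i; rewrite /comp.
  under eq_fun do rewrite tnth_mktuple; exact: measurable_coord.
exists (fun k => (fun x : E n => [tuple x 0%R i | i < n] : n.-tuple TR) @^-1` F k).
  by rewrite -preimage_bigcup -TF preimage_setT.
move=> k; have [mFk Fkoo] := Foo k; split.
  by rewrite -[X in measurable X]setTI; apply: mrow.
rewrite /leb /= /pushforward (_ : _ @^-1` _ = F k)//.
rewrite -comp_preimage (_ : _ \o _ = id) ?preimage_id//.
apply/funext => t /=; apply: eq_from_tnth => i.
by rewrite tnth_mktuple mxE.
Qed.

HB.instance Definition _ n := Measure_isSigmaFinite.Build _ _ _ (@leb R n)
  (leb_sigma_finite n).

Definition shiftR (a : R) (x : TR) : TR := (x + a)%R.

Lemma measurable_shiftR a : measurable_fun setT (shiftR a).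
Proof. exact: measurable_funD. Qed.

HB.instance Definition _ a := isMeasurableFun.Build _ _ _ _ (shiftR a)
  (@measurable_shiftR a).

(** Both measures agree on half-open intervals, and this characterises Lebesgue measure on the
    line. *)
Lemma lebesgue_measure_shift (a : R) (D : set TR) : measurable D ->
  pushforward (@lebesgue_measure R) (shiftR a) D = lebesgue_measure D.
Proof.
move=> mD; apply/esym/lebesgue_measure_unique => //= _ [[u v]] _ <-.
rewrite /pushforward /=.
rewrite (_ : _ @^-1` _ = `](u - a)%R, (v - a)%R]%classic).
  by rewrite !lebesgue_measure_itv /= !lte_fin ltrD2r -!EFinD opprB addrA addrNK.
by apply/seteqP; split => x /=; rewrite /shiftR !in_itv /= ltrBlDr lerBrDr.
Qed.

Lemma ge0_integral_shift1 (a : R) (f : TR -> \bar R) :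
  measurable_fun setT f -> (forall x, 0 <= f x) ->
  \int[lebesgue_measure]_x f (x + a)%R = \int[lebesgue_measure]_x f x.
Proof.
move=> mf f0.
have ms := @measurable_shiftR a.
have := @ge0_integral_pushforward _ _ _ _ _ _ ms (@lebesgue_measure R) setT f measurableT.
rewrite preimage_setT => <- //.
apply: eq_measure_integral => D mD _; exact: lebesgue_measure_shift.
Qed.

Lemma ge0_integral_leb n (f : E n -> \bar R) :
  measurable_fun setT f -> (forall x, 0 <= f x) ->
  \int[@leb R n]_x f x = \int[leb_tuple R n]_t f (row_of t).
Proof.
move=> mf f0.
have := @ge0_integral_pushforward _ _ _ _ _ _ (@measurable_row_of R n)
  (leb_tuple R n) setT f measurableT mf (fun x _ => f0 x).
by rewrite preimage_setT.
Qed.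

Lemma ge0_integral_leb_tupleS n (f : n.+1.-tuple TR -> \bar R) :
  measurable_fun setT f -> (forall x, 0 <= f x) ->
  \int[leb_tuple R n.+1]_t f t =
  \int[lebesgue_measure]_x \int[leb_tuple R n]_t f (consT (x, t)).
Proof.
move=> mf f0.
have := @ge0_integral_pushforward _ _ _ _ _ _ (@measurable_consT R n)
  ((@lebesgue_measure R) \x (leb_tuple R n)) setT f measurableT mf (fun x _ => f0 x).
rewrite preimage_setT => /= ->.
rewrite fubini_tonelli1//.
by apply: measurableT_comp mf _; exact: measurable_consT.
Qed.

Definition shiftT n (h : n.-tuple TR) (t : n.-tuple TR) : n.-tuple TR :=
  [tuple (tnth t i + tnth h i)%R | i < n].

Lemma measurable_shiftT n h : measurable_fun setT (@shiftT n h).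
Proof.
apply/measurable_fun_tnthP => i; rewrite /comp.
under eq_fun do rewrite tnth_mktuple.
by apply: measurable_funD => //; exact: measurable_tnth.
Qed.

(** Induction on the dimension: Tonelli splits off the first coordinate, the tail is shifted by the
    induction hypothesis and the head by the one-dimensional invariance. *)
Lemma ge0_integral_shiftT n h (f : n.-tuple TR -> \bar R) :
  measurable_fun setT f -> (forall x, 0 <= f x) ->
  \int[leb_tuple R n]_t f (shiftT h t) = \int[leb_tuple R n]_t f t.
Proof.
elim: n h f => [|n ih] h f mf f0.
  by apply: eq_integral => t _; rewrite [shiftT h t]tuple0 [t]tuple0.
rewrite !ge0_integral_leb_tupleS//; last first.
  exact: measurableT_comp mf (measurable_shiftT h).
have mc : measurable_fun setT (f \o @consT R n).
  by apply: measurableT_comp mf _; exact: measurable_consT.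
pose g (x : TR) := \int[leb_tuple R n]_t f (consT (x, t)).
transitivity (\int[lebesgue_measure]_x g (x + thead h)%R).
  apply: eq_integral => x _; rewrite /g.
  rewrite -(ih [tuple of behead h] (fun t => f (consT ((x + thead h)%R, t)))) //.
    apply: eq_integral => t _; congr f; apply: eq_from_tnth => i.
    rewrite !tnth_mktuple; case: (unliftP ord0 i) => [j|] ->.
      rewrite /consT /= !tnthS /= tnth_mktuple.
      congr (_ + _)%R; rewrite tnth_behead; congr tnth.
      by apply/val_inj; rewrite /= inordK// ltnS.
    by rewrite /consT !tnth0.
  by apply: measurableT_comp mc _; exact: measurable_pair1.
apply: ge0_integral_shift1 => [|x]; last exact: integral_ge0.
apply: (@measurable_fun_fubini_tonelli_F _ _ _ _ _ (leb_tuple R n)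
  (f \o @consT R n)) => //.
by move=> z /=.
Qed.

Lemma ge0_integral_shift n (h : E n) (f : E n -> \bar R) :
  measurable_fun setT f -> (forall x, 0 <= f x) ->
  \int[@leb R n]_x f (x + h)%R = \int[@leb R n]_x f x.
Proof.
move=> mf f0.
have mr := @measurable_row_of R n.
rewrite !ge0_integral_leb//; last first.
  apply: measurableT_comp mf _; exact: measurable_addrV.
rewrite -(@ge0_integral_shiftT n [tuple h 0%R i | i < n] (f \o @row_of R n))//.
  apply: eq_integral => t _ /=; congr f; apply/rowP => i.
  by rewrite !mxE !tnth_mktuple.
  exact: measurableT_comp mf mr.
by move=> x /=.
Qed.

Definition box n (l : R) : set (E n) := [set x | forall i, (0 <= x 0 i <= l)%R].
Arguments box : clear implicits.

Lemma measurable_box n l : measurable (box n l).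
Proof.
have -> : box n l = \bigcap_(i in [set: 'I_n])
    ((fun x : E n => x 0%R i) @^-1` `[0%R, l]%classic).
  by apply/seteqP; split=> [x xb i _|x xb i]; have := xb i;
    rewrite /= in_itv/=; exact.
apply: fin_bigcap_measurable => // i _.
rewrite -[X in measurable X]setTI; apply: measurable_coord => //.
Qed.

Lemma leb_box n (l : R) : (0 <= l)%R -> @leb R n (box n l) = (l ^+ n)%:E.
Proof.
move=> l0; rewrite /leb /= /pushforward.
elim: n => [|n ih].
  (* In dimension 0 the measure is the Dirac mass at the empty tuple, in agreement with
     [l ^+ 0 = 1]. *)
  by rewrite /= diracE mem_set// => -[].
rewrite /= /leb_step /pushforward.
rewrite (_ : _ @^-1` _ = `[0%R, l]%classic `*` (@row_of R n @^-1` box n l)).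
  rewrite product_measure1E//; last first.
    by rewrite -[X in measurable X]setTI; apply: measurable_row_of => //; exact: measurable_box.
  rewrite ih exprS EFinM; congr (_ * _).
  transitivity (@lebesgue_measure R `[0%R, l]%classic); first by [].
  rewrite lebesgue_measure_itv/= lte_fin; case: ltgtP l0 => // [l0 _|<- //].
  by rewrite sube0.
apply/seteqP; split=> -[x t] /=.
  move=> b; split; first by have := b ord0; rewrite mxE tnth0 in_itv.
  by move=> i; have := b (lift ord0 i); rewrite !mxE tnthS.
move=> [x0 b] i; rewrite mxE; case: (unliftP ord0 i) => [j|] ->.
  by rewrite tnthS; have := b j; rewrite mxE.
by rewrite tnth0; move: x0; rewrite in_itv.
Qed.

End lebesgue_rV_theory.

Arguments box {R} n l.

(** * Integrals of real-valued functions *)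

Section real_integrals.
Context d (T : measurableType d) (R : realType) (mu : {measure set T -> \bar R}).
Implicit Types f g : T -> R.
Local Notation integ f := (mu.-integrable setT (EFin \o (f : T -> R))).

Lemma integ_measurable f : integ f -> measurable_fun setT f.
Proof. by move=> /measurable_int/measurable_EFinP. Qed.

Lemma integ_le f g : measurable_fun setT f -> integ g ->
  (forall x, `|f x| <= g x) -> integ f.
Proof.
move=> mf ig fg; apply: le_integrable ig => //; first exact/measurable_EFinP.
by move=> x _; rewrite /= lee_fin; apply: le_trans (fg x) (ler_norm _).
Qed.

Lemma integD f g : integ f -> integ g -> integ (fun x => f x + g x).
Proof. by move=> iF ig; exact: (integrableD _ iF ig). Qed.

Lemma integB f g : integ f -> integ g -> integ (fun x => f x - g x).
Proof. by move=> iF ig; exact: (integrableB _ iF ig). Qed.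

Lemma integN f : integ f -> integ (fun x => - f x).
Proof. by move=> iF; exact: (integrableN iF). Qed.

Lemma integZ k f : integ f -> integ (fun x => k * f x).
Proof. by move=> iF; exact: (integrableZl _ k iF). Qed.

Lemma integ0 : integ (fun=> 0).
Proof. exact: integrable0. Qed.

Lemma integ_norm f : integ f -> integ (fun x => `|f x|).
Proof. by move=> iF; exact: (integrable_norm iF). Qed.

Lemma integ_sum (I : Type) (s : seq I) (F : I -> T -> R) :
  (forall i, integ (F i)) -> integ (fun x => \sum_(i <- s) F i x).
Proof.
move=> iF; elim: s => [|a s ih].
  by under eq_fun do rewrite big_nil; exact: integ0.
by under eq_fun do rewrite big_cons; exact: integD.
Qed.

Lemma integM_bounded f g (K : R) : integ f -> measurable_fun setT g ->
  (forall x, `|g x| <= K) -> integ (fun x => f x * g x).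
Proof.
move=> iF mg gK; apply: (@integ_le _ (fun x => K * `|f x|)).
- by apply: measurable_funM => //; exact: integ_measurable.
- exact/integZ/integ_norm.
- by move=> x; rewrite normrM mulrC ler_wpM2r.
Qed.

Lemma IntD f g : integ f -> integ g ->
  \int[mu]_x (f x + g x) = \int[mu]_x f x + \int[mu]_x g x.
Proof. by move=> *; rewrite RintegralD. Qed.

Lemma IntB f g : integ f -> integ g ->
  \int[mu]_x (f x - g x) = \int[mu]_x f x - \int[mu]_x g x.
Proof. by move=> *; rewrite RintegralB. Qed.

Lemma IntZ k f : integ f -> \int[mu]_x (k * f x) = k * \int[mu]_x f x.
Proof. by move=> *; rewrite RintegralZl. Qed.

Lemma Int0 : \int[mu]_x (0 : R) = 0.
Proof. by rewrite /Rintegral integral0_eq. Qed.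

Lemma IntN f : integ f -> \int[mu]_x (- f x) = - \int[mu]_x f x.
Proof.
move=> iF; under eq_Rintegral do rewrite -mulN1r.
by rewrite IntZ// mulN1r.
Qed.

Lemma Int_sum (I : Type) (s : seq I) (F : I -> T -> R) :
  (forall i, integ (F i)) ->
  \int[mu]_x (\sum_(i <- s) F i x) = \sum_(i <- s) \int[mu]_x F i x.
Proof.
move=> iF; elim: s => [|a s ih].
  by under eq_Rintegral do rewrite big_nil; rewrite big_nil Int0.
under eq_Rintegral do rewrite big_cons; rewrite big_cons IntD ?ih//.
exact: integ_sum.
Qed.

Lemma Int_le f g : integ f -> integ g -> (forall x, f x <= g x) ->
  \int[mu]_x f x <= \int[mu]_x g x.
Proof. by move=> iF ig fg; apply: le_Rintegral. Qed.

Lemma Int_ge0 f : (forall x, 0 <= f x) -> 0 <= \int[mu]_x f x.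
Proof. by move=> f0; apply: Rintegral_ge0. Qed.

Lemma Int_norm f : integ f -> `|\int[mu]_x f x| <= \int[mu]_x `|f x|.
Proof. by move=> iF; apply: le_normr_Rintegral. Qed.

Lemma Int_EFin f : integ f -> (\int[mu]_x f x)%:E = (\int[mu]_x (f x)%:E)%E.
Proof. by move=> iF; rewrite fineK//; exact: integrable_fin_num. Qed.

Lemma Int_dominated_cvg (fn : nat -> T -> R) f g :
  (forall n, measurable_fun setT (fn n)) -> measurable_fun setT f ->
  (\forall x \ae mu, fn n x @[n --> \oo] --> f x) -> integ g ->
  (forall n x, `|fn n x| <= g x) ->
  integ f /\ \int[mu]_x fn n x @[n --> \oo] --> \int[mu]_x f x.
Proof.
move=> mfn mf fnf ig fng.
have [iF _ h] := @dominated_convergence _ _ _ mu _ measurableT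
  (fun n x => (fn n x)%:E) (EFin \o f) (EFin \o g)
  (fun n => proj2 (measurable_EFinP _ _) (mfn n))
  (proj2 (measurable_EFinP _ _) mf)
  (filterS (fun x (Hx : fn n x @[n --> \oo] --> f x) _ => cvg_comp _ _ Hx
     (fun A h => h)) fnf) ig
  (aeW _ (fun x n _ => fng n x)).
split => //; apply/fine_cvg; rewrite fineK; last exact: integrable_fin_num.
exact: h.
Qed.

(** Measurability of [g] is asked for separately, since the Borel sigma-algebra is not complete. *)
Lemma integ_ae_eq f g : integ f -> measurable_fun setT g ->
  (\forall x \ae mu, f x = g x) -> integ g.
Proof.
move=> iF mg fg; have mf := integ_measurable iF.
apply/integrableP; split; first exact/measurable_EFinP.
move/integrableP : iF => [_]; apply: le_lt_trans.
rewrite le_eqVlt; apply/orP; left; apply/eqP; apply: ae_eq_integral => //.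
- by apply: measurableT_comp => //; exact/measurable_EFinP.
- by apply: measurableT_comp => //; exact/measurable_EFinP.
- by apply: filterS fg => x /= -> _.
Qed.

Lemma Int_ae_eq f g : measurable_fun setT f -> measurable_fun setT g ->
  (\forall x \ae mu, f x = g x) -> \int[mu]_x f x = \int[mu]_x g x.
Proof.
move=> mf mg fg; rewrite /Rintegral; congr fine; apply: ae_eq_integral => //.
- exact/measurable_EFinP.
- exact/measurable_EFinP.
- by apply: filterS fg => x /= -> _.
Qed.

Lemma Int_eq0_ae f : integ f -> (forall x, 0 <= f x) -> \int[mu]_x f x = 0 ->
  \forall x \ae mu, f x = 0.
Proof.
move=> iF f0 If0.
have : (\int[mu]_(x in setT) `|(EFin \o f) x| = 0)%E.
  under eq_integral do rewrite gee0_abs ?lee_fin//=.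
  by rewrite -Int_EFin// If0.
move=> h; have [+ _] := ae_eq_integral_abs mu measurableT (measurable_int _ iF).
move=> /(_ h) hh; apply: filterS hh => x /= hx.
by have := hx I => -[].
Qed.

End real_integrals.
Notation integ mu f := (integrable mu setT (EFin \o f)).

Section leb_integrals.
Context {R : realType} {d : nat}.
Local Notation E := 'rV[R]_d.
Local Notation leb := (@leb R d).
Implicit Types f g : E -> R.

Lemma compact_bounded_cont (K : set E) f : compact K -> continuous f ->
  exists2 M : R, 0 < M & forall x, K x -> `|f x| <= M.
Proof.
move=> cK cf.
have /compact_bounded[N [_ HN]] : compact (f @` K).
  by apply: continuous_compact => //; exact: continuous_subspaceT.
exists (`|N| + 1); first by rewrite ltr_wpDl.
by move=> x Kx; apply: HN; [rewrite ltr_pwDr// ler_norm|exists x].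
Qed.

Lemma rV_normP (x : E) (M : R) : 0 <= M -> (`|x| <= M <-> forall i, `|x 0 i| <= M).
Proof.
move=> M0; rewrite [in X in X <-> _]/Num.norm /= mx_normrE; split => [h i|h].
  by apply: le_trans h; apply: (le_bigmax _ (fun ij : 'I_1 * 'I_d => `|x ij.1 ij.2|) (0, i)).
by apply/bigmax_leP; split => // -[a i] _ /=; rewrite (ord1 a).
Qed.

Lemma leb_shift (h : E) (D : set E) : measurable D ->
  leb ((fun x => x + h) @^-1` D) = leb D.
Proof.
move=> mD.
have mh : measurable ((fun x => x + h) @^-1` D).
  rewrite -[X in measurable X]setTI; apply: measurable_addrV => //.
rewrite -[X in leb X = _]setIT -[X in _ = leb X]setIT -!integral_indic//.
rewrite -(@ge0_integral_shift _ _ h (fun x => (\1_D x)%:E)) //.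
by apply/measurable_EFinP; exact: measurable_indic.
Qed.

Lemma leb_compact_lty (K : set E) : compact K -> (leb K < +oo)%E.
Proof.
move=> /[dup] cK /compact_bounded[N [_ HN]].
pose M : R := `|N| + 1; have M0 : 0 <= M by rewrite addr_ge0.
have KM x : K x -> forall i, `|x 0 i| <= M.
  by move=> Kx; apply/rV_normP => //; apply: HN => //; rewrite ltr_pwDr// ler_norm.
have H1 : (leb K <= leb ((fun x => x + const_mx M)%R @^-1` box d (2 * M)%R))%E.
  apply: le_measure; rewrite ?inE.
  - exact: measurable_compact_rV.
  - rewrite -[X in measurable X]setTI; apply: measurable_addrV => //.
    exact: measurable_box.
  - move=> x /KM xM i; rewrite !mxE.
    by have := xM i; rewrite ler_norml => /andP[a b]; apply/andP; split; lra.
apply: le_lt_trans H1 _; rewrite leb_shift; last exact: measurable_box.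
by rewrite leb_box ?ltry// mulr_ge0.
Qed.

End leb_integrals.

(** * Locally integrable functions and compactly supported multipliers *)

Section local_integrability.
Context {R : realType} {d : nat}.
Local Notation E := 'rV[R]_d.
Local Notation leb := (@leb R d).
Implicit Types f g : E -> R.

Definition locint f := measurable_fun setT f /\
  forall K, compact K -> integ leb (f \_ K).

(** The name stands for bounded with compact support: these are the multipliers that turn every
    [locint] function into an integrable one, and most integrability claims below reduce to this
    pairing. *)
Definition bcs g := [/\ measurable_fun setT g, exists M : R, forall x, `|g x| <= M &
  exists2 K : set E, compact K & forall x, ~ K x -> g x = 0].

Lemma measurable_restrictE f (K : set E) : measurable K ->
  measurable_fun setT f -> measurable_fun setT (f \_ K).
Proof. by move=> mK mf; apply/(measurable_restrictT _ mK)/measurable_funTS. Qed.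

Lemma integ_restrict_le f g (K : set E) : measurable K -> measurable_fun setT f ->
  integ leb (g \_ K) -> (forall x, K x -> `|f x| <= g x) -> integ leb (f \_ K).
Proof.
move=> mK mf ig fg; apply: integ_le ig _; first exact: measurable_restrictE.
by move=> x; rewrite !patchE; case: ifPn => [/set_mem/fg//|]; rewrite normr0.
Qed.

Lemma integ_cst_compact (c : R) (K : set E) : compact K -> integ leb ((fun=> c) \_ K).
Proof.
move=> cK; have mK := measurable_compact_rV cK.
rewrite -restrict_EFin; apply/integrable_restrict => //; rewrite setTI.
apply: measurable_bounded_integrable => //; first exact: leb_compact_lty.
exact: bounded_cst.
Qed.

Lemma locintM_bcs f g : locint f -> bcs g -> integ leb (fun x => f x * g x).
Proof.
move=> [mf lf] [mg [M gM] [K cK gK]].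
have -> : (fun x => f x * g x) = fun x => (f \_ K) x * g x.
  apply/funext => x; rewrite patchE; case: ifPn => // /negP xK.
  by rewrite gK ?mulr0// => Kx; apply: xK; rewrite inE.
by apply: (@integM_bounded _ _ _ _ _ _ M) => //; exact: lf.
Qed.

Lemma locint_cont f : continuous f -> locint f.
Proof.
move=> cf; have mf := continuous_measurable_rV cf; split => // K cK.
have [M _ fM] := compact_bounded_cont cK cf.
by apply: integ_restrict_le (integ_cst_compact M cK) fM => //;
  exact: measurable_compact_rV.
Qed.

Lemma locint_cst (c : R) : locint (fun=> c).
Proof. by apply: locint_cont; exact: cst_continuous. Qed.

Lemma locintM_cont f c : locint f -> continuous c -> locint (fun x => f x * c x).
Proof.
move=> [mf lf] cc; have mc := continuous_measurable_rV cc.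
split=> [|K cK]; first exact: measurable_funM.
have [M M0 cM] := compact_bounded_cont cK cc.
apply: (@integ_restrict_le _ (fun x => M * `|f x|)).
- exact: measurable_compact_rV.
- exact: measurable_funM.
- have := integZ M (integ_norm (lf _ cK)); congr (integ leb _).
  by apply/funext => x; rewrite !patchE; case: ifP; rewrite ?normr0 ?mulr0.
- by move=> x /cM; rewrite normrM mulrC => H; exact: ler_wpM2r.
Qed.

Lemma locintD f g : locint f -> locint g -> locint (fun x => f x + g x).
Proof.
move=> [mf lf] [mg lg]; split => [|K cK]; first exact: measurable_funD.
have := integD (lf _ cK) (lg _ cK); congr (integ leb _).
by apply/funext => x; rewrite !patchE; case: ifP; rewrite ?addr0.
Qed.

Lemma locintZ k f : locint f -> locint (fun x => k * f x).
Proof.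
move=> [mf lf]; split => [|K cK]; first exact: measurable_funM.
have := integZ k (lf _ cK); congr (integ leb _).
by apply/funext => x; rewrite !patchE; case: ifP; rewrite ?mulr0.
Qed.

Lemma locint_sum (I : Type) (s : seq I) (F : I -> E -> R) :
  (forall i, locint (F i)) -> locint (fun x => \sum_(i <- s) F i x).
Proof.
move=> iF; elim: s => [|a s ih].
  by under eq_fun do rewrite big_nil; exact: locint_cst.
by under eq_fun do rewrite big_cons; exact: locintD.
Qed.

Lemma bcsM_cont f c : bcs f -> continuous c -> bcs (fun x => f x * c x).
Proof.
move=> [mf [M fM] [K cK fK]] cc; have mc := continuous_measurable_rV cc.
have [N N0 cN] := compact_bounded_cont cK cc.
split; first exact: measurable_funM.
- exists (`|M| * N) => x; have [Kx|/fK ->] := pselect (K x).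
    by rewrite normrM ler_pM//; [exact: le_trans (ler_norm _)|exact: cN].
  by rewrite mul0r normr0 mulr_ge0// ltW.
- by exists K => // x /fK ->; rewrite mul0r.
Qed.

Lemma bcsM f g : bcs f -> bcs g -> bcs (fun x => f x * g x).
Proof.
move=> [mf [M fM] [K cK fK]] [mg [N gN] _].
split; first exact: measurable_funM.
- by exists (M * N) => x; rewrite normrM ler_pM.
- by exists K => // x /fK ->; rewrite mul0r.
Qed.

Lemma bcs_cont f (K : set E) : continuous f -> compact K ->
  (forall x, ~ K x -> f x = 0) -> bcs f.
Proof.
move=> cf cK fK; split; first exact: continuous_measurable_rV.
  have [M M0 fM] := compact_bounded_cont cK cf; exists M => x.
  by have [/fM//|/fK ->] := pselect (K x); rewrite normr0 ltW.
by exists K.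
Qed.

Lemma bcs_integ f : bcs f -> integ leb f.
Proof.
by move=> /(locintM_bcs (locint_cst 1)); under eq_fun do rewrite mul1r.
Qed.

Lemma Lploc_integ (s : R) f : 1 <= s -> Lploc setT s f ->
  measurable_fun setT f /\
  forall K, compact K -> integ leb ((fun x => `|f x| `^ s) \_ K).
Proof.
move=> s1 [mf lf]; split => // K cK.
have := Lfun_integrable s1 (lf K cK (@subsetT _ _)).
congr (integrable leb _ _); apply/funext => x /=; rewrite !patchE.
by case: ifP => //; rewrite normr0 powR0// gt_eqF// (lt_le_trans _ s1).
Qed.

(** The pointwise bound |f| <= 1 + |f|^s suffices, because compact sets have finite measure. *)
Lemma Lploc_locint (s : R) f : 1 <= s -> Lploc setT s f -> locint f.
Proof.
move=> s1 /(Lploc_integ s1)[mf lf]; split => // K cK.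
apply: (@integ_restrict_le _ (fun x => 1 + `|f x| `^ s)) => //.
- exact: measurable_compact_rV.
- have := integD (integ_cst_compact 1 cK) (lf K cK); congr (integ leb _).
  by apply/funext => x; rewrite !patchE; case: ifP; rewrite ?addr0.
- move=> x _; have [f1|/ltW f1] := leP `|f x| 1.
    by apply: le_trans f1 _; rewrite lerDl powR_ge0.
  rewrite -[leLHS]add0r lerD//; apply: le_trans (_ : `|f x| `^ 1 <= _).
    by rewrite powRr1.
  by rewrite ler_powR.
Qed.

Lemma Lploc2_locint_sqr (s : R) f : 2 <= s -> Lploc setT s f ->
  locint (fun x => f x ^+ 2).
Proof.
move=> s2 lf; have s1 : 1 <= s by lra.
have [mf {}lf] := Lploc_integ s1 lf; split => [|K cK]; first exact: measurable_funX.
apply: (@integ_restrict_le _ (fun x => 1 + `|f x| `^ s)) => //.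
- exact: measurable_compact_rV.
- exact: measurable_funX.
- have := integD (integ_cst_compact 1 cK) (lf K cK); congr (integ leb _).
  by apply/funext => x; rewrite !patchE; case: ifP; rewrite ?addr0.
- move=> x _; rewrite normrX; have [f1|/ltW f1] := leP `|f x| 1.
    apply: le_trans (_ : 1 <= _); first by rewrite exprn_ile1.
    by rewrite lerDl powR_ge0.
  rewrite -[leLHS]add0r lerD//; apply: le_trans (_ : `|f x| `^ 2 <= _).
    by rewrite powR_mulrn.
  by rewrite ler_powR.
Qed.

Lemma locint_le f g : measurable_fun setT f -> locint g ->
  (forall x, `|f x| <= g x) -> locint f.
Proof.
move=> mf [mg lg] fg; split => // K cK.
by apply: integ_restrict_le (lg K cK) _ => //; exact: measurable_compact_rV.
Qed.

Lemma locint_sqrD f g : locint f -> locint g ->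
  locint (fun x => f x ^+ 2) -> locint (fun x => g x ^+ 2) ->
  locint (fun x => (f x + g x) ^+ 2).
Proof.
move=> [mf _] [mg _] lf lg.
apply: (@locint_le _ (fun x => 2 * (f x ^+ 2 + g x ^+ 2))).
- by apply: measurable_funX; exact: measurable_funD.
- exact/locintZ/locintD.
- by move=> x; rewrite ger0_norm ?sqr_ge0//; have := sqr_ge0 (f x - g x); nra.
Qed.

Lemma locint_sqrM_cont f c : continuous c ->
  locint (fun x => f x ^+ 2) -> locint (fun x => (f x * c x) ^+ 2).
Proof.
move=> cc lf; under eq_fun do rewrite exprMn; apply: locintM_cont => //.
move=> x; under eq_fun do rewrite expr2.
exact: (continuousM (cc x) (cc x)).
Qed.

Lemma locint_sqr_sum (I : Type) (s : seq I) (F : I -> E -> R) :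
  (forall i, locint (F i)) -> (forall i, locint (fun x => F i x ^+ 2)) ->
  locint (fun x => (\sum_(i <- s) F i x) ^+ 2).
Proof.
move=> lF lF2; elim: s => [|a s ih].
  by under eq_fun do rewrite big_nil; exact: locint_cst.
under eq_fun do rewrite big_cons; apply: locint_sqrD => //.
exact: locint_sum.
Qed.

End local_integrability.

(** * Integration against a measure with density *)

Section density.
Context d (T : measurableType d) (R : realType).
Variables (nu mu : {measure set T -> \bar R}) (rho : T -> R).
Hypotheses (mrho : measurable_fun setT rho) (rho0 : forall x, 0 <= rho x).
Hypothesis muE : forall U, measurable U -> mu U = (\int[nu]_(x in U) (rho x)%:E)%E.
Local Open Scope ereal_scope.

Lemma ge0_integral_density (f : T -> \bar R) : measurable_fun setT f ->
  (forall x, 0 <= f x) -> \int[mu]_x f x = \int[nu]_x (f x * (rho x)%:E).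
Proof.
have mr : measurable_fun setT (EFin \o rho) by exact/measurable_EFinP.
have r0 x : 0 <= (rho x)%:E by rewrite lee_fin.
move=> mf f0.
apply: (@ge0_measurable_ind _ _ _ (fun f : T -> \bar R =>
  \int[mu]_x f x = \int[nu]_x (f x * (rho x)%:E))) => //.
- move=> D mD; rewrite integral_indic// setIT muE// integral_mkcond.
  apply: eq_integral => x _; rewrite patchE indicE.
  by case: (x \in D); rewrite ?mul1e ?mul0e.
- move=> k g k0 mg g0 ih; rewrite ge0_integralZl_EFin// ih -ge0_integralZl_EFin//.
  + by apply: eq_integral => x _; rewrite muleA.
  + by move=> x _; rewrite mule_ge0.
  + exact: emeasurable_funM.
- move=> g h mg mh g0 h0 ihg ihh; rewrite ge0_integralD// ihg ihh -ge0_integralD//.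
  + by apply: eq_integral => x _; rewrite ge0_muleDl.
  + by move=> x _; rewrite mule_ge0.
  + exact: emeasurable_funM.
  + by move=> x _; rewrite mule_ge0.
  + exact: emeasurable_funM.
- move=> gn g mgn gn0 ndg gng ih.
  have gE x : g x = limn (gn ^~ x) by apply/esym/cvg_lim.
  transitivity (limn (fun n => \int[mu]_x gn n x)).
    by rewrite -monotone_convergence//; apply: eq_integral => x _; exact: gE.
  transitivity (limn (fun n => \int[nu]_x (gn n x * (rho x)%:E))).
    by congr (limn _); apply/funext => n; exact: ih.
  rewrite -monotone_convergence//.
  + apply: eq_integral => x _; apply/cvg_lim => //.
    exact: cvgeZr.
  + by move=> n; exact: emeasurable_funM.
  + by move=> n x _; rewrite mule_ge0.
  + by move=> x _ a b ab; rewrite lee_wpmul2r//; exact: ndg.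
Qed.

Lemma integral_density (f : T -> R) : measurable_fun setT f ->
  \int[mu]_x (f x)%:E = \int[nu]_x (f x * rho x)%:E.
Proof.
move=> mf; have mf' : measurable_fun setT (EFin \o f) by exact/measurable_EFinP.
rewrite integralE [RHS]integralE !ge0_integral_density//.
- congr (_ - _); apply: eq_integral => x _.
    by rewrite !funeposE /= -!EFin_max -EFinM maxr_pMl// mul0r.
  by rewrite !funenegE /= -!EFin_max -EFinM maxr_pMl// mul0r mulNr.
- exact: measurable_funeneg.
- exact: measurable_funepos.
Qed.

Lemma integ_density (f : T -> R) : measurable_fun setT f ->
  integ mu f <-> integ nu (fun x => f x * rho x)%R.
Proof.
move=> mf; have mf' : measurable_fun setT (EFin \o f) by exact/measurable_EFinP.
have mf2 : measurable_fun setT (fun x => f x * rho x)%R by exact: measurable_funM.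
split=> /integrableP[_ h]; apply/integrableP; split; try exact/measurable_EFinP.
- move: h; rewrite ge0_integral_density//; last exact: measurableT_comp.
  congr (_ < _); apply: eq_integral => x _.
  by rewrite /= normrM (ger0_norm (rho0 _)) EFinM.
- move: h; rewrite ge0_integral_density//; last exact: measurableT_comp.
  congr (_ < _); apply: eq_integral => x _.
  by rewrite /= normrM (ger0_norm (rho0 _)) EFinM.
Qed.

Lemma Int_density (f : T -> R) : measurable_fun setT f ->
  (\int[mu]_x f x = \int[nu]_x (f x * rho x))%R.
Proof. by move=> mf; rewrite /Rintegral integral_density. Qed.

End density.

(** * Smooth functions *)

Section smooth_calculus.
Context {R : realType} {d : nat}.
Local Notation E := 'rV[R]_d.
Implicit Types f g : E -> R.
Local Notation e_ i := (delta_mx 0 i : E).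

Lemma contD (T : topologicalType) (f g : T -> R) :
  continuous f -> continuous g -> continuous (fun x => f x + g x).
Proof. by move=> cf cg x; apply: cvgD; [exact: cf|exact: cg]. Qed.

Lemma contM (T : topologicalType) (f g : T -> R) :
  continuous f -> continuous g -> continuous (fun x => f x * g x).
Proof. by move=> cf cg x; apply: cvgM; [exact: cf|exact: cg]. Qed.

Lemma cont_comp (T : topologicalType) (f : T -> R) (s : R -> R) :
  continuous f -> continuous s -> continuous (fun x => s (f x)).
Proof. by move=> cf cs x; apply: continuous_comp; [exact: cf|exact: cs]. Qed.

(** Reduces directional derivatives to one real variable, where the chain rule, the fundamental
    theorem of calculus and derivation under the integral sign apply. *)
Lemma is_derive_line f (x v : E) (df : R) :
  is_derive x v f df <-> is_derive (0 : R) 1 (fun h : R => f (h *: v + x)) df.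
Proof.
have eqF : (fun h : R => h^-1 *: (((fun h : R => f (h *: v + x)) \o shift 0) (h *: 1)
     - f (0 *: v + x))) = (fun h => h^-1 *: ((f \o shift x) (h *: v) - f x)).
  by apply/funext => h /=; rewrite addr0 scale0r add0r [h *: 1]mulr1.
split=> -[der <-]; split.
- by rewrite /derivable eqF.
- by rewrite /derive eqF.
- by move: der; rewrite /derivable eqF.
- by rewrite /derive eqF.
Qed.

Lemma is_derive_line_at f (y v : E) (s df : R) :
  is_derive (y + s *: v) v f df -> is_derive s 1 (fun h : R => f (y + h *: v)) df.
Proof.
move/is_derive_line => H.
have -> : (fun h : R => f (y + h *: v)) =
    (fun h : R => f (h *: v + (y + s *: v))) \o (fun h => h - s).
  by apply/funext => h /=; rewrite addrCA -scalerDl subrK.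
rewrite -(mulr1 df); apply: is_derive1_comp; first by rewrite subrr.
by rewrite -[X in is_derive _ _ _ X](subr0 1); apply: is_deriveB.
Qed.

Lemma is_derive_comp (s : R -> R) f (x v : E) (a b : R) :
  is_derive (f x) 1 s a -> is_derive x v f b -> is_derive x v (s \o f) (a * b).
Proof.
move=> ds /is_derive_line df; apply/is_derive_line.
apply: (@is_derive1_comp _ s (fun h : R => f (h *: v + x))) => //.
by rewrite scale0r add0r.
Qed.

Lemma CkS_derivable k f i x : Ck k.+1 f ->
  is_derive x (e_ i) f (partial i f x).
Proof. by move=> [_ /(_ i)[h _]]; apply: DeriveDef => //; exact: h. Qed.

Lemma Ck_continuous k f : Ck k f -> continuous f.
Proof. by case: k => [|k] []. Qed.

Lemma CkW k f : Ck k.+1 f -> Ck k f.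
Proof.
elim: k f => [|k ih] f [cf hf]; split => // i.
by have [df /ih] := hf i.
Qed.

(** [Ck] refers to the derivatives computed by [partial]; in this form an explicit candidate for
    each of them can be supplied instead. *)
Lemma CkS k f (g : 'I_d -> E -> R) : continuous f ->
  (forall i x, is_derive x (e_ i) f (g i x)) -> (forall i, Ck k (g i)) ->
  Ck k.+1 f.
Proof.
move=> cf df cg; split => // i; split => [x|]; first by have [] := df i x.
by have -> : partial i f = g i by apply/funext => x; have [_] := df i x.
Qed.

Lemma partialE f i x a : is_derive x (e_ i) f a -> partial i f x = a.
Proof. by case. Qed.

Lemma Ck_cst k (c : R) : Ck k (fun _ : E => c).
Proof.
elim: k c => [|k ih] c; first by split => //; exact: cst_continuous.
by apply: (@CkS _ _ (fun _ _ => 0)) => //; exact: cst_continuous.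
Qed.

Lemma CkD k f g : Ck k f -> Ck k g -> Ck k (fun x => f x + g x).
Proof.
elim: k f g => [|k ih] f g cf cg.
  by split => //; apply: contD; [exact: Ck_continuous cf|exact: Ck_continuous cg].
apply: (@CkS _ _ (fun i x => partial i f x + partial i g x)).
- by apply: contD; [exact: Ck_continuous cf|exact: Ck_continuous cg].
- by move=> i x; exact: (is_deriveD (CkS_derivable i x cf) (CkS_derivable i x cg)).
- by move=> i; apply: ih; [have [_ /(_ i)[]] := cf|have [_ /(_ i)[]] := cg].
Qed.

Lemma CkM k f g : Ck k f -> Ck k g -> Ck k (fun x => f x * g x).
Proof.
elim: k f g => [|k ih] f g cf cg.
  by split => //; apply: contM; [exact: Ck_continuous cf|exact: Ck_continuous cg].
apply: (@CkS _ _ (fun i x => f x * partial i g x + g x * partial i f x)).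
- by apply: contM; [exact: Ck_continuous cf|exact: Ck_continuous cg].
- by move=> i x; exact: (is_deriveM (CkS_derivable i x cf) (CkS_derivable i x cg)).
- move=> i; apply: CkD; apply: ih; try exact: CkW.
    by have [_ /(_ i)[]] := cg.
  by have [_ /(_ i)[]] := cf.
Qed.

Lemma CkZ k (c : R) f : Ck k f -> Ck k (fun x => c * f x).
Proof. by move=> cf; apply: CkM => //; exact: Ck_cst. Qed.

Lemma CkN k f : Ck k f -> Ck k (fun x => - f x).
Proof. by move/(CkZ (-1)); under eq_fun do rewrite mulN1r. Qed.

Lemma CkB k f g : Ck k f -> Ck k g -> Ck k (fun x => f x - g x).
Proof. by move=> cf /CkN; exact: CkD. Qed.

Lemma CkX k n f : Ck k f -> Ck k (fun x => f x ^+ n).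
Proof.
move=> cf; elim: n => [|n ih].
  by under eq_fun do rewrite expr0; exact: Ck_cst.
by under eq_fun do rewrite exprS; exact: CkM.
Qed.

Lemma Ck_sum (I : Type) (r : seq I) k (F : I -> E -> R) :
  (forall i, Ck k (F i)) -> Ck k (fun x => \sum_(i <- r) F i x).
Proof.
move=> cF; elim: r => [|a r ih].
  by under eq_fun do rewrite big_nil; exact: Ck_cst.
by under eq_fun do rewrite big_cons; exact: CkD.
Qed.

Lemma Ck_prod (I : Type) (r : seq I) k (F : I -> E -> R) :
  (forall i, Ck k (F i)) -> Ck k (fun x => \prod_(i <- r) F i x).
Proof.
move=> cF; elim: r => [|a r ih].
  by under eq_fun do rewrite big_nil; exact: Ck_cst.
by under eq_fun do rewrite big_cons; exact: CkM.
Qed.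

Lemma is_derive_coord (x : E) i j : is_derive x (e_ i) (fun y : E => y 0 j) (i == j)%:R.
Proof.
apply/is_derive_line.
under [X in is_derive _ _ X _]eq_fun do rewrite !mxE eqxx /=.
rewrite -[X in is_derive _ _ _ X]addr0.
apply: (@is_deriveD _ _ _ (fun h : R => h * (j == i)%:R) (fun=> x 0 j)).
have -> : (fun h : R => h * (j == i)%:R) = (i == j)%:R \*: id.
  by apply/funext => h; rewrite eq_sym mulrC.
rewrite -[X in is_derive _ _ _ X]mulr1; exact: is_deriveZ.
Qed.

Lemma Ck_coord k j : Ck k (fun x : E => x 0 j).
Proof.
case: k => [|k]; first by split => // x; exact: coord_continuous.
apply: (@CkS _ _ (fun i _ => (i == j)%:R)).
- by move=> x; exact: coord_continuous.
- by move=> i x; exact: is_derive_coord.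
- by move=> i; exact: Ck_cst.
Qed.

Fixpoint smooth1 (k : nat) (s : R -> R) : Prop :=
  continuous s /\
  if k is k'.+1 then (forall x, derivable s x 1) /\ smooth1 k' (derive1 s) else True.

Lemma smooth1S_derive k s (x : R) : smooth1 k.+1 s -> is_derive x 1 s ((derive1 s) x).
Proof. by move=> [_ [h _]]; apply: DeriveDef => //; rewrite derive1E. Qed.

Lemma smooth1W k s : smooth1 k.+1 s -> smooth1 k s.
Proof.
elim: k s => [|k ih] s [cs hs]; split => //.
by have [ds /ih] := hs.
Qed.

Lemma smooth1_continuous k s : smooth1 k s -> continuous s.
Proof. by case: k => [|k] []. Qed.

Lemma smooth1_derive k s : smooth1 k.+1 s -> smooth1 k (derive1 s).
Proof. by move=> [_ []]. Qed.

Lemma is_derive1_continuous (s ds : R -> R) :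
  (forall x : R, is_derive x 1 s (ds x)) -> continuous s.
Proof.
move=> h x; apply: differentiable_continuous; apply/derivable1_diffP.
by have [] := h x.
Qed.

Lemma smooth1S k (s ds : R -> R) : (forall x : R, is_derive x 1 s (ds x)) ->
  smooth1 k ds -> smooth1 k.+1 s.
Proof.
move=> h sds; split; first exact: is_derive1_continuous h.
split => [x|]; first by have [] := h x.
suff -> : (derive1 s) = ds by [].
by apply/funext => x; rewrite derive1E; have [_] := h x.
Qed.

Lemma smooth1_cst k (c : R) : smooth1 k (fun=> c).
Proof.
elim: k c => [|k ih] c; first by split => //; exact: cst_continuous.
by apply: (@smooth1S _ _ (fun=> 0)) => // x; exact: is_derive_cst.
Qed.

Lemma smooth1D k s t : smooth1 k s -> smooth1 k t -> smooth1 k (fun x => s x + t x).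
Proof.
elim: k s t => [|k ih] s t cs ct.
  by split => //; apply: contD; [exact: smooth1_continuous cs|exact: smooth1_continuous ct].
apply: (@smooth1S _ _ (fun x => (derive1 s) x + (derive1 t) x)).
- by move=> x; exact: (is_deriveD (smooth1S_derive x cs) (smooth1S_derive x ct)).
- by apply: ih; exact: smooth1_derive.
Qed.

Lemma smooth1M k s t : smooth1 k s -> smooth1 k t -> smooth1 k (fun x => s x * t x).
Proof.
elim: k s t => [|k ih] s t cs ct.
  by split => //; apply: contM; [exact: smooth1_continuous cs|exact: smooth1_continuous ct].
apply: (@smooth1S _ _ (fun x => s x * (derive1 t) x + t x * (derive1 s) x)).
- by move=> x; exact: (is_deriveM (smooth1S_derive x cs) (smooth1S_derive x ct)).
- by apply: smooth1D; apply: ih; try exact: smooth1W; exact: smooth1_derive.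
Qed.

Lemma smooth1_comp k s t : smooth1 k s -> smooth1 k t -> smooth1 k (s \o t).
Proof.
elim: k s t => [|k ih] s t cs ct.
  by split => //; apply: (@cont_comp _ t); [exact: smooth1_continuous ct|exact: smooth1_continuous cs].
apply: (@smooth1S _ _ (fun x => (derive1 s \o t) x * (derive1 t) x)).
- by move=> x; exact: (is_derive1_comp (smooth1S_derive _ cs) (smooth1S_derive x ct)).
- apply: smooth1M; last exact: smooth1_derive.
  by apply: ih; [exact: smooth1_derive|exact: smooth1W].
Qed.

Lemma smooth1_id k : smooth1 k id.
Proof.
case: k => [|k]; first by split => // x; exact: cvg_id.
by apply: (@smooth1S _ _ (fun=> 1)) => //; exact: smooth1_cst.
Qed.

Lemma smooth1_affine k (a b : R) : smooth1 k (fun x => a * x + b).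
Proof.
apply: smooth1D; last exact: smooth1_cst.
by apply: smooth1M; [exact: smooth1_cst|exact: smooth1_id].
Qed.

Lemma Ck_comp k s f : smooth1 k s -> Ck k f -> Ck k (fun x => s (f x)).
Proof.
elim: k s f => [|k ih] s f cs cf.
  by split => //; apply: cont_comp; [exact: Ck_continuous cf|exact: smooth1_continuous cs].
apply: (@CkS _ _ (fun i x => (derive1 s) (f x) * partial i f x)).
- by apply: cont_comp; [exact: Ck_continuous cf|exact: smooth1_continuous cs].
- move=> i x; apply: (@is_derive_comp s f); last exact: CkS_derivable cf.
  exact: smooth1S_derive cs.
- move=> i; apply: CkM; last by have [_ /(_ i)[]] := cf.
  by apply: ih; [exact: smooth1_derive|exact: CkW].
Qed.

Lemma partial_cst i (c : R) x : partial i (fun _ : E => c) x = 0.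
Proof. by apply: partialE; exact: is_derive_cst. Qed.

Lemma partialD i f g x : Ck 1 f -> Ck 1 g ->
  partial i (fun y => f y + g y) x = partial i f x + partial i g x.
Proof. by move=> cf cg; apply: partialE; exact: (is_deriveD (CkS_derivable i x cf) (CkS_derivable i x cg)). Qed.

Lemma partialM i f g x : Ck 1 f -> Ck 1 g ->
  partial i (fun y => f y * g y) x = f x * partial i g x + g x * partial i f x.
Proof. by move=> cf cg; apply: partialE; exact: (is_deriveM (CkS_derivable i x cf) (CkS_derivable i x cg)). Qed.

Lemma partialZ i (c : R) f x : Ck 1 f ->
  partial i (fun y => c * f y) x = c * partial i f x.
Proof.
by move=> cf; rewrite partialM ?partial_cst ?mulr0 ?addr0//; exact: Ck_cst.
Qed.

Lemma partialN i f x : Ck 1 f -> partial i (fun y => - f y) x = - partial i f x.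
Proof.
move=> cf; have := partialZ i (-1) x cf; rewrite mulN1r => <-.
by congr partial; apply/funext => y; rewrite mulN1r.
Qed.

Lemma partialB i f g x : Ck 1 f -> Ck 1 g ->
  partial i (fun y => f y - g y) x = partial i f x - partial i g x.
Proof. by move=> cf cg; rewrite partialD ?partialN//; exact: CkN. Qed.

Lemma partial_comp i s f x : smooth1 1 s -> Ck 1 f ->
  partial i (fun y => s (f y)) x = (derive1 s) (f x) * partial i f x.
Proof.
move=> cs cf; apply: partialE; apply: (@is_derive_comp s f).
  exact: (@smooth1S_derive 0).
exact: (@CkS_derivable 0).
Qed.

Lemma CkS_partial k f i : Ck k.+1 f -> Ck k (partial i f).
Proof. by move=> [_ /(_ i)[]]. Qed.

Lemma partial_near f g i x : (\forall y \near x, f y = g y) ->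
  partial i f x = partial i g x.
Proof. by move=> fg; apply: near_eq_derive. Qed.

Lemma supp_out f x : ~ supp f x -> f x = 0.
Proof.
by move=> nx; apply/eqP/negPn/negP => fx; apply: nx; exact: subset_closure.
Qed.

Lemma supp_near f x : ~ supp f x -> \forall y \near x, f y = 0.
Proof.
move=> nx; have : nbhs x (~` supp f).
  by apply: open_nbhs_nbhs; split => //; apply: closed_openC; exact: closed_closure.
by apply: filterS => y; exact: supp_out.
Qed.

Lemma supp_sub f (K : set E) : closed K -> (forall x, ~ K x -> f x = 0) ->
  supp f `<=` K.
Proof.
move=> cK fK; rewrite (proj1 (closure_id K) cK); apply: closure_subset => x /= fx.
by apply: contrapT => /fK f0; rewrite f0 eqxx in fx.
Qed.

Lemma partial_out f i x : ~ supp f x -> partial i f x = 0.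
Proof.
by move=> /supp_near h; rewrite (@partial_near _ (fun=> 0) i x h) partial_cst.
Qed.

(** Any compact set outside which [f] vanishes will do, so the closed support never has to be
    computed. *)
Lemma test_funP (U K : set E) f : (forall k, Ck k f) -> compact K -> K `<=` U ->
  (forall x, ~ K x -> f x = 0) -> test_fun U f.
Proof.
move=> cf cK KU fK.
have sK : supp f `<=` K.
  by apply: supp_sub fK; apply: compact_closed cK; exact: (@norm_hausdorff R 'rV[R]_d).
split => //; last exact: subset_trans KU.
by apply: subclosed_compact sK => //; exact: closed_closure.
Qed.

Lemma test_fun_out (U : set E) f x : test_fun U f -> ~ U x -> f x = 0.
Proof. by move=> [_ _ sU] Ux; apply: supp_out => /sU. Qed.

Lemma test_fun_partial (U : set E) f i : test_fun U f -> test_fun U (partial i f).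
Proof.
move=> [cf cs sU]; apply: (@test_funP _ (supp f)) => //.
- by move=> k; apply: CkS_partial.
- by move=> x; exact: partial_out.
Qed.

Lemma test_funM_l (U : set E) f g : test_fun U f -> (forall k, Ck k g) ->
  test_fun U (fun x => f x * g x).
Proof.
move=> [cf cs sU] cg; apply: (@test_funP _ (supp f)) => //.
- by move=> k; exact: CkM.
- by move=> x /supp_out ->; rewrite mul0r.
Qed.

Lemma test_funM_r (U : set E) f g : test_fun U f -> (forall k, Ck k g) ->
  test_fun U (fun x => g x * f x).
Proof.
by move=> tf cg; under eq_fun do rewrite mulrC; exact: test_funM_l.
Qed.

Lemma test_funD (U : set E) f g : test_fun U f -> test_fun U g ->
  test_fun U (fun x => f x + g x).
Proof.
move=> [cf cs sU] [cg cs' sU']; apply: (@test_funP _ (supp f `|` supp g)) => //.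
- by move=> k; exact: CkD.
- exact: compactU.
- by move=> x [/sU|/sU'].
- by move=> x /not_orP[/supp_out -> /supp_out ->]; rewrite addr0.
Qed.

Lemma test_funZ (U : set E) (c : R) f : test_fun U f -> test_fun U (fun x => c * f x).
Proof. by move=> tf; apply: test_funM_r => // k; exact: Ck_cst. Qed.

Lemma test_funB (U : set E) f g : test_fun U f -> test_fun U g ->
  test_fun U (fun x => f x - g x).
Proof.
move=> tf /(test_funZ (-1)) tg; have := test_funD tf tg.
by under eq_fun do rewrite mulN1r.
Qed.

Lemma test_fun0 (U : set E) : test_fun U (fun=> 0).
Proof.
apply: (@test_funP _ set0) => //; first by move=> k; exact: Ck_cst.
exact: compact0.
Qed.

Lemma test_fun_sub (U V : set E) f : U `<=` V -> test_fun U f -> test_fun V f.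
Proof. by move=> UV [cf cs sU]; split => //; exact: subset_trans UV. Qed.

Lemma test_fun_bcs (U : set E) f : test_fun U f -> bcs f.
Proof.
move=> [cf cs sU]; apply: (bcs_cont (Ck_continuous (cf 0)) cs).
by move=> x; exact: supp_out.
Qed.

End smooth_calculus.

(** * Smooth steps and smooth truncations on the line *)

Section smooth_step.
Context {R : realType}.
Implicit Types (p : {poly R}) (x y : R).

(** The functions p(1/x) exp(-1/x), extended by 0 to x <= 0. Derivation maps the class to itself and
    replaces p by X^2 (p - p'), so that smoothness at 0 is an induction on the order with p
    arbitrary. *)
Definition expinv p x : R := if 0 < x then p.[x^-1] * expR (- x^-1) else 0.

(** A single term of the exponential series gives y^i exp(-y) <= i!, whence the constant, the sum of
    |p_i| i!. *)
Lemma horner_expR_bounded p : exists2 C : R, 0 <= C &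
  forall y, 0 <= y -> `|p.[y]| * expR (- y) <= C.
Proof.
exists (\sum_(i < size p) `|p`_i| * i`!%:R).
  by apply: sumr_ge0 => i _; rewrite mulr_ge0.
move=> y y0; rewrite horner_coef.
apply: (@le_trans _ _ ((\sum_(i < size p) `|p`_i * y ^+ i|) * expR (- y))).
  by rewrite ler_wpM2r ?expR_ge0//; exact: ler_norm_sum.
rewrite mulr_suml; apply: ler_sum => i _.
rewrite normrM -mulrA ler_wpM2l// (ger0_norm (exprn_ge0 _ _))//.
rewrite expRN ler_pdivrMr ?expR_gt0//.
case: (nat_of_ord i) => [|n]; first by rewrite expr0 fact0 mul1r; have := expR_ge1Dx y; lra.
have := expR_ge1Dxn n y0.
have f0 : (0 : R) < (n.+1)`!%:R by rewrite ltr0n fact_gt0.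
move=> h; rewrite mulrC -ler_pdivrMr//; lra.
Qed.

Lemma expinv_ge0 x : 0 <= expinv 1 x.
Proof. by rewrite /expinv; case: ifP => // _; rewrite hornerC mul1r expR_ge0. Qed.

Lemma expinv_le0 p x : x <= 0 -> expinv p x = 0.
Proof. by rewrite /expinv leNgt; case: ifP. Qed.

Lemma expinv_bounded p : exists C : R, forall x, `|expinv p x| <= C.
Proof.
have [C C0 HC] := horner_expR_bounded p; exists C => x; rewrite /expinv.
case: ifP => [x0|_]; last by rewrite normr0.
rewrite normrM (ger0_norm (expR_ge0 _)); apply: HC.
by rewrite invr_ge0 ltW.
Qed.

Lemma is_derive0_quadratic (g : R -> R) (C : R) : 0 <= C ->
  (forall h, `|g h| <= C * h ^+ 2) -> is_derive (0 : R) 1 g 0.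
Proof.
move=> C0 gC.
have g0 : g 0 = 0.
  by apply/eqP; rewrite -normr_le0; have := gC 0; rewrite expr0n mulr0.
have H : h^-1 *: ((g \o shift 0) (h *: (1 : R)) - g 0) @[h --> 0^'] --> (0 : R).
  apply: (@norm_cvg0 _ R).
  apply: (@squeeze_cvgr _ _ _ _ (fun=> 0) (fun h : R => C * `|h|)).
  - near=> h; rewrite normr_ge0 /= g0 subr0 addr0 [h *: 1]mulr1.
    have h0 : h != 0 by near: h; exact: nbhs_dnbhs_neq.
    rewrite /GRing.scale /= normrM normfV mulrC ler_pdivrMr ?normr_gt0//.
    rewrite -mulrA -normrM -expr2 (ger0_norm (sqr_ge0 h)); exact: gC.
  - exact: cvg_cst.
  - rewrite -[X in _ --> X](mulr0 C); apply: cvgM; first exact: cvg_cst.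
    by apply/norm_cvg0P/cvg_within.
apply: DeriveDef; last by apply/cvg_lim.
by apply/cvg_ex; exists 0.
Unshelve. all: by end_near. Qed.

Lemma is_derive_expinv p x :
  is_derive x 1 (expinv p) (expinv ('X^2 * (p - p^`())) x).
Proof.
have [x0|x0|->] := ltgtP x 0.
- rewrite (expinv_le0 _ (ltW x0)).
  apply: (@near_eq_is_derive _ _ _ (fun=> 0)).
  near=> y; rewrite expinv_le0//; apply: ltW; near: y.
  exact: lt_nbhsl.
- have xn : x != 0 by rewrite gt_eqF.
  apply: (@near_eq_is_derive _ _ _ (fun y => p.[y^-1] * expR (- y^-1))).
    near=> y; rewrite /expinv ifT//; near: y; exact: lt_nbhsr.
  rewrite /=.
  have dinv : is_derive x 1 (fun y : R => y^-1) (- x ^- 2).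
    have := @is_deriveV _ id x 1 1 xn (is_derive_id _ _).
    by rewrite /GRing.scale /= mulr1.
  have dp : is_derive x 1 (fun y : R => p.[y^-1]) (p^`().[x^-1] * - x ^- 2).
    apply: (@is_derive1_comp _ (fun y => p.[y]) (fun y => y^-1)) => //.
    exact: is_derive_poly.
  have de : is_derive x 1 (fun y : R => expR (- y^-1)) (expR (- x^-1) * x ^- 2).
    apply: (@is_derive1_comp _ expR (fun y => - y^-1)).
    by have := is_deriveN dinv; rewrite opprK.
  have := is_deriveM dp de; rewrite /expinv x0.
  set a := (X in is_derive _ _ _ X -> _); set b := (X in _ -> is_derive _ _ _ X).
  suff -> : a = b by [].
  rewrite /a /b /GRing.scale /= hornerM hornerXn hornerD hornerN.
  by move: p.[_] p^`().[_] (expR _) => u v w; field.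
- rewrite expinv_le0//.
  (* The factor X^2, evaluated at 1/h, extracts h^2: a quadratic bound at 0 shows that the
     derivative there is 0. *)
  have [C C0 HC] := horner_expR_bounded (p * 'X^2).
  have bnd h : `|expinv p h| <= C * h ^+ 2.
    rewrite /expinv; case: ifPn => [h0|_]; last by rewrite normr0 mulr_ge0// sqr_ge0.
    rewrite normrM (ger0_norm (expR_ge0 _)).
    have := HC h^-1; rewrite invr_ge0 => /(_ (ltW h0)).
    rewrite hornerM hornerXn normrM (ger0_norm (sqr_ge0 h^-1)) mulrAC exprVn.
    by rewrite ler_pdivrMr ?exprn_gt0.
  exact: (is_derive0_quadratic C0).
Unshelve. all: by end_near. Qed.

Lemma smooth1_expinv k p : smooth1 k (expinv p).
Proof.
elim: k p => [|k ih] p.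
  split => //; exact: is_derive1_continuous (is_derive_expinv p).
exact: smooth1S (is_derive_expinv p) (ih _).
Qed.

Lemma expinv1_nd x y : x <= y -> expinv 1 x <= expinv 1 y.
Proof.
move=> xy; rewrite {1}/expinv; case: ifPn => [x0|_]; last exact: expinv_ge0.
have y0 : 0 < y by exact: lt_le_trans xy.
rewrite /expinv y0 !hornerC !mul1r ler_expR lerN2 lef_pV2//.
Qed.

Lemma expinv1_gt0 x : 0 < x -> 0 < expinv 1 x.
Proof. by move=> x0; rewrite /expinv x0 hornerC mul1r expR_gt0. Qed.

(** With psi = [expinv 1] this is psi(psi(1) - psi(1 - x)), normalised. The inner expression is
    nonpositive for x <= 0, where psi kills it, and equals psi(1) for x >= 1. Being a composition,
    it needs no quotient rule. *)
Definition sstep x : R := (expinv 1 (expinv 1 1))^-1 *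
  expinv 1 (expinv 1 1 - expinv 1 (1 - x)).

Lemma smooth1_sstep k : smooth1 k sstep.
Proof.
apply: smooth1M; first exact: smooth1_cst.
apply: (@smooth1_comp _ k (expinv 1) (fun x => expinv 1 1 - expinv 1 (1 - x))).
  exact: smooth1_expinv.
have -> : (fun x => expinv 1 1 - expinv 1 (1 - x)) =
  (fun x => expinv 1 1 + (-1) * ((expinv 1 \o (fun x => (-1) * x + 1)) x)).
  by apply/funext => x /=; rewrite !mulN1r (addrC _ 1).
apply: smooth1D; first exact: smooth1_cst.
apply: smooth1M; first exact: smooth1_cst.
by apply: smooth1_comp; [exact: smooth1_expinv|exact: smooth1_affine].
Qed.

Lemma sstep_le0 x : x <= 0 -> sstep x = 0.
Proof.
move=> x0; rewrite /sstep (@expinv_le0 _ (_ - _)) ?mulr0// subr_le0.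
by apply: expinv1_nd; rewrite lerBrDr gerDl.
Qed.

Lemma sstep_ge1 x : 1 <= x -> sstep x = 1.
Proof.
move=> x1; rewrite /sstep (@expinv_le0 _ (1 - x)) ?subr_le0// subr0.
by rewrite mulVf// gt_eqF// !expinv1_gt0.
Qed.

Lemma sstep_ge0 x : 0 <= sstep x.
Proof. by rewrite mulr_ge0 ?invr_ge0 ?expinv_ge0. Qed.

Lemma sstep_nd x y : x <= y -> sstep x <= sstep y.
Proof.
move=> xy; rewrite ler_wpM2l ?invr_ge0 ?expinv_ge0//; apply: expinv1_nd.
by rewrite lerD2l lerN2; apply: expinv1_nd; rewrite lerD2l lerN2.
Qed.

Lemma sstep_le1 x : sstep x <= 1.
Proof.
have [x1|/ltW x1] := leP 1 x; first by rewrite sstep_ge1.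
by rewrite -(sstep_ge1 (lexx 1)); exact: sstep_nd.
Qed.

Lemma continuous_bounded_itv (s : R -> R) (a b : R) : a <= b -> continuous s ->
  (forall x, x < a -> s x = 0) -> (forall x, b < x -> s x = 0) ->
  exists2 C : R, 0 <= C & forall x, `|s x| <= C.
Proof.
move=> ab cs sa sb.
have cs' : {within `[a, b], continuous (fun x => `|s x|)}.
  apply: continuous_subspaceT => x; apply: (@continuous_comp _ _ _ s Num.norm); first exact: cs.
  exact: norm_continuous.
have [c _ hc] := EVT_max ab cs'; exists `|s c| => // x.
have [xa|ax] := ltP x a; first by rewrite sa ?normr0.
have [bx|xb] := ltP b x; first by rewrite sb ?normr0.
by apply: hc; rewrite in_itv /= ax xb.
Qed.

Lemma derive1_near0 (s : R -> R) (c x : R) : (\forall y \near x, s y = c) ->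
  derive1 s x = 0.
Proof.
move=> sc; rewrite derive1E (near_eq_derive _ sc).
exact: derive_cst.
Qed.

Lemma sstep_derive_out x : (x < 0 \/ 1 < x) -> derive1 sstep x = 0.
Proof.
case=> x0; [apply: (@derive1_near0 _ 0)|apply: (@derive1_near0 _ 1)]; near=> y.
- by apply: sstep_le0; apply: ltW; near: y; exact: lt_nbhsl.
- by apply: sstep_ge1; apply: ltW; near: y; exact: lt_nbhsr.
Unshelve. all: by end_near. Qed.

Lemma sstep_derive2_out x : (x < 0 \/ 1 < x) -> derive1 (derive1 sstep) x = 0.
Proof.
case=> x0; apply: (@derive1_near0 _ 0); near=> y; apply: sstep_derive_out.
- by left; near: y; exact: lt_nbhsl.
- by right; near: y; exact: lt_nbhsr.
Unshelve. all: by end_near. Qed.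

Lemma sstep_derivatives_bounded : exists2 C : R, 0 <= C &
  forall x, `|derive1 sstep x| <= C /\ `|derive1 (derive1 sstep) x| <= C.
Proof.
have s2 := smooth1_sstep 2.
have [C1 C10 h1] : exists2 C : R, 0 <= C & forall x, `|derive1 sstep x| <= C.
  apply: (@continuous_bounded_itv _ 0 1) => //.
  - exact: smooth1_continuous (smooth1_derive s2).
  - by move=> x x0; apply: sstep_derive_out; left.
  - by move=> x x0; apply: sstep_derive_out; right.
have [C2 C20 h2] : exists2 C : R, 0 <= C &
    forall x, `|derive1 (derive1 sstep) x| <= C.
  apply: (@continuous_bounded_itv _ 0 1) => //.
  - exact: smooth1_continuous (smooth1_derive (smooth1_derive s2)).
  - by move=> x x0; apply: sstep_derive2_out; left.
  - by move=> x x0; apply: sstep_derive2_out; right.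
exists (C1 + C2); first exact: addr_ge0.
by move=> x; split; [apply: le_trans (h1 x) _; rewrite lerDl|
  apply: le_trans (h2 x) _; rewrite lerDr].
Qed.

(** This is (1 + 1/x) exp(-1/x) for x > 0, the derivative of x exp(-1/x): a smooth nondecreasing
    substitute for the indicator of x > 0 with values in [0, 1] and an explicit primitive,
    [trunc_prim], that also vanishes for x <= 0. *)
Definition smooth_trunc x : R := expinv (1 + 'X) x.

Definition trunc_prim x : R := x * expinv 1 x.

Lemma smooth1_smooth_trunc k : smooth1 k smooth_trunc.
Proof. exact: smooth1_expinv. Qed.

Lemma smooth1_trunc_prim k : smooth1 k trunc_prim.
Proof. by apply: smooth1M; [exact: smooth1_id|exact: smooth1_expinv]. Qed.

Lemma derive1_trunc_prim : derive1 trunc_prim = smooth_trunc.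
Proof.
apply/funext => x; rewrite derive1E.
have := is_deriveM (is_derive_id x (1 : R)) (is_derive_expinv 1 x).
case=> _ ->; rewrite /GRing.scale /= mulr1 /smooth_trunc /expinv.
case: ifPn => [x0|_]; last by rewrite mulr0 addr0.
have xn : x != 0 by rewrite gt_eqF.
have -> : (1 : {poly R})^`() = 0 by rewrite -polyC1 derivC.
rewrite subr0 mulr1 hornerXn hornerD hornerX -polyC1 hornerC.
by move: (expR _) => w; field.
Qed.

Lemma derive1_smooth_trunc : derive1 smooth_trunc = expinv 'X^3.
Proof.
apply/funext => x; rewrite derive1E.
have [_ ->] := is_derive_expinv (1 + 'X) x; congr (expinv _ x).
by rewrite derivD derivC derivX add0r addrAC subrr add0r -exprSr.
Qed.

Lemma smooth_trunc_le0 x : x <= 0 -> smooth_trunc x = 0.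
Proof. exact: expinv_le0. Qed.

Lemma trunc_prim_le0 x : x <= 0 -> trunc_prim x = 0.
Proof. by move=> x0; rewrite /trunc_prim expinv_le0// mulr0. Qed.

Lemma smooth_trunc_ge0 x : 0 <= smooth_trunc x.
Proof.
rewrite /smooth_trunc /expinv; case: ifP => // x0.
by rewrite mulr_ge0 ?expR_ge0// !hornerE addr_ge0// invr_ge0 ltW.
Qed.

Lemma smooth_trunc_le1 x : smooth_trunc x <= 1.
Proof.
rewrite /smooth_trunc /expinv; case: ifP => // x0.
rewrite expRN ler_pdivrMr ?expR_gt0// mul1r !hornerE.
by have := expR_ge1Dx x^-1.
Qed.

Lemma derive1_smooth_trunc_ge0 x : 0 <= derive1 smooth_trunc x.
Proof.
rewrite derive1_smooth_trunc /expinv; case: ifP => // x0.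
by rewrite mulr_ge0 ?expR_ge0// !hornerE exprn_ge0// invr_ge0 ltW.
Qed.

Lemma derive1_smooth_trunc_bounded : exists2 C : R, 0 < C &
  forall x, derive1 smooth_trunc x <= C.
Proof.
have [C hC] := expinv_bounded ('X^3); exists (`|C| + 1); first by rewrite ltr_wpDl.
move=> x; rewrite derive1_smooth_trunc; apply: le_trans (ler_norm _) _.
by apply: le_trans (hC x) _; apply: le_trans (ler_norm _) _; rewrite lerDl.
Qed.

Lemma smooth_trunc_nd x y : x <= y -> smooth_trunc x <= smooth_trunc y.
Proof.
move=> xy; have s1 := smooth1_smooth_trunc 1.
have [|c _ h] := MVT_segment xy (fun z _ => smooth1S_derive z s1).
  exact/continuous_subspaceT/(smooth1_continuous s1).
by rewrite -subr_ge0 h mulr_ge0 ?subr_ge0//; exact: derive1_smooth_trunc_ge0.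
Qed.

Lemma smooth_trunc1_gt0 : 0 < smooth_trunc 1.
Proof.
rewrite /smooth_trunc /expinv ltr01 mulr_gt0 ?expR_gt0// !hornerE invr1; lra.
Qed.

End smooth_step.

(** * A Faber-Krahn inequality by averaging translations *)

Section faber_krahn.
Context {R : realType} {d : nat}.
Local Notation E := 'rV[R]_d.
Local Notation leb := (@leb R d).
Local Notation e_ i := (delta_mx 0 i : E).
Implicit Types g : E -> R.

(** Cauchy-Schwarz along a line: with I the increment and w the derivative, expanding the
    nonnegative integral of (w - I/t)^2 gives I^2 / t <= J, the integral of w^2. *)
Lemma increment_sqr_le g i (y : E) (t : R) : 0 < t -> Ck 1 g ->
  (((g (y + t *: e_ i) - g y) ^+ 2)%:E <= t%:E *
    \int[lebesgue_measure]_(s in `[0%R, t]) ((partial i g (y + s *: e_ i)) ^+ 2)%:E)%E.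
Proof.
move=> t0 cg.
pose w s := partial i g (y + s *: e_ i).
pose F s := g (y + s *: e_ i).
have dF (s : R) : is_derive s 1 F (w s) by apply: is_derive_line_at; exact: CkS_derivable cg.
have cy : continuous (fun s : R => y + s *: e_ i).
  by move=> s; apply: cvgD; [exact: cvg_cst|apply: cvgZl; exact: cvg_id].
have cw : continuous w.
  move=> s.
  apply: (@continuous_comp _ _ _ (fun s : R => y + s *: e_ i) (partial i g)).
    exact: cy.
  exact: (Ck_continuous (CkS_partial i cg)).
have cF := is_derive1_continuous dF.
have iw : lebesgue_measure.-integrable `[0, t] (EFin \o w).
  apply: continuous_compact_integrable; first exact: segment_compact.
  exact: continuous_subspaceT.
have iw2 : lebesgue_measure.-integrable `[0, t] (EFin \o (fun s => w s ^+ 2)).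
  apply: continuous_compact_integrable; first exact: segment_compact.
  apply: continuous_subspaceT; under eq_fun do rewrite expr2; exact: contM.
pose I := F t - F 0.
have IE : (\int[lebesgue_measure]_(s in `[0%R, t]) w s = I)%R.
  rewrite /Rintegral (@continuous_FTC2 _ w F)//.
  - exact: continuous_subspaceT.
  - split; first by move=> x _; have [] := dF x.
    + by apply: cvg_at_right_filter; exact: cF.
    + by apply: cvg_at_left_filter; exact: cF.
  - by move=> x _; rewrite derive1E; have [_ ->] := dF x.
have -> : g (y + t *: e_ i) - g y = I by rewrite /I /F scale0r addr0.
pose J := (\int[lebesgue_measure]_(s in `[0%R, t]) (w s ^+ 2))%R.
have -> : (\int[lebesgue_measure]_(s in `[0%R, t]) ((w s) ^+ 2)%:E = J%:E)%E.
  by rewrite /J /Rintegral fineK//; exact: integrable_fin_num.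
rewrite lee_fin.
have k0 : 0 <= (\int[lebesgue_measure]_(s in `[0%R, t]) (w s - I / t) ^+ 2)%R.
  by apply: Rintegral_ge0 => x _; exact: sqr_ge0.
have ic (c : R) : lebesgue_measure.-integrable `[0, t] (EFin \o (fun _ : R => c)).
  apply: continuous_compact_integrable; first exact: segment_compact.
  by apply: continuous_subspaceT; exact: cst_continuous.
have : (\int[lebesgue_measure]_(s in `[0%R, t]) (w s - I / t) ^+ 2)%R =
    J - 2 * (I / t) * I + (I / t) ^+ 2 * t.
  transitivity (\int[lebesgue_measure]_(s in `[0%R, t])
      ((w s ^+ 2 - (2 * (I / t)) * w s) + (I / t) ^+ 2))%R.
    by apply: eq_Rintegral => x _; ring.
  have iZ : lebesgue_measure.-integrable `[0, t] (EFin \o (fun s => (2 * (I / t)) * w s)).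
    exact: (integrableZl _ _ iw).
  rewrite RintegralD//; last exact: (integrableB _ iw2 iZ).
  rewrite RintegralB// RintegralZl// IE; congr (_ + _).
  rewrite /Rintegral integral_cst//= lebesgue_measure_itv/= lte_fin t0 sube0 -EFinM//.
move=> h; rewrite h in k0.
have tn : t != 0 by rewrite gt_eqF.
have : 0 <= J - I ^+ 2 / t.
  by move: k0; congr (0 <= _); field.
by rewrite subr_ge0 ler_pdivrMr// mulrC.
Qed.

Lemma measurable_line g i : measurable_fun setT g ->
  measurable_fun setT (fun z : E * measurableTypeR R => g (z.1 + z.2 *: e_ i)).
Proof.
move=> mg; apply: measurableT_comp mg _; apply: measurable_addrV => //.
by apply: measurable_scalerV; [exact: measurable_snd|exact: measurable_cst].
Qed.

(** Integrate [increment_sqr_le] over all starting points, exchange the integrals, and use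
    translation invariance for each s in [0, t]. *)
Lemma translation_sqr_le1 g i (t : R) : 0 <= t -> Ck 1 g ->
  (\int[leb]_y ((g (y + t *: e_ i) - g y) ^+ 2)%:E <=
   (t ^+ 2)%:E * \int[leb]_y ((partial i g y) ^+ 2)%:E)%E.
Proof.
rewrite le_eqVlt => /orP[/eqP <- cg|t0 cg].
  rewrite integral0_eq ?expr0n ?mul0e// => y _.
  by rewrite scale0r addr0 subrr expr0n.
have mg := continuous_measurable_rV (Ck_continuous cg).
have mp := continuous_measurable_rV (Ck_continuous (CkS_partial i cg)).
pose f (z : E * measurableTypeR R) : \bar R :=
  (((partial i g (z.1 + z.2 *: e_ i)) ^+ 2) * \1_(`[0, t]%classic) z.2)%:E.
have mf : measurable_fun setT f.
  apply/measurable_EFinP; apply: measurable_funM.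
    by apply: measurable_funX; exact: measurable_line.
  by apply: measurableT_comp => //; exact: measurable_indic.
have f0 z : (0 <= f z)%E by rewrite lee_fin mulr_ge0 ?sqr_ge0.
have H1 y : (\int[lebesgue_measure]_(s in `[0%R, t])
    ((partial i g (y + s *: e_ i)) ^+ 2)%:E = \int[lebesgue_measure]_s f (y, s))%E.
  rewrite integral_mkcond; apply: eq_integral => s _.
  by rewrite patchE /f indicE /=; case: (s \in _); rewrite ?mulr1 ?mulr0.
have mF : measurable_fun setT (fun y => \int[lebesgue_measure]_s f (y, s))%E.
  exact: (@measurable_fun_fubini_tonelli_F _ _ _ _ _ (@lebesgue_measure R) f mf f0).
apply: (@le_trans _ _ (\int[leb]_y (t%:E * \int[lebesgue_measure]_s f (y, s)))%E).
  apply: ge0_le_integral => //.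
  - by move=> y _; rewrite lee_fin sqr_ge0.
  - apply/measurable_EFinP; apply: measurable_funX; apply: measurable_funB => //.
    by apply: measurableT_comp mg _; exact: measurable_addrV.
  - by apply: emeasurable_funM.
  - by move=> y _; rewrite -H1; exact: increment_sqr_le.
rewrite ge0_integralZl_EFin//; last 2 first.
- by move=> y _; apply: integral_ge0.
- exact: ltW.
rewrite (fubini_tonelli f)// expr2 EFinM -muleA; apply: lee_wpmul2l.
  by rewrite lee_fin ltW.
under eq_integral => s _.
  have -> : (\int[leb]_y f (y, s) = (\1_(`[0, t]%classic) s)%:E *
      \int[leb]_y ((partial i g y) ^+ 2)%:E)%E.
    rewrite /f indicE /=; case: (s \in _) => /=; last first.
      by under eq_integral do rewrite mulr0; rewrite integral0 mul0e.
    under eq_integral do rewrite mulr1; rewrite mul1e.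
    apply: (@ge0_integral_shift _ _ (s *: e_ i)
      (fun y => ((partial i g y) ^+ 2)%:E)).
    - by apply/measurable_EFinP; exact: measurable_funX.
    - by move=> y; rewrite lee_fin sqr_ge0.
  over.
rewrite ge0_integralZr//; last 2 first.
- by apply/measurable_EFinP; exact: measurable_indic.
- by apply: integral_ge0 => y _; rewrite lee_fin sqr_ge0.
rewrite integral_indic// setIT lee_wpmul2r//.
  by apply: integral_ge0 => y _; rewrite lee_fin sqr_ge0.
apply: (@le_trans _ _ (@lebesgue_measure R `[0, t]%classic)) => //.
by rewrite lebesgue_measure_itv/= lte_fin t0 sube0.
Qed.

(** The factor 2^n comes from adding one term at a time by (a + b)^2 <= 2 a^2 + 2 b^2; it is the
    source of the powers of 2 in the Faber-Krahn constant. *)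
Lemma sqr_sum_le n (a : nat -> R) :
  (\sum_(k < n) a k) ^+ 2 <= 2 ^+ n * \sum_(k < n) (a k) ^+ 2.
Proof.
elim: n => [|n ih]; first by rewrite !big_ord0 mulr0 expr0n.
rewrite !big_ord_recr /= [2 ^+ n.+1]exprS.
set S := \sum_(k < n) a k in ih *; set Q := \sum_(k < n) a k ^+ 2 in ih *.
have p1 : 1 <= (2 : R) ^+ n by apply: exprn_ege1; lra.
have := sqr_ge0 (S - a n); have := sqr_ge0 (a n); nra.
Qed.

(** The vertices of the path from 0 to [h] along the coordinate axes; it splits a translation into
    translations in one coordinate. *)
Definition rowprefix (h : E) (k : nat) : E := \row_j (if (j < k)%N then h 0 j else 0).

Lemma rowprefixS h (k : 'I_d) : rowprefix h k.+1 = rowprefix h k + h 0 k *: e_ k.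
Proof.
apply/rowP => j; rewrite !mxE eqxx /= ltnS leq_eqVlt.
have [->|jk] := eqVneq j k; first by rewrite eqxx ltnn mulr1 add0r.
by rewrite (negbTE (_ : nat_of_ord j != k)) //= mulr0 addr0.
Qed.

Lemma translation_sqr_le g (h : E) (l : R) : (forall i, 0 <= h 0 i <= l) -> Ck 1 g ->
  (\int[leb]_x ((g (x + h) - g x) ^+ 2)%:E <=
   (2 ^+ d * l ^+ 2)%:E * \sum_(i < d) \int[leb]_y ((partial i g y) ^+ 2)%:E)%E.
Proof.
move=> hl cg; have mg := continuous_measurable_rV (Ck_continuous cg).
pose a (x : E) (k : nat) := g (x + rowprefix h k.+1) - g (x + rowprefix h k).
have aE x : g (x + h) - g x = \sum_(k < d) a x k.
  rewrite -(big_mkord xpredT (a x)) telescope_sumr// /rowprefix; congr (g _ - g _).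
    by apply/rowP => j; rewrite !mxE ltn_ord.
  by apply/rowP => j; rewrite !mxE ltn0 addr0.
have ms k : measurable_fun setT (fun x : E => g (x + rowprefix h k)).
  by apply: measurableT_comp mg _; exact: measurable_addrV.
have ma k : measurable_fun setT (fun x => ((a x k) ^+ 2)%:E).
  by apply/measurable_EFinP; apply: measurable_funX; exact: measurable_funB.
have a0 k x : (0 <= ((a x k) ^+ 2)%:E)%E by rewrite lee_fin sqr_ge0.
apply: (@le_trans _ _ (\int[leb]_x ((2 ^+ d)%:E * \sum_(k < d) ((a x k) ^+ 2)%:E))%E).
  apply: ge0_le_integral => //.
  - by move=> x _; rewrite lee_fin sqr_ge0.
  - apply/measurable_EFinP; apply: measurable_funX; apply: measurable_funB => //.
    by apply: measurableT_comp mg _; exact: measurable_addrV.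
  - by apply: emeasurable_funM => //; exact: emeasurable_sum.
  - by move=> x _; rewrite aE sumEFin -EFinM lee_fin; exact: sqr_sum_le.
rewrite ge0_integralZl_EFin//; last 2 first.
- by move=> x _; apply: sume_ge0.
- exact: emeasurable_sum.
rewrite ge0_integral_sum// EFinM -muleA lee_wpmul2l ?lee_fin ?exprn_ge0//.
rewrite ge0_sume_distrr; last first.
  by move=> i _; apply: integral_ge0 => x _; rewrite lee_fin sqr_ge0.
apply: lee_sum => k _.
have /andP[h0 hk] := hl k.
apply: (@le_trans _ _ (((h 0 k) ^+ 2)%:E * \int[leb]_y ((partial k g y) ^+ 2)%:E)%E).
  apply: le_trans (translation_sqr_le1 k h0 cg).
  rewrite -(@ge0_integral_shift _ _ (rowprefix h k)
    (fun y => ((g (y + h 0 k *: e_ k) - g y) ^+ 2)%:E)).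
  - apply: ge0_le_integral => //.
    + apply/measurable_EFinP; apply: measurable_funX; apply: measurable_funB => //.
      by apply: measurableT_comp mg _; do 2 apply: measurable_addrV => //.
    + by move=> x _; rewrite /a rowprefixS addrA.
  - apply/measurable_EFinP; apply: measurable_funX; apply: measurable_funB => //.
    by apply: measurableT_comp mg _; exact: measurable_addrV.
  - by move=> x; rewrite lee_fin sqr_ge0.
apply: lee_wpmul2r; first by apply: integral_ge0 => x _; rewrite lee_fin sqr_ge0.
by rewrite lee_fin lerXn2r ?nnegrE//; exact: le_trans hk.
Qed.

(** For x in D and h in the box, g(x)^2 <= 2 (g(x+h) - g(x))^2 + 2 g(x+h)^2. Integrate in x over D
    and in h over the box. The first term is controlled by the gradient through
    [translation_sqr_le]; the second contributes at most 2 m J, with J the integral of g^2. Since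
    the box has volume 4 m, half of the left-hand side 4 m J remains. *)
Lemma faber_krahn_box g (D : set E) (m l : R) : Ck 1 g -> measurable D ->
  (forall x, ~ D x -> g x = 0) -> 0 < l -> l ^+ d = 4 * m -> (leb D <= m%:E)%E ->
  integ leb (fun x => g x ^+ 2) ->
  (forall i, integ leb (fun x => partial i g x ^+ 2)) ->
  \int[leb]_x (g x ^+ 2) <=
    2 ^+ d.+2 * l ^+ 2 * \sum_(i < d) \int[leb]_x (partial i g x ^+ 2).
Proof.
move=> cg mD gD l0 lm Dm ig ip.
have mg := continuous_measurable_rV (Ck_continuous cg).
pose J := \int[leb]_x (g x ^+ 2).
pose S := \sum_(i < d) \int[leb]_x (partial i g x ^+ 2).
have J0 : 0 <= J by apply: Int_ge0 => x; exact: sqr_ge0.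
have SE : (\sum_(i < d) \int[leb]_y ((partial i g y) ^+ 2)%:E = S%:E)%E.
  by rewrite /S -sumEFin; apply: eq_bigr => i _; rewrite Int_EFin.
have JE : (\int[leb]_x (g x ^+ 2)%:E = J%:E)%E by rewrite Int_EFin.
pose f (z : E * E) : \bar R := (\1_D z.1 * (g (z.1 + z.2)) ^+ 2)%:E.
have mgs : measurable_fun setT (fun z : E * E => g (z.1 + z.2)).
  by apply: measurableT_comp mg _; exact: measurable_addrV.
have mf : measurable_fun setT f.
  apply/measurable_EFinP; apply: measurable_funM.
    by apply: measurableT_comp => //; exact: measurable_indic.
  exact: measurable_funX.
have f0 z : (0 <= f z)%E by rewrite lee_fin mulr_ge0 ?sqr_ge0.
have mG : measurable_fun setT (fun h => \int[leb]_x f (x, h))%E.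
  exact: (@measurable_fun_fubini_tonelli_G _ _ _ _ _ leb f mf f0).
(* Here h runs over the whole space, so that the inner integral is J for every x in D and the total
   is at most the measure of D times J. *)
have tot : (\int[leb]_h \int[leb]_x f (x, h) <= m%:E * J%:E)%E.
  rewrite -(fubini_tonelli f)//.
  under eq_integral => x _.
    have -> : (\int[leb]_h f (x, h) = (\1_D x)%:E * J%:E)%E.
      transitivity (\int[leb]_h ((\1_D x)%:E * (g (h + x) ^+ 2)%:E))%E.
        by apply: eq_integral => h _; rewrite /f /= EFinM addrC.
      rewrite ge0_integralZl_EFin//; last 2 first.
      - by move=> y _; rewrite lee_fin sqr_ge0.
      - apply/measurable_EFinP; apply: measurable_funX.
        by apply: measurableT_comp mg _; exact: measurable_addrV.
      rewrite (@ge0_integral_shift _ _ x (fun y => (g y ^+ 2)%:E)) ?JE//.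
      - by apply/measurable_EFinP; exact: measurable_funX.
      - by move=> y; rewrite lee_fin sqr_ge0.
    over.
  rewrite ge0_integralZr//; last first.
    by apply/measurable_EFinP; exact: measurable_indic.
  rewrite integral_indic// setIT lee_wpmul2r//.
have point h : box d l h ->
    (J%:E <= (2 ^+ d.+1 * l ^+ 2 * S)%:E + 2%:E * \int[leb]_x f (x, h))%E.
  move=> hb; have := translation_sqr_le hb cg; rewrite SE -EFinM.
  set X := (X in (X <= _)%E -> _) => HX.
  apply: (@le_trans _ _ (2%:E * X + 2%:E * \int[leb]_x f (x, h))%E); last first.
    apply: leeD => //.
    apply: (@le_trans _ _ (2%:E * (2 ^+ d * l ^+ 2 * S)%:E)%E).
      by apply: lee_wpmul2l.
    by rewrite -EFinM lee_fin [2 ^+ d.+1]exprS !mulrA.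
  have mX : measurable_fun setT (fun x : E => ((g (x + h) - g x) ^+ 2)%:E).
    apply/measurable_EFinP; apply: measurable_funX; apply: measurable_funB => //.
    by apply: measurableT_comp mg _; exact: measurable_addrV.
  have mfh : measurable_fun setT (fun x => f (x, h)).
    exact: measurableT_comp mf (measurable_pair2 _).
  rewrite -ge0_integralZl_EFin//; last by move=> x _; rewrite lee_fin sqr_ge0.
  rewrite -ge0_integralZl_EFin// -ge0_integralD//; last 4 first.
  - by move=> x _; rewrite mule_ge0// lee_fin sqr_ge0.
  - exact: emeasurable_funM.
  - by move=> x _; rewrite mule_ge0.
  - exact: emeasurable_funM.
  rewrite -JE; apply: ge0_le_integral => //.
  - by move=> x _; rewrite lee_fin sqr_ge0.
  - by apply/measurable_EFinP; exact: measurable_funX.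
  - by apply: emeasurable_funD; exact: emeasurable_funM.
  - move=> x _; rewrite /f /= -!EFinM -EFinD lee_fin indicE.
    have [xD|xD] := pselect (D x).
      (* The two sides differ by exactly (a - 2 b)^2. *)
      rewrite (mem_set xD) /=; move: (g x) (g (x + h)) => a b.
      by have := sqr_ge0 (a - 2 * b); nra.
    rewrite (memNset xD) gD//= expr0n subr0 mul0r mulr0 addr0.
    by rewrite mulr_ge0// sqr_ge0.
have key : ((l ^+ d)%:E * J%:E <=
    (l ^+ d)%:E * (2 ^+ d.+1 * l ^+ 2 * S)%:E + 2%:E * (m%:E * J%:E))%E.
  have mb : measurable (box d l : set E) by exact: measurable_box.
  have S0 : 0 <= S by apply: sumr_ge0 => i _; apply: Int_ge0 => x; exact: sqr_ge0.
  have c0 : 0 <= 2 ^+ d.+1 * l ^+ 2 * S by rewrite !mulr_ge0// ?exprn_ge0// ltW.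
  apply: (@le_trans _ _ (\int[leb]_(h in box d l)
     ((2 ^+ d.+1 * l ^+ 2 * S)%:E + 2%:E * \int[leb]_x f (x, h)))%E).
    rewrite -(leb_box d (ltW l0)) muleC -integral_cst//.
    apply: ge0_le_integral => //.
    apply: measurable_funTS; apply: emeasurable_funD => //.
    exact: emeasurable_funM.
  rewrite ge0_integralD//; last 2 first.
  - by move=> h _; rewrite mule_ge0// integral_ge0.
  - by apply: measurable_funTS; exact: emeasurable_funM.
  have lb : leb (box d l) = (l ^+ d)%:E := leb_box d (ltW l0).
  rewrite integral_cst// muleC; apply: leeD; first by rewrite -lb.
  rewrite ge0_integralZl_EFin//; last 2 first.
  - by move=> h _; rewrite integral_ge0.
  - exact: measurable_funTS.
  apply: lee_wpmul2l => //; apply: le_trans tot.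
  apply: ge0_subset_integral => //.
  by move=> h _; rewrite integral_ge0.
move: key; rewrite -!EFinM -EFinD lee_fin lm -/S -/J => key.
have m0 : 0 < m by rewrite -(@pmulr_rgt0 _ 4)// -lm exprn_gt0.
have : m * (J - 2 ^+ d.+2 * l ^+ 2 * S) <= 0.
  move: key; rewrite exprS [2 ^+ d.+2]exprS [2 ^+ d.+1]exprS => key.
  nra.
by rewrite pmulr_rle0// subr_le0.
Qed.

End faber_krahn.

(** * Test functions and mollifiers *)

Section cube_bumps.
Context {R : realType} {d : nat}.
Local Notation E := 'rV[R]_d.
Local Notation leb := (@leb R d).

Definition cube (c : E) (r : R) : set E := [set x | forall i, `|x 0 i - c 0 i| <= r].

Lemma cube_compact c r : compact (cube c r).
Proof.
have -> : cube c r = [set v : E | forall i, `[c 0 i - r, c 0 i + r]%classic (v 0 i)].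
  apply/seteqP; split=> x /= xc i; have := xc i; rewrite /= in_itv /=.
    by rewrite distrC ler_distlC.
  by rewrite distrC ler_distlC.
apply: (@rV_compact _ _ (fun i => `[c 0 i - r, c 0 i + r]%classic)) => i.
exact: segment_compact.
Qed.

Definition cube_bump (c : E) (r : R) (x : E) : R :=
  \prod_(i < d) expinv 1 (r ^+ 2 - (x 0 i - c 0 i) ^+ 2).

Lemma Ck_cube_bump k c r : Ck k (cube_bump c r).
Proof.
apply: Ck_prod => i.
apply: (@Ck_comp _ _ _ (expinv 1) (fun x : E => r ^+ 2 - (x 0 i - c 0 i) ^+ 2)).
  exact: smooth1_expinv.
apply: CkB; first exact: Ck_cst.
under eq_fun do rewrite expr2.
by apply: CkM; apply: CkB; (exact: Ck_coord || exact: Ck_cst).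
Qed.

Lemma expinv1_le1 (x : R) : expinv 1 x <= 1.
Proof.
rewrite /expinv; case: ifP => // x0; rewrite hornerC mul1r -expR0 ler_expR.
by rewrite oppr_le0 invr_ge0 ltW.
Qed.

Lemma cube_bump_ge0 c r x : 0 <= cube_bump c r x.
Proof. by apply: prodr_ge0 => i _; exact: expinv_ge0. Qed.

Lemma cube_bump_le1 c r x : cube_bump c r x <= 1.
Proof. by apply: prodr_ile1 => i _; rewrite expinv_ge0 expinv1_le1. Qed.

Lemma cube_bump_out (c : E) r (x : E) : 0 < r -> (exists i, r <= `|x 0 i - c 0 i|) ->
  cube_bump c r x = 0.
Proof.
move=> r0 [i xi]; rewrite /cube_bump (bigD1 i)//= expinv_le0 ?mul0r//.
by rewrite subr_le0 -[leRHS]real_normK ?num_real// lerXn2r ?nnegrE// ltW.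
Qed.

Lemma cube_bump_gt0 (c : E) r (x : E) : (forall i, `|x 0 i - c 0 i| < r) -> 0 < cube_bump c r x.
Proof.
move=> xr; apply: prodr_gt0 => i _; apply: expinv1_gt0; rewrite subr_gt0.
rewrite -[ltLHS]real_normK ?num_real// ltrXn2r// ?nnegrE//.

Qed.

Lemma cube_bump_test c r (U : set E) : 0 < r -> cube c r `<=` U ->
  test_fun U (cube_bump c r).
Proof.
move=> r0 cU; apply: (@test_funP _ _ _ (cube c r)) => //.
- by move=> k; exact: Ck_cube_bump.
- exact: cube_compact.
- move=> x nx; apply: cube_bump_out => //; apply: contrapT => nex; apply: nx => i.
  by rewrite leNgt; apply/negP => /ltW h; apply: nex; exists i.
Qed.

(** Rational centres and radii 1/(n+1) make the family of cubes countable, so that [pickle]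
    enumerates a cover of any open set. *)
Lemma open_cube (U : set E) x : open U -> U x ->
  exists (q : 'rV[rat]_d) (n : nat), [/\ cube (\row_i ratr (q 0 i)) n.+1%:R^-1 `<=` U &
    forall i, `|x 0 i - (\row_i ratr (q 0 i) : E) 0 i| < n.+1%:R^-1].
Proof.
move=> oU Ux; have /nbhs_ballP[e /= e0 eU] : nbhs x U by exact: open_nbhs_nbhs.
have e20 : 0 < e / 4 by rewrite divr_gt0.
have [k _ /(_ k (leqnn k)) ke] := near_infty_natSinv_lt (PosNum e20).
have /boolp.choice[q qP] : forall i, exists r : rat,
    `|x 0 i - ratr r| < k.+1%:R^-1 :> R.
  move=> i; have /rat_in_itvoo[r] : x 0 i - k.+1%:R^-1 < x 0 i + k.+1%:R^-1 :> R.
    by rewrite ltrD2l gtrN// invr_gt0.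
  by rewrite in_itv /= -ltr_distlC distrC => rP; exists r; rewrite distrC.
exists (\row_i q i), k; split; last by move=> i; rewrite !mxE.
move=> y yc; apply: eU; rewrite mx_norm_ball /ball_ /=.
apply: (@le_lt_trans _ _ (e / 2)); last by lra.
apply/rV_normP; first by lra.
move=> i; rewrite !mxE; have := yc i; rewrite !mxE => yi.
have := qP i; rewrite /= in ke.
have -> : x 0 i - y 0 i = (x 0 i - ratr (q i)) - (y 0 i - ratr (q i)) by ring.
move=> xi; apply: le_trans (ler_normB _ _) _.
apply: (@le_trans _ _ (e / 4 + e / 4)); last by lra.
by apply: lerD; [exact/ltW/(lt_trans xi)|exact/(le_trans yi)/ltW].
Qed.

(** With b_k the bumps on the countably many cubes inside U, the functions 1 - prod_(k < n) (1 -
    b_k)^n work: at a point of U some b_k is positive, and the n-th power of its factor tends to 0.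
    Each product is finite, so smoothness and compact support are immediate. *)
Lemma test_fun_approx_open (U : set E) : open U -> exists phi : nat -> E -> R,
  [/\ forall n, test_fun U (phi n), forall n x, 0 <= phi n x <= 1,
      forall x, U x -> phi n x @[n --> \oo] --> (1 : R) &
      forall n x, ~ U x -> phi n x = 0].
Proof.
move=> oU.
pose D := [set p : 'rV[rat]_d * nat | cube (\row_i ratr (p.1 0 i)) p.2.+1%:R^-1 `<=` U].
pose b k := if (unpickle k : option ('rV[rat]_d * nat)) is Some p then
  (if `[< D p >] then cube_bump (\row_i ratr (p.1 0 i)) p.2.+1%:R^-1 else fun=> 0)
  else fun=> 0.
have tb k : test_fun U (b k).
  rewrite /b; case: unpickle => [p|]; last exact: test_fun0.
  by case: asboolP => [Dp|_]; [exact: cube_bump_test|exact: test_fun0].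
have b01 k x : 0 <= b k x <= 1.
  rewrite /b; case: unpickle => [p|]; last by rewrite lexx ler01.
  by case: asboolP => [Dp|_]; rewrite ?cube_bump_ge0 ?cube_bump_le1// lexx ler01.
have bout k x : ~ U x -> b k x = 0 by exact: test_fun_out.
pose P n x := \prod_(k < n) (1 - b k x) ^+ n.
have P01 n x : 0 <= P n x <= 1.
  apply/andP; split.
    by apply: prodr_ge0 => k _; rewrite exprn_ge0// subr_ge0; case/andP: (b01 k x).
  apply: prodr_ile1 => k _; have /andP[b0 b1] := b01 k x.
  by rewrite exprn_ge0 ?subr_ge0//= exprn_ile1 ?subr_ge0// lerBlDr lerDl.
exists (fun n x => 1 - P n x); split.
- move=> n; apply: (@test_funP _ _ _ (\bigcup_(k in `I_n) supp (b k))).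
  + move=> k; apply: CkB; first exact: Ck_cst.
    apply: Ck_prod => j; have [cb _ _] := tb j.
    by apply: CkX; apply: CkB => //; exact: Ck_cst.
  + rewrite bigcup_mkord; apply: (big_ind (@compact E)).
    * exact: compact0.
    * exact: compactU.
    * by move=> k _; have [] := tb k.
  + by move=> x [k _]; have [_ _] := tb k; exact.
  + move=> x nx; rewrite /P big1 ?subrr// => k _.
    by rewrite supp_out ?subr0 ?expr1n// => kx; apply: nx; exists k => /=.
- by move=> n x; have := P01 n x => /andP[? ?]; rewrite subr_ge0 lerBlDr lerDl; apply/andP.
- move=> x Ux; rewrite -[X in _ --> X]subr0; apply: cvgB; first exact: cvg_cst.
  have [q [m [qU xq]]] := open_cube oU Ux.
  pose k := pickle (q, m).
  have bx : 0 < b k x.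
    rewrite /b /k pickleK; case: asboolP => [_|nD]; last by case: nD.
    exact: cube_bump_gt0.
  have /andP[_ bx1] := b01 k x.
  apply: (@squeeze_cvgr _ _ _ _ (fun=> 0) (fun n => (1 - b k x) ^+ n)).
  + near=> n; have /andP[-> _] /= := P01 n x.
    have kn : (k < n)%N by near: n; exact: nbhs_infty_gt.
    rewrite /P (bigD1 (Ordinal kn))//= ler_piMr// ?exprn_ge0 ?subr_ge0//.
    apply: prodr_ile1 => j _; have /andP[b0 b1] := b01 j x.
    by rewrite exprn_ge0 ?subr_ge0//= exprn_ile1 ?subr_ge0// lerBlDr lerDl.
  + exact: cvg_cst.
  + apply: cvg_expr; rewrite ger0_norm ?subr_ge0//.
    by rewrite ltrBlDr ltrDl.
- by move=> n x nx; rewrite /P big1 ?subrr// => k _; rewrite bout// subr0 expr1n.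
Unshelve. all: by end_near. Qed.

End cube_bumps.

(** * The fundamental lemma of the calculus of variations *)

Section fundamental_lemma.
Context {R : realType} {d : nat}.
Local Notation E := 'rV[R]_d.
Local Notation leb := (@leb R d).
Implicit Types f g h : E -> R.

(** The measurable sets over which [h] integrates to 0 form a Dynkin system containing the open
    sets, which are stable under intersection; hence all Borel sets belong to it. *)
Lemma integ_open_eq0 (mu : {measure set E -> \bar R}) h : integ mu h ->
  (forall O, open O -> (\int[mu]_(x in O) (h x)%:E = 0)%E) ->
  \forall x \ae mu, h x = 0.
Proof.
move=> ih hO.
pose H := [set A : set E | measurable A /\ (\int[mu]_(x in A) (h x)%:E = 0)%E].
have openI : setI_closed (@open E) by move=> A B oA oB; exact: openI.
have dH : dynkin H.
  split.
  - by split => //; apply: hO; exact: openT.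
  - move=> A [mA A0]; split; first exact: measurableC.
    have : (\int[mu]_(x in A `|` ~` A) (h x)%:E = 0)%E.
      by rewrite setUv; apply: hO; exact: openT.
    rewrite integral_setU//.
    + by rewrite A0 add0e.
    + exact: measurableC.
    + by rewrite setUv; exact: (measurable_int _ ih).
    + by apply/disj_setPS; rewrite setICr.
  - move=> F tF HF; split; first by apply: bigcupT_measurable => k; have [] := HF k.
    rewrite integral_bigcup//.
    + by rewrite eseries0// => k _ _; have [] := HF k.
    + by move=> k; have [] := HF k.
    + apply: (integrableS measurableT) => //.
      by apply: bigcupT_measurable => k; have [] := HF k.
have sH : <<s (@open E) >> `<=` H.
  rewrite -setI_closed_g_dynkin_g_sigma_algebra// => A; apply; split => // O oO.
  by split; [exact: measurable_open_rV|exact: hO].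
have : ae_eq mu setT (EFin \o h) (cst 0%E).
  apply: integral_ae_eq => // A _ mA; rewrite integral0.
  by have [] := sH _ mA.
by apply: filterS => x /(_ I) /= [].
Qed.

Lemma integ_restrict_test (U : set E) h p :
  (forall K, compact K -> K `<=` U -> integ leb (h \_ K)) -> test_fun U p ->
  integ leb (fun x => (h \_ U) x * p x).
Proof.
move=> ih tp; have [mp [M pM] _] := test_fun_bcs tp.
have [_ cp sp] := tp.
have := integM_bounded (ih _ cp sp) mp pM; congr (integ leb _).
apply/funext => x /=; rewrite !patchE.
case: ifPn => [xp|xp]; first by rewrite ifT// inE; apply: sp; rewrite inE in xp.
by rewrite (@supp_out _ _ p) ?mulr0// => px; rewrite notin_setE in xp.
Qed.

Lemma fundamental_lemma (U : set E) h : open U -> measurable_fun U h ->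
  (forall K, compact K -> K `<=` U -> integ leb (h \_ K)) ->
  (forall phi, test_fun U phi -> \int[leb]_(x in U) (h x * phi x) = 0) ->
  \forall x \ae leb, U x -> h x = 0.
Proof.
move=> oU mh ih h0; have mU := measurable_open_rV oU.
have [phi [tphi phi01 phi1 phi_out]] := test_fun_approx_open oU.
pose k n x := (h \_ U) x * phi n x.
have ihp p : test_fun U p -> integ leb (fun x => (h \_ U) x * p x).
  exact: integ_restrict_test.
have hp0 p : test_fun U p -> \int[leb]_x ((h \_ U) x * p x) = 0.
  move=> tp; rewrite -[RHS](h0 _ tp) [RHS]Rintegral_mkcond.
  by apply: eq_Rintegral => x _; rewrite !patchE; case: ifP; rewrite ?mul0r.
have k0 n : \forall x \ae leb, k n x = 0.
  apply: integ_open_eq0 => [|O oO]; first exact: ihp.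
  have [psi [tpsi psi01 psi1 psi_out]] := test_fun_approx_open oO.
  have mO := measurable_open_rV oO.
  have := @Int_dominated_cvg _ _ _ leb (fun m x => k n x * psi m x)
    (fun x => k n x * \1_O x) (fun x => `|k n x|).
  have mk : measurable_fun setT (k n) by apply: integ_measurable; exact: ihp.
  case.
  - move=> m; apply: measurable_funM => //.
    by have [] := test_fun_bcs (tpsi m).
  - by apply: measurable_funM => //; exact: measurable_indic.
  - apply: aeW => x; apply: cvgM; first exact: cvg_cst.
    rewrite indicE; have [Ox|nOx] := pselect (O x).
      by rewrite (mem_set Ox); exact: psi1.
    rewrite (memNset nOx); under eq_fun do rewrite psi_out//; exact: cvg_cst.
  - exact/integ_norm/ihp.
  - move=> m x; rewrite normrM; have /andP[p0 p1] := psi01 m x.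
    by rewrite (ger0_norm p0) ler_piMr.
  move=> ik; have -> : (fun m => \int[leb]_x (k n x * psi m x)) = fun=> 0.
    apply/funext => m; rewrite -[RHS](hp0 (fun x => phi n x * psi m x)).
      by apply: eq_Rintegral => x _; rewrite /k mulrA.
    by apply: test_funM_l => // j; have [] := tpsi m.
  move=> /(cvg_lim (@Rhausdorff R)); rewrite lim_cst// => e0.
  rewrite integral_mkcond -[RHS](congr1 EFin (esym e0)) Int_EFin//.
  apply: eq_integral => x _; rewrite patchE indicE.
  by case: (x \in O); rewrite ?mulr1 ?mulr0.
have : \forall x \ae leb, forall n, k n x = 0 by exact: ae_foralln.
apply: filterS => x kx Ux.
have h1 := phi1 _ Ux.
have : \forall n \near \oo, 0 < phi n x by exact: cvgr_gt h1 _ ltr01.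
case=> n _ /(_ n (leqnn n)) pn.
have := kx n; rewrite /k patchE (mem_set Ux) => /eqP; rewrite mulf_eq0.
by rewrite (gt_eqF pn) orbF => /eqP.
Qed.

End fundamental_lemma.

(** * Mollification *)

Section mollifier.
Context {R : realType} {d : nat}.
Local Notation E := 'rV[R]_d.
Local Notation leb := (@leb R d).
Local Notation e_ i := (delta_mx 0 i : E).
Implicit Types f g : E -> R.

Lemma Int_shift f (h : E) : measurable_fun setT f ->
  \int[leb]_x f (x + h) = \int[leb]_x f x.
Proof.
move=> mf; have mf' : measurable_fun setT (EFin \o f) by exact/measurable_EFinP.
rewrite /Rintegral; congr fine; rewrite integralE [RHS]integralE; congr (_ - _)%E.
  rewrite -(@ge0_integral_shift _ _ h ((EFin \o f)^\+)%E)//.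
    by apply: eq_integral => x _; rewrite !funeposE.
  exact: measurable_funepos.
rewrite -(@ge0_integral_shift _ _ h ((EFin \o f)^\-)%E)//.
  by apply: eq_integral => x _; rewrite !funenegE.
exact: measurable_funeneg.
Qed.

Lemma leb_cube (c : E) (r : R) : 0 <= r -> leb (cube c r) = ((2 * r) ^+ d)%:E.
Proof.
move=> r0; rewrite -leb_box ?mulr_ge0//.
rewrite -(leb_shift (\row_i (r - c 0 i)) (@measurable_box R d (2 * r))).
congr (leb _); apply/seteqP; split=> x xc i; have := xc i; rewrite !mxE ler_norml.
  by move=> /andP[a b]; apply/andP; split; lra.
by move=> /andP[a b]; apply/andP; split; lra.
Qed.

Lemma leb_open_gt0 (U : set E) x : open U -> U x -> (0 < leb U)%E.
Proof.
move=> oU Ux; have [q [n [qU _]]] := open_cube oU Ux.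
have h : (0 < leb (cube (\row_i ratr (q ord0 i)) n.+1%:R^-1))%E.
  by rewrite leb_cube// lte_fin exprn_gt0// mulr_gt0// invr_gt0.
apply: lt_le_trans h _.
apply: le_measure => //; rewrite inE.
  by apply: measurable_compact_rV; exact: cube_compact.
exact: measurable_open_rV.
Qed.

Lemma ae_continuous_le f (c : R) (U : set E) : open U -> continuous f ->
  (\forall x \ae leb, U x -> f x <= c) -> forall x, U x -> f x <= c.
Proof.
move=> oU cf [N [mN N0 HN]] x Ux; rewrite leNgt; apply/negP => cx.
pose V := U `&` [set y | c < f y].
have oV : open V.
  apply: openI => //.
  apply: (@open_comp _ _ f [set y | c < y]); last exact: open_gt.
  by move=> y _; exact: cf.
have : (0 < leb V)%E by exact: leb_open_gt0 (conj Ux cx).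
apply/negP; rewrite -leNgt -N0; apply: le_measure; rewrite ?inE//.
  exact: measurable_open_rV.
move=> y [Uy cy]; apply: HN => /= h.
by have := h Uy; rewrite leNgt cy.
Qed.

Definition moll_mass (n : nat) : R := \int[leb]_x cube_bump 0 n.+1%:R^-1 x.

Lemma cube_bump_integ (c : E) (r : R) : 0 < r -> integ leb (cube_bump c r).
Proof.
move=> r0; apply: bcs_integ; apply: (@test_fun_bcs _ _ setT).
exact: cube_bump_test.
Qed.

Lemma moll_mass_gt0 n : 0 < moll_mass n.
Proof.
have r0 : 0 < n.+1%:R^-1 :> R by rewrite invr_gt0.
rewrite lt_neqAle Int_ge0 ?andbT; last by move=> x; exact: cube_bump_ge0.
apply/eqP => /esym /(Int_eq0_ae (cube_bump_integ _ r0)) h.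
have {}h := h (fun x => cube_bump_ge0 _ _ _).
have cb : continuous (cube_bump (0 : E) n.+1%:R^-1).
  exact: (Ck_continuous (Ck_cube_bump 0 _ _)).
have : cube_bump (0 : E) n.+1%:R^-1 0 <= 0.
  apply: (ae_continuous_le openT cb) => //.
  by apply: filterS h => x -> _.
rewrite leNgt => /negP; apply; apply: cube_bump_gt0 => i.
by rewrite subrr normr0.
Qed.

Definition moll (n : nat) (x : E) : R :=
  (moll_mass n)^-1 * cube_bump 0 n.+1%:R^-1 x.

Lemma moll_ge0 n x : 0 <= moll n x.
Proof. by rewrite mulr_ge0 ?cube_bump_ge0// invr_ge0 ltW// moll_mass_gt0. Qed.

Lemma moll_even n x : moll n (- x) = moll n x.
Proof.
by congr (_ * _); apply: eq_bigr => i _; rewrite !mxE subr0 subr0 sqrrN.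
Qed.

Lemma moll_test n : test_fun setT (moll n).
Proof. by apply: test_funZ; apply: cube_bump_test => //; rewrite invr_gt0. Qed.

Lemma moll_int1 n : \int[leb]_x moll n x = 1.
Proof.
rewrite IntZ; last by apply: cube_bump_integ; rewrite invr_gt0.
by rewrite mulVf// gt_eqF// moll_mass_gt0.
Qed.

Lemma moll_out n (x : E) i : n.+1%:R^-1 <= `|x 0 i| -> moll n x = 0.
Proof.
move=> xi; rewrite /moll cube_bump_out ?mulr0 ?invr_gt0//.
by exists i; rewrite mxE subr0.
Qed.

Lemma continuous_bounded_bcs f : bcs f -> exists2 M : R, 0 <= M & forall x, `|f x| <= M.
Proof.
by move=> [_ [M fM] _]; exists M => //; apply: le_trans (fM 0).
Qed.

Lemma cont_shift (T : topologicalType) (g : E -> T) (x : E) :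
  continuous g -> continuous (fun y : E => g (y - x)).
Proof.
move=> cg y; apply: (@continuous_comp _ _ _ (fun y : E => y - x) g); last exact: cg.
apply: (@continuousD _ _ _ (fun y : E => y) (fun=> - x)); first exact: cvg_id.
exact: cst_continuous.
Qed.

Lemma bcs_shift f (x : E) : bcs f -> bcs (fun y => f (y - x)).
Proof.
move=> [mf [M fM] [K cK fK]]; split.
- by apply: measurableT_comp mf _; exact: measurable_addrV.
- by exists M.
- exists ((fun y => y + x) @` K).
    apply: continuous_compact => //; apply: continuous_subspaceT => y.
    apply: (@continuousD _ _ _ (fun y : E => y) (fun=> x)); first exact: cvg_id.
    exact: cst_continuous.
  by move=> y ny; apply: fK => Ky; apply: ny; exists (y - x) => //; rewrite subrK.
Qed.

(* The mollifiers are even, so [y - x] may stand for [x - y]. *)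
Definition convol f (eta : E -> R) (x : E) : R := \int[leb]_y (f y * eta (y - x)).

Lemma conv_shift f eta x : measurable_fun setT f -> measurable_fun setT eta ->
  convol f eta x = \int[leb]_z (f (z + x) * eta z).
Proof.
move=> mf me; rewrite /convol -(@Int_shift _ x).
  by apply: eq_Rintegral => z _; rewrite addrK.
apply: measurable_funM => //; apply: measurableT_comp me _.
exact: measurable_addrV.
Qed.

Lemma test_fun_bound (U : set E) eta : test_fun U eta ->
  exists2 M : R, 0 <= M & forall x, `|eta x| <= M.
Proof. by move=> /test_fun_bcs/continuous_bounded_bcs. Qed.

Lemma conv_integrand_integ f eta x : integ leb f -> test_fun setT eta ->
  integ leb (fun y => f y * eta (y - x)).
Proof.
move=> iF te; have [M M0 eM] := test_fun_bound te.
apply: (@integM_bounded _ _ _ _ _ _ M) => //.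
have [me _ _] := test_fun_bcs te.
by apply: measurableT_comp me _; exact: measurable_addrV.
Qed.

Lemma conv_cvg f eta x (xn : nat -> E) : integ leb f -> test_fun setT eta ->
  xn n @[n --> \oo] --> x -> convol f eta (xn n) @[n --> \oo] --> convol f eta x.
Proof.
move=> iF te xnx; have [M M0 eM] := test_fun_bound te.
have [ce _ _] := te; have cce := Ck_continuous (ce 0).
have mf := integ_measurable iF.
have me (y : E) : measurable_fun setT (fun x : E => eta (x - y)).
  have [me _ _] := test_fun_bcs te.
  by apply: measurableT_comp me _; exact: measurable_addrV.
have := @Int_dominated_cvg _ _ _ leb (fun n y => f y * eta (y - xn n))
   (fun y => f y * eta (y - x)) (fun y => M * `|f y|).
case => //.
- by move=> n; exact: measurable_funM.
- exact: measurable_funM.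
- apply: aeW => y; apply: cvgM; first exact: cvg_cst.
  apply: (@cvg_comp _ _ _ (fun n => y - xn n) eta _ (nbhs (y - x))).
    by apply: cvgB => //; exact: cvg_cst.
  exact: cce.
- by apply: integZ; exact: integ_norm.
- by move=> n y; rewrite normrM mulrC ler_wpM2r.
Qed.

Lemma seq_continuous (F : E -> R) :
  (forall x (xn : nat -> E), xn n @[n --> \oo] --> x ->
     F (xn n) @[n --> \oo] --> F x) -> continuous F.
Proof.
move=> sF x; apply: contrapT => nF.
have [e e0 He] : exists2 e : R, 0 < e &
    forall n : nat, exists y, ball x n.+1%:R^-1 y /\ e <= `|F x - F y|.
  apply: contrapT => nex; apply: nF => A /nbhs_ballP[e /= e0 eA].
  apply: contrapT => nA; apply: nex; exists e => // n.
  apply: contrapT => ny; apply: nA; apply/nbhs_ballP.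
  exists n.+1%:R^-1 => /=; first by rewrite invr_gt0.
  move=> y xy /=; apply: eA; rewrite /ball /= ltNge; apply/negP => ey.
  by apply: ny; exists y.
have [xn xnP] := boolp.choice He.
have : F (xn n) @[n --> \oo] --> F x.
  apply: sF; apply/cvg_ballP => r r0; near=> n.
  have [xb _] := xnP n; apply: le_ball xb.
  by apply: ltW; near: n; exact: (near_infty_natSinv_lt (PosNum r0)).
move=> /cvgrPdist_lt/(_ _ e0)[N _ /(_ N (leqnn N)) /=].
by have [_] := xnP N; rewrite leNgt => /negbTE ->.
Unshelve. all: by end_near. Qed.

Lemma conv_continuous f eta : integ leb f -> test_fun setT eta ->
  continuous (convol f eta).
Proof.
by move=> iF te; apply: seq_continuous => x xn; exact: conv_cvg.
Qed.

(** The derivative falls on [eta] under the integral sign, with dominating function M |f|; the minus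
    sign is due to the argument y - x in [convol]. *)
Lemma conv_derive f eta x i : integ leb f -> test_fun setT eta ->
  is_derive x (e_ i) (convol f eta) (- convol f (partial i eta) x).
Proof.
move=> iF te; apply/is_derive_line.
have tp := test_fun_partial i te.
have [M M0 eM] := test_fun_bound tp.
have mf := integ_measurable iF.
pose F (h : R) (y : E) := f y * eta (y - (h *: e_ i + x)).
have dF (h : R) y : is_derive h 1 (F^~ y) (f y * - partial i eta (y - (h *: e_ i + x))).
  have ce : Ck 1 eta by have [] := te.
  have d1 : is_derive h 1 (fun h : R => eta ((y - x) + (- h) *: e_ i))
      (- partial i eta (y - (h *: e_ i + x))).
    rewrite -mulrN1.
    apply: (@is_derive1_comp _ (fun s : R => eta ((y - x) + s *: e_ i)) (fun h => - h)).
    apply: is_derive_line_at.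
    have -> : y - x + - h *: e_ i = y - (h *: e_ i + x).
      by rewrite scaleNr opprD addrA addrAC.
    exact: CkS_derivable ce.
  have := is_deriveM (is_derive_cst (f y) h 1) d1.
  rewrite scaler0 addr0; congr is_derive.
  apply/funext => s; transitivity (f y * eta (y - x + - s *: e_ i)) => //.
  by rewrite /F scaleNr opprD addrA addrAC.
have iF' h : integ leb (F h) by exact: conv_integrand_integ.
have iG : integ leb (fun y => M * `|f y|) by apply: integZ; exact: integ_norm.
have G0 y : 0 <= M * `|f y| by rewrite mulr_ge0.
have I0 : (0 : R) \in `]-1, 1[ by rewrite in_itv /= ltrN10 ltr01.
have p1E h y : partial1of2 F h y = f y * - partial i eta (y - (h *: e_ i + x)).
  by rewrite partial1of2E; have [_ ->] := dF h y.
have GF h y : `|partial1of2 F h y| <= M * `|f y|.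
  by rewrite p1E normrM normrN mulrC ler_wpM2r.
have H1 := @derivable_under_integral _ _ _ leb F setT measurableT 0 (-1) 1 I0
  (fun h _ => iF' h) (fun h y _ _ => @ex_derive _ _ _ _ _ _ _ (dF h y))
  _ G0 iG (fun h y _ _ => GF h y).
have H2 := @differentiation_under_integral _ _ _ leb F setT measurableT 0 (-1) 1 I0
  (fun h _ => iF' h) (fun h y _ _ => @ex_derive _ _ _ _ _ _ _ (dF h y))
  _ G0 iG (fun h y _ _ => GF h y).
apply: DeriveDef; first exact: H1.
rewrite -derive1E [LHS]H2 -IntN; last exact: conv_integrand_integ.
by apply: eq_Rintegral => y _; rewrite p1E scale0r add0r mulrN.
Qed.

Lemma Ck_conv k f eta : integ leb f -> test_fun setT eta -> Ck k (convol f eta).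
Proof.
elim: k eta => [|k ih] eta iF te.
  by split => //; exact: conv_continuous.
apply: (@CkS _ _ _ _ (fun i x => - convol f (partial i eta) x)).
- exact: conv_continuous.
- by move=> i x; exact: conv_derive.
- by move=> i; apply: CkN; apply: ih => //; exact: test_fun_partial.
Qed.

Lemma conv_moll_cvg f x : measurable_fun setT f -> (forall n, integ leb (fun z => f (z + x) * moll n z)) ->
  {for x, continuous f} -> convol f (moll n) x @[n --> \oo] --> f x.
Proof.
move=> mf ifm cf; apply/cvgrPdist_le => e e0.
have /nbhs_ballP[r /= r0 rP] : nbhs x [set y | `|f x - f y| <= e].
  by have /cvgrPdist_le/(_ _ e0) := cf.
near=> n.
have nr : n.+1%:R^-1 < r.
  by near: n; exact: (near_infty_natSinv_lt (PosNum r0)).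
have [mm _ _] := test_fun_bcs (moll_test n).
have im : integ leb (moll n) by exact/bcs_integ/test_fun_bcs/moll_test.
rewrite conv_shift//.
have -> : f x = \int[leb]_z (f x * moll n z) by rewrite IntZ// moll_int1 mulr1.
rewrite -IntB//; last exact: integZ.
apply: le_trans (Int_norm _) _; first by apply: integB => //; exact: integZ.
rewrite -[leRHS]mulr1 -(moll_int1 n) -IntZ//.
apply: Int_le; first by apply: integ_norm; apply: integB => //; exact: integZ.
  exact: integZ.
move=> z; rewrite -mulrBl normrM (ger0_norm (moll_ge0 _ _)).
have [zr|] := pselect (forall i, `|z 0 i| < n.+1%:R^-1).
  rewrite ler_wpM2r ?moll_ge0//; apply: rP.
  rewrite mx_norm_ball /ball_ /= opprD addrCA subrr addr0 normrN.
  apply: le_lt_trans nr; apply/rV_normP; first by rewrite invr_ge0.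
  by move=> i; exact/ltW.
move=> /existsNP[i /negP]; rewrite -leNgt => /moll_out ->.
by rewrite !mulr0.
Unshelve. all: by end_near. Qed.

End mollifier.

(** * Product rule for weak derivatives *)

Section weak_product_rule.
Context {R : realType} {d : nat}.
Local Notation E := 'rV[R]_d.
Local Notation leb := (@leb R d).
Local Notation e_ i := (delta_mx 0 i : E).
Implicit Types f g : E -> R.

Lemma is_derive_shift f i (x y : E) (a : R) : is_derive (y - x) (e_ i) f a ->
  is_derive y (e_ i) (fun y => f (y - x)) a.
Proof.
move/is_derive_line => h; apply/is_derive_line.
by under eq_fun do rewrite -addrA.
Qed.

Lemma Ck_shift k f (x : E) : Ck k f -> Ck k (fun y => f (y - x)).
Proof.
elim: k f => [|k ih] f cf; first by split => //; exact/cont_shift/(Ck_continuous cf).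
apply: (@CkS _ _ _ _ (fun i y => partial i f (y - x))).
- exact/cont_shift/(Ck_continuous cf).
- by move=> i y; apply: is_derive_shift; exact: CkS_derivable cf.
- by move=> i; apply: ih; exact: CkS_partial.
Qed.

Lemma moll_bounded n : exists2 M : R, 0 <= M & forall x : E, `|moll n x| <= M.
Proof. exact: test_fun_bound (moll_test n). Qed.

(** Fubini together with the evenness of the mollifier, whose boundedness makes the product kernel
    integrable. *)
Lemma conv_symmetric f g n : integ leb f -> integ leb g ->
  \int[leb]_x (f x * convol g (moll n) x) = \int[leb]_y (g y * convol f (moll n) y).
Proof.
move=> iF ig; have [M M0 mM] := moll_bounded n.
have [mm _ _] := test_fun_bcs (@moll_test R d n).
have mf := integ_measurable iF; have mg := integ_measurable ig.
pose F (z : E * E) : \bar R := (f z.1 * g z.2 * moll n (z.2 - z.1))%:E.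
have mF : measurable_fun setT F.
  apply/measurable_EFinP; apply: measurable_funM; first apply: measurable_funM.
  - exact: measurableT_comp mf measurable_fst.
  - exact: measurableT_comp mg measurable_snd.
  - apply: measurableT_comp mm _; apply: measurable_addrV => //.
    exact: measurable_opprV.
have iFF : ((leb \x leb)%E).-integrable setT F.
  apply/integrable12ltyP => //.
  apply: (@le_lt_trans _ _ (\int[leb]_x (\int[leb]_y ((M * `|f x|)%:E * (`|g y|)%:E)))%E).
    apply: ge0_le_integral => //.
    - by move=> x _; apply: integral_ge0.
    - exact: (@measurable_fun_fubini_tonelli_F _ _ _ _ _ leb (fun z => `|F z|)%E
        (measurableT_comp (@abse_measurable _ setT) mF) (fun z => abse_ge0 _)).
    - under eq_fun do rewrite integralZl ?integ_norm//.
      apply: emeasurable_funM => //; apply/measurable_EFinP.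
      by apply: measurable_funM => //; exact: measurableT_comp.
    - move=> x _; apply: ge0_le_integral => //.
      + by apply: measurableT_comp => //; exact: measurableT_comp mF (measurable_pair1 _).
      + apply: emeasurable_funM => //; apply/measurable_EFinP.
        exact: measurableT_comp.
      + move=> y _; rewrite /F /= -EFinM lee_fin (normrM (f x * g y)) (normrM (f x)).
        by rewrite mulrC -[leRHS]mulrA; apply: ler_wpM2r; [exact: mulr_ge0|exact: mM].
  have G0 : (0 <= \int[leb]_y (`|g y|)%:E)%E by apply: integral_ge0 => y _; rewrite lee_fin.
  under eq_integral do rewrite integralZl ?integ_norm//.
  have -> : (\int[leb]_y (`|g y|)%:E = (\int[leb]_y `|g y|)%:E)%E.
    by rewrite Int_EFin//; exact: integ_norm.
  rewrite integralZr//; last by apply: integZ; exact: integ_norm.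
  have -> : (\int[leb]_x (M * `|f x|)%:E = (\int[leb]_x (M * `|f x|))%:E)%E.
    by rewrite Int_EFin//; apply: integZ; exact: integ_norm.
  by rewrite -EFinM ltry.
have H := Fubini iFF.
rewrite /Rintegral; congr fine.
transitivity (\int[leb]_x \int[leb]_y F (x, y))%E.
  apply: eq_integral => x _; rewrite /F /= EFinM /convol.
  have ii := conv_integrand_integ x ig (moll_test n).
  rewrite (Int_EFin ii) -(integralZl measurableT ii).
  by apply: eq_integral => y _; rewrite /= -EFinM mulrA.
rewrite H; apply: eq_integral => y _; rewrite /F /= EFinM.
have ii := conv_integrand_integ y iF (moll_test n).
rewrite /convol (Int_EFin ii) -(integralZl measurableT ii).
apply: eq_integral => x _; rewrite /= -(opprB y x) moll_even.
by move: (moll n _) => m; rewrite -EFinM; congr EFin; ring.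
Qed.

Lemma conv_moll_le f (M : R) n x : integ leb f -> (forall y, `|f y| <= M) ->
  `|convol f (moll n) x| <= M.
Proof.
move=> iF fM; have im : integ leb (@moll R d n) by exact/bcs_integ/test_fun_bcs/moll_test.
have [mm _ _] := test_fun_bcs (@moll_test R d n).
have ii := conv_integrand_integ x iF (moll_test n).
apply: le_trans (Int_norm ii) _.
have ims : integ leb (fun y => moll n (y - x)).
  by apply: bcs_integ; apply: bcs_shift; exact: test_fun_bcs (moll_test n).
apply: (@le_trans _ _ (\int[leb]_y (M * moll n (y - x)))).
  apply: Int_le; [exact: integ_norm|exact: integZ|].
  by move=> y; rewrite normrM (ger0_norm (moll_ge0 _ _)) ler_wpM2r// moll_ge0.
by rewrite IntZ// (@Int_shift _ _ (moll n) (- x))// moll_int1 mulr1.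
Qed.

(** The product psi = phi r cannot be used directly to test the weak derivative of [a], as [r] is
    not smooth. Its mollification can, and has the mollified theta as derivative. The mollifier is
    then moved from theta onto [a], where continuity of [a] gives pointwise convergence, while
    theta, merely integrable, stays fixed. *)
Lemma weak_product i (a ga r gr : E -> R) : continuous a -> continuous r ->
  locint ga -> locint gr ->
  (forall phi, test_fun setT phi ->
     \int[leb]_x (a x * partial i phi x) = - \int[leb]_x (ga x * phi x)) ->
  (forall phi, test_fun setT phi ->
     \int[leb]_x (r x * partial i phi x) = - \int[leb]_x (gr x * phi x)) ->
  forall phi, test_fun setT phi ->
    \int[leb]_x ((a x * r x) * partial i phi x) =
    - \int[leb]_x ((ga x * r x + a x * gr x) * phi x).
Proof.
move=> ca cr lga lgr wa wr phi tphi.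
have [cphi Kc _] := tphi; set K := supp phi in Kc.
have bphi := test_fun_bcs tphi.
have bp := test_fun_bcs (test_fun_partial i tphi).
have cphi0 := Ck_continuous (cphi 0).
pose psi x := phi x * r x.
have bpsi : bcs psi by exact: bcsM_cont.
have cpsi : continuous psi by exact: contM.
(* The weak derivative of psi, obtained by testing that of [r] with phi times a translated
   mollifier. *)
pose theta x := gr x * phi x + r x * partial i phi x.
have itheta : integ leb theta.
  apply: integD; apply: locintM_bcs => //; exact: locint_cont.
have ipsi : integ leb psi by exact: bcs_integ.
have psiK x : ~ K x -> psi x = 0 by move=> /supp_out h; rewrite /psi h mul0r.
have thetaK x : ~ K x -> theta x = 0.
  by move=> nK; rewrite /theta (partial_out i nK) (supp_out nK) !mulr0 addr0.
have [M [M0 KM]] : exists M : R, 0 < M /\ forall x, K x -> forall j, `|x 0 j| <= M.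
  have /compact_bounded[N [_ HN]] := Kc.
  exists (`|N| + 1); split; first by rewrite ltr_wpDl.
  by move=> x Kx; apply/rV_normP; [exact: addr_ge0|];
    apply: HN => //; rewrite ltr_pwDr// ler_norm.
(* Mollifiers have radius at most 1, so all mollified functions vanish outside this cube. *)
pose K1 : set E := cube 0 (M + 1).
have cK1 : compact K1 by exact: cube_compact.
have convK1 f n x : (forall x, ~ K x -> f x = 0) -> ~ K1 x -> convol f (moll n) x = 0.
  move=> fK nx; rewrite /convol -(@Int0 _ _ _ leb); apply: eq_Rintegral => y _.
  have [Ky|/fK ->] := pselect (K y); last by rewrite mul0r.
  have /existsNP[j /negP] := nx; rewrite -ltNge mxE subr0 => xj.
  rewrite (@moll_out _ _ _ _ j) ?mulr0// !mxE.
  have n1 : n.+1%:R^-1 <= 1 :> R by rewrite invf_le1// ler1n.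
  apply: (le_trans n1); have := KM _ Ky j; rewrite distrC => yj.
  by have := lerB_dist (x 0 j) (y 0 j); lra.
have tpsin n : test_fun setT (convol psi (moll n)).
  apply: (test_funP _ cK1) => //.
  - by move=> k; apply: Ck_conv => //; exact: moll_test.
  - by move=> x; exact: convK1.
have dpsin n x : partial i (convol psi (moll n)) x = convol theta (moll n) x.
  rewrite (partialE (conv_derive x i ipsi (moll_test n))).
  have tm := moll_test n : test_fun _ (@moll R d n).
  have [cm _ _] := tm.
  have tpm : test_fun setT (fun y => phi y * moll n (y - x)).
    by apply: test_funM_l => // k; exact: Ck_shift.
  have bm : bcs (fun y => moll n (y - x)).
    by apply: bcs_shift; exact: test_fun_bcs tm.
  have bdm : bcs (fun y => partial i (moll n) (y - x)).
    by apply: bcs_shift; exact: test_fun_bcs (test_fun_partial i tm).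
  have := wr _ tpm.
  have -> : (fun y => r y * partial i (fun y => phi y * moll n (y - x)) y) =
     fun y => psi y * partial i (moll n) (y - x) + r y * partial i phi y * moll n (y - x).
    apply/funext => y; rewrite partialM ?(cphi 1%N)//; last exact: (Ck_shift x (cm 1%N)).
    rewrite (partialE (is_derive_shift (CkS_derivable i (y - x) (cm 1%N)))).
    by rewrite /psi; ring.
  rewrite IntD; last 2 first.
  - by apply: conv_integrand_integ => //; exact: test_fun_partial.
  - apply: conv_integrand_integ => //; apply: locintM_bcs => //; exact: locint_cont.
  move=> wE.
  pose Q := \int[leb]_y (r y * partial i phi y * moll n (y - x)).
  pose P := \int[leb]_y (gr y * (phi y * moll n (y - x))).
  have -> : - convol psi (partial i (moll n)) x = P + Q.
    by move: wE; rewrite -/(convol psi (partial i (moll n)) x) -/P -/Q => wE; lra.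
  rewrite /convol /P /Q -IntD; first by apply: eq_Rintegral => y _; rewrite /theta; ring.
  - by apply: locintM_bcs => //; exact: bcsM.
  - by apply: conv_integrand_integ => //; apply: locintM_bcs => //; exact: locint_cont.
have eqn n : \int[leb]_x (a x * convol theta (moll n) x) =
    - \int[leb]_x (ga x * convol psi (moll n) x).
  rewrite -(wa _ (tpsin n)); apply: eq_Rintegral => x _; by rewrite dpsin.
have mK1 : measurable K1 by exact: measurable_compact_rV.
(* Cutting [a] off makes it integrable; near every point of K nothing is changed, so its
   mollifications still tend to [a] there. *)
pose aK := a \_ K1.
have iaK : integ leb aK by have [_] := locint_cont ca; exact.
have [Na Na0 aN] := compact_bounded_cont cK1 ca.
have aKN y : `|aK y| <= Na.
  rewrite /aK patchE; case: ifPn => [/set_mem/aN//|_]; by rewrite normr0 ltW.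
have lhs n : \int[leb]_x (a x * convol theta (moll n) x) =
    \int[leb]_y (theta y * convol aK (moll n) y).
  rewrite -(conv_symmetric n iaK itheta); apply: eq_Rintegral => x _; rewrite /aK patchE.
  case: ifPn => // /negP nK1; rewrite (convK1 theta)// ?mulr0 ?mul0r//.
  by move=> Kx; apply: nK1; rewrite inE.
have aKa y : K y -> aK y = a y.
  move=> Ky; rewrite /aK patchE mem_set// => j; rewrite mxE subr0.
  by have := KM _ Ky j; lra.
have mconv f n : integ leb f -> measurable_fun setT (convol f (moll n)).
  by move=> iF; apply: continuous_measurable_rV; apply: conv_continuous => //; exact: moll_test.
have imoll f n x : measurable_fun setT f -> (exists N : R, forall y, `|f y| <= N) ->
    integ leb (fun z => f (z + x) * moll n z).
  move=> mf [N fN].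
  have im : integ leb (@moll R d n) by exact/bcs_integ/test_fun_bcs/moll_test.
  have -> : (fun z => f (z + x) * moll n z) = fun z => moll n z * f (z + x).
    by apply/funext => z; rewrite mulrC.
  apply: (integM_bounded (K := N) im) => //.
  by apply: measurableT_comp mf _; exact: measurable_addrV.
have cvgL : \int[leb]_y (theta y * convol aK (moll n) y) @[n --> \oo] -->
    \int[leb]_y (theta y * a y).
  have := @Int_dominated_cvg _ _ _ leb (fun n y => theta y * convol aK (moll n) y)
    (fun y => theta y * a y) (fun y => Na * `|theta y|).
  case => //.
  - move=> n; apply: measurable_funM; first exact: integ_measurable itheta.
    exact: mconv.
  - apply: measurable_funM; first exact: integ_measurable itheta.
    exact: continuous_measurable_rV.
  - apply: aeW => y; have [Ky|/thetaK ->] := pselect (K y); last first.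
      by under eq_fun do rewrite mul0r; rewrite mul0r; exact: cvg_cst.
    apply: cvgM; first exact: cvg_cst.
    rewrite -(aKa _ Ky); apply: conv_moll_cvg.
    + exact: integ_measurable iaK.
    + by move=> n; apply: imoll; [exact: integ_measurable iaK|exists Na].
    + change (aK z @[z --> y] --> aK y); rewrite (aKa _ Ky).
      suff h : \forall z \near y, a z = aK z.
        move=> U /(ca y) hU.
        by apply: (@filterS2 E (nbhs y) _ _ _ _ _ h hU) => w /= ->.
      apply/nbhs_ballP; exists 1 => //= z; rewrite mx_norm_ball /ball_ /= => yz.
      rewrite /aK patchE mem_set// => j; rewrite mxE subr0.
      have := KM _ Ky j; have /rV_normP := ltW yz => /(_ ler01 j); rewrite !mxE.
      by have := lerB_dist (z 0 j) (y 0 j); rewrite (distrC (z 0 j)); lra.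
  - by apply: integZ; exact: integ_norm.
  - by move=> n y; rewrite normrM mulrC ler_wpM2r//; exact: conv_moll_le.
have [Np [Np0 psiN]] : exists N : R, 0 <= N /\ forall y, `|psi y| <= N.
  by have [N N0 ?] := continuous_bounded_bcs bpsi; exists N.
have cvgR : \int[leb]_x (ga x * convol psi (moll n) x) @[n --> \oo] -->
    \int[leb]_x (ga x * psi x).
  have [mga iga] := lga.
  have := @Int_dominated_cvg _ _ _ leb (fun n y => ga y * convol psi (moll n) y)
    (fun y => ga y * psi y) (fun y => Np * `|(ga \_ K1) y|).
  case => //.
  - by move=> n; apply: measurable_funM => //; exact: mconv.
  - by apply: measurable_funM => //; exact: continuous_measurable_rV.
  - apply: aeW => y; apply: cvgM; first exact: cvg_cst.
    apply: conv_moll_cvg; [exact: integ_measurable ipsi| |exact: cpsi].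
    by move=> n; apply: imoll; [exact: integ_measurable ipsi|exists Np].
  - by apply: integZ; apply: integ_norm; exact: iga.
  - move=> n y; rewrite patchE; case: ifPn => [_|/negP nK1].
      by rewrite normrM mulrC ler_wpM2r//; exact: conv_moll_le.
    by rewrite convK1// ?mulr0 ?normr0 ?mulr0// => Ky; apply: nK1; rewrite inE.
have key : \int[leb]_y (theta y * a y) = - \int[leb]_x (ga x * psi x).
  have /(cvg_lim (@Rhausdorff R)) <- := cvgL.
  apply/(cvg_lim (@Rhausdorff R)).
  have -> : (fun n => \int[leb]_y (theta y * convol aK (moll n) y)) =
     fun n => - \int[leb]_x (ga x * convol psi (moll n) x).
    by apply/funext => n; rewrite -lhs eqn.
  exact: cvgN.
have i1 : integ leb (fun y => a y * r y * partial i phi y).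
  by apply: locintM_bcs => //; apply: locint_cont; exact: contM.
have i2 : integ leb (fun y => a y * gr y * phi y).
  apply: locintM_bcs => //; under eq_fun do rewrite mulrC; exact: locintM_cont.
have i3 : integ leb (fun y => ga y * r y * phi y).
  by apply: locintM_bcs => //; exact: locintM_cont.
have e1 : \int[leb]_y (theta y * a y) =
    \int[leb]_y (a y * r y * partial i phi y) + \int[leb]_y (a y * gr y * phi y).
  by rewrite -IntD//; apply: eq_Rintegral => y _; rewrite /theta; ring.
have e2 : \int[leb]_x ((ga x * r x + a x * gr x) * phi x) =
    \int[leb]_x (ga x * psi x) + \int[leb]_y (a y * gr y * phi y).
  transitivity (\int[leb]_x (ga x * r x * phi x + a x * gr x * phi x)).
    by apply: eq_Rintegral => x _; ring.
  rewrite IntD//; congr (_ + _); apply: eq_Rintegral => x _; rewrite /psi; ring.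
by rewrite e2 opprD -key e1; ring.
Qed.

End weak_product_rule.

(** * Weak derivatives and integration by parts *)

Section weak_partial.
Context {R : realType} {d : nat}.
Local Notation E := 'rV[R]_d.
Local Notation leb := (@leb R d).
Implicit Types f g h : E -> R.

Lemma Lploc1P (U : set E) f : Lploc U 1 f <->
  measurable_fun U f /\ forall K, compact K -> K `<=` U -> integ leb (f \_ K).
Proof.
by split=> -[mf lf]; split=> // K cK KU; apply/Lfun1_integrable; exact: lf.
Qed.

Lemma weakD_spec (U : set E) i f g : is_weak_partial U i f g ->
  is_weak_partial U i f (weakD U i f).
Proof. by move=> wg; rewrite /weakD; apply: (@xgetPex _ (fun=> 0)); exists g. Qed.

Lemma Int_restrict_test (m : {measure set E -> \bar R}) (U : set E) g p :
  \int[m]_(x in U) (g x * p x) = \int[m]_x ((g \_ U) x * p x).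
Proof.
rewrite Rintegral_mkcond; apply: eq_Rintegral => x _.
by rewrite !patchE; case: ifP; rewrite ?mul0r.
Qed.

Lemma weak_partial_unique (U : set E) i f g h : open U ->
  is_weak_partial U i f g -> is_weak_partial U i f h ->
  \forall x \ae leb, U x -> g x = h x.
Proof.
move=> oU [_ /Lploc1P[mg lg] wg] [_ /Lploc1P[mh lh] wh].
have : \forall x \ae leb, U x -> g x - h x = 0.
  apply: fundamental_lemma => //; first exact: measurable_funB.
    move=> K cK KU; have := integB (lg _ cK KU) (lh _ cK KU).
    congr (integ leb _); apply/funext => x; rewrite !patchE.
    by case: ifP; rewrite ?subr0.
  move=> phi tp; rewrite Int_restrict_test.
  transitivity (\int[leb]_x ((g \_ U) x * phi x - (h \_ U) x * phi x)).
    apply: eq_Rintegral => x _; rewrite !patchE -mulrBl.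
    by case: ifP; rewrite ?subr0.
  rewrite IntB ?integ_restrict_test// -!Int_restrict_test.
  by apply/eqP; rewrite subr_eq0 -eqr_opp -wg// -wh.
by apply: filterS => x h0 Ux; apply/eqP; rewrite -subr_eq0 h0.
Qed.

(** The regularity shared by all coefficients: the weak derivative on the whole space is locally
    square integrable, while nothing beyond local integrability is recorded for [f] itself. *)
Definition weak2 i f g := [/\ locint f, locint g, locint (fun x => g x ^+ 2) &
  forall phi, test_fun setT phi ->
    \int[leb]_x (f x * partial i phi x) = - \int[leb]_x (g x * phi x)].

Lemma weak2_partial i f g : weak2 i f g -> is_weak_partial setT i f g.
Proof.
by move=> [[mf lf] [mg lg] _ w]; split => //; apply/Lploc1P; split => // K cK _; auto.
Qed.

Lemma locint_ae_eq f g : locint f -> measurable_fun setT g ->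
  (\forall x \ae leb, f x = g x) -> locint g.
Proof.
move=> [mf lf] mg fg; split => // K cK; apply: (integ_ae_eq (lf K cK)).
  by apply: measurable_restrictE => //; exact: measurable_compact_rV.
by apply: filterS fg => x e; rewrite !patchE e.
Qed.

Lemma weak2_weakD i f g : weak2 i f g -> weak2 i f (weakD setT i f).
Proof.
move=> w2; have wp := weak2_partial w2; have wD := weakD_spec wp.
have := weak_partial_unique openT wp wD; case: w2 => lf lg lg2 w.
case: wD => _ /Lploc1P[mD lD] wD gD.
have {}gD : \forall x \ae leb, g x = weakD setT i f x.
  by apply: filterS gD => x; exact.
split => //; first exact: locint_ae_eq lg mD gD.
apply: locint_ae_eq lg2 _ _; first exact: measurable_funX.
by apply: filterS gD => x ->.
Qed.

Lemma H1loc_weak2 (s : R) i f : 2 <= s -> H1loc s f -> weak2 i f (weakD setT i f).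
Proof.
move=> s2 [lf /(_ i)[g [_ _ w] lg]]; have s1 : 1 <= s by lra.
apply: (@weak2_weakD _ _ g); split => //; first exact: Lploc_locint lf.
- exact: Lploc_locint lg.
- exact: Lploc2_locint_sqr lg.
Qed.

Lemma weak2D i f g df dg : weak2 i f df -> weak2 i g dg ->
  weak2 i (fun x => f x + g x) (fun x => df x + dg x).
Proof.
move=> [lf ldf lf2 wf] [lg ldg lg2 wg]; split; [exact: locintD|exact: locintD| |].
  exact: locint_sqrD.
move=> phi tp; have bp := test_fun_bcs tp.
have bdp := test_fun_bcs (test_fun_partial i tp).
under eq_Rintegral do rewrite mulrDl.
rewrite IntD; [|exact: locintM_bcs|exact: locintM_bcs].
rewrite wf// wg// -opprD -IntD; [|exact: locintM_bcs|exact: locintM_bcs].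
by congr (- _); apply: eq_Rintegral => x _; rewrite mulrDl.
Qed.

End weak_partial.

(** * Local integrability of the drifts and the generator of the symmetric part *)

Section coefficients.
Context {R : realType} {d : nat}.
Local Notation E := 'rV[R]_d.
Local Notation leb := (@leb R d).
Context {p q : R} {A C : E -> 'M[R]_d} {H : E -> E} {rho : E -> R}
  {mu : {measure set E -> \bar R}}.
Local Notation beta := (log_drift A rho).
Local Notation G := (drift A C H).
Local Notation B := (fun x => G x - log_drift A rho x).
Hypothesis p2 : 2 <= p.
Hypothesis ha : assumption_a p A C H.
Hypothesis hrho : invariant_density p A G rho mu.
Implicit Types f g h : E -> R.

Lemma dotv_mulv (a : 'M[R]_d) (x y : E) :
  dotv (mulv a x) y = \sum_i \sum_j (a i j * x 0 j * y 0 i).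
Proof.
rewrite /dotv /mulv; apply: eq_bigr => i _; rewrite mxE mulr_suml.
by apply: eq_bigr => j _; rewrite mxE (mulrC (x 0 j)).
Qed.

Lemma rho_measurable : measurable_fun setT rho.
Proof. by apply: continuous_measurable_rV; exact: (rho_continuous hrho). Qed.

Lemma rhoV_continuous : continuous (fun x => (rho x)^-1).
Proof.
move=> x; have r0 : rho x != 0 by apply: lt0r_neq0; exact: (rho_gt0 hrho).
apply: (@cvgV _ _ (nbhs x) _ _ _ r0).
exact: (rho_continuous hrho).
Qed.

Lemma Int_mu f : measurable_fun setT f ->
  \int[mu]_x f x = \int[leb]_x (f x * rho x).
Proof.
apply: Int_density; [exact: rho_measurable| |exact: (mu_density hrho)].
by move=> x; exact/ltW/(rho_gt0 hrho).
Qed.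

Lemma integ_mu f : measurable_fun setT f ->
  integ mu f <-> integ leb (fun x => f x * rho x).
Proof.
apply: integ_density; [exact: rho_measurable| |exact: (mu_density hrho)].
by move=> x; exact/ltW/(rho_gt0 hrho).
Qed.

Lemma locintM_bcs_mu f g : locint f -> bcs g -> integ mu (fun x => f x * g x).
Proof.
move=> lf bg; apply/integ_mu.
  by case: lf => mf _; case: bg => mg _ _; exact: measurable_funM.
under eq_fun do rewrite -mulrA.
by apply: locintM_bcs => //; apply: bcsM_cont => //; exact: (rho_continuous hrho).
Qed.

Lemma bcs_integ_mu g : bcs g -> integ mu g.
Proof.
move=> bg; have := locintM_bcs_mu (locint_cst 1) bg.
by under eq_fun do rewrite mul1r.
Qed.

Lemma weak2_a i j k : weak2 k (fun x => A x i j) (weakD setT k (fun x => A x i j)).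
Proof. exact: H1loc_weak2 (lexx _) (a_sobolev ha i j). Qed.

Lemma weak2_c i j k : weak2 k (fun x => C x i j) (weakD setT k (fun x => C x i j)).
Proof. exact: H1loc_weak2 (lexx _) (c_sobolev ha i j). Qed.

Lemma weak2_rho k : weak2 k rho (weakD setT k rho).
Proof. exact: H1loc_weak2 p2 (rho_sobolev hrho). Qed.

Lemma beta_term i j :
  let f x := weakD setT j (fun y => A y i j) x + A x i j * (weakD setT j rho x / rho x) in
  locint f /\ locint (fun x => f x ^+ 2).
Proof.
have [_ la la2 _] := weak2_a i j j; have [_ lr lr2 _] := weak2_rho j.
have c : continuous (fun x => A x i j * (rho x)^-1).
  by apply: contM; [exact: (a_continuous ha)|exact: rhoV_continuous].
have e : (fun x => A x i j * (weakD setT j rho x / rho x)) =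
    fun x => weakD setT j rho x * (A x i j * (rho x)^-1).
  by apply/funext => x; ring.
have l1 : locint (fun x => A x i j * (weakD setT j rho x / rho x)).
  by rewrite e; exact: locintM_cont.
have l2 : locint (fun x => (A x i j * (weakD setT j rho x / rho x)) ^+ 2).
  have := locint_sqrM_cont c lr2; congr locint.
  by apply/funext => x; rewrite -[X in X ^+ 2](congr1 (@^~ x) e).
by split; [exact: locintD|exact: locint_sqrD].
Qed.

Lemma beta_locint i : locint (fun x => beta x 0 i) /\ locint (fun x => beta x 0 i ^+ 2).
Proof.
pose F j x := weakD setT j (fun y => A y i j) x + A x i j * (weakD setT j rho x / rho x).
have e : (fun x => beta x 0 i) = fun x => 2^-1 * \sum_j F j x.
  by apply/funext => x; rewrite mxE.
have lF j := (beta_term i j).1; have lF2 j := (beta_term i j).2.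
split; rewrite ?e; first by apply: locintZ; exact: locint_sum.
have -> : (fun x => beta x 0 i ^+ 2) = fun x => 2^-1 ^+ 2 * (\sum_j F j x) ^+ 2.
  by apply/funext => x; rewrite -exprMn mxE.
by apply: locintZ; exact: locint_sqr_sum.
Qed.

Lemma drift_locint i : locint (fun x => G x 0 i) /\ locint (fun x => G x 0 i ^+ 2).
Proof.
pose F j := weakD setT j (fun y => (A y + (C y)^T) i j).
have wF j : weak2 j (fun y => (A y + (C y)^T) i j) (F j).
  apply: weak2_weakD.
  have -> : (fun y => (A y + (C y)^T) i j) = fun y => A y i j + C y j i.
    by apply/funext => y; rewrite !mxE.
  by apply: weak2D; [exact: weak2_a|exact: weak2_c].
have lF j : locint (F j) by have [] := wF j.
have lF2 j : locint (fun x => F j x ^+ 2) by have [] := wF j.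
have lH : locint (fun x => H x 0 i).
  have p1 : 1 <= p by apply: le_trans p2; rewrite ler1n.
  exact: (Lploc_locint p1 (h_Lploc ha i)).
have lH2 : locint (fun x => H x 0 i ^+ 2) by exact: Lploc2_locint_sqr (h_Lploc ha i).
have e x : G x 0 i = 2^-1 * (\sum_j F j x) + H x 0 i by rewrite !mxE.
have l1 : locint (fun x => 2^-1 * (\sum_j F j x)) by apply: locintZ; exact: locint_sum.
have l2 : locint (fun x => (2^-1 * (\sum_j F j x)) ^+ 2).
  by under eq_fun do rewrite exprMn; apply: locintZ; exact: locint_sqr_sum.
split; first by under eq_fun do rewrite e; exact: locintD.
by under eq_fun do rewrite e; exact: locint_sqrD.
Qed.

(** Local square integrability of B is what makes <B, grad u_n> converge when the gradients converge
    in L^2. *)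
Lemma B_locint i : locint (fun x => B x 0 i) /\ locint (fun x => B x 0 i ^+ 2).
Proof.
have [lb lb2] := beta_locint i; have [lg lg2] := drift_locint i.
have e x : B x 0 i = G x 0 i + (-1) * beta x 0 i by rewrite !mxE mulN1r.
have l1 : locint (fun x => (-1) * beta x 0 i) by exact: locintZ.
split; first by under eq_fun do rewrite e; exact: locintD.
under eq_fun do rewrite e; apply: locint_sqrD => //.
by under eq_fun do rewrite mulN1r sqrrN.
Qed.

Lemma Lop_locint (b : E -> E) h : (forall i, locint (fun x => b x 0 i)) -> Ck 2 h ->
  locint (Lop A b h).
Proof.
move=> lb ch; apply: locintD.
  apply: locintZ; apply: locint_sum => i; apply: locint_sum => j.
  apply: locint_cont; apply: contM; first exact: (a_continuous ha).
  exact/Ck_continuous/CkS_partial/(CkS_partial j ch).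
apply: locint_sum => i; apply: locintM_cont => //.
exact/Ck_continuous/(CkS_partial i ch).
Qed.

Lemma cont_sum (I : Type) (s : seq I) (F : I -> E -> R) :
  (forall i, continuous (F i)) -> continuous (fun x => \sum_(i <- s) F i x).
Proof.
move=> cF; elim: s => [|i s ih]; first by under eq_fun do rewrite big_nil; exact: cst_continuous.
by under eq_fun do rewrite big_cons; exact: contD.
Qed.

Lemma form_continuous h g : Ck 1 h -> Ck 1 g ->
  continuous (fun x => dotv (mulv (A x) (grad h x)) (grad g x)).
Proof.
move=> ch cg; under eq_fun do rewrite dotv_mulv.
apply: cont_sum => i; apply: cont_sum => j.
under eq_fun do rewrite !mxE.
apply: contM; first apply: contM.
- exact: (a_continuous ha).
- exact: Ck_continuous (CkS_partial j ch).
- exact: Ck_continuous (CkS_partial i cg).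
Qed.

(* The function [Lop A beta h] is the generator of the symmetric part. *)
Lemma form_by_parts h g : (forall k, Ck k h) -> test_fun setT g ->
  2^-1 * \int[mu]_x dotv (mulv (A x) (grad h x)) (grad g x) =
  - \int[mu]_x (g x * Lop A beta h x).
Proof.
have alg (x y z s u v : R) : s = x + y -> u = - y -> v = x + z -> u = v -> z = - s.
  by move=> -> -> ->; lra.
move=> ch tg; have [cg _ _] := tg.
have mr := rho_measurable; have cr := rho_continuous hrho.
have bg := test_fun_bcs tg.
have thj j : test_fun setT (fun x => g x * partial j h x).
  by apply: test_funM_l => // k; exact: CkS_partial.
pose a i j x := A x i j * rho x.
have ca i j : continuous (a i j) by apply: contM => //; exact: (a_continuous ha).
pose da i j x := weakD setT i (fun y => A y j i) x * rho x + A x j i * weakD setT i rho x.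
have asym i j : (fun y => A y i j) = (fun y => A y j i).
  by apply/funext => y; rewrite (a_sym ha).
(* The entry of A and [rho] are only weakly differentiable, so [weak_product] differentiates their
   product; the test function g d_j h carries all smooth factors. *)
have w i j : \int[leb]_x (a i j x * partial i (fun y => g y * partial j h y) x) =
    - \int[leb]_x (da i j x * (g x * partial j h x)).
  have [_ lA _ wA] := weak2_a j i i; have [_ lr _ wr] := weak2_rho i.
  rewrite /a /da; under eq_Rintegral do rewrite (a_sym ha).
  have cA : continuous (fun x => A x j i) by exact: (a_continuous ha).
  exact: (weak_product cA cr lA lr wA wr (thj j)).
have lda i j : locint (da i j).
  have [_ lA _ _] := weak2_a j i i; have [_ lr _ _] := weak2_rho i.
  apply: locintD; first exact: locintM_cont.
  by under eq_fun do rewrite mulrC; apply: locintM_cont => //; exact: (a_continuous ha).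
have bt i : bcs (partial i g) by exact: test_fun_bcs (test_fun_partial i tg).
have ct j : continuous (partial j h) by exact: Ck_continuous (CkS_partial j (ch 1%N)).
have ct2 i j : continuous (partial i (partial j h)).
  exact: Ck_continuous (CkS_partial i (CkS_partial j (ch 2%N))).
have i1 i j : integ leb (fun x => a i j x * (partial i g x * partial j h x)).
  by apply: locintM_bcs; [exact: locint_cont|exact: bcsM_cont].
have i2 i j : integ leb (fun x => a i j x * (g x * partial i (partial j h) x)).
  by apply: locintM_bcs; [exact: locint_cont|exact: bcsM_cont].
have i3 i j : integ leb (fun x => da i j x * (g x * partial j h x)).
  by apply: locintM_bcs; [exact: lda|exact: bcsM_cont].
have key i j : \int[leb]_x (a i j x * (partial i g x * partial j h x)) =
    - \int[leb]_x (a i j x * (g x * partial i (partial j h) x) +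
                   da i j x * (g x * partial j h x)).
  have i4 : integ leb (fun x => a i j x * partial i (fun y => g y * partial j h y) x).
    apply: locintM_bcs; first exact: locint_cont.
    exact: test_fun_bcs (test_fun_partial i (thj j)).
  have e1 := IntD (i2 i j) (i3 i j); have e2 := w i j; have e3 := IntD (i2 i j) (i1 i j).
  have e4 : \int[leb]_x (a i j x * partial i (fun y => g y * partial j h y) x) =
     \int[leb]_x (a i j x * (g x * partial i (partial j h) x) +
                 a i j x * (partial i g x * partial j h x)).
    apply: eq_Rintegral => x _.
    rewrite partialM; [|exact: (cg 1%N)|exact: (CkS_partial j (ch 2%N))]; ring.
  exact: (alg _ _ _ _ _ _ e1 e2 e3 e4).
have lb i := (beta_locint i).1.
have mL : measurable_fun setT (Lop A beta h).
  by have [] := Lop_locint lb (ch 2%N).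
have mg : measurable_fun setT g by have [] := bg.
have mpg i : measurable_fun setT (partial i g) by have [] := bt i.
have mD : measurable_fun setT (fun x => dotv (mulv (A x) (grad h x)) (grad g x)).
  apply: continuous_measurable_rV; exact: form_continuous (ch 1%N) (cg 1%N).
rewrite !Int_mu//; last exact: measurable_funM.
have -> : \int[leb]_x (dotv (mulv (A x) (grad h x)) (grad g x) * rho x) =
    \sum_i \sum_j \int[leb]_x (a i j x * (partial i g x * partial j h x)).
  pose F i j x := a i j x * (partial i g x * partial j h x).
  have iFi i : integ leb (fun x => \sum_j F i j x) by apply: integ_sum => j; exact: i1.
  transitivity (\int[leb]_x \sum_i \sum_j F i j x); last first.
    rewrite Int_sum//; apply: eq_bigr => i _; rewrite Int_sum// => j; exact: i1.
  apply: eq_Rintegral => x _; rewrite dotv_mulv mulr_suml; apply: eq_bigr => i _.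
  rewrite mulr_suml; apply: eq_bigr => j _; rewrite !mxE /F /a.
  by move: (A x i j) (rho x) => u v; ring.
under eq_bigr do (under eq_bigr do rewrite key).
under eq_bigr do rewrite sumrN.
rewrite sumrN mulrN; congr (- _).
pose F i j x := a i j x * (g x * partial i (partial j h) x) + da i j x * (g x * partial j h x).
have iF i j : integ leb (F i j) by exact: integD.
have iFi i : integ leb (fun x => \sum_j F i j x) by exact: integ_sum.
rewrite (eq_bigr (fun i => \int[leb]_x \sum_j F i j x)); last by move=> i _; rewrite Int_sum.
rewrite -Int_sum// -IntZ; last exact: integ_sum.
apply: eq_Rintegral => x _; rewrite /Lop.
have -> : \sum_i beta x 0 i * partial i h x =
    2^-1 * \sum_i \sum_j (da i j x / rho x * partial j h x).
  rewrite [X in _ = 2^-1 * X]exchange_big/= mulr_sumr; apply: eq_bigr => j _; rewrite mxE.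
  rewrite -!mulrA; congr (_ * _); rewrite mulr_suml; apply: eq_bigr => i _; rewrite /da.
  have r0 : rho x != 0 by apply: lt0r_neq0; exact: (rho_gt0 hrho).
  by field.
rewrite -mulrDr -big_split/= (mulrCA (g x)) -mulrA; congr (_ * _).
rewrite -mulrA (mulrC (g x)) -!mulrA mulr_suml; apply: eq_bigr => i _.
rewrite -big_split/= mulr_suml; apply: eq_bigr => j _; rewrite /F /a.
have r0 : rho x != 0 by apply: lt0r_neq0; exact: (rho_gt0 hrho).
by move: (A x i j) (da i j x) => u v; field.
Qed.

End coefficients.

(** * Radial cutoffs *)

Section ball_cutoff.
Context {R : realType} {d : nat}.
Local Notation E := 'rV[R]_d.
Implicit Types (x z : E) (a b : R).

(** Squared Euclidean distance, a polynomial and hence smooth everywhere, also at the centre. Balls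
    are described by bounds on it, so the radii below are squared radii. *)
Definition sqd z x : R := dotv (x - z) (x - z).

Lemma sqdE z x : sqd z x = \sum_i (x 0 i - z 0 i) ^+ 2.
Proof. by rewrite /sqd /dotv; apply: eq_bigr => i _; rewrite !mxE expr2. Qed.

Lemma sqd_ge0 z x : 0 <= sqd z x.
Proof. by rewrite sqdE sumr_ge0// => i _; rewrite sqr_ge0. Qed.

Lemma Ck_sqd k z : Ck k (sqd z).
Proof.
have -> : sqd z = fun x => \sum_i (x 0 i - z 0 i) ^+ 2 by apply/funext => x; rewrite sqdE.
by apply: Ck_sum => i; apply/CkX/CkB; [exact: Ck_coord|exact: Ck_cst].
Qed.

Lemma partial_coord i j x : partial i (fun y : E => y 0 j) x = (i == j)%:R.
Proof. exact: partialE (is_derive_coord x i j). Qed.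

Lemma partial_sum (I : Type) (s : seq I) i (F : I -> E -> R) x :
  (forall j, Ck 1 (F j)) ->
  partial i (fun y => \sum_(j <- s) F j y) x = \sum_(j <- s) partial i (F j) x.
Proof.
move=> cF; elim: s => [|j s ih].
  by under eq_fun do rewrite big_nil; rewrite big_nil partial_cst.
under eq_fun do rewrite big_cons; rewrite big_cons partialD// ?ih//.
exact: Ck_sum.
Qed.

Lemma partial_sqd i z x : partial i (sqd z) x = 2 * (x 0 i - z 0 i).
Proof.
have -> : sqd z = fun x => \sum_j (x 0 j - z 0 j) ^+ 2 by apply/funext => y; rewrite sqdE.
have cj j : Ck 1 (fun y : E => y 0 j - z 0 j) by apply: CkB; [exact: Ck_coord|exact: Ck_cst].
rewrite partial_sum => [|j]; last exact: CkX.
rewrite (bigD1 i)//= big1 ?addr0 => [|j ji].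
  under eq_fun do rewrite expr2; rewrite partialM// partialB; [|exact: Ck_coord|exact: Ck_cst].
  by rewrite partial_coord eqxx partial_cst (_ : true%:R = 1)//; ring.
under eq_fun do rewrite expr2; rewrite partialM// partialB; [|exact: Ck_coord|exact: Ck_cst].
by rewrite partial_coord eq_sym (negbTE ji) partial_cst subr0 mulr0 addr0.
Qed.

Lemma sqd_compact z b : compact [set x | sqd z x <= b].
Proof.
apply: (@subclosed_compact _ _ (cube z (1 + `|b|))).
- apply: (@closed_comp _ _ (sqd z) [set y | y <= b]).
    by move=> x _; exact: Ck_continuous (Ck_sqd 0 z) x.
  exact: closed_le.
- exact: cube_compact.
- move=> x /= xb i.
  have h : (x 0 i - z 0 i) ^+ 2 <= b.
    by apply: le_trans xb; rewrite sqdE (bigD1 i)//= lerDl sumr_ge0// => j _; rewrite sqr_ge0.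
  have b0 : b <= `|b| by exact: ler_norm.
  have := normr_ge0 (x 0 i - z 0 i); have := normr_ge0 b.
  rewrite -(real_normK (num_real _)) in h; nra.
Qed.

(* A smooth transition from 0 on [sqd z x <= a] to 1 on [b <= sqd z x]. *)
Definition bcut z a b x : R := sstep ((b - a)^-1 * sqd z x + - a / (b - a)).

Lemma bcut_argE z a b x : a < b ->
  (b - a)^-1 * sqd z x + - a / (b - a) = (sqd z x - a) / (b - a).
Proof. by move=> ab; rewrite mulrBl mulNr mulrC. Qed.

Lemma bcut_in z a b x : a < b -> sqd z x <= a -> bcut z a b x = 0.
Proof.
move=> ab xa; rewrite /bcut bcut_argE//; apply: sstep_le0.
by rewrite pmulr_lle0 ?subr_le0// invr_gt0 subr_gt0.
Qed.

Lemma bcut_out z a b x : a < b -> b <= sqd z x -> bcut z a b x = 1.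
Proof.
move=> ab xb; rewrite /bcut bcut_argE//; apply: sstep_ge1.
by rewrite ler_pdivlMr ?subr_gt0// mul1r lerD2r.
Qed.

Lemma bcut_ge0 z a b x : 0 <= bcut z a b x. Proof. exact: sstep_ge0. Qed.
Lemma bcut_le1 z a b x : bcut z a b x <= 1. Proof. exact: sstep_le1. Qed.

Lemma Ck_bcut_arg k z a b : Ck k (fun x => (b - a)^-1 * sqd z x + - a / (b - a)).
Proof. by apply: CkD; [apply: CkZ; exact: Ck_sqd|exact: Ck_cst]. Qed.

Lemma Ck_bcut k z a b : Ck k (bcut z a b).
Proof. by apply: (@Ck_comp _ _ k sstep); [exact: smooth1_sstep|exact: Ck_bcut_arg]. Qed.

Lemma partial_bcut i z a b x : partial i (bcut z a b) x =
  derive1 sstep ((b - a)^-1 * sqd z x + - a / (b - a)) *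
  ((b - a)^-1 * (2 * (x 0 i - z 0 i))).
Proof.
rewrite /bcut partial_comp; [|exact: smooth1_sstep|exact: Ck_bcut_arg].
rewrite partialD; [|by apply: CkZ; exact: Ck_sqd|exact: Ck_cst].
by rewrite partialZ ?partial_cst ?addr0 ?partial_sqd//; exact: Ck_sqd.
Qed.

Lemma partial_bcut2 i j z a b x : partial i (partial j (bcut z a b)) x =
  derive1 (derive1 sstep) ((b - a)^-1 * sqd z x + - a / (b - a)) *
    ((b - a)^-1 * (2 * (x 0 i - z 0 i))) * ((b - a)^-1 * (2 * (x 0 j - z 0 j))) +
  derive1 sstep ((b - a)^-1 * sqd z x + - a / (b - a)) *
    ((b - a)^-1 * (2 * (i == j)%:R)).
Proof.
have -> : partial j (bcut z a b) = fun x =>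
  derive1 sstep ((b - a)^-1 * sqd z x + - a / (b - a)) *
  ((b - a)^-1 * (2 * (x 0 j - z 0 j))) by apply/funext => y; exact: partial_bcut.
have c1 : Ck 1 (fun y => derive1 sstep ((b - a)^-1 * sqd z y + - a / (b - a))).
  apply: (@Ck_comp _ _ 1 (derive1 sstep)); last exact: Ck_bcut_arg.
  exact: smooth1_derive (smooth1_sstep 2).
have cj : Ck 1 (fun y : E => y 0 j - z 0 j) by apply: CkB; [exact: Ck_coord|exact: Ck_cst].
have c2 : Ck 1 (fun y : E => 2 * (y 0 j - z 0 j)) by exact: CkZ.
rewrite partialM//; last exact: CkZ.
rewrite partialZ// partialZ// partialB; [|exact: Ck_coord|exact: Ck_cst].
rewrite partial_coord partial_cst subr0.
rewrite (@partial_comp _ _ _ (derive1 sstep)); last exact: Ck_bcut_arg; last first.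
  exact: smooth1_derive (smooth1_sstep 2).
rewrite partialD; [|by apply: CkZ; exact: Ck_sqd|exact: Ck_cst].
rewrite partialZ ?partial_cst ?addr0 ?partial_sqd; [|exact: Ck_sqd].
by move: (derive1 _ _) (derive1 _ _) => u v; ring.
Qed.

Lemma cutoff_test z a b : a < b -> forall U : set E, [set x | sqd z x <= b] `<=` U ->
  test_fun U (fun x => 1 - bcut z a b x).
Proof.
move=> ab U sU; apply: (@test_funP _ _ U [set x | sqd z x <= b]) => //.
- by move=> k; apply: CkB; [exact: Ck_cst|exact: Ck_bcut].
- exact: sqd_compact.
- by move=> x /negP; rewrite -ltNge => /ltW xb; rewrite bcut_out ?subrr.
Qed.

Lemma compact_sqd (K : set E) z : compact K -> exists b, 0 < b /\ forall x, K x -> sqd z x < b.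
Proof.
move=> cK; have [b b0 bK] := compact_bounded_cont cK (Ck_continuous (Ck_sqd 0 z)).
exists (b + 1); split; first by rewrite addr_gt0.
by move=> x /bK; rewrite ger0_norm ?sqd_ge0// => h; rewrite ltr_pwDr.
Qed.

End ball_cutoff.

(** * Closability of the Dirichlet form *)

Section L2_complete.
Context {dT : measure_display} {T : measurableType dT} {R : realType}.
Variable mu : {measure set T -> \bar R}.
Implicit Types f g h : T -> R.

Lemma fatou_le (f : nat -> T -> \bar R) (g : T -> \bar R) (c : \bar R) :
  (forall n, measurable_fun setT (f n)) -> (forall n x, 0 <= f n x)%E ->
  (forall x, f n x @[n --> \oo] --> g x) ->
  (forall n, \int[mu]_x f n x <= c)%E -> (\int[mu]_x g x <= c)%E.
Proof.
move=> mf f0 fg fc.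
have -> : (\int[mu]_x g x = \int[mu]_x limn_einf (f ^~ x))%E.
  by apply: eq_integral => x _; have [-> _] := cvg_limn_einf_sup (fg x).
apply: le_trans (fatou _ _ _ _) _ => //.
rewrite limn_einf_lim; apply: lime_le; first exact: is_cvg_einfs.
by apply: nearW => n; apply: le_trans (fc n); apply: ereal_inf_lbound; exists n => /=.
Qed.

(** The sum of the series is integrable, hence finite almost everywhere, and it bounds each of its
    terms. *)
Lemma ae_bounded_summable (h : nat -> T -> R) : (forall n, integ mu (h n)) ->
  (forall n x, 0 <= h n x) -> (forall n, \int[mu]_x h n x <= 2^-1 ^+ n) ->
  \forall x \ae mu, exists M : R, forall n, h n x <= M.
Proof.
move=> ih h0 hn.
have mh n : measurable_fun setT (fun x => (h n x)%:E).
  by apply/measurable_EFinP; exact: integ_measurable (ih n).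
pose S x := (\sum_(0 <= k <oo) (h k x)%:E)%E.
have S0 x : (0 <= S x)%E by apply: nneseries_ge0 => k _ _; rewrite lee_fin.
have mS : measurable_fun setT S.
  by apply: ge0_emeasurable_sum => // k x _ _; rewrite lee_fin.
have iS : mu.-integrable setT S.
  apply/integrableP; split => //.
  under eq_integral do rewrite gee0_abs//.
  rewrite integral_nneseries//; last by move=> n x _; rewrite lee_fin.
  apply: (@le_lt_trans _ _ (\sum_(0 <= k <oo) (2^-1 ^+ k)%:E)%E).
    apply: lee_nneseries => // k _; first by rewrite -Int_EFin ?lee_fin ?Int_ge0.
    by rewrite -Int_EFin ?lee_fin.
  have c : cvgn (series (geometric (1 : R) 2^-1)).
    by apply: is_cvg_geometric_series; rewrite ger0_norm// invf_lt1// ltr1n.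
  have -> : (\sum_(0 <= k <oo) (2^-1 ^+ k)%:E = (limn (series (geometric (1 : R) 2^-1)))%:E)%E.
    rewrite -EFin_lim//; congr (limn _); apply/funext => n /=.
    by rewrite /series /= sumEFin; under eq_bigr do rewrite mul1r.
  exact: ltry.
apply: filterS (integrable_ae measurableT iS) => x /(_ I) Sfin.
exists (fine (S x)) => n; rewrite -lee_fin fineK//.
apply: le_trans (_ : \sum_(0 <= k < n.+1) (h k x)%:E <= _)%E.
  by rewrite big_nat_recr//= leeDr// sume_ge0// => k _; rewrite lee_fin.
by apply: nneseries_lim_ge => k _ _; rewrite lee_fin.
Qed.

Lemma cvg_of_summable (u : nat -> R) (M : R) :
  (forall n, `|u n.+1 - u n| <= M * 2^-1 ^+ n) -> cvgn u.
Proof.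
move=> uM.
have M0 : 0 <= M.
  by have := uM 0%N; rewrite expr0 mulr1; apply: le_trans; exact: normr_ge0.
have c : cvgn (series (fun n => u n.+1 - u n)).
  apply: normed_cvg; apply: (@series_le_cvg _ _ (geometric M 2^-1)) => //.
  - by move=> n; exact: normr_ge0.
  - by move=> n; rewrite /geometric /= mulr_ge0// exprn_ge0// invr_ge0.
  - by apply: is_cvg_geometric_series; rewrite ger0_norm// invf_lt1// ltr1n.
have -> : u = fun n => u 0%N + series (fun n => u n.+1 - u n) n.
  by apply/funext => n; rewrite /series /= telescope_sumr// addrC subrK.
by apply: is_cvgD => //; exact: is_cvg_cst.
Qed.

(** Riesz-Fischer: a fast subsequence converges almost everywhere, and Fatou's lemma bounds the
    distance of each h_n to the limit by the Cauchy bound. *)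
Lemma L2_complete (h : nat -> T -> R) : (forall n, measurable_fun setT (h n)) ->
  (forall n, integ mu (fun x => h n x ^+ 2)) ->
  (forall e : R, 0 < e -> exists N, forall m n, (N <= m)%N -> (N <= n)%N ->
    \int[mu]_x ((h m x - h n x) ^+ 2) < e) ->
  exists g, [/\ measurable_fun setT g, integ mu (fun x => g x ^+ 2),
    forall n, integ mu (fun x => (h n x - g x) ^+ 2) &
    \int[mu]_x ((h n x - g x) ^+ 2) @[n --> \oo] --> (0 : R)].
Proof.
move=> mh ih hC.
have iB f g : measurable_fun setT f -> measurable_fun setT g ->
    integ mu (fun x => f x ^+ 2) -> integ mu (fun x => g x ^+ 2) ->
    integ mu (fun x => (f x - g x) ^+ 2).
  move=> mf mg i1 i2; apply: integ_le (integD (integZ 2 i1) (integZ 2 i2)) _.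
    by apply: measurable_funX; exact: measurable_funB.
  by move=> x; rewrite ger0_norm ?sqr_ge0//; have := sqr_ge0 (f x + g x); nra.
have /boolp.choice[N HN] : forall k : nat, exists N, forall m n, (N <= m)%N -> (N <= n)%N ->
    \int[mu]_x ((h m x - h n x) ^+ 2) < 8^-1 ^+ k.
  by move=> k; apply: hC; rewrite exprn_gt0// invr_gt0.
(* Partial sums make the chosen indices nondecreasing and at least both k and N k. *)
pose s k := (\sum_(j < k.+1) (N j).+1)%N.
have sN k : (N k <= s k)%N by rewrite /s big_ord_recr/= (leq_trans (leqnSn _))// leq_addl.
have sk k : (k <= s k)%N.
  elim: k => // k IHk; by rewrite /s big_ord_recr/= -/(s k) addnS ltnS (leq_trans IHk)// leq_addr.
have sS k : (s k <= s k.+1)%N by rewrite /s [X in (_ <= X)%N]big_ord_recr/= leq_addr.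
(* The squared increments integrate to at most 8^-k; after the weight 4^k they are still summable,
   and their boundedness makes the increments themselves decay like 2^-k. *)
pose D k x := 4 ^+ k * (h (s k.+1) x - h (s k) x) ^+ 2.
have aeD : \forall x \ae mu, exists M : R, forall n, D n x <= M.
  apply: ae_bounded_summable.
  - by move=> n; apply: integZ; exact: iB.
  - by move=> n x; rewrite mulr_ge0// ?sqr_ge0// exprn_ge0.
  - move=> n; rewrite IntZ; last exact: iB.
    have e : 2^-1 ^+ n = 4 ^+ n * 8^-1 ^+ n :> R by rewrite -exprMn; congr (_ ^+ _); lra.
    rewrite e ler_wpM2l ?exprn_ge0//; apply/ltW/HN; last exact: sN.
    exact: leq_trans (sN n) (sS n).
have aec : \forall x \ae mu, cvgn (fun k => h (s k) x).
  apply: filterS aeD => x [M HM]; apply: (@cvg_of_summable _ (1 + M)) => n.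
  have M0 : 0 <= M.
    by apply: le_trans (HM 0%N); rewrite mulr_ge0// ?sqr_ge0// exprn_ge0.
  have := HM n; rewrite /D; set a := _ - _ => ha.
  have t0 : (0 : R) < 2 ^+ n by rewrite exprn_gt0.
  rewrite exprVn ler_pdivlMr//.
  have e4 : 4 ^+ n = (2 ^+ n) ^+ 2 :> R by rewrite -exprM mulnC exprM; congr (_ ^+ _); lra.
  (* A nonnegative number whose square is at most M is at most 1 + M. *)
  have h1 : (`|a| * 2 ^+ n) ^+ 2 <= M by rewrite exprMn real_normK ?num_real// mulrC -e4.
  by have := mulr_ge0 (normr_ge0 a) (ltW t0); nra.
have [Z [mZ Z0 HZ]] := aec.
(* Setting the subsequence to 0 on the exceptional null set makes it converge everywhere, so that
   its limit is measurable. *)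
pose g' k x := (h (s k) \_ (~` Z)) x.
have mg' k : measurable_fun setT (g' k).
  by apply/(measurable_restrictT _ _).1; [exact: measurableC|exact: measurable_funTS].
have cg' x : cvgn (g' ^~ x).
  rewrite /g'; have [Zx|nZx] := pselect (Z x).
    have -> : (fun k => (h (s k) \_ (~` Z)) x) = fun=> 0; last exact: is_cvg_cst.
    by apply/funext => k; rewrite patchE memNset.
  have -> : (fun k => (h (s k) \_ (~` Z)) x) = fun k => h (s k) x.
    by apply/funext => k; rewrite patchE mem_set.
  by apply: contrapT => nc; apply: nZx; exact: HZ.
pose g x := limn (g' ^~ x).
have gg x : g' k x @[k --> \oo] --> g x by exact: cg'.
have mg : measurable_fun setT g by apply: (measurable_fun_cvg (h := g')) => // x _; exact: gg.
have aeg k : \forall x \ae mu, h (s k) x = g' k x.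
  exists Z; split => // x /= nh; apply: contrapT => nZ; apply: nh.
  by rewrite /g' patchE mem_set.
have bound (e : R) n : (forall k, (n <= k)%N -> \int[mu]_x ((h n x - h k x) ^+ 2) <= e) ->
    (\int[mu]_x ((h n x - g x) ^+ 2)%:E <= e%:E)%E.
  move=> en; apply: (@fatou_le (fun k x => ((h n x - g' (n + k)%N x) ^+ 2)%:E)).
  - move=> k; apply/measurable_EFinP; apply: measurable_funX.
    by apply: measurable_funB => //; exact: mg'.
  - by move=> k x; rewrite lee_fin sqr_ge0.
  - move=> x; apply: cvg_EFin; first by near=> k.
    have c1 : (h n x - g' (n + k)%N x) @[k --> \oo] --> h n x - g x.
      apply: cvgB; first exact: cvg_cst.
      by apply: (@cvg_comp _ _ _ (fun k => n + k)%N (g'^~ x) _ _ _ _ (gg x)); exact: cvg_addnl.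
    by under eq_fun do rewrite /= expr2; rewrite expr2; apply: cvgM.
  - move=> k.
    have E : \int[mu]_x ((h n x - g' (n + k)%N x) ^+ 2) =
        \int[mu]_x ((h n x - h (s (n + k)%N) x) ^+ 2).
      apply: Int_ae_eq; [by apply: measurable_funX; exact: measurable_funB| |].
        by apply: measurable_funX; exact: measurable_funB.
      by apply: filterS (aeg (n + k)%N) => x ->.
    rewrite -Int_EFin; first by rewrite lee_fin E en// (leq_trans _ (sk _))// leq_addr.
    apply: (integ_ae_eq (iB _ _ (mh n) (mh (s (n + k)%N)) (ih n) (ih _))).
      by apply: measurable_funX; exact: measurable_funB.
    by apply: filterS (aeg (n + k)%N) => x ->.
have bound' n (e : R) : (forall k, (n <= k)%N -> \int[mu]_x ((h n x - h k x) ^+ 2) <= e) ->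
    integ mu (fun x => (h n x - g x) ^+ 2).
  move=> /bound le; apply/integrableP; split.
    by apply/measurable_EFinP/measurable_funX; exact: measurable_funB.
  under eq_integral do rewrite gee0_abs ?lee_fin ?sqr_ge0//.
  exact: le_lt_trans le (ltry _).
have [N1 HN1] := hC 1 ltr01.
have iN1 : integ mu (fun x => (h N1 x - g x) ^+ 2).
  by apply: (bound' _ 1) => k k1; apply/ltW/HN1.
have ig : integ mu (fun x => g x ^+ 2).
  apply: integ_le (integD (integZ 2 (ih N1)) (integZ 2 iN1)) _.
    exact: measurable_funX.
  by move=> x; rewrite ger0_norm ?sqr_ge0//; have := sqr_ge0 (2 * h N1 x - g x); nra.
exists g; split => //; first by move=> n; exact: iB.
apply/cvgrPdist_le => e e0; have [N2 HN2] := hC e e0.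
exists N2 => // n /= n2; rewrite sub0r normrN ger0_norm ?Int_ge0//; last first.
  by move=> x; exact: sqr_ge0.
rewrite -lee_fin Int_EFin; last exact: iB.
by apply: bound => k nk; apply/ltW/HN2 => //; exact: leq_trans nk.
Unshelve. all: by end_near.
Qed.

(* Young's inequality replaces Cauchy-Schwarz, so that no square root is needed. *)
Lemma L2_pairing_cvg0 (h : nat -> T -> R) (w : T -> R) : (forall n, measurable_fun setT (h n)) ->
  measurable_fun setT w ->
  (forall n, integ mu (fun x => h n x ^+ 2)) -> integ mu (fun x => w x ^+ 2) ->
  \int[mu]_x (h n x ^+ 2) @[n --> \oo] --> (0 : R) ->
  (forall n, integ mu (fun x => w x * h n x)) /\
  \int[mu]_x (`|w x * h n x|) @[n --> \oo] --> (0 : R).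
Proof.
move=> mh mw ih iw h0.
have young (s a b : R) : 0 < s -> `|a * b| <= s * a ^+ 2 + s^-1 * b ^+ 2.
  move=> s0; rewrite normrM -(real_normK (num_real a)) -(real_normK (num_real b)).
  have sV : 0 < s^-1 by rewrite invr_gt0.
  have e : s * s^-1 = 1 by rewrite mulfV// gt_eqF.
  set u := `|a|; set v := `|b|.
  have := mulr_ge0 (ltW sV) (sqr_ge0 (s * u - v)).
  have -> : s^-1 * (s * u - v) ^+ 2 = (s * s^-1) * (s * u ^+ 2 - 2 * (u * v)) + s^-1 * v ^+ 2 by ring.
  rewrite e mul1r; have uv : 0 <= u * v by rewrite mulr_ge0// normr_ge0.
  by move=> ?; lra.
have iP n : integ mu (fun x => w x * h n x).
  apply: integ_le (integD (integZ 1 iw) (integZ 1^-1 (ih n))) _.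
    exact: measurable_funM.
  by move=> x; exact: young.
split => //; apply/cvgrPdist_lt => e e0.
set I := \int[mu]_x (w x ^+ 2).
have I0 : 0 <= I by apply: Int_ge0 => x; exact: sqr_ge0.
pose s := e / (2 * (I + 1)).
have s0 : 0 < s by rewrite divr_gt0// mulr_gt0// ltr_wpDl.
have es : 0 < e * s / 2 by rewrite divr_gt0// mulr_gt0.
have /cvgrPdist_lt/(_ _ es)[N _ HN] := h0.
exists N => // n /HN; rewrite !sub0r !normrN => /(le_lt_trans (ler_norm _)) hn.
rewrite ger0_norm ?Int_ge0//.
apply: (@le_lt_trans _ _ (s * I + s^-1 * \int[mu]_x (h n x ^+ 2))).
  rewrite -IntZ// -IntZ// -IntD; [|exact: integZ|exact: integZ].
  by apply: Int_le => [||x]; [exact: integ_norm|apply: integD; exact: integZ|exact: young].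
have h1 : s * I < e / 2.
  rewrite /s mulrAC ltr_pdivrMr ?mulr_gt0// ?ltr_wpDl//.
  have -> : e / 2 * (2 * (I + 1)) = e * I + e by field.
  by rewrite ltrDl.
have h2 : s^-1 * \int[mu]_x (h n x ^+ 2) < e / 2.
  by rewrite mulrC ltr_pdivrMr//; lra.
lra.
Qed.

Lemma L2_pairing_cvg (h : nat -> T -> R) (g w : T -> R) :
  (forall n, measurable_fun setT (h n)) -> measurable_fun setT g -> measurable_fun setT w ->
  integ mu (fun x => g x ^+ 2) -> integ mu (fun x => w x ^+ 2) ->
  (forall n, integ mu (fun x => (h n x - g x) ^+ 2)) ->
  \int[mu]_x ((h n x - g x) ^+ 2) @[n --> \oo] --> (0 : R) ->
  [/\ integ mu (fun x => w x * g x), forall n, integ mu (fun x => w x * h n x) &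
  \int[mu]_x (w x * h n x) @[n --> \oo] --> \int[mu]_x (w x * g x)].
Proof.
move=> mh mg mw ig iw ih h0.
have mB n : measurable_fun setT (fun x => h n x - g x) by exact: measurable_funB.
have [iP P0] := L2_pairing_cvg0 mB mw ih iw h0.
have iwg : integ mu (fun x => w x * g x).
  apply: integ_le (integD iw ig) _; first exact: measurable_funM.
  by move=> x; rewrite ler_norml; apply/andP; split; nra.
have iwh n : integ mu (fun x => w x * h n x).
  by have := integD (iP n) iwg; congr (integ mu _); apply/funext => x; ring.
split => //; apply/cvgrPdist_lt => e e0.
have /cvgrPdist_lt/(_ _ e0)[N _ HN] := P0.
exists N => // n /HN; rewrite sub0r normrN => /(le_lt_trans (ler_norm _)); apply: le_lt_trans.
rewrite -(IntB iwg (iwh n)); apply: le_trans (Int_norm (integB iwg (iwh n))) _.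
apply: Int_le => [||x]; [exact/integ_norm/integB|exact: integ_norm (iP n)|].
by rewrite -mulrBr !normrM distrC.
Qed.

End L2_complete.

(** * The energy form on smooth functions *)

Section energy_form.
Context {R : realType} {d : nat}.
Local Notation E := 'rV[R]_d.
Local Notation leb := (@leb R d).
Context {p q : R} {A C : E -> 'M[R]_d} {H : E -> E} {rho : E -> R}
  {mu : {measure set E -> \bar R}}.
Local Notation beta := (log_drift A rho).
Local Notation G := (drift A C H).
Local Notation B := (fun x => G x - log_drift A rho x).
Hypothesis p2 : 2 <= p.
Hypothesis ha : assumption_a p A C H.
Hypothesis hrho : invariant_density p A G rho mu.
Implicit Types f g h : E -> R.

Lemma dotvD (x y z : E) : dotv (x + y) z = dotv x z + dotv y z.
Proof. by rewrite /dotv -big_split; apply: eq_bigr => i _; rewrite !mxE mulrDl. Qed.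

Lemma dotvZ (k : R) (x y : E) : dotv (k *: x) y = k * dotv x y.
Proof. by rewrite /dotv mulr_sumr; apply: eq_bigr => i _; rewrite !mxE mulrA. Qed.

Lemma dotvC (x y : E) : dotv x y = dotv y x.
Proof. by rewrite /dotv; apply: eq_bigr => i _; rewrite mulrC. Qed.

Lemma mulvD (a : 'M[R]_d) (x y : E) : mulv a (x + y) = mulv a x + mulv a y.
Proof. by rewrite /mulv mulmxDl. Qed.

Lemma mulvZ (a : 'M[R]_d) (k : R) (x : E) : mulv a (k *: x) = k *: mulv a x.
Proof. by rewrite /mulv scalemxAl. Qed.

Lemma mulv_sym x (u v : E) : dotv (mulv (A x) u) v = dotv (mulv (A x) v) u.
Proof.
rewrite !dotv_mulv exchange_big/=; apply: eq_bigr => i _; apply: eq_bigr => j _.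
by rewrite (a_sym ha) mulrAC.
Qed.

Lemma mulv_ge0 x (u : E) : 0 <= dotv (mulv (A x) u) u.
Proof.
have cx : compact (closure [set x]).
  rewrite -(closure_id _).1; first exact: compact_set1.
  by apply: compact_closed; [exact: norm_hausdorff|exact: compact_set1].
have [nu nu0 /(_ x u erefl)/andP[+ _]] := a_elliptic ha cx.
apply: le_trans; rewrite mulr_ge0 ?invr_ge0 ?(ltW nu0)// /dotv sumr_ge0// => i _.
by rewrite -expr2 sqr_ge0.
Qed.

Lemma mulv_lin x (u v w : E) (k : R) : dotv (mulv (A x) (u + k *: v)) w =
  dotv (mulv (A x) u) w + k * dotv (mulv (A x) v) w.
Proof. by rewrite mulvD mulvZ dotvD dotvZ. Qed.

(** Expand the nonnegative form at v + s u and at v - s u and divide by s. The free weight s makes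
    this a substitute for Cauchy-Schwarz without square roots. *)
Lemma mulv_young x (s : R) (u v : E) : 0 < s ->
  `|dotv (mulv (A x) u) v| <=
    s * dotv (mulv (A x) u) u + s^-1 * dotv (mulv (A x) v) v.
Proof.
move=> s0; have sV : 0 < s^-1 by rewrite invr_gt0.
have e : s * s^-1 = 1 by rewrite mulfV// gt_eqF.
have exp k : dotv (mulv (A x) (v + k *: u)) (v + k *: u) =
    dotv (mulv (A x) v) v + 2 * k * dotv (mulv (A x) u) v + k ^+ 2 * dotv (mulv (A x) u) u.
  rewrite mulv_lin !(mulv_sym x _ (v + k *: u)) !mulv_lin (mulv_sym x v u).
  by move: (dotv _ v) (dotv _ u) => a b; ring.
have h k := mulv_ge0 x (v + k *: u); have u0 := mulv_ge0 x u; have v0 := mulv_ge0 x v.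
have h1 := mulr_ge0 (ltW sV) (h s); have h2 := mulr_ge0 (ltW sV) (h (- s)).
rewrite exp in h1; rewrite exp in h2.
move: (dotv (mulv (A x) u) u) (dotv (mulv (A x) v) v) (dotv (mulv (A x) u) v) u0 v0 h1 h2 => a b c a0 b0 h1 h2.
have e1 : s^-1 * (b + 2 * s * c + s ^+ 2 * a) = s^-1 * b + (s * s^-1) * (2 * c + s * a) by ring.
have e2 : s^-1 * (b + 2 * - s * c + (- s) ^+ 2 * a) =
  s^-1 * b + (s * s^-1) * (- 2 * c + s * a) by ring.
rewrite e1 e mul1r in h1; rewrite e2 e mul1r in h2.
have := mulr_ge0 (ltW s0) a0; have := mulr_ge0 (ltW sV) b0.
by rewrite ler_norml => ? ?; apply/andP; split; lra.
Qed.

Lemma elliptic_compact (K : set E) : compact K -> exists2 nu : R, 0 < nu &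
  forall x (xi : E), K x -> \sum_i (xi 0 i) ^+ 2 <= nu * dotv (mulv (A x) xi) xi.
Proof.
move=> cK; have cK' : compact (closure K).
  by rewrite -(closure_id _).1//; apply: compact_closed => //; exact: norm_hausdorff.
have [nu nu0 h] := a_elliptic ha cK'; exists nu => // x xi Kx.
by have /andP[+ _] := h x xi Kx; rewrite ler_pdivrMl//; apply: le_trans.
Qed.

(** On a compact set both rho and 1/rho are bounded; the sum of the two bounds serves in either
    direction. *)
Lemma mu_leb_compact (K : set E) : compact K -> exists2 kappa : R, 0 < kappa &
  forall f, measurable_fun setT f -> (forall x, 0 <= f x) -> (forall x, ~ K x -> f x = 0) ->
    (integ mu f -> integ leb f /\ \int[leb]_x f x <= kappa * \int[mu]_x f x) /\
    (integ leb f -> integ mu f /\ \int[mu]_x f x <= kappa * \int[leb]_x f x).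
Proof.
move=> cK.
have [M M0 hM] := compact_bounded_cont cK (rho_continuous hrho).
have [N N0 hN] := compact_bounded_cont cK (rhoV_continuous hrho).
exists (M + N); first exact: addr_gt0.
move=> f mf f0 fK; have mr := rho_measurable hrho.
have h1 x : `|f x| <= (M + N) * (f x * rho x).
  have [Kx|/fK ->] := pselect (K x); last by rewrite normr0 mul0r mulr0.
  rewrite ger0_norm// mulrCA -[leLHS]mulr1 ler_wpM2l//.
  have r0 := rho_gt0 hrho x; have NV := le_trans (ler_norm _) (hN x Kx).
  have e : rho x * (rho x)^-1 = 1 by rewrite mulfV// gt_eqF.
  have : 0 <= M * rho x by rewrite mulr_ge0// ltW.
  have : rho x * (rho x)^-1 <= rho x * N by rewrite ler_wpM2l// ltW.
  by rewrite e mulrDl (mulrC (rho x)); lra.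
have h2 x : `|f x * rho x| <= (M + N) * f x.
  have [Kx|/fK ->] := pselect (K x); last by rewrite mul0r normr0 mulr0.
  rewrite normrM (ger0_norm (f0 x)) mulrC ler_wpM2r//.
  by apply: le_trans (hM x Kx) _; rewrite lerDl ltW.
split=> [/(integ_mu hrho mf) i1|i1].
  have i2 : integ leb f by exact: integ_le (integZ (M + N) i1) h1.
  split => //; rewrite (Int_mu hrho)// -IntZ//; apply: Int_le => //; first exact: integZ.
  by move=> x; apply: le_trans (h1 x); exact: ler_norm.
have mfr : measurable_fun setT (fun x => f x * rho x) by exact: measurable_funM.
have i2 : integ leb (fun x => f x * rho x) by exact: integ_le (integZ (M + N) i1) h2.
split; first exact/(integ_mu hrho).
rewrite (Int_mu hrho)// -IntZ//; apply: Int_le => //; first exact: integZ.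
by move=> x; apply: le_trans (h2 x); exact: ler_norm.
Qed.

Definition form_density g h x := dotv (mulv (A x) (grad g x)) (grad h x).
(** Without the factor 1/2 of [dform] and over the whole space: when one argument is a test function
    of [V], the integrand vanishes outside [V]. *)
Definition energy g h := \int[mu]_x form_density g h x.

Lemma energyE g h : energy g h = \int[mu]_x form_density g h x.
Proof. by []. Qed.

Lemma grad_out g x : ~ supp g x -> grad g x = 0.
Proof. by move=> gx; apply/rowP => i; rewrite !mxE partial_out. Qed.

Lemma dotv0 (x : E) : dotv x 0 = 0.
Proof. by rewrite /dotv big1// => i _; rewrite mxE mulr0. Qed.

Lemma form_density_bcs h g (U : set E) : Ck 1 h -> test_fun U g -> bcs (form_density h g).
Proof.
move=> ch [cg cK _]; apply: (bcs_cont _ cK); first by have := form_continuous ha ch (cg 1%N); exact.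
by move=> x /grad_out gx; rewrite /form_density gx dotv0.
Qed.

Lemma form_density_integ h g (U : set E) : Ck 1 h -> test_fun U g ->
  integ mu (form_density h g).
Proof. by move=> ch tg; apply: (bcs_integ_mu hrho); exact: form_density_bcs ch tg. Qed.

Lemma form_densityC g h x : form_density g h x = form_density h g x.
Proof. exact: mulv_sym. Qed.

Lemma energyC g h : energy g h = energy h g.
Proof. by apply: eq_Rintegral => x _; rewrite form_densityC. Qed.

Lemma form_densityB f g h x : Ck 1 f -> Ck 1 g ->
  form_density (f \- g) h x = form_density f h x - form_density g h x.
Proof.
move=> cf cg; rewrite /form_density.
have -> : grad (f \- g) x = grad f x + (-1) *: grad g x.
  by apply/rowP => i; rewrite !mxE mulN1r; exact: partialB.
by rewrite mulv_lin mulN1r.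
Qed.

Lemma energyB f g h (U : set E) : Ck 1 f -> Ck 1 g -> test_fun U h ->
  energy (f \- g) h = energy f h - energy g h.
Proof.
move=> cf cg th; rewrite /energy.
under eq_Rintegral do rewrite (form_densityB _ _ cf cg).
exact: IntB (form_density_integ cf th) (form_density_integ cg th).
Qed.

Lemma energy_ge0 g : 0 <= energy g g.
Proof. by apply: Int_ge0 => x; exact: mulv_ge0. Qed.

Lemma energy_young (s : R) g h (U V : set E) : 0 < s -> test_fun U g -> test_fun V h ->
  `|energy g h| <= s * energy g g + s^-1 * energy h h.
Proof.
move=> s0 tg th; have [cg _ _] := tg; have [ch _ _] := th.
have i1 := form_density_integ (cg 1%N) tg; have i2 := form_density_integ (ch 1%N) th.
have i3 := form_density_integ (cg 1%N) th.
apply: le_trans (Int_norm i3) _; rewrite /energy -(IntZ s i1) -(IntZ s^-1 i2).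
rewrite -(IntD (integZ s i1) (integZ s^-1 i2)); apply: Int_le => [||x].
- exact: integ_norm.
- by apply: integD; exact: integZ.
- exact: mulv_young.
Qed.

Lemma dform_energy (V : set E) g h : test_fun V g -> dform mu A V g h = 2^-1 * energy g h.
Proof.
move=> tg; rewrite /dform Rintegral_mkcond; congr (_ * _).
apply: eq_Rintegral => x _; rewrite patchE; case: ifPn => // /negP xV.
rewrite -/(form_density g h x) form_densityC /form_density (@grad_out g) ?dotv0//.
by move=> sx; apply: xV; rewrite inE; have [_ _ sV] := tg; exact: sV.
Qed.

Lemma energy_sum_le (K : set E) : compact K -> exists2 c : R, 0 < c &
  forall g (U : set E), test_fun U g -> (forall x, ~ K x -> grad g x = 0) ->
  forall i, \int[leb]_x (partial i g x ^+ 2) <= c * energy g g.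
Proof.
move=> cK; have [nu nu0 hnu] := elliptic_compact cK.
have [kap kap0 hkap] := mu_leb_compact cK.
exists (kap * nu); first exact: mulr_gt0.
move=> g U tg gK i; have [cg _ _] := tg.
have bp : bcs (partial i g) by exact: test_fun_bcs (test_fun_partial i tg).
have bp2 : bcs (fun x => partial i g x ^+ 2).
  by under eq_fun do rewrite expr2; exact: bcsM.
have ip := bcs_integ_mu hrho bp2.
have [mp _ _] := bp2.
have [|_ le] := (hkap _ mp (fun x => sqr_ge0 _) _).1 ip.
  by move=> x /gK; move/rowP/(_ i); rewrite !mxE => ->; rewrite expr0n.
apply: le_trans le _; rewrite -mulrA ler_pM2l//.
have i1 := form_density_integ (cg 1%N) tg.
rewrite /energy -(IntZ nu i1); apply: Int_le => // [|x]; first exact: integZ.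
have [Kx|nKx] := pselect (K x).
  apply: le_trans (hnu x (grad g x) Kx).
  by rewrite (bigD1 i)//= mxE lerDl sumr_ge0// => j _; exact: sqr_ge0.
move/gK : (nKx) => /rowP/(_ i); rewrite !mxE => ->; rewrite expr0n/=.
by rewrite mulr_ge0// ?(ltW nu0)//; exact: mulv_ge0.
Qed.

End energy_form.

Section Lnorm2.
Context {dT : measure_display} {T : measurableType dT} {R : realType}.
Variable mu : {measure set T -> \bar R}.
Implicit Types f : T -> R.

Lemma Lfun2_integ f : f \in Lfun mu 2%:E ->
  measurable_fun setT f /\ integ mu (fun x => f x ^+ 2).
Proof.
move=> lf; split; last exact: Lfun2_integrable_sqr.
by move: lf; rewrite inE => /andP[/[!inE]].
Qed.

Lemma Lnorm2_sqr f : measurable_fun setT f -> integ mu (fun x => f x ^+ 2) ->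
  exists a : R, ('N[mu]_2%:E[EFin \o f] = a%:E)%E /\ \int[mu]_x (f x ^+ 2) = a ^+ 2.
Proof.
move=> mf iF.
have e : ('N[mu]_2%:E[EFin \o f] `^ 2 = (\int[mu]_x (f x ^+ 2))%:E)%E.
  rewrite powR_Lnorm// Int_EFin//; apply: eq_integral => x _ /=.
  by rewrite powR_mulrn// real_normK ?num_real.
have N0 : (0 <= 'N[mu]_2%:E[EFin \o f])%E by exact: Lnorm_ge0.
move: e N0; case: ('N[mu]_2%:E[EFin \o f])%E => [a| |]//=; last by rewrite pnatr_eq0.
by move=> [e] a0; exists a; split => //; rewrite -e -powR_mulrn.
Qed.

Lemma Lnorm2_cvg0 (f : nat -> T -> R) : (forall n, measurable_fun setT (f n)) ->
  (forall n, integ mu (fun x => f n x ^+ 2)) ->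
  ('N[mu]_2%:E[EFin \o f n] @[n --> \oo] --> 0)%E ->
  \int[mu]_x (f n x ^+ 2) @[n --> \oo] --> (0 : R).
Proof.
move=> mf iF.
have /boolp.choice[a ha] : forall n, exists a : R,
    ('N[mu]_2%:E[EFin \o f n] = a%:E)%E /\ \int[mu]_x (f n x ^+ 2) = a ^+ 2.
  by move=> n; exact: Lnorm2_sqr.
have -> : (fun n => 'N[mu]_2%:E[EFin \o f n])%E = (fun n => (a n)%:E).
  by apply/funext => n; exact: (ha n).1.
move=> /fine_cvg /= a0.
have -> : (fun n => \int[mu]_x (f n x ^+ 2)) = fun n => a n * a n.
  by apply/funext => n; rewrite (ha n).2 expr2.
rewrite -[X in _ --> X](mulr0 0); exact: cvgM.
Qed.

End Lnorm2.

(** * Integration by parts for test functions *)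

Section form_domain.
Context {R : realType} {d : nat}.
Local Notation E := 'rV[R]_d.
Local Notation leb := (@leb R d).
Local Notation e_ i := (delta_mx 0 i : E).
Context {p q : R} {A C : E -> 'M[R]_d} {H : E -> E} {rho : E -> R}
  {mu : {measure set E -> \bar R}}.
Local Notation beta := (log_drift A rho).
Local Notation G := (drift A C H).
Local Notation B := (fun x => G x - log_drift A rho x).
Local Notation energy := (@energy R d A mu).
Hypothesis p2 : 2 <= p.
Hypothesis ha : assumption_a p A C H.
Hypothesis hrho : invariant_density p A G rho mu.
Implicit Types f g h : E -> R.

(** Let F be the indicator of a cube that contains the support with margin 1. The convolution of F
    with [g] is constant near 0, so its derivative at 0 vanishes, and that derivative is minus the
    integral in question. *)
Lemma Int_partial0 g i (U : set E) : test_fun U g -> \int[leb]_x partial i g x = 0.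
Proof.
move=> /(test_fun_sub (@subsetT _ U)) tg; have [cg cK _] := tg.
have [b [b0 hb]] := compact_sqd 0 cK.
have [M M0 KM] : exists2 M : R, 0 < M & forall x, supp g x -> `|x| <= M.
  have [N [_ HN]] := compact_bounded cK.
  by exists (`|N| + 1) => [|x Kx]; [rewrite ltr_wpDl|apply: HN => //; rewrite ltr_pwDr// ler_norm].
pose Q := cube (0 : E) (M + 1); pose F := (\1_Q : E -> R).
have mQ : measurable Q by apply: measurable_compact_rV; exact: cube_compact.
have iF : integ leb F.
  have := integ_cst_compact 1 (@cube_compact R d (0 : E) (M + 1)); congr (integ leb _).
  by apply/funext => x; rewrite patchE /F indicE; case: ifP.
have QF x : ~ Q x -> M + 1 < `|x|.
  move=> nQ; rewrite ltNge; apply/negP => le; apply: nQ => j; rewrite mxE subr0.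
  by have /rV_normP := le; apply; rewrite addr_ge0// ltW.
have Fg x y : `|x| < 1 -> F y * g (y - x) = g (y - x).
  move=> x1; rewrite /F indicE; case: (boolP (y \in Q)) => [_|/negP yQ]; first by rewrite mul1r.
  rewrite mul0r supp_out// => /KM; apply/negP; rewrite -ltNge.
  have : ~ Q y by move=> Qy; apply: yQ; rewrite inE.
  by move=> /QF; have := lerB_dist y x; lra.
have mg : measurable_fun setT g by have [] := test_fun_bcs tg.
have near0 : \forall x \near (0 : E), convol F g x = \int[leb]_y g y.
  apply/nbhs_ballP; exists 1 => //= x; rewrite mx_norm_ball /ball_ /= sub0r normrN => x1.
  rewrite /convol -(@Int_shift _ _ g (- x) mg); apply: eq_Rintegral => y _; exact: Fg.
have := partialE (conv_derive 0 i iF tg).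
rewrite (partial_near _ near0) partial_cst => /esym/eqP; rewrite oppr_eq0 => /eqP e.
rewrite -[RHS]e /convol; apply: eq_Rintegral => y _; rewrite subr0.
have [sy|/partial_out ->] := pselect (supp g y); last by rewrite mulr0.
rewrite /F indicE mem_set ?mul1r// => j; rewrite mxE subr0.
by have /rV_normP := le_trans (KM _ sy) (ler_wpDr ler01 (lexx M)); apply; rewrite addr_ge0// ltW.
Qed.

Lemma test_by_parts u phi i (U V : set E) : test_fun U u -> test_fun V phi ->
  \int[leb]_x (u x * partial i phi x) = - \int[leb]_x (partial i u x * phi x).
Proof.
move=> tu tphi; have [cu _ _] := tu; have [cphi _ _] := tphi.
have t1 := test_funM_l tu cphi.
have := Int_partial0 i t1.
have b1 : bcs (fun x => u x * partial i phi x).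
  apply: bcsM; first exact: test_fun_bcs tu.
  exact: test_fun_bcs (test_fun_partial i tphi).
have b2 : bcs (fun x => partial i u x * phi x).
  by apply: bcsM; [exact: test_fun_bcs (test_fun_partial i tu)|exact: test_fun_bcs tphi].
have -> : \int[leb]_x partial i (fun x => u x * phi x) x =
    \int[leb]_x (u x * partial i phi x + partial i u x * phi x).
  apply: eq_Rintegral => x _; rewrite partialM; [|exact: cu 1%N|exact: cphi 1%N].
  by rewrite (mulrC (phi x)).
by rewrite (IntD (bcs_integ b1) (bcs_integ b2)) => /eqP; rewrite addr_eq0 => /eqP.
Qed.

Lemma Lop_locint_sqr (b : E -> E) h : (forall i, locint (fun x => b x 0 i)) ->
  (forall i, locint (fun x => b x 0 i ^+ 2)) -> Ck 2 h ->
  locint (fun x => Lop A b h x ^+ 2).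
Proof.
move=> lb lb2 ch.
pose F x := 2^-1 * (\sum_i \sum_j A x i j * partial i (partial j h) x).
have cF : continuous F.
  apply: contM; first exact: cst_continuous.
  apply: cont_sum => i; apply: cont_sum => j; apply: contM; first exact: (a_continuous ha).
  exact: Ck_continuous (CkS_partial i (CkS_partial j ch)).
have cp i : continuous (partial i h) by exact: Ck_continuous (CkS_partial i ch).
apply: locint_sqrD.
- exact: locint_cont cF.
- by apply: locint_sum => i; exact: locintM_cont.
- by apply: locint_cont; under eq_fun do rewrite expr2; exact: contM.
- by apply: locint_sqr_sum => i; [exact: locintM_cont|exact: locint_sqrM_cont].
Qed.

Lemma locint_compact_integ_mu f (K : set E) : locint f -> compact K ->
  (forall x, ~ K x -> f x = 0) -> integ mu f.
Proof.
move=> lf cK fK; have mK := measurable_compact_rV cK.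
have b1 : bcs (\1_K : E -> R).
  split; [exact: measurable_indic|exists 1 => x|exists K => // x nK].
    by rewrite indicE; case: (_ \in _); rewrite ?normr1 ?normr0.
  by rewrite indicE memNset.
have := locintM_bcs_mu hrho lf b1; congr (integ mu _); apply/funext => x.
have [Kx|nKx] := pselect (K x); first by rewrite indicE mem_set ?mulr1.
by rewrite fK// mul0r.
Qed.

Lemma Lop_out (b : E -> E) h x : ~ supp h x -> Lop A b h x = 0.
Proof.
move=> hx; rewrite /Lop [X in _ + X]big1 ?addr0 => [|i _]; last by rewrite partial_out ?mulr0.
rewrite big1 ?mulr0// => i _; rewrite big1// => j _; rewrite (@partial_near _ _ _ (fun=> 0)) ?partial_cst ?mulr0//.
have /open_nbhs_nbhs : open_nbhs x (~` supp h).
  by split => //; apply: closed_openC; exact: closed_closure.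
by apply: filterS => y /= /partial_out.
Qed.

Lemma energy_Lop g h (U V : set E) : test_fun U g -> test_fun V h ->
  energy g h = - (2 * \int[mu]_x (Lop A beta g x * h x)).
Proof.
move=> [cg _ _] /(test_fun_sub (@subsetT _ V)) th.
have := form_by_parts p2 ha hrho cg th; rewrite -/(energy g h).
under eq_Rintegral do rewrite mulrC.
by move=> e; have := congr1 (fun z => 2 * z) e; rewrite mulVKf// mulrN.
Qed.

(* Closability: if [g n --> 0] in L^2 and is Cauchy for the form, the form of
   [g n] is within epsilon of [energy (g n) (g m)] = -2 \int (L0 (g n)) (g m),
   which vanishes as [m --> oo]. *)
Lemma energy_closable (V : set E) (g : nat -> E -> R) : (forall n, test_fun V (g n)) ->
  \int[mu]_x (g n x ^+ 2) @[n --> \oo] --> (0 : R) ->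
  (forall e : R, 0 < e -> exists N, forall m n, (N <= m)%N -> (N <= n)%N ->
    energy (g m \- g n) (g m \- g n) < e) ->
  energy (g n) (g n) @[n --> \oo] --> (0 : R).
Proof.
have alg1 (a b c e : R) : 0 <= c -> a - b - (b - c) < e / 2 -> a <= e / 2 + 2 * b by lra.
have alg2 (a b e : R) : a <= e / 2 + 2 * b -> b < e / 4 -> a <= e by lra.
move=> tg g0 gC; apply/cvgrPdist_le => e e0.
have e2 : 0 < e / 2 by rewrite divr_gt0.
have [N HN] := gC _ e2; exists N => // n /= Nn.
rewrite sub0r normrN ger0_norm; last exact: energy_ge0 ha _.
have lim0 : energy (g n) (g m) @[m --> \oo] --> (0 : R).
  have [cgn cK _] := tg n.
  have lb i := (beta_locint p2 ha hrho i).1.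
  have lb2 i := (beta_locint p2 ha hrho i).2.
  have lL : locint (fun x => Lop A beta (g n) x ^+ 2) by exact: Lop_locint_sqr.
  have [mL _] := Lop_locint ha lb (cgn 2%N).
  have iL : integ mu (fun x => Lop A beta (g n) x ^+ 2).
    by apply: (locint_compact_integ_mu lL cK) => x /(Lop_out beta) ->; rewrite expr0n.
  have mg m : measurable_fun setT (g m) by have [] := test_fun_bcs (tg m).
  have ig m : integ mu (fun x => g m x ^+ 2).
    apply: (bcs_integ_mu hrho); under eq_fun do rewrite expr2.
    by apply: bcsM; exact: test_fun_bcs (tg m).
  have [iP /cvgrPdist_lt h0] := L2_pairing_cvg0 mg mL ig iL g0.
  apply/cvgrPdist_lt => r r0; have r2 : 0 < r / 2 by rewrite divr_gt0.
  have := h0 _ r2; apply: filterS => m; rewrite !sub0r !normrN => hm.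
  rewrite (energy_Lop (tg n) (tg m)) normrN normrM ger0_norm// mulrC -ltr_pdivlMr//.
  by apply: le_lt_trans (Int_norm (iP m)) _; exact: le_lt_trans (ler_norm _) hm.
(* Expand the energy of g_n - g_m, which is below e/2, and drop the nonnegative energy of g_m. *)
have le m : (N <= m)%N -> energy (g n) (g n) <= e / 2 + 2 * energy (g n) (g m).
  move=> Nm; have [cn _ _] := tg n; have [cm _ _] := tg m.
  have h := HN _ _ Nn Nm.
  have tB : test_fun V (g n \- g m) by exact: test_funB (tg n) (tg m).
  have cB : forall k, Ck k (g n \- g m) by have [] := tB.
  have e1 := energyB ha hrho (cn 1%N) (cm 1%N) (tg n).
  have e3 := energyB ha hrho (cn 1%N) (cm 1%N) tB.
  have e4 := energyC ha (g n) (g n \- g m).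
  have e5 := energyC ha (g m) (g n \- g m).
  have e6 := energyB ha hrho (cn 1%N) (cm 1%N) (tg m).
  have e7 := energyC ha (g m) (g n).
  have pm := @energy_ge0 _ _ p A C H mu ha (g m).
  rewrite e4 e5 e1 e6 e7 in e3; rewrite e3 in h.
  exact: alg1 pm h.
have e4 : 0 < e / 4 by rewrite divr_gt0.
have /cvgrPdist_lt/(_ _ e4)[K _ HK] := lim0.
apply: alg2 (le (maxn N K) (leq_maxl _ _)) _.
have := HK (maxn N K) (leq_maxr _ _); rewrite /= sub0r normrN.
exact: le_lt_trans (ler_norm _).
Qed.

End form_domain.

(** * Approximating sequences in the form domain *)

Section form_limits.
Context {R : realType} {d : nat}.
Local Notation E := 'rV[R]_d.
Local Notation leb := (@leb R d).
Context {p q : R} {A C : E -> 'M[R]_d} {H : E -> E} {rho : E -> R}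
  {mu : {measure set E -> \bar R}}.
Local Notation beta := (log_drift A rho).
Local Notation G := (drift A C H).
Local Notation B := (fun x => G x - log_drift A rho x).
Local Notation energy := (@energy R d A mu).
Hypothesis p2 : 2 <= p.
Hypothesis ha : assumption_a p A C H.
Hypothesis hrho : invariant_density p A G rho mu.
Implicit Types f g h u : E -> R.

Lemma restrict_test_sub (V : set E) g u : test_fun V g ->
  (g \- u) \_ V = fun x => g x - (u \_ V) x.
Proof.
move=> tg; apply/funext => x; rewrite !patchE; case: ifPn => // /negP xV.
by rewrite (test_fun_out tg) ?subrr// => Vx; apply: xV; rewrite inE.
Qed.

Lemma form_approx_L2 (V : set E) u (un : nat -> E -> R) : form_approx mu A V u un ->
  [/\ measurable_fun setT (u \_ V), integ mu (fun x => (u \_ V) x ^+ 2),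
      forall n, integ mu (fun x => (un n x - (u \_ V) x) ^+ 2) &
      \int[mu]_x ((un n x - (u \_ V) x) ^+ 2) @[n --> \oo] --> (0 : R)].
Proof.
move=> [/Lfun2_integ[mu0 iu0] tun u0 _].
have mun n : measurable_fun setT (un n) by have [] := test_fun_bcs (tun n).
have iun n : integ mu (fun x => un n x ^+ 2).
  apply: (bcs_integ_mu hrho); under eq_fun do rewrite expr2.
  by apply: bcsM; exact: test_fun_bcs (tun n).
have mB n : measurable_fun setT (fun x => un n x - (u \_ V) x) by exact: measurable_funB.
have iB n : integ mu (fun x => (un n x - (u \_ V) x) ^+ 2).
  apply: integ_le (integD (integZ 2 (iun n)) (integZ 2 iu0)) _; first exact: measurable_funX.
  by move=> x; rewrite ger0_norm ?sqr_ge0//; have := sqr_ge0 (un n x + (u \_ V) x); nra.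
split => //; apply: Lnorm2_cvg0 => //.
apply: cvg_trans u0; apply: near_eq_cvg; apply: nearW => n.
by rewrite /distL (restrict_test_sub _ (tun n)).
Qed.

Lemma form_approx_cauchy (V : set E) u (un : nat -> E -> R) : form_approx mu A V u un ->
  forall e : R, 0 < e -> exists N, forall m n, (N <= m)%N -> (N <= n)%N ->
    energy (un m \- un n) (un m \- un n) < e.
Proof.
move=> [_ tun _ uC] e e0; have e2 : 0 < 2^-1 * e by rewrite mulr_gt0// invr_gt0.
have [N HN] := uC _ e2; exists N => m n Nm Nn; have := HN m n Nm Nn.
have tB : test_fun V (un m \- un n) by exact: test_funB.
by rewrite (dform_energy ha _ tB) ltr_pM2l// invr_gt0.
Qed.

Lemma energyBB g h (U : set E) : test_fun U g -> test_fun U h ->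
  energy (g \- h) (g \- h) = energy g g - 2 * energy g h + energy h h.
Proof.
have alg (a b c : R) : a - b - (b - c) = a - 2 * b + c by ring.
move=> tg th; have [cg _ _] := tg; have [ch _ _] := th.
have tB : test_fun U (g \- h) by exact: test_funB.
rewrite (energyB ha hrho (cg 1%N) (ch 1%N) tB).
rewrite (energyC ha g (g \- h)) (energyC ha h (g \- h)).
rewrite (energyB ha hrho (cg 1%N) (ch 1%N) tg) (energyB ha hrho (cg 1%N) (ch 1%N) th).
rewrite (energyC ha h g); exact: alg.
Qed.

(** Young's inequality with weight 1/4 on [g]: in twice the expansion of the energy of g - h, the
    cross term 4 energy g h is at most energy g g + 16 energy h h. *)
Lemma energy_sub_le g h (U : set E) : test_fun U g -> test_fun U h ->
  energy g g <= 2 * energy (g \- h) (g \- h) + 14 * energy h h.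
Proof.
have alg (a b c : R) : b <= 4^-1 * a + 4^-1^-1 * c -> a <= 2 * (a - 2 * b + c) + 14 * c.
  by rewrite invrK; lra.
move=> tg th; rewrite (energyBB tg th); apply: alg; apply: le_trans (ler_norm _) _.
by apply: (energy_young ha hrho _ tg th); rewrite invr_gt0.
Qed.

Lemma energy_sub_le_add g h (U : set E) : test_fun U g -> test_fun U h ->
  energy (g \- h) (g \- h) <= 3 * energy g g + 3 * energy h h.
Proof.
have alg (a b c : R) : `|b| <= 1 * a + 1^-1 * c -> a - 2 * b + c <= 3 * a + 3 * c.
  by rewrite ler_norml invr1 => /andP[]; lra.
move=> tg th; rewrite (energyBB tg th); apply: alg.
by apply: (energy_young ha hrho _ tg th).
Qed.

Lemma form_approx_bounded (V : set E) u (un : nat -> E -> R) : form_approx mu A V u un ->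
  exists2 M : R, 0 < M & exists N, forall n, (N <= n)%N -> energy (un n) (un n) <= M.
Proof.
move=> fu; have [_ tun _ _] := fu.
have [N HN] := form_approx_cauchy fu ltr01.
exists (3 + 14 * energy (un N) (un N)).
  by rewrite ltr_wpDr// mulr_ge0//; exact: energy_ge0 ha _.
exists N => n Nn; apply: le_trans (energy_sub_le (tun n) (tun N)) _.
by rewrite lerD2r; have := HN n N Nn (leqnn N); lra.
Qed.

Lemma form_approx_test (V : set E) g : test_fun V g -> form_approx mu A V g (fun=> g).
Proof.
move=> tg; have bg := test_fun_bcs tg; have [mg _ _] := bg.
have e : g \_ V = g.
  apply/funext => x; rewrite patchE; case: ifPn => // /negP xV.
  by rewrite (test_fun_out tg)// => Vx; apply: xV; rewrite inE.
split => //.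
- rewrite /inL e inE; apply/andP; split; rewrite inE//= /finite_norm.
  have i2 : integ mu (fun x => g x ^+ 2).
    by apply: (bcs_integ_mu hrho); under eq_fun do rewrite expr2; exact: bcsM.
  by have [a [-> _]] := Lnorm2_sqr mg i2; exact: ltry.
- rewrite /distL; have -> : (g \- g) \_ V = cst 0.
    by apply/funext => x; rewrite patchE /= subrr; case: ifP.
  have -> : (EFin \o cst (0 : R)) = cst (0%E : \bar R) :> (E -> \bar R) by [].
  by rewrite Lnorm0; [exact: cvg_cst|rewrite eqe pnatr_eq0].
- move=> r r0; exists 0%N => m n _ _.
  have tB : test_fun V (g \- g) by exact: test_funB.
  rewrite (dform_energy ha _ tB).
  have -> : energy (g \- g) (g \- g) = 0.
    rewrite -[RHS](@Int0 _ _ _ mu); apply: eq_Rintegral => x _.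
    have -> : (g \- g) = fun=> 0 by apply/funext => y /=; rewrite subrr.
    rewrite /form_density (_ : grad _ x = 0) ?dotv0//.
    by apply/rowP => i; rewrite !mxE partial_cst.
  by rewrite mulr0.
Qed.

Lemma young_cvg0 (a b c : nat -> R) (M : R) : (exists N, forall n, (N <= n)%N -> a n <= M) ->
  (forall n, 0 <= a n) -> (forall n, 0 <= b n) -> b n @[n --> \oo] --> (0 : R) ->
  (forall n (s : R), 0 < s -> `|c n| <= s * a n + s^-1 * b n) ->
  c n @[n --> \oo] --> (0 : R).
Proof.
move=> [N0 aM] a0 b0 bc h; have M0 : 0 <= M by exact: le_trans (a0 _) (aM N0 (leqnn _)).
apply/cvgrPdist_lt => e e0.
pose s := e / (2 * (M + 1)); have s0 : 0 < s by rewrite divr_gt0// mulr_gt0// ltr_wpDl.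
have es : 0 < e / 2 * s by rewrite mulr_gt0// divr_gt0.
have /cvgrPdist_lt/(_ _ es)[N _ HN] := bc.
exists (maxn N0 N) => // n /=; rewrite geq_max => /andP[n0 /HN].
rewrite !sub0r !normrN => /(le_lt_trans (ler_norm _)) bn.
apply: le_lt_trans (h n s s0) _.
have h1 : s * a n < e / 2.
  apply: le_lt_trans (_ : s * M < _); first by rewrite ler_pM2l// aM.
  rewrite /s mulrAC ltr_pdivrMr ?mulr_gt0// ?ltr_wpDl//.
  have -> : e / 2 * (2 * (M + 1)) = e * M + e by field.
  by rewrite ltrDl.
have h2 : s^-1 * b n < e / 2 by rewrite mulrC ltr_pdivrMr.
lra.
Qed.

Lemma energy_cvg0 (V : set E) (g h : nat -> E -> R) (M : R) :
  (forall n, test_fun V (g n)) -> (forall n, test_fun V (h n)) ->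
  (exists N, forall n, (N <= n)%N -> energy (g n) (g n) <= M) ->
  energy (h n) (h n) @[n --> \oo] --> (0 : R) ->
  energy (g n) (h n) @[n --> \oo] --> (0 : R).
Proof.
move=> tg th gM h0; apply: young_cvg0 gM _ _ h0 _ => [n|n|n s s0].
- exact: energy_ge0 ha _.
- exact: energy_ge0 ha _.
- exact: (energy_young ha hrho s0 (tg n) (th n)).
Qed.

(** The differences tend to 0 in L^2 and are Cauchy for the form, so closability applies. Form
    values therefore do not depend on the approximating sequences. *)
Lemma form_approx_sub (V : set E) u (un vn : nat -> E -> R) :
  form_approx mu A V u un -> form_approx mu A V u vn ->
  energy (un n \- vn n) (un n \- vn n) @[n --> \oo] --> (0 : R).
Proof.
have alg (a b e : R) : a < e / 6 -> b < e / 6 -> 3 * a + 3 * b < e by lra.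
move=> fu fv; have [_ tu _ _] := fu; have [_ tv _ _] := fv.
have [mu0 iu0 iu u0] := form_approx_L2 fu; have [_ _ iv v0] := form_approx_L2 fv.
have tB n : test_fun V (un n \- vn n) by exact: test_funB.
apply: (energy_closable p2 ha hrho tB).
  apply: (@squeeze_cvgr _ _ _ _ (fun=> 0) (fun n => 2 * \int[mu]_x ((un n x - (u \_ V) x) ^+ 2) +
    2 * \int[mu]_x ((vn n x - (u \_ V) x) ^+ 2))).
  - apply: nearW => n; rewrite Int_ge0/= => [|x]; last exact: sqr_ge0.
    rewrite -(IntZ 2 (iu n)) -(IntZ 2 (iv n)) -(IntD (integZ 2 (iu n)) (integZ 2 (iv n))).
    apply: Int_le => [||x].
    + apply: (bcs_integ_mu hrho); under eq_fun do rewrite expr2.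
      by apply: bcsM; exact: test_fun_bcs (tB n).
    + by apply: integD; exact: integZ.
    + rewrite /=; move: (un n x) (vn n x) ((u \_ V) x) => a b c.
      by have := sqr_ge0 (a + b - 2 * c); nra.
  - exact: cvg_cst.
  - rewrite -[X in _ --> X](addr0 0) -[X in X + _](mulr0 2) -[X in _ + X](mulr0 2).
    by apply: cvgD; apply: cvgM => //; exact: cvg_cst.
move=> e e0; have e4 : 0 < e / 6 by rewrite divr_gt0.
have [N1 H1] := form_approx_cauchy fu e4; have [N2 H2] := form_approx_cauchy fv e4.
exists (maxn N1 N2) => m n; rewrite !geq_max => /andP[m1 m2] /andP[n1 n2].
have -> : (un m \- vn m) \- (un n \- vn n) = (un m \- un n) \- (vn m \- vn n).
  by apply/funext => x /=; move: (un m x) (un n x) (vn m x) (vn n x) => a b c r; ring.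
have t1 : test_fun V (un m \- un n) by exact: test_funB.
have t2 : test_fun V (vn m \- vn n) by exact: test_funB.
apply: le_lt_trans (energy_sub_le_add t1 t2) _.
exact: alg (H1 m n m1 n1) (H2 m n m2 n2).
Qed.

End form_limits.

(** * Weak gradients in the form domain *)

Section weak_gradient_limit.
Context {R : realType} {d : nat}.
Local Notation E := 'rV[R]_d.
Local Notation leb := (@leb R d).
Context {p q : R} {A C : E -> 'M[R]_d} {H : E -> E} {rho : E -> R}
  {mu : {measure set E -> \bar R}}.
Local Notation beta := (log_drift A rho).
Local Notation G := (drift A C H).
Local Notation B := (fun x => G x - log_drift A rho x).
Local Notation energy := (@energy R d A mu).
Hypothesis p2 : 2 <= p.
Hypothesis ha : assumption_a p A C H.
Hypothesis hrho : invariant_density p A G rho mu.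
Implicit Types f g h u : E -> R.

Lemma sqr_integ_restrict f (K : set E) : compact K -> measurable_fun setT f ->
  integ leb (fun x => f x ^+ 2) -> integ leb (f \_ K).
Proof.
move=> cK mf i2; have mK := measurable_compact_rV cK.
apply: integ_le (integD (integ_cst_compact 1 cK) i2) _; first exact: measurable_restrictE.
move=> x; rewrite !patchE; case: ifP => _; last by rewrite normr0 add0r sqr_ge0.
by rewrite ler_norml; apply/andP; split;
  have := sqr_ge0 (f x - 1); have := sqr_ge0 (f x + 1); nra.
Qed.

(** By ellipticity the energy dominates the Lebesgue L^2 norm of the gradients on the closure of V,
    so these converge; integration by parts shows that the limit is a weak derivative on V, and
    uniqueness identifies it with [weakD] almost everywhere. This links the drift term, written with
    [weakD], to the approximating test functions. *)
Lemma form_weakD (V : set E) u (un : nat -> E -> R) i : relcompact_open V ->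
  form_approx mu A V u un -> let g := weakD V i u \_ V in
  [/\ measurable_fun setT g, integ leb (fun x => g x ^+ 2),
      forall n, integ leb (fun x => (partial i (un n) x - g x) ^+ 2) &
      \int[leb]_x ((partial i (un n) x - g x) ^+ 2) @[n --> \oo] --> (0 : R)].
Proof.
move=> [oV cV] fu; have [_ tun _ _] := fu; have mV := measurable_open_rV oV.
have [mu0 iu0 iun un0] := form_approx_L2 hrho fu.
have VK : V `<=` closure V by exact: subset_closure.
have cun n k : Ck k (un n) by have [] := tun n.
have bp n : bcs (partial i (un n)) by exact: test_fun_bcs (test_fun_partial i (tun n)).
have [c c0 hc] := energy_sum_le ha hrho cV.
have gradK g : test_fun V g -> forall x, ~ closure V x -> grad g x = 0.
  by move=> [_ _ sV] x nV; apply: grad_out => /sV /VK.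
have mh n : measurable_fun setT (partial i (un n)) by have [] := bp n.
have sqr_bcs f : bcs f -> bcs (fun x => f x ^+ 2).
  by move=> bf; under eq_fun do rewrite expr2; exact: bcsM.
have ih n : integ leb (fun x => partial i (un n) x ^+ 2) by exact/bcs_integ/sqr_bcs.
have hC (e : R) : 0 < e -> exists N, forall m n, (N <= m)%N -> (N <= n)%N ->
    \int[leb]_x ((partial i (un m) x - partial i (un n) x) ^+ 2) < e.
  move=> e0; have ec : 0 < e / c by rewrite divr_gt0.
  have [N HN] := form_approx_cauchy ha fu ec; exists N => m n Nm Nn.
  have tB : test_fun V (un m \- un n) by exact: test_funB.
  have -> : \int[leb]_x ((partial i (un m) x - partial i (un n) x) ^+ 2) =
      \int[leb]_x (partial i (un m \- un n) x ^+ 2).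
    by apply: eq_Rintegral => x _; rewrite partialB.
  apply: le_lt_trans (hc _ V tB (gradK _ tB) i) _.
  by have := HN m n Nm Nn; rewrite ltr_pdivlMr// mulrC.
have [g [mg ig ihg hg]] := L2_complete mh ih hC.
have [kap kap0 hkap] := mu_leb_compact hrho cV.
have u0K x : ~ closure V x -> (u \_ V) x = 0.
  by move=> nK; rewrite patchE memNset// => /VK.
have un_out n x : ~ closure V x -> un n x = 0.
  by move=> nK; apply: (test_fun_out (tun n)) => /VK.
have iu0l : integ leb (fun x => (u \_ V) x ^+ 2).
  apply: (proj1 ((hkap _ _ _ _).1 iu0)) => [|x|x /u0K ->]; last by rewrite expr0n.
    exact: measurable_funX.
  exact: sqr_ge0.
have mun n : measurable_fun setT (un n) by have [] := test_fun_bcs (tun n).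
have hD n : integ leb (fun x => (un n x - (u \_ V) x) ^+ 2) /\
    \int[leb]_x ((un n x - (u \_ V) x) ^+ 2) <= kap * \int[mu]_x ((un n x - (u \_ V) x) ^+ 2).
  apply: ((hkap _ _ _ _).1 (iun n)) => [|x|x nK].
  - by apply: measurable_funX; exact: measurable_funB.
  - exact: sqr_ge0.
  - by rewrite u0K// un_out// subrr expr0n.
have D0 : \int[leb]_x ((un n x - (u \_ V) x) ^+ 2) @[n --> \oo] --> (0 : R).
  apply: (@squeeze_cvgr _ _ _ _ (fun=> 0)
      (fun n => kap * \int[mu]_x ((un n x - (u \_ V) x) ^+ 2))).
  - by apply: nearW => n; rewrite Int_ge0 ?(hD n).2// => x; exact: sqr_ge0.
  - exact: cvg_cst.
  - by rewrite -[X in _ --> X](mulr0 kap); apply: cvgM => //; exact: cvg_cst.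
have wp : is_weak_partial V i u g.
  split.
  - apply/Lploc1P; split; first exact: (measurable_restrictT _ mV).2.
    move=> K cK KV; have mK := measurable_compact_rV cK.
    have -> : u \_ K = (u \_ V) \_ K; last exact: sqr_integ_restrict.
    apply/funext => x; rewrite !patchE; case: ifPn => // /set_mem/KV Vx.
    by rewrite mem_set.
  - apply/Lploc1P; split; first exact: measurable_funTS.
    by move=> K cK KV; exact: sqr_integ_restrict.
  - move=> phi tphi; have bphi := test_fun_bcs tphi; have [mphi _ _] := bphi.
    have bdphi := test_fun_bcs (test_fun_partial i tphi); have [mdphi _ _] := bdphi.
    have [_ _ c1] := L2_pairing_cvg mun mu0 mdphi iu0l (bcs_integ (sqr_bcs _ bdphi))
      (fun n => (hD n).1) D0.
    have [_ _ c2] := L2_pairing_cvg mh mg mphi ig (bcs_integ (sqr_bcs _ bphi)) ihg hg.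
    rewrite Int_restrict_test.
    have -> : \int[leb]_(x in V) (g x * phi x) = \int[leb]_x (phi x * g x).
      rewrite Int_restrict_test; apply: eq_Rintegral => x _; rewrite patchE mulrC.
      case: ifPn => // /negP xV; rewrite (test_fun_out tphi) ?mul0r//.
      by move=> Vx; apply: xV; rewrite inE.
    under eq_Rintegral do rewrite mulrC.
    have /(cvg_lim (@Rhausdorff R)) <- := c1; apply/(cvg_lim (@Rhausdorff R)).
    have -> : (fun n => \int[leb]_x (partial i phi x * un n x)) =
        (fun n => - \int[leb]_x (phi x * partial i (un n) x)).
      apply/funext => n; under eq_Rintegral do rewrite mulrC.
      by rewrite (test_by_parts _ (tun n) tphi); under eq_Rintegral do rewrite mulrC.
    exact: cvgN.
have wD := weakD_spec wp; have wg := weak_partial_unique oV wp wD.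
have [_ /Lploc1P[mD _] _] := wD.
have mD0 : measurable_fun setT (weakD V i u \_ V) by exact: (measurable_restrictT _ mV).1.
have aeg : \forall x \ae leb, (g \_ V) x = (weakD V i u \_ V) x.
  by apply: filterS wg => x e; rewrite !patchE; case: ifPn => // /set_mem.
have mgV : measurable_fun setT (g \_ V) by exact: measurable_restrictE.
(* The gradients of the u_n vanish outside V, so restricting the limit to V only decreases the
   distance. *)
have le n x : (partial i (un n) x - (g \_ V) x) ^+ 2 <= (partial i (un n) x - g x) ^+ 2.
  rewrite patchE; case: ifPn => // /negP xV; rewrite (@partial_out _ _ (un n)) ?subrr ?expr0n/= ?sqr_ge0//.
  by have [_ _ sV] := tun n => /sV Vx; apply: xV; rewrite inE.
have iV n : integ leb (fun x => (partial i (un n) x - (g \_ V) x) ^+ 2).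
  apply: integ_le (ihg n) _; first by apply: measurable_funX; exact: measurable_funB.
  by move=> x; rewrite ger0_norm ?sqr_ge0.
have aeD n : \forall x \ae leb, (partial i (un n) x - (g \_ V) x) ^+ 2 =
    (partial i (un n) x - (weakD V i u \_ V) x) ^+ 2 by apply: filterS aeg => x ->.
have mm n : measurable_fun setT (fun x => (partial i (un n) x - (weakD V i u \_ V) x) ^+ 2).
  by apply: measurable_funX; exact: measurable_funB.
split => //.
- have igV : integ leb (fun x => (g \_ V) x ^+ 2).
    apply: integ_le ig _; first exact: measurable_funX.
    by move=> x; rewrite ger0_norm ?sqr_ge0// patchE; case: ifP; rewrite ?expr0n/= ?sqr_ge0.
  by apply: (integ_ae_eq igV); [exact: measurable_funX|apply: filterS aeg => x ->].
- by move=> n; exact: integ_ae_eq (iV n) (mm n) (aeD n).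
- apply: (@squeeze_cvgr _ _ _ _ (fun=> 0)
      (fun n => \int[leb]_x ((partial i (un n) x - g x) ^+ 2))) => //.
  + apply: nearW => n; rewrite Int_ge0/= => [|x]; last exact: sqr_ge0.
    rewrite -(Int_ae_eq _ (mm n) (aeD n)); first exact: Int_le.
    by apply: measurable_funX; exact: measurable_funB.
  + exact: cvg_cst.
Qed.

(** [form_value] provides approximating sequences of its own; [form_approx_sub] allows the given
    sequence for [u] and the constant sequence for [phi] in their place. *)
Lemma gen0_test (V : set E) u w (un : nat -> E -> R) phi : gen0 mu A V u w ->
  form_approx mu A V u un -> test_fun V phi ->
  energy (un n) phi @[n --> \oo] --> - (2 * \int[mu]_x ((w \_ V) x * phi x)).
Proof.
have lim3 (a b c : nat -> R) (l : R) : a n @[n --> \oo] --> (0 : R) ->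
    b n @[n --> \oo] --> (0 : R) -> c n @[n --> \oo] --> l ->
    a n + b n + 2 * c n @[n --> \oo] --> 2 * l.
  move=> a0 b0 cl; rewrite -[X in _ --> X]add0r -[X in _ --> X + _]addr0.
  by apply: cvgD; [exact: cvgD|apply: cvgM => //; exact: cvg_cst].
move=> [_ _ gw] fu tphi; have fphi := form_approx_test ha hrho tphi.
have [yn [vn [fy fv]]] := gw phi (ex_intro _ _ fphi).
rewrite Int_restrict_test => cv.
have [_ tu _ _] := fu; have [_ ty _ _] := fy; have [_ tv _ _] := fv.
have [M M0 yM] := form_approx_bounded ha hrho fy.
have c1 := energy_cvg0 ha hrho ty (fun n => test_funB tphi (tv n)) yM
  (form_approx_sub p2 ha hrho fphi fv).
have phiM : exists N, forall n, (N <= n)%N -> energy phi phi <= energy phi phi by exists 0%N.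
have c2 := energy_cvg0 ha hrho (fun=> tphi) (fun n => test_funB (tu n) (ty n)) phiM
  (form_approx_sub p2 ha hrho fu fy).
have -> : (fun n => energy (un n) phi) = (fun n => energy phi (un n \- yn n) +
    energy (yn n) (phi \- vn n) + 2 * dform mu A V (yn n) (vn n)).
  apply/funext => n; rewrite (dform_energy ha _ (ty n)) mulrA mulfV// mul1r.
  have cu k : Ck k (un n) by have [] := tu n.
  have cy k : Ck k (yn n) by have [] := ty n.
  have cv' k : Ck k (vn n) by have [] := tv n.
  have cp k : Ck k phi by have [] := tphi.
  rewrite (energyC ha phi (un n \- yn n)) (energyB ha hrho (cu 1%N) (cy 1%N) tphi).
  rewrite (energyC ha (yn n) (phi \- vn n)) (energyB ha hrho (cp 1%N) (cv' 1%N) (ty n)).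
  rewrite (energyC ha phi (yn n)) (energyC ha (vn n) (yn n)).
  by rewrite addrA !subrK.
rewrite -mulrN; exact: lim3 c2 c1 cv.
Qed.

End weak_gradient_limit.

(** * Energy estimates for the resolvent *)

Section key_estimate.
Context {R : realType} {d : nat}.
Local Notation E := 'rV[R]_d.
Local Notation leb := (@leb R d).
Context {p q : R} {A C : E -> 'M[R]_d} {H : E -> E} {rho : E -> R}
  {mu : {measure set E -> \bar R}}.
Local Notation beta := (log_drift A rho).
Local Notation G := (drift A C H).
Local Notation B := (fun x => G x - log_drift A rho x).
Local Notation energy := (@energy R d A mu).
Local Notation form_density := (@form_density R d A).
Hypothesis p2 : 2 <= p.
Hypothesis ha : assumption_a p A C H.
Hypothesis hrho : invariant_density p A G rho mu.
Implicit Types f g h u W : E -> R.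

Lemma partial_near_cst f i x (c : R) : (\forall y \near x, f y = c) -> partial i f x = 0.
Proof. by move=> fc; rewrite (@partial_near _ _ _ (fun=> c)) ?partial_cst. Qed.

Lemma Lop_near_cst (b : E -> E) f x (c : R) : (\forall y \near x, f y = c) ->
  Lop A b f x = 0.
Proof.
move=> fc; rewrite /Lop [X in _ + X]big1 ?addr0 => [|i _]; last first.
  by rewrite (partial_near_cst i fc) mulr0.
rewrite big1 ?mulr0// => i _; rewrite big1// => j _.
rewrite (@partial_near_cst _ _ _ 0) ?mulr0//.
have := nbhs_interior fc; apply: filterS => y; exact: partial_near_cst.
Qed.

Lemma near_sqd_lt (z x : E) (a : R) : sqd z x < a -> \forall y \near x, sqd z (y : E) < a.
Proof.
have c : continuous (sqd z) := Ck_continuous (Ck_sqd 0 z).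
by move=> xa; exact: (cvgr_lt _ (c x)).
Qed.

Lemma near_sqd_gt (z x : E) (a : R) : a < sqd z x -> \forall y \near x, a < sqd z (y : E).
Proof.
have c : continuous (sqd z) := Ck_continuous (Ck_sqd 0 z).
by move=> xa; exact: (cvgr_gt _ (c x)).
Qed.

Lemma Lop_split f x : Lop A G f x = Lop A beta f x + dotv (B x) (grad f x).
Proof.
rewrite /Lop -addrA; congr (_ + _); rewrite /dotv -big_split; apply: eq_bigr => i _ /=.
have -> : (G x - beta x) 0 i = G x 0 i - beta x 0 i by rewrite [LHS]mxE [X in _ + X]mxE.
by rewrite [grad f x 0 i]mxE; move: (G x 0 i) (beta x 0 i) (partial i f x) => a b e; ring.
Qed.

Lemma dotB_integ f g (U : set E) : Ck 1 f -> test_fun U g ->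
  integ mu (fun x => dotv (B x) (grad f x) * g x).
Proof.
move=> cf tg; have bg := test_fun_bcs tg.
have : integ mu (fun x => \sum_i (B x 0 i * (g x * partial i f x))).
  apply: integ_sum => i; apply: (locintM_bcs_mu hrho); first exact: (B_locint p2 ha hrho i).1.
  by apply: bcsM_cont => //; exact: Ck_continuous (CkS_partial i cf).
congr (integ mu _); apply/funext => x; rewrite /dotv mulr_suml; apply: eq_bigr => i _.
by rewrite [grad f x 0 i]mxE; move: (_ 0 i) (partial i f x) (g x) => a b e; ring.
Qed.

Lemma exists_cutoff (K : set E) : compact K -> exists chi : E -> R,
  [/\ test_fun setT chi, forall x, K x -> \forall y \near x, chi y = 1 &
      forall x, 0 <= chi x <= 1].
Proof.
move=> cK; have [b [b0 hb]] := compact_sqd 0 cK; have bb : b < b + 1 by rewrite ltrDl.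
exists (fun x => 1 - bcut 0 b (b + 1) x); split.
- exact: cutoff_test.
- move=> x /hb /near_sqd_lt; apply: filterS => y yb.
  by rewrite bcut_in ?subr0// ltW.
- by move=> x; rewrite subr_ge0 bcut_le1 lerBlDr lerDl bcut_ge0.
Qed.

(** Invariance says that L g integrates to 0. So does its symmetric part, by testing it with a
    cutoff that equals 1 near the support of [g]; the remainder is <B, grad g>. *)
Lemma drift_divergence_free g (U : set E) : test_fun U g ->
  \int[mu]_x dotv (B x) (grad g x) = 0.
Proof.
move=> tg0; have tg := test_fun_sub (@subsetT _ U) tg0; have [cg cK _] := tg.
have [chi [tchi chi1 _]] := exists_cutoff cK; have [cchi _ _] := tchi.
have iB : integ mu (fun x => dotv (B x) (grad g x)).
  have := dotB_integ (cg 1%N) tchi; congr (integ mu _); apply/funext => x.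
  have [/chi1/nbhs_singleton ->|nx] := pselect (supp g x); first by rewrite mulr1.
  by rewrite (grad_out nx) dotv0 mul0r.
have lb i := (beta_locint p2 ha hrho i).1.
have iL : integ mu (Lop A beta g).
  apply: (locint_compact_integ_mu hrho (Lop_locint ha lb (cg 2%N)) cK) => x.
  exact: Lop_out.
have L0 : \int[mu]_x Lop A beta g x = 0.
  have := energy_Lop p2 ha hrho tg tchi.
  have -> : energy g chi = 0.
    rewrite energyE -[RHS](@Int0 _ _ _ mu); apply: eq_Rintegral => x _.
    have [/chi1 h|nx] := pselect (supp g x).
      rewrite /form_density (_ : grad chi x = 0) ?dotv0//.
      by apply/rowP => i; rewrite !mxE (partial_near_cst i h).
    by rewrite (form_densityC ha) /form_density (grad_out nx) dotv0.
  have -> : \int[mu]_x (Lop A beta g x * chi x) = \int[mu]_x Lop A beta g x.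
    apply: eq_Rintegral => x _.
    have [/chi1/nbhs_singleton ->|nx] := pselect (supp g x); first by rewrite mulr1.
    by rewrite (@Lop_out _ _ A beta g x nx) mul0r.
  by move/eqP; rewrite eq_sym oppr_eq0 mulf_eq0 pnatr_eq0/= => /eqP.
have := mu_invariant hrho tg.
have -> : (fun x => (Lop A G g x)%:E) = EFin \o (fun x => Lop A beta g x + dotv (B x) (grad g x)).
  by apply/funext => x /=; rewrite Lop_split.
by rewrite -Int_EFin ?(IntD iL iB) ?L0 ?add0r; [case|exact: integD].
Qed.

(** [Psi] is the primitive of [Phi]: Phi(v) grad v is then the gradient of Psi(v), which
    [drift_divergence_free] annihilates. Both vanish on s <= 0, so that composed with g - W, for W
    >= 0, they give test functions whenever [g] is one. *)
Record truncation (Phi Psi : R -> R) (c : R) : Prop := {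
  trunc_smooth : forall k, smooth1 k Phi ;
  trunc_primitive_smooth : forall k, smooth1 k Psi ;
  trunc_primitive : derive1 Psi = Phi ;
  trunc_out : forall s, s <= 0 -> Phi s = 0 ;
  trunc_primitive_out : forall s, s <= 0 -> Psi s = 0 ;
  trunc_range : forall s, 0 <= Phi s <= 1 ;
  trunc_derive : forall s, 0 <= derive1 Phi s <= c ;
  trunc_cst : 0 < c }.

Lemma cvg_sum0 (I : Type) (s : seq I) (F : I -> nat -> R) :
  (forall i, F i n @[n --> \oo] --> (0 : R)) ->
  \sum_(i <- s) F i n @[n --> \oo] --> (0 : R).
Proof.
move=> F0; elim: s => [|i s ih]; first by under eq_fun do rewrite big_nil; exact: cvg_cst.
by under eq_fun do rewrite big_cons; have := cvgD (F0 i) ih; rewrite addr0; exact.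
Qed.

Section local_estimate.
Variables (Phi Psi : R -> R) (c : R) (W : E -> R).
Hypothesis hT : truncation Phi Psi c.
Hypothesis cW : forall k, Ck k W.
Hypothesis W0 : forall x, 0 <= W x.

Lemma trunc_test s g (U : set E) : (forall k, smooth1 k s) -> (forall r, r <= 0 -> s r = 0) ->
  test_fun U g -> test_fun U (fun x => s (g x - W x)).
Proof.
move=> ss s0 [cg cK sU]; apply: (@test_funP _ _ U (supp g)) => //.
  by move=> k; apply: (@Ck_comp _ _ k s) => //; exact: CkB.
by move=> x nx; rewrite (supp_out nx) s0// sub0r oppr_le0.
Qed.

Lemma grad_comp s g x : (forall k, smooth1 k s) -> Ck 1 g ->
  grad (fun y => s (g y)) x = derive1 s (g x) *: grad g x.
Proof.
by move=> ss cg; apply/rowP => i; rewrite !mxE; exact: partial_comp (ss 1%N) cg.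
Qed.

Lemma gradB g h x : Ck 1 g -> Ck 1 h -> grad (fun y => g y - h y) x = grad g x - grad h x.
Proof. by move=> cg ch; apply/rowP => i; rewrite !mxE partialB. Qed.

Lemma form_density_trunc g x : (forall k, Ck k g) ->
  form_density (fun y => g y - W y) (fun y => Phi (g y - W y)) x =
  derive1 Phi (g x - W x) * form_density (fun y => g y - W y) (fun y => g y - W y) x.
Proof.
move=> cg; rewrite /form_density (grad_comp _ (trunc_smooth hT)); last exact: CkB.
by rewrite dotvC dotvZ dotvC.
Qed.

(** By the chain rule the left integrand carries the square of Phi' and the right one Phi' itself,
    with 0 <= Phi' <= c. *)
Lemma trunc_energy_le g (U : set E) : test_fun U g ->
  energy (fun x => Phi (g x - W x)) (fun x => Phi (g x - W x)) <=
  c * energy (fun x => g x - W x) (fun x => Phi (g x - W x)).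
Proof.
move=> tg; have [cg _ _] := tg.
have tP := trunc_test (trunc_smooth hT) (trunc_out hT) tg; have [cP _ _] := tP.
have cv k : Ck k (fun x => g x - W x) by exact: CkB.
have i1 := form_density_integ ha hrho (cP 1%N) tP.
have i2 := form_density_integ ha hrho (cv 1%N) tP.
rewrite energyE -(IntZ c i2); apply: Int_le => // [|x]; first exact: integZ.
rewrite form_density_trunc// /form_density (grad_comp _ (trunc_smooth hT)) ?(cv 1%N)//.
rewrite mulvZ dotvZ dotvC dotvZ dotvC.
have /andP[D0 Dc] := trunc_derive hT (g x - W x).
have F0 := mulv_ge0 ha x (grad (fun y => g y - W y) x).
by rewrite ler_wpM2r// mulr_ge0.
Qed.

Lemma energy_W phi (U : set E) : test_fun U phi ->
  energy W phi = - (2 * \int[mu]_x (phi x * Lop A beta W x)).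
Proof.
move=> /(test_fun_sub (@subsetT _ U)) tphi.
have := form_by_parts p2 ha hrho cW tphi; rewrite -/(energy W phi) => e.
have := congr1 (fun z => 2 * z) e; rewrite mulVKf// mulrN; exact.
Qed.

Lemma locint_restrict_integ_mu f (K : set E) : locint f -> compact K -> integ mu (f \_ K).
Proof.
move=> lf cK; have mK := measurable_compact_rV cK.
have b1 : bcs (\1_K : E -> R).
  split; [exact: measurable_indic|exists 1 => x|exists K => // x nK].
    by rewrite indicE; case: (_ \in _); rewrite ?normr1 ?normr0.
  by rewrite indicE memNset.
have := locintM_bcs_mu hrho lf b1; congr (integ mu _); apply/funext => x.
by rewrite patchE indicE; case: ifP => _; rewrite ?mulr1 ?mulr0.
Qed.

(** The energy of Phi(u_n - W) is at most c times its mixed energy with u_n - W. The part with W is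
    an integral against a bounded function, by integration by parts on W; the part with u_n is split
    by Young's inequality with weight 2 c, so that half of the left-hand side absorbs the
    remainder. *)
Lemma trunc_energy_bounded (V : set E) u (un : nat -> E -> R) : relcompact_open V ->
  form_approx mu A V u un -> exists2 M : R, 0 < M & exists N, forall n, (N <= n)%N ->
    energy (fun x => Phi (un n x - W x)) (fun x => Phi (un n x - W x)) <= M.
Proof.
have alg (f e l M I k : R) : 0 < k -> f <= k * (e - l) -> `|l| <= 2 * I ->
    `|e| <= (2 * k) * M + (2 * k)^-1 * f -> f <= 4 * k ^+ 2 * M + 4 * k * I.
  move=> k0; rewrite !ler_norml => h1 /andP[h2 h3] /andP[h4 h5].
  have kk : k * k^-1 = 1 by rewrite mulfV// gt_eqF.
  have h6 : k * e <= k * (2 * k * M + (2 * k)^-1 * f) by rewrite ler_pM2l.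
  have h7 : k * (2 * k * M + (2 * k)^-1 * f) = 2 * k ^+ 2 * M + k * k^-1 * 2^-1 * f.
    by rewrite invfM; ring.
  have h8 : k * - l <= k * (2 * I) by rewrite ler_pM2l// lerNl.
  rewrite h7 kk in h6; lra.
move=> [oV cV] fu; have [_ tun _ _] := fu; have c0 := trunc_cst hT.
have [M M0 [N HN]] := form_approx_bounded ha hrho fu.
have lb i := (beta_locint p2 ha hrho i).1.
have lL : locint (Lop A beta W) by have := Lop_locint ha lb (cW 2%N); exact.
have iL := locint_restrict_integ_mu lL cV.
pose K : set E := closure V.
pose I := \int[mu]_x `|(Lop A beta W \_ K) x|.
have I0 : 0 <= I by exact: Int_ge0.
exists (4 * c ^+ 2 * M + 4 * c * I).
  by rewrite ltr_wpDr ?mulr_ge0 ?mulr_gt0 ?exprn_gt0// ltW.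
exists N => n Nn; have tP := trunc_test (trunc_smooth hT) (trunc_out hT) (tun n).
have [cu _ _] := tun n; have [cP _ _] := tP.
have bP := test_fun_bcs tP.
have h1 := trunc_energy_le (tun n); have eB := energyB ha hrho (cu 1%N) (cW 1%N) tP.
rewrite eB in h1.
apply: (alg _ (energy (un n) (fun x => Phi (un n x - W x))) _ _ _ c c0 h1).
  rewrite (energy_W tP) normrN normrM (ger0_norm (ler0n _ 2)) ler_pM2l//.
  have iP : integ mu (fun x => Phi (un n x - W x) * Lop A beta W x).
    have := locintM_bcs_mu hrho lL bP; congr (integ mu _); apply/funext => x; exact: mulrC.
  apply: le_trans (Int_norm iP) _; apply: Int_le => [||x]; [exact: integ_norm|exact: integ_norm|].
  rewrite patchE; case: ifPn => [_|/negP nV].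
    have /andP[P0 P1] := trunc_range hT (un n x - W x).
    by rewrite normrM (ger0_norm P0) ler_piMl.
  rewrite (test_fun_out tP) ?mul0r ?normr0// => Vx; apply: nV; rewrite inE; exact: subset_closure.
have s0 : 0 < 2 * c by rewrite mulr_gt0.
apply: le_trans (energy_young ha hrho s0 (tun n) tP) _.
by rewrite lerD2r ler_pM2l//; exact: HN.
Qed.

Lemma dotvDr (x y z : E) : dotv x (y + z) = dotv x y + dotv x z.
Proof. by rewrite dotvC dotvD !(dotvC x). Qed.

Lemma dotvZr (k : R) (x y : E) : dotv x (k *: y) = k * dotv x y.
Proof. by rewrite dotvC dotvZ dotvC. Qed.

(** The integrands differ by <B, grad Psi(g - W)>, and Psi(g - W) is a test function. *)
Lemma drift_trunc0 g (U : set E) : test_fun U g ->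
  \int[mu]_x (dotv (B x) (grad g x) * Phi (g x - W x)) =
  \int[mu]_x (dotv (B x) (grad W x) * Phi (g x - W x)).
Proof.
move=> tg; have [cg _ _] := tg.
have tP := trunc_test (trunc_smooth hT) (trunc_out hT) tg.
have tQ := trunc_test (trunc_primitive_smooth hT) (trunc_primitive_out hT) tg.
have i1 := dotB_integ (cg 1%N) tP; have i2 := dotB_integ (cW 1%N) tP.
apply/eqP; rewrite -subr_eq0 -(IntB i1 i2) -[eqbRHS](drift_divergence_free tQ); apply/eqP.
apply: eq_Rintegral => x _.
rewrite (grad_comp _ (trunc_primitive_smooth hT)); last exact: CkB.
rewrite (trunc_primitive hT) (gradB _ (cg 1%N) (cW 1%N)).
have -> : grad g x - grad W x = grad g x + (-1) *: grad W x by rewrite scaleN1r.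
rewrite dotvZr dotvDr dotvZr.
by move: (dotv _ _) (dotv _ _) => a b; ring.
Qed.

Definition weak_drift (V : set E) u (x : E) : R := dotv (B x) (\row_i weakD V i u x).

(** For fixed n, phi = Phi(u_n - W) is a test function of V, and [gen0_test] makes minus the
    integral of w phi half the limit of energy u_j phi. Replacing u_j by u_n costs little, as the
    sequence is Cauchy and phi has bounded energy; replacing the weak gradient of u by grad u_n in
    the drift costs little, as |phi| <= 1. Now [drift_trunc0] trades grad u_n for grad W, and <B,
    grad W> completes the symmetric part to L W. *)
Lemma local_estimate (V : set E) u w (un : nat -> E -> R) (eta : R) : relcompact_open V ->
  0 < eta -> gen0 mu A V u w -> form_approx mu A V u un ->
  exists N, forall n, (N <= n)%N ->
  integ mu (fun x => ((fun y => w y + weak_drift V u y) \_ V) x * Phi (un n x - W x)) /\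
  2^-1 * energy (fun x => un n x - W x) (fun x => Phi (un n x - W x)) <=
  - (\int[mu]_x (((fun y => w y + weak_drift V u y) \_ V) x * Phi (un n x - W x))) +
    \int[mu]_x (Lop A G W x * Phi (un n x - W x)) + eta.
Proof.
have alg1 (e l b t ee : R) : l = - (2 * ee) -> `|l - b| < t / 4 ->
    `|b - e| <= t / 2 -> 2^-1 * e <= - ee + 3 / 8 * t.
  by move=> -> /ltW; rewrite !ler_norml => /andP[h1 h2] /andP[h3 h4]; lra.
have alg2 (e eu ew iw id ibu ibw ilb t x : R) : 0 < t -> e = eu - ew -> ew = - (2 * ilb) ->
    2^-1 * eu <= - iw + 3 / 8 * t -> id = ibu - x -> ibu = ibw -> `|x| <= t / 4 ->
    2^-1 * e <= - (iw + id) + (ilb + ibw) + t.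
  by move=> t0 -> -> h1 -> ->; rewrite ler_norml => /andP[h3 h4]; lra.
have alg3 (x y t : R) : x <= t / 4 -> y <= t / 4 -> x + y <= t / 2 by lra.
move=> rV eta0 gu fu; have [oV cV] := rV; have [_ tun _ _] := fu.
have mV := measurable_open_rV oV; have VK : V `<=` closure V by exact: subset_closure.
have mK := measurable_closed_rV (@closed_closure _ V); pose K : set E := closure V.
have [_ /Lfun2_integ[mw iw2] _] := gu.
have eta4 : 0 < eta / 4 by rewrite divr_gt0.
pose b i x := ((fun y : E => B y 0 i) \_ K) x * rho x.
have lB i := B_locint p2 ha hrho i.
have mB i : measurable_fun setT ((fun y : E => B y 0 i) \_ K).
  by apply: measurable_restrictE => //; have [[]] := lB i.
have mb i : measurable_fun setT (b i).
  by apply: measurable_funM => //; exact: rho_measurable hrho.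
have ib i : integ leb (fun x => b i x ^+ 2).
  have [_ h] := locint_sqrM_cont (rho_continuous hrho) (lB i).2.
  have := h _ cV; congr (integ leb _); apply/funext => x; rewrite /b !patchE.
  by case: ifP => // _; rewrite mul0r expr0n.
have conv i := form_weakD ha hrho i rV fu.
pose e i n x := b i x * (partial i (un n) x - (weakD V i u \_ V) x).
have conv0 i : (forall n, integ leb (e i n)) /\
    \int[leb]_x `|e i n x| @[n --> \oo] --> (0 : R).
  have [mg ig ih h0] := conv i; apply: L2_pairing_cvg0 => //.
  move=> n; apply: measurable_funB => //.
  by have [] := test_fun_bcs (test_fun_partial i (tun n)).
have sum0 : \sum_i \int[leb]_x `|e i n x| @[n --> \oo] --> (0 : R).
  by apply: cvg_sum0 => i; exact: (conv0 i).2.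
have /cvgrPdist_lt/(_ _ eta4)[N1 _ HN1] := sum0.
have [M M0 [N2 HN2]] := trunc_energy_bounded rV fu.
(* The weight in Young's inequality: the energy bound M then contributes eta/4, and the Cauchy
   property supplies another eta/4. *)
pose s := 4 * M / eta; have s0 : 0 < s by rewrite divr_gt0// mulr_gt0.
have sM : s^-1 * M = eta / 4 by rewrite /s; field; rewrite !gt_eqF.
have es : 0 < eta / 4 / s by rewrite divr_gt0.
have [N3 HN3] := form_approx_cauchy ha fu es.
exists (maxn N1 (maxn N2 N3)) => n; rewrite !geq_max => /and3P[n1 n2 n3].
have tP := trunc_test (trunc_smooth hT) (trunc_out hT) (tun n).
have [cu _ _] := tun n; have [cP _ _] := tP; have bP := test_fun_bcs tP.
set phi := fun x => Phi (un n x - W x) in tP cP bP *.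
have phi1 x : `|phi x| <= 1.
  by have /andP[P0 P1] := trunc_range hT (un n x - W x); rewrite ger0_norm.
have [mphi _ _] := bP.
have S1 : 2^-1 * energy (un n) phi <= - (\int[mu]_x ((w \_ V) x * phi x)) + 3 / 8 * eta.
  have /cvgrPdist_lt/(_ _ eta4)[N4 _ HN4] := gen0_test p2 ha hrho gu fu tP.
  pose j := maxn N3 N4; have j3 : (N3 <= j)%N := leq_maxl _ _.
  apply: (alg1 _ _ _ _ _ erefl (HN4 j (leq_maxr _ _))).
  have [cj _ _] := tun j; have tB : test_fun V (un j \- un n) by exact: test_funB.
  rewrite -(energyB ha hrho (cj 1%N) (cu 1%N) tP).
  apply: le_trans (energy_young ha hrho s0 tB tP) _.
  have h1 := HN3 j n j3 n3; have h2 := HN2 n n2.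
  have h3 : s * energy (un j \- un n) (un j \- un n) <= eta / 4.
    by rewrite mulrC -ler_pdivlMr// ltW.
  have h4 : s^-1 * energy phi phi <= eta / 4.
    by rewrite -sM ler_pM2l// invr_gt0.
  exact: alg3 h3 h4.
have mD i : measurable_fun setT (weakD V i u \_ V) by have [] := conv i.
have wdE : weak_drift V u \_ V = fun x => \sum_i ((fun y : E => B y 0 i) \_ K) x * (weakD V i u \_ V) x.
  apply/funext => x; rewrite patchE; case: ifPn => xV.
    rewrite /weak_drift /dotv; apply: eq_bigr => i _; rewrite !patchE xV mem_set ?mxE//.
    by apply: VK; rewrite inE in xV.
  by rewrite big1// => i _; rewrite [X in _ * X]patchE (negbTE xV) mulr0.
have mwd : measurable_fun setT (weak_drift V u \_ V).
  by rewrite wdE; apply: measurable_sum => i; exact: measurable_funM.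
have iBu := dotB_integ (cu 1%N) tP; have iBW := dotB_integ (cW 1%N) tP.
have iBul := (integ_mu hrho (integ_measurable iBu)).1 iBu.
pose eP x := (\sum_i e i n x) * phi x.
have ie : integ leb (fun x => \sum_i e i n x) by apply: integ_sum => i; exact: (conv0 i).1.
have ieP : integ leb eP by exact: (integM_bounded (K := 1) ie).
have wd_eq x : (weak_drift V u \_ V) x * phi x * rho x =
    dotv (B x) (grad (un n) x) * phi x * rho x - eP x.
  have [Vx|nV] := pselect (V x); last first.
    by rewrite /eP (test_fun_out tP nV) !mulr0 !mul0r subrr.
  rewrite wdE /eP /dotv !mulr_suml -sumrB; apply: eq_bigr => i _.
  have -> : ((fun y : E => B y 0 i) \_ K) x = B x 0 i by rewrite patchE mem_set//; exact: VK.
  have -> : e i n x = B x 0 i * rho x * (partial i (un n) x - (weakD V i u \_ V) x).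
    by rewrite /e /b patchE mem_set//; exact: VK.
  rewrite [grad (un n) x 0 i]mxE; move: (phi x) (rho x) (B x 0 i) (partial _ _ _) (_ x) => a1 a2 a3 a4 a5.
  ring.
have iwdl : integ leb (fun x => (weak_drift V u \_ V) x * phi x * rho x).
  by under eq_fun do rewrite wd_eq; exact: integB.
have mwp : measurable_fun setT (fun x => (weak_drift V u \_ V) x * phi x) by exact: measurable_funM.
have iwd := (integ_mu hrho mwp).2 iwdl.
have iw : integ mu (fun x => (w \_ V) x * phi x).
  have iphi2 : integ mu (fun x => phi x ^+ 2).
    by apply: (bcs_integ_mu hrho); under eq_fun do rewrite expr2; exact: bcsM.
  apply: integ_le (integD iw2 iphi2) _; first exact: measurable_funM.
  by move=> x; rewrite ler_norml; apply/andP; split; nra.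
have split_w x : ((fun y => w y + weak_drift V u y) \_ V) x * phi x =
    (w \_ V) x * phi x + (weak_drift V u \_ V) x * phi x.
  by rewrite -mulrDl !patchE; case: ifP; rewrite ?addr0.
split; first by under eq_fun do rewrite split_w; exact: integD.
have lb i := (beta_locint p2 ha hrho i).1.
have lL : locint (Lop A beta W) by have := Lop_locint ha lb (cW 2%N); exact.
have iL : integ mu (fun x => Lop A beta W x * phi x) by exact: (locintM_bcs_mu hrho lL bP).
have E1 : \int[mu]_x (((fun y => w y + weak_drift V u y) \_ V) x * phi x) =
    \int[mu]_x ((w \_ V) x * phi x) + \int[mu]_x ((weak_drift V u \_ V) x * phi x).
  by rewrite -(IntD iw iwd); apply: eq_Rintegral => x _; exact: split_w.
have E2 : \int[mu]_x (Lop A G W x * phi x) =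
    \int[mu]_x (Lop A beta W x * phi x) + \int[mu]_x (dotv (B x) (grad W x) * phi x).
  by rewrite -(IntD iL iBW); apply: eq_Rintegral => x _; rewrite Lop_split mulrDl.
have E3 : \int[mu]_x ((weak_drift V u \_ V) x * phi x) =
    \int[mu]_x (dotv (B x) (grad (un n) x) * phi x) - \int[leb]_x eP x.
  rewrite (Int_mu hrho mwp) (Int_mu hrho (integ_measurable iBu)) -(IntB iBul ieP).
  by apply: eq_Rintegral => x _; exact: wd_eq.
have E4 : `|\int[leb]_x eP x| <= eta / 4.
  apply: le_trans (Int_norm ieP) _.
  apply: le_trans (_ : \int[leb]_x (\sum_i `|e i n x|) <= _).
    apply: Int_le => [||x]; first exact: integ_norm.
      by apply: integ_sum => i; apply: integ_norm; exact: (conv0 i).1.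
    rewrite /eP normrM; apply: le_trans (_ : `|\sum_i e i n x| <= _).
      by rewrite ler_piMr.
    exact: ler_norm_sum.
  rewrite Int_sum => [|i]; last by apply: integ_norm; exact: (conv0 i).1.
  have := HN1 n n1; rewrite /= sub0r normrN => /ltW; exact: le_trans (ler_norm _).
have Ev := energyB ha hrho (cu 1%N) (cW 1%N) tP.
have EW : energy W phi = - (2 * \int[mu]_x (Lop A beta W x * phi x)).
  by rewrite (energy_W tP); congr (- (2 * _)); apply: eq_Rintegral => x _; exact: mulrC.
have EB := drift_trunc0 (tun n).
rewrite E1 E2; exact: (alg2 _ _ _ _ _ _ _ _ _ _ eta0 Ev EW S1 E3 EB E4).
Qed.

End local_estimate.

End key_estimate.

(** * From Dirichlet problems to the resolvent on the whole space *)

Section resolvent_estimate.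
Context {R : realType} {d : nat}.
Local Notation E := 'rV[R]_d.
Local Notation leb := (@leb R d).
Context {p q : R} {A C : E -> 'M[R]_d} {H : E -> E} {rho : E -> R}
  {mu : {measure set E -> \bar R}}.
Local Notation beta := (log_drift A rho).
Local Notation G := (drift A C H).
Local Notation B := (fun x => G x - log_drift A rho x).
Local Notation energy := (@energy R d A mu).
Local Notation weak_drift := (@weak_drift R d A C H rho).
Hypothesis p2 : 2 <= p.
Hypothesis ha : assumption_a p A C H.
Hypothesis hrho : invariant_density p A G rho mu.
Implicit Types f g h u : E -> R.

Lemma open_sqd_lt (z : E) (a : R) : open [set x : E | sqd z x < a].
Proof. by rewrite openE => x; exact: near_sqd_lt. Qed.

Lemma relcompact_sqd_lt (z : E) (a : R) : relcompact_open [set x : E | sqd z x < a].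
Proof.
split; first exact: open_sqd_lt.
apply: (subclosed_compact _ (@sqd_compact _ _ z a)); first exact: closed_closure.
have cl : closed [set x : E | sqd z x <= a].
  by apply: compact_closed; [exact: norm_hausdorff|exact: sqd_compact].
by rewrite [X in _ `<=` X](closure_id _).1//; apply: closure_subset => x /= /ltW.
Qed.

Lemma exhaustion_sqd : exhaustion (fun n => [set x : E | sqd 0 x < n%:R]).
Proof.
split; first by move=> n; exact: relcompact_sqd_lt.
- by move=> m n mn x /= h; apply: lt_le_trans h _; rewrite ler_nat.
- apply/seteqP; split => // x _.
  exists (Num.truncn (sqd 0 x)).+1 => //=; exact: truncnS_gt.
Qed.

Lemma inL1_integ (V : set E) f : inL mu 1 V f -> integ mu (f \_ V).
Proof. by move/Lfun1_integrable. Qed.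

Lemma distL1_cvg (V : set E) (fn : nat -> E -> R) f : (forall n, inL mu 1 V (fn n)) ->
  inL mu 1 V f -> distL mu 1 V (fn n) f @[n --> \oo] --> 0%E ->
  forall e : R, 0 < e -> exists N, forall n, (N <= n)%N ->
    \int[mu]_x `|(fn n \_ V) x - (f \_ V) x| < e.
Proof.
move=> /(_ _)/inL1_integ ifn /inL1_integ iF /fine_cvg/cvgrPdist_lt c e e0.
have [N _ HN] := c e e0; exists N => n /HN /=; rewrite sub0r normrN.
apply: le_lt_trans; apply: le_trans (ler_norm _); rewrite /distL Lnorm1.
rewrite /Rintegral le_eqVlt; apply/orP; left; apply/eqP; congr fine.
apply: eq_integral => x _ /=; rewrite !patchE.
by case: ifP; rewrite ?subrr.
Qed.

(** Three layers separate [u] from test functions: the exhaustion, the closure of the operator in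
    L^1 on each V, and the form domain. One index is fixed in each, with errors below e/3, and
    [local_estimate] is applied at the innermost layer. Only integrals survive in the conclusion, so
    none of the intermediate objects has to be kept. *)
Lemma key_estimate (Phi Psi : R -> R) (c : R) (W f u : E -> R) (e : R) :
  truncation Phi Psi c -> (forall k, Ck k W) -> (forall x, 0 <= W x) ->
  resolvent mu A B 1 f u -> (forall x, 0 <= u x) -> 0 < e ->
  exists z : E -> R, [/\ test_fun setT z, integ mu (fun x => z x - u x),
    \int[mu]_x `|z x - u x| <= e,
    integ mu (fun x => (f x + Lop A G W x) * Phi (z x - W x)) &
    2^-1 * energy (fun x => z x - W x) (fun x => Phi (z x - W x)) <=
    \int[mu]_x ((f x + Lop A G W x) * Phi (z x - W x)) + e].
Proof.
have alg (e1 iw il ifp r : R) : e1 <= - iw + il + r / 3 -> - iw <= ifp + r / 3 + r / 3 ->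
  e1 <= ifp + il + r by lra.
have alg3 (a b k r : R) : a < r / 3 -> b < r / 3 -> k < r / 3 -> a + b + k <= r by lra.
have alg4 (a b k r : R) : b < r / 3 -> k < r / 3 -> a + b + k <= a + r / 3 + r / 3 by lra.
move=> hT cW W0 [Lf Lu hres] u0 e0; have e3 : 0 < e / 3 by rewrite divr_gt0.
have [un [hun cun]] := hres _ exhaustion_sqd.
pose Vn n := [set x : E | sqd 0 x < n%:R].
have patchT g : g \_ setT = g by apply/funext => x; rewrite patchE in_setT.
have iF : integ mu f by have := inL1_integ Lf; rewrite patchT.
have iu : integ mu u by have := inL1_integ Lu; rewrite patchT.
have LV n : inL mu 1 setT ((un n) \_ (Vn n)).
  by have [_ [h _ _]] := hun n; rewrite /inL patchT.
have [N1 HN1] := distL1_cvg LV Lu cun e3.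
have {HN1} := HN1 N1 (leqnn _); rewrite !patchT => hU.
set V := Vn N1 in hU; pose U := un N1.
have rV : relcompact_open V by exact: relcompact_sqd_lt.
have [oV cV] := rV; have mV := measurable_open_rV oV.
have VK : V `<=` closure V by exact: subset_closure.
have [_ [LU LUf [yn [wn [hyw cy cw]]]]] := hun N1.
have iU := inL1_integ LU; have iUf := inL1_integ LUf.
have [N2 HN2] := distL1_cvg (fun n => let: And3 h _ _ := hyw n in h) LU cy e3.
have [N3 HN3] := distL1_cvg (fun n => let: And3 _ h _ := hyw n in h) LUf cw e3.
pose m := maxn N2 N3.
have [Ly Lw [_ [w0 gy wE]]] := hyw m.
have iy := inL1_integ Ly; have iw := inL1_integ Lw.
have hy := HN2 m (leq_maxl _ _); have hw := HN3 m (leq_maxr _ _).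
move: (yn m) (wn m) Ly Lw gy wE iy iw hy hw => y w Ly Lw gy wE iy iw hy hw.
have [[fn fy] _ _] := gy; have [_ tfn _ _] := fy.
have [my0 iy02 ifn fn0] := form_approx_L2 hrho fy.
pose chi : E -> R := \1_(closure V).
have mchi : measurable_fun setT chi.
  by apply: measurable_indic; exact: measurable_closed_rV (@closed_closure _ V).
have ichi : integ mu (fun x => chi x ^+ 2).
  have := locint_restrict_integ_mu hrho (locint_cst 1) cV; congr (integ mu _).
  by apply/funext => x; rewrite patchE /chi indicE; case: ifP => _; rewrite ?expr1n ?expr0n.
have mfn n : measurable_fun setT (fun x => fn n x - (y \_ V) x).
  by apply: measurable_funB => //; have [] := test_fun_bcs (tfn n).
have [_ /cvgrPdist_lt/(_ _ e3)[N5 _ HN5]] := L2_pairing_cvg0 mfn mchi ifn ichi fn0.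
have [N4 HN4] := local_estimate p2 ha hrho hT cW W0 rV e3 gy fy.
pose i := maxn N4 N5; have [iwphi est] := HN4 i (leq_maxl _ _).
have {HN5} := HN5 i (leq_maxr _ _); rewrite /= sub0r normrN => /(le_lt_trans (ler_norm _)) hz.
have tz := tfn i; set z := fn i in iwphi est hz tz.
have {}hz : \int[mu]_x `|z x - (y \_ V) x| < e / 3.
  apply: le_lt_trans hz; rewrite le_eqVlt; apply/orP; left; apply/eqP.
  apply: eq_Rintegral => x _; rewrite /chi indicE.
  have [Kx|nK] := pselect (closure V x); first by rewrite mem_set// mul1r.
  have nV : ~ V x by move/VK.
  by rewrite (test_fun_out tz nV) patchE memNset// subrr mulr0.
have iz : integ mu z by apply: (bcs_integ_mu hrho); exact: test_fun_bcs tz.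
have izy : integ mu (fun x => z x - (y \_ V) x) by exact: integB.
have iyU : integ mu (fun x => (y \_ V) x - (U \_ V) x) by exact: integB.
have iUu : integ mu (fun x => (U \_ V) x - u x) by exact: integB.
have tP := trunc_test cW W0 (trunc_smooth hT) (trunc_out hT) tz.
have bP := test_fun_bcs tP; have [mphi _ _] := bP.
set phi := fun x => Phi (z x - W x) in tP bP mphi iwphi est *.
have phi01 x : 0 <= phi x <= 1 by exact: (trunc_range hT).
have phi1 x : `|phi x| <= 1 by have /andP[P0 P1] := phi01 x; rewrite ger0_norm.
have ifp : integ mu (fun x => f x * phi x) by exact: integM_bounded iF mphi phi1.
have lg k := (drift_locint p2 ha k).1.
have lL : locint (Lop A G W) by have := Lop_locint ha lg (cW 2%N); exact.
have iL : integ mu (fun x => Lop A G W x * phi x) by exact: (locintM_bcs_mu hrho lL bP).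
have iwp : integ mu (fun x => (w \_ V) x * phi x) by exact: integM_bounded iw mphi phi1.
have Ew : \int[mu]_x (((fun k => w0 k + weak_drift V y k) \_ V) x * phi x) =
    \int[mu]_x ((w \_ V) x * phi x).
  apply: Int_ae_eq; [exact: integ_measurable iwphi|exact: integ_measurable iwp|].
  apply: filterS wE => x hx; congr (_ * _); rewrite !patchE; case: ifPn => // /set_mem Vx.
  by rewrite hx.
exists z; split.
- exact: test_fun_sub (@subsetT _ V) tz.
- exact: integB.
- have i1 := integ_norm izy; have i2 := integ_norm iyU; have i3 := integ_norm iUu.
  apply: le_trans (alg3 _ _ _ _ hz hy hU).
  rewrite -(IntD i1 i2) -(IntD (integD i1 i2) i3).
  apply: Int_le => [||x]; first by apply: integ_norm; exact: integB.
    by apply: integD => //; exact: integD.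
  have -> : z x - u x = z x - (y \_ V) x + ((y \_ V) x - (U \_ V) x) + ((U \_ V) x - u x).
    by rewrite !addrA !subrK.
  by apply: le_trans (ler_normD _ _) _; rewrite lerD2r; exact: ler_normD.
- by under eq_fun do rewrite mulrDl; exact: integD.
- rewrite Ew in est.
  have -> : \int[mu]_x ((f x + Lop A G W x) * phi x) =
      \int[mu]_x (f x * phi x) + \int[mu]_x (Lop A G W x * phi x).
    by rewrite -(IntD ifp iL); apply: eq_Rintegral => x _; rewrite mulrDl.
  apply: alg est _.
  (* Here w is close to U - f and U is close to u. So -w phi is at most f phi - u phi up to these
     two errors, and u >= 0 allows -u phi to be dropped. *)
  apply: le_trans (alg4 (\int[mu]_x (f x * phi x)) _ _ _ hw hU).
  pose UF := (fun x => 1 * U x - f x) \_ V.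
  have iwU : integ mu (fun x => (w \_ V) x - UF x) by exact: integB.
  have i1 := integ_norm iwU; have i2 := integ_norm iUu.
  rewrite -(IntN iwp) -(IntD ifp i1) -(IntD (integD ifp i1) i2).
  apply: Int_le => [||x]; first exact: integN.
    by apply: integD => //; exact: integD.
  have /andP[P0 P1] := phi01 x; have ux := u0 x.
  have [Vx|nV] := pselect (V x); last first.
    by rewrite (test_fun_out tP nV) !mulr0 oppr0 add0r addr_ge0.
  rewrite /UF !patchE mem_set// mul1r.
  have h1 := ler_norm (- (w x - (U x - f x))); have h2 := ler_norm (- (U x - u x)).
  rewrite !normrN in h1 h2.
  have h3 := mulr_ge0 P0 ux.
  have h4 : - (w x - (U x - f x)) * phi x <= `|w x - (U x - f x)|.
    by apply: le_trans (ler_norm _) _; rewrite normrM normrN ler_piMr// ger0_norm.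
  have h5 : - (U x - u x) * phi x <= `|U x - u x|.
    by apply: le_trans (ler_norm _) _; rewrite normrM normrN ler_piMr// ger0_norm.
  move: (w x) (U x) (f x) (u x) (phi x) h3 h4 h5 => a1 a2 a3 a4 a5 h3 h4 h5; lra.
Qed.

End resolvent_estimate.

(** * Local boundedness of the resolvent *)

Section truncation_instance.
Context {R : realType}.
Implicit Types k l s : R.

Definition trunc_at k l s : R := smooth_trunc (l^-1 * s + - k / l).
Definition trunc_prim_at k l s : R := l * trunc_prim (l^-1 * s + - k / l).

Lemma derive1_affine (f : R -> R) (a b s : R) : (forall j, smooth1 j f) ->
  derive1 (fun x => f (a * x + b)) s = derive1 f (a * s + b) * a.
Proof.
move=> sf; have h1 := smooth1S_derive (a * s + b) (sf 1%N).
have h3 : is_derive s 1 (fun x : R => a * x + b) a.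
  have := is_deriveD (is_deriveZ a (is_derive_id s 1)) (is_derive_cst b s 1).
  by rewrite addr0 [_ *: _]mulr1.
have h4 := @is_derive1_comp _ f (fun x : R => a * x + b) s _ _ h1 h3.
by rewrite derive1E (@derive_val _ _ _ _ _ _ _ h4).
Qed.

Lemma truncation_at k l (ct : R) : 0 <= k -> 0 < l -> 0 < ct ->
  (forall s, derive1 (@smooth_trunc R) s <= ct) ->
  truncation (trunc_at k l) (trunc_prim_at k l) (ct / l).
Proof.
move=> k0 l0 ct0 hct.
have arg s : s <= 0 -> l^-1 * s + - k / l <= 0.
  move=> s0; rewrite mulrC -mulrDl pmulr_lle0 ?invr_gt0// subr_le0.
  exact: le_trans k0.
split.
- move=> j; apply: (@smooth1_comp _ j smooth_trunc (fun s => l^-1 * s + - k / l)).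
    exact: smooth1_smooth_trunc.
  exact: smooth1_affine.
- move=> j; apply: (@smooth1M _ j (fun=> l) (fun s => trunc_prim (l^-1 * s + - k / l))).
    exact: smooth1_cst.
  apply: (@smooth1_comp _ j trunc_prim (fun s => l^-1 * s + - k / l)).
    exact: smooth1_trunc_prim.
  exact: smooth1_affine.
- apply/funext => s; rewrite /trunc_prim_at.
  have h := smooth1S_derive s (smooth1_comp (smooth1_trunc_prim 1) (smooth1_affine 1 l^-1 (- k / l))).
  have h2 : is_derive s 1 (fun x => l * trunc_prim (l^-1 * x + - k / l))
      (l * derive1 (fun x => trunc_prim (l^-1 * x + - k / l)) s).
    exact: is_deriveZ h.
  rewrite derive1E (@derive_val _ _ _ _ _ _ _ h2) derive1_affine; last exact: smooth1_trunc_prim.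
  by rewrite derive1_trunc_prim mulrCA mulfV ?gt_eqF// mulr1.
- by move=> s /arg; exact: smooth_trunc_le0.
- by move=> s /arg /trunc_prim_le0; rewrite /trunc_prim_at => ->; rewrite mulr0.
- by move=> s; rewrite smooth_trunc_ge0 smooth_trunc_le1.
- move=> s; rewrite derive1_affine; last exact: smooth1_smooth_trunc.
  apply/andP; split; last by rewrite ler_pM2r ?invr_gt0.
  by rewrite mulr_ge0 ?derive1_smooth_trunc_ge0 ?invr_ge0 ?(ltW l0).
- by rewrite divr_gt0.
Qed.

Lemma trunc_at_arg k l s : 0 < l -> l^-1 * s + - k / l = (s - k) / l.
Proof. by move=> l0; rewrite mulrC -mulrDl. Qed.

Lemma trunc_at_le k l s : 0 < l -> s <= k -> trunc_at k l s = 0.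
Proof.
move=> l0 sk; rewrite /trunc_at trunc_at_arg//; apply: smooth_trunc_le0.
by rewrite pmulr_lle0 ?invr_gt0// subr_le0.
Qed.

Lemma trunc_at_ge k l s : 0 < l -> k + l <= s -> smooth_trunc 1 <= trunc_at k l s.
Proof.
move=> l0 sk; rewrite /trunc_at trunc_at_arg//; apply: smooth_trunc_nd.
by rewrite ler_pdivlMr// mul1r lerBrDl.
Qed.

End truncation_instance.

(** * Two iteration lemmas for real sequences *)

Section real_iterations.
Context {R : realType}.

Lemma powR_half (eta : R) : 0 < eta -> exists2 s : R, 0 < s < 1 & s `^ eta = 2^-1.
Proof.
move=> eta0; exists (2^-1 `^ eta^-1); last by rewrite -powRrM mulVf ?gt_eqF// powRr1.
have e1 : (1 : R) `^ eta^-1 = 1 by rewrite powR1.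
rewrite powR_gt0 ?invr_gt0//= -[ltRHS]e1.
by rewrite gt0_ltr_powR ?invr_gt0 ?nnegrE ?invr_ge0// invf_lt1// ltr1n.
Qed.

(* The values of [phi] enter through strict bounds [m], so that no power of 0 occurs. *)
Lemma stampacchia (phi : R -> R) (K eta k0 m0 s : R) : 0 < K -> 0 < eta -> 0 <= k0 ->
  0 < s < 1 -> s `^ eta = 2^-1 ->
  (forall h k m, k0 <= k -> k < h -> phi k < m -> m <= 1 -> phi h <= K * m `^ (1 + eta) / (h - k)) ->
  (forall h k, k <= h -> phi h <= phi k) -> (forall k, 0 <= phi k) ->
  phi k0 < m0 -> m0 <= 1 -> phi (k0 + 4 * K * m0 `^ eta / s) = 0.
Proof.
move=> K0 eta0 k00 /andP[s0 s1] sE hphi mono phi0 km m1.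
have m00 : 0 < m0 by apply: le_lt_trans km; exact: phi0.
(* Levels k_n = k0 + dd (1 - 2^-n) against bounds m_n = m0 s^n. The power s^eta = 1/2 compensates
   the halving of k_(n+1) - k_n, and the factor 4 leaves a spare factor 2 that keeps the inequality
   strict. *)
pose dd := 4 * K * m0 `^ eta / s.
have dd0 : 0 < dd by rewrite divr_gt0// !mulr_gt0// powR_gt0.
pose kn n := k0 + dd * (1 - 2^-1 ^+ n); pose mn n := m0 * s ^+ n.
have half01 n : 0 < (2^-1 : R) ^+ n <= 1.
  by rewrite exprn_gt0 ?invr_gt0//= exprn_ile1 ?invr_ge0// invf_le1// ler1n.
have s01 n : 0 < s ^+ n <= 1 by rewrite exprn_gt0//= exprn_ile1 ?ltW.
have claim n : phi (kn n) < mn n.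
  elim: n => [|n ih]; first by rewrite /kn /mn !expr0 subrr mulr0 addr0 mulr1.
  have /andP[t0 t1] := half01 n; have /andP[u0 u1] := s01 n.
  have kk : kn n.+1 - kn n = dd * 2^-1 ^+ n / 2.
    by rewrite /kn exprS; set t := 2^-1 ^+ n; field.
  have dk : 0 < kn n.+1 - kn n by rewrite kk divr_gt0// mulr_gt0.
  have k0n : k0 <= kn n by rewrite /kn lerDl mulr_ge0 ?subr_ge0 ?(ltW dd0).
  have mn1 : mn n <= 1 by rewrite /mn mulr_ile1// ltW.
  have kl : kn n < kn n.+1 by rewrite -subr_gt0.
  apply: le_lt_trans (hphi _ _ _ k0n kl ih mn1) _.
  have mn0 : 0 < mn n by rewrite /mn mulr_gt0.
  rewrite powRD; last by rewrite (gt_eqF mn0) implybT.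
  rewrite (powRr1 (ltW mn0)) ltr_pdivrMr// kk /mn.
  have -> : (m0 * s ^+ n) `^ eta = m0 `^ eta * 2^-1 ^+ n.
    rewrite powRM ?(ltW m00) ?(ltW u0)//; congr (_ * _).
    by rewrite -[s ^+ n](powR_mulrn _ (ltW s0)) -powRrM mulrC powRrM sE powR_mulrn ?invr_ge0.
  rewrite /dd exprS.
  have X : m0 * (s * s ^+ n) * (4 * K * m0 `^ eta / s * 2^-1 ^+ n / 2) =
      2 * (K * (m0 * s ^+ n * (m0 `^ eta * 2^-1 ^+ n))).
    set a := m0 `^ eta; set b := 2^-1 ^+ n; set g := s ^+ n; field.
    by rewrite gt_eqF.
  rewrite X ltr_pMl ?ltr1n// !mulr_gt0// powR_gt0//.
apply/eqP; rewrite eq_le phi0 andbT; apply/ler_addgt0Pr => e e0; rewrite add0r.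
have [n _ hn] : \forall n \near \oo, mn n < e.
  have /cvgr_lt : mn n @[n --> \oo] --> (0 : R).
    rewrite /mn -[X in _ --> X](mulr0 m0); apply: cvgM; first exact: cvg_cst.
    by apply: cvg_expr; rewrite ger0_norm ?ltW.
  exact.
apply: le_trans (ltW (hn n (leqnn n))); apply: le_trans (ltW (claim n)).
by apply: mono; rewrite lerD2l -/dd ler_piMr ?(ltW dd0)// gerBl exprn_ge0 ?invr_ge0.
Qed.

(* If [M i] bounds [u] on the i-th of an increasing sequence of balls and
   [M i <= k i + theta * M (i + 1)], with [k] geometric of ratio less than
   [1 / theta], then [M 0] is bounded independently of the global bound. *)
Lemma geometric_absorption (L t Moo : R) (good : nat -> R -> Prop) : 0 <= L -> 1 <= t ->
  0 <= Moo -> (forall i, good i Moo) ->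
  (forall i M, 0 <= M -> good i.+1 M -> good i (L * t ^+ i + 1 + (2 * t)^-1 * M)) ->
  (forall i M M', M <= M' -> good i M -> good i M') ->
  good 0%N (2 * (L + 1) + 1).
Proof.
move=> L0 t1 Moo0 gM step mono; have t0 : 0 < t by exact: lt_le_trans t1.
pose th := (2 * t)^-1; have th0 : 0 < th by rewrite invr_gt0 mulr_gt0.
have th1 : th <= 2^-1 by rewrite lef_pV2 ?posrE ?mulr_gt0// ler_pMr.
(* Descending induction from i = n, where only the a priori bound Moo is known; each step down
   multiplies its share by theta. *)
have claim n i : (i <= n)%N -> good i (2 * (L + 1) * t ^+ i + Moo * th ^+ (n - i)).
  move=> le_in; rewrite -(subKn le_in); move: (n - i)%N (leq_subr i n) => j.
  elim: j => [|j ih] jn.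
    rewrite subn0 subnn expr0 mulr1; apply: mono (gM n).
    by rewrite lerDr !mulr_ge0 ?addr_ge0// exprn_ge0// ltW.
  have jn' := ltnW jn; have e1 : (n - j.+1).+1 = (n - j)%N by rewrite subnSK.
  have := ih jn'; rewrite -e1 => /step h.
  rewrite subKn//; apply: mono (h _).
    have a1 : 1 <= t ^+ (n - j.+1) by exact: exprn_ege1.
    rewrite e1 (subKn jn') -e1 exprS; set a := t ^+ _ in a1 *.
    have e2 : (2 * t)^-1 * (2 * (L + 1) * (t * a) + Moo * th ^+ j) =
        (L + 1) * a + Moo * th ^+ j.+1.
      by rewrite mulrDr (exprS th) /th; set y := (2 * t)^-1 ^+ j; field; rewrite gt_eqF.
    rewrite e2; lra.
  by rewrite addr_ge0// mulr_ge0// ?mulr_ge0 ?addr_ge0 ?exprn_ge0// ltW.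
have [n _ hn] : \forall n \near \oo, Moo * th ^+ n < 1.
  have /cvgr_lt : Moo * th ^+ n @[n --> \oo] --> (0 : R).
    rewrite -[X in _ --> X](mulr0 Moo); apply: cvgM; first exact: cvg_cst.
    by apply: cvg_expr; rewrite ger0_norm ?(ltW th0)//; apply: le_lt_trans th1 _; lra.
  by apply.
apply: mono (claim n 0%N (leq0n n)); rewrite expr0 mulr1 subn0 lerD2l.
exact/ltW/(hn n (leqnn n)).
Qed.

End real_iterations.

(** * Integrals over small sets and bounds on the cutoffs *)

Section local_bounds.
Context {R : realType} {d : nat}.
Local Notation E := 'rV[R]_d.
Local Notation leb := (@leb R d).
Context {p q : R} {A C : E -> 'M[R]_d} {H : E -> E} {rho : E -> R}
  {mu : {measure set E -> \bar R}}.
Local Notation beta := (log_drift A rho).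
Local Notation G := (drift A C H).
Hypothesis ha : assumption_a p A C H.
Hypothesis hb : assumption_b q G.
Hypothesis hrho : invariant_density p A G rho mu.
Hypothesis q1 : 1 < q.
Implicit Types f g h u : E -> R.

Lemma ae_mu_leb (P : E -> Prop) : (\forall x \ae mu, P x) -> \forall x \ae leb, P x.
Proof.
move=> [N [mN muN NP]]; have := mu_density hrho mN; rewrite muN => /esym N0.
have mr : measurable_fun N (EFin \o rho).
  by apply/measurable_EFinP; apply: measurable_funTS; exact: rho_measurable hrho.
have : (\int[leb]_(x in N) `|(EFin \o rho) x| = 0)%E.
  rewrite -[RHS]N0; apply: eq_integral => x _ /=.
  by rewrite ger0_norm// ltW// (rho_gt0 hrho).
move/(ae_eq_integral_abs _ mN mr).1; apply: filterS => x h.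
apply: contrapT => /NP /h /= []; apply/eqP; rewrite gt_eqF//; exact: (rho_gt0 hrho).
Qed.

Lemma ae_leb_mu (P : E -> Prop) : (\forall x \ae leb, P x) -> \forall x \ae mu, P x.
Proof.
move=> [N [mN N0 NP]]; exists N; split => //.
rewrite (mu_density hrho mN) null_set_integral//.
by apply/measurable_EFinP; apply: measurable_funTS; exact: rho_measurable hrho.
Qed.

(* Hoelder's inequality on a set of small measure, up to a constant, from the
   pointwise bound [g <= s + s `^ (1 - q) * g `^ q]. *)
Lemma set_hoelder dT (T : measurableType dT) (nu : {measure set T -> \bar R}) (D : set T)
  (g : T -> R) (m kap J : R) : 0 < m -> 0 <= kap -> measurable D -> measurable_fun setT g ->
  (forall x, 0 <= g x) -> integ nu (\1_D : T -> R) -> \int[nu]_x (\1_D x : R) <= kap * m ->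
  integ nu (fun x => g x `^ q * \1_D x) -> \int[nu]_x (g x `^ q * \1_D x) <= J ->
  integ nu (fun x => g x * \1_D x) /\
  \int[nu]_x (g x * \1_D x) <= (kap + J) * m `^ (1 - q^-1).
Proof.
move=> m0 kap0 mD mg g0 iD ID ig Ig; have q0 : 0 < q by exact: lt_trans q1.
(* With this s both terms of the pointwise bound scale like m^(1 - 1/q). *)
pose s := m `^ (- q^-1); have s0 : 0 < s by exact: powR_gt0.
have mi : measurable_fun setT (\1_D : T -> R) by exact: measurable_indic.
have le x : `|g x * \1_D x| <= s * \1_D x + s `^ (1 - q) * (g x `^ q * \1_D x).
  have i0 : 0 <= (\1_D x : R) by rewrite indicE.
  rewrite ger0_norm ?mulr_ge0// mulrA -mulrDl ler_wpM2r//.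
  have [gs|gs] := leP (g x) s.
    by apply: le_trans gs _; rewrite lerDl mulr_ge0// powR_ge0.
  have gx : 0 < g x by exact: lt_trans gs.
  apply: (@le_trans _ _ (g x `^ (1 - q) * g x `^ q)).
    by rewrite -powRD ?subrK ?powRr1// (gt_eqF gx) implybT.
  rewrite -[leLHS]add0r lerD ?(ltW s0)// ler_wpM2r ?powR_ge0//.
  have -> : 1 - q = - (q - 1) by rewrite opprB.
  rewrite !powRN lef_pV2 ?posrE ?powR_gt0//; apply: ge0_ler_powR.
  - by rewrite subr_ge0 ltW.
  - by rewrite nnegrE ltW.
  - by rewrite nnegrE.
  - exact: ltW.
have i1 := integZ s iD; have i2 := integZ (s `^ (1 - q)) ig.
have iG : integ nu (fun x => g x * \1_D x).
  by apply: integ_le (integD i1 i2) le; exact: measurable_funM.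
split => //.
apply: (@le_trans _ _ (s * \int[nu]_x (\1_D x : R) + s `^ (1 - q) * \int[nu]_x (g x `^ q * \1_D x))).
  rewrite -(IntZ s iD) -(IntZ _ ig) -(IntD i1 i2); apply: Int_le => // [|x].
    exact: integD.
  exact: le_trans (ler_norm _) (le x).
have e1 : s * m = m `^ (1 - q^-1).
  by rewrite /s -{2}(powRr1 (ltW m0)) -powRD ?(gt_eqF m0) ?implybT// addrC.
have e2 : s `^ (1 - q) = m `^ (1 - q^-1).
  by rewrite /s -powRrM; congr (_ `^ _); field; rewrite gt_eqF.
rewrite mulrDl lerD//.
  by rewrite -e1 mulrCA ler_pM2l.
by rewrite e2 mulrC ler_wpM2r// powR_ge0.
Qed.

Lemma sum_bounded (n : nat) (F : 'I_n -> R -> Prop) :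
  (forall i (x y : R), x <= y -> F i x -> F i y) -> (forall i, exists2 M : R, 0 < M & F i M) ->
  exists2 M : R, 0 < M & forall i, F i M.
Proof.
move=> mono hF; have /boolp.choice[M hM] : forall i, exists M : R, 0 < M /\ F i M.
  by move=> i; have [M M0 FM] := hF i; exists M.
exists (1 + \sum_i M i).
  by rewrite ltr_wpDr// sumr_ge0// => i _; have [/ltW] := hM i.
move=> i; apply: mono (hM i).2; rewrite (bigD1 i)//= addrCA lerDl addr_ge0// sumr_ge0// => j _.
by have [/ltW] := hM j.
Qed.

(** First derivatives of the cutoff are of order 1/(b - a) and second ones of order 1/(b - a)^2,
    which dominates as b - a <= 1. The constant depends on the large ball only, not on a and b, so
    it serves all steps of the iteration. *)
Lemma Lop_bcut_bound (o : E) (amax : R) : 0 <= amax -> exists2 K : R, 0 < K &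
  forall (a b : R) (x : E), a < b -> b - a <= 1 -> sqd o x <= amax ->
    `|Lop A G (bcut o a b) x| <= K / (b - a) ^+ 2 * (1 + \sum_i `|G x 0 i|).
Proof.
have alg (z1 z2 z3 z4 : R) : 0 <= z1 -> 0 <= z2 -> 0 <= z3 -> 0 <= z4 ->
    z1 + z2 * z4 <= (z3 + z1 + z2) * (1 + z4).
  move=> h1 h2 h3 h4; have := mulr_ge0 h1 h4; have := mulr_ge0 h3 h4; lra.
move=> a0; have [s s0 hs] := @sstep_derivatives_bounded R.
have cK : compact [set x | sqd o x <= amax] by exact: sqd_compact.
have [M M0 hM] : exists2 M : R, 0 < M & forall i, forall j x, sqd o x <= amax -> `|A x i j| <= M.
  apply: (@sum_bounded _ (fun i M => forall j x, sqd o x <= amax -> `|A x i j| <= M)).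
    by move=> i x y xy h j z /(h j) h'; exact: le_trans xy.
  move=> i; apply: (@sum_bounded _ (fun j M => forall x, sqd o x <= amax -> `|A x i j| <= M)).
    by move=> j x y xy h z /h h'; exact: le_trans xy.
  move=> j; have cA : continuous (fun x => A x i j) by exact: (a_continuous ha).
  by have [N N0 hN] := compact_bounded_cont cK cA; exists N.
pose X := 1 + amax; have X1 : 1 <= X by rewrite lerDl.
have xX i x : sqd o x <= amax -> `|x 0 i - o 0 i| <= X.
  move=> xa; have h : (x 0 i - o 0 i) ^+ 2 <= amax.
    by apply: le_trans xa; rewrite sqdE (bigD1 i)//= lerDl sumr_ge0// => j _; rewrite sqr_ge0.
  rewrite -(real_normK (num_real _)) in h; rewrite /X.
  by have := normr_ge0 (x 0 i - o 0 i); move: `|_| h => y h y0; nra.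
pose c1 := 2 * s * X; pose c2 := s * (4 * X ^+ 2 + 2).
have c10 : 0 <= c1 by rewrite !mulr_ge0// (le_trans ler01).
have c20 : 0 <= c2 by rewrite mulr_ge0// addr_ge0// mulr_ge0// exprn_ge0// (le_trans ler01).
have pos (r : R) : 0 <= r -> 0 <= 2^-1 * (d%:R * (d%:R * (M * r))).
  move=> r0; apply: mulr_ge0; first by rewrite invr_ge0.
  do 2 (apply: mulr_ge0; first exact: ler0n).
  by rewrite mulr_ge0// ltW.
exists (1 + 2^-1 * (d%:R * (d%:R * (M * c2))) + c1).
  by have := pos _ c20; lra.
move=> a b x ab ba xa.
have l0 : 0 < b - a by rewrite subr_gt0.
pose t := (b - a)^-1; have t1 : 1 <= t by rewrite -(invr1 R) lef_pV2 ?posrE.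
have t0 : 0 < t by exact: lt_le_trans t1.
have tt : t <= t ^+ 2 by rewrite expr2 ler_pMl.
pose y := (b - a)^-1 * sqd o x + - a / (b - a).
have [s1 s2] := hs y.
have D1 i : `|partial i (bcut o a b) x| <= c1 * t ^+ 2.
  rewrite partial_bcut -/y -/t normrM.
  have -> : c1 * t ^+ 2 = s * (t ^+ 2 * (2 * X)) by rewrite /c1; ring.
  apply: ler_pM => //; rewrite normrM (gtr0_norm t0); apply: ler_pM => //.
  - exact: ltW.
  - by rewrite normrM (ger0_norm (ler0n _ 2)) ler_pM2l//; exact: xX.
have D2 i j : `|partial i (partial j (bcut o a b)) x| <= c2 * t ^+ 2.
  rewrite partial_bcut2 -/y -/t; apply: le_trans (ler_normD _ _) _.
  have -> : c2 * t ^+ 2 = s * (t * (2 * X)) * (t * (2 * X)) + s * (t ^+ 2 * 2).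
    by rewrite /c2; ring.
  have n1 k : `|t * (2 * (x 0 k - o 0 k))| <= t * (2 * X).
    rewrite normrM (gtr0_norm t0) ler_pM2l// normrM (ger0_norm (ler0n _ 2)) ler_pM2l//.
    exact: xX.
  apply: lerD.
    rewrite normrM; apply: ler_pM => //.
    by rewrite normrM; apply: ler_pM.
  rewrite normrM; apply: ler_pM => //; rewrite normrM (gtr0_norm t0); apply: ler_pM => //.
  - exact: ltW.
  - by rewrite normrM (ger0_norm (ler0n _ 2)) ler_piMr//; case: (i == j); rewrite ?normr1 ?normr0.
rewrite /Lop; apply: le_trans (ler_normD _ _) _.
have -> : (1 + 2^-1 * (d%:R * (d%:R * (M * c2))) + c1) / (b - a) ^+ 2 =
    t ^+ 2 + 2^-1 * (d%:R * (d%:R * (M * (c2 * t ^+ 2)))) + c1 * t ^+ 2.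
  by rewrite -exprVn -/t; ring.
have S0 : 0 <= \sum_i `|G x 0 i| by exact: sumr_ge0.
have t20 : 0 <= t ^+ 2 by rewrite exprn_ge0// ltW.
have Q0 : 0 <= 2^-1 * (d%:R * (d%:R * (M * (c2 * t ^+ 2)))).
  by apply: pos; rewrite mulr_ge0.
have h1 : `|2^-1 * \sum_i \sum_j A x i j * partial i (partial j (bcut o a b)) x| <=
    2^-1 * (d%:R * (d%:R * (M * (c2 * t ^+ 2)))).
  rewrite normrM ger0_norm ?invr_ge0// ler_pM2l ?invr_gt0//.
  have cst n (z : R) : n%:R * z = \sum_(i < n) z by rewrite sumr_const card_ord mulr_natl.
  apply: le_trans (ler_norm_sum _ _ _) _; rewrite cst; apply: ler_sum => i _.
  apply: le_trans (ler_norm_sum _ _ _) _; rewrite cst; apply: ler_sum => j _.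
  by rewrite normrM; apply: ler_pM => //; exact: hM.
have h2 : `|\sum_i G x 0 i * partial i (bcut o a b) x| <= c1 * t ^+ 2 * \sum_i `|G x 0 i|.
  apply: le_trans (ler_norm_sum _ _ _) _; rewrite mulr_sumr; apply: ler_sum => i _.
  by rewrite normrM mulrC ler_wpM2r.
apply: le_trans (lerD h1 h2) _.
have c1t : 0 <= c1 * t ^+ 2 by rewrite mulr_ge0.
exact: alg.
Qed.

End local_bounds.

(** * Level sets of u minus a barrier *)

Section level_sets.
Context {R : realType} {d : nat}.
Local Notation E := 'rV[R]_d.
Local Notation leb := (@leb R d).
Context {p q : R} {A C : E -> 'M[R]_d} {H : E -> E} {rho : E -> R}
  {mu : {measure set E -> \bar R}}.
Local Notation beta := (log_drift A rho).
Local Notation G := (drift A C H).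
Local Notation B := (fun x => G x - log_drift A rho x).
Local Notation energy := (@energy R d A mu).
Local Notation form_density := (@form_density R d A).
Hypothesis p2 : 2 <= p.
Hypothesis ha : assumption_a p A C H.
Hypothesis hb : assumption_b q G.
Hypothesis hrho : invariant_density p A G rho mu.
Hypothesis q1 : 1 < q.
Hypothesis d1 : (0 < d)%N.
Implicit Types g : E -> R.

Lemma Lop_near (b : E -> E) (g h : E -> R) (x : E) : (\forall y \near x, g y = h y) ->
  Lop A b g x = Lop A b h x.
Proof.
move=> gh; have e1 i : partial i g x = partial i h x := partial_near i gh.
have e2 i j : partial i (partial j g) x = partial i (partial j h) x.
  apply: partial_near; have := nbhs_interior gh; apply: filterS => y; exact: partial_near.
have s1 : \sum_i \sum_j A x i j * partial i (partial j g) x =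
    \sum_i \sum_j A x i j * partial i (partial j h) x.
  by apply: eq_bigr => i _; apply: eq_bigr => j _; rewrite e2.
have s2 : \sum_i b x 0 i * partial i g x = \sum_i b x 0 i * partial i h x.
  by apply: eq_bigr => i _; rewrite e1.
exact: (congr2 (fun a c : R => 2^-1 * a + c) s1 s2).
Qed.

Lemma LopZ (b : E -> E) (k : R) g x : Ck 2 g ->
  Lop A b (fun y => k * g y) x = k * Lop A b g x.
Proof.
have alg (c l a e : R) : c * (l * a) + l * e = l * (c * a + e) by ring.
move=> cg; have e j : partial j (fun y => k * g y) = fun y => k * partial j g y.
  by apply/funext => y; rewrite partialZ//; exact: CkW.
have e2 i j : partial i (partial j (fun y => k * g y)) x = k * partial i (partial j g) x.
  by rewrite e partialZ//; exact: CkS_partial.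
have s1 : \sum_i \sum_j A x i j * partial i (partial j (fun y => k * g y)) x =
    k * \sum_i \sum_j A x i j * partial i (partial j g) x.
  rewrite mulr_sumr; apply: eq_bigr => i _; rewrite mulr_sumr; apply: eq_bigr => j _.
  by rewrite e2 mulrCA.
have s2 : \sum_i b x 0 i * partial i (fun y => k * g y) x =
    k * \sum_i b x 0 i * partial i g x.
  by rewrite mulr_sumr; apply: eq_bigr => i _; rewrite e mulrCA.
exact: etrans (congr2 (fun a c : R => 2^-1 * a + c) s1 s2) (alg _ _ _ _).
Qed.

Section one_level.
Variables (o : E) (a1 r dl M Moo : R) (f u : E -> R).
Hypothesis hu : resolvent mu A B 1 f u.
Hypothesis f0 : forall x, 0 <= f x.
Hypothesis u0 : forall x, 0 <= u x.
Hypothesis dl0 : 0 < dl.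
Hypothesis rdl : r + dl <= a1.
Hypothesis M0 : 0 <= M.
Hypothesis Moo0 : 0 <= Moo.
Hypothesis uM : \forall x \ae leb, sqd o x < r + dl -> u x <= M.
Hypothesis uMoo : \forall x \ae leb, u x <= Moo.

(** Two consecutive steps. Beyond r + dl/2 the barrier is at least M, and beyond r + dl at least M +
    Moo, so u can exceed it only where sqd is below r + dl/2. There the second step is still 0 and L
    W involves M alone: the global bound Moo creates the compact support without entering any
    estimate. *)
Definition barrier x : R :=
  M * bcut o r (r + dl / 2) x + Moo * bcut o (r + dl / 2) (r + dl) x.
Local Notation W := barrier.
Local Notation v := (fun x => u x - barrier x).

Let r1 : r < r + dl / 2. Proof. by rewrite ltrDl divr_gt0. Qed.
Let r2 : r + dl / 2 < r + dl.
Proof. by rewrite ltrD2l ltr_pdivrMr// ltr_pMr// ltr1n. Qed.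

Lemma Ck_barrier k : Ck k W.
Proof. by apply: CkD; apply: CkZ; exact: Ck_bcut. Qed.

Lemma barrier_ge0 x : 0 <= W x.
Proof. by rewrite addr_ge0// mulr_ge0// bcut_ge0. Qed.

Lemma barrier_in x : sqd o x <= r -> W x = 0.
Proof.
move=> xr; by rewrite /barrier (bcut_in r1 xr) (bcut_in r2) ?mulr0 ?addr0// (le_trans xr)// ltW.
Qed.

Lemma Lop_barrier_out x : ~ (sqd o x <= a1) -> Lop A G W x = 0.
Proof.
move=> /negP; rewrite -ltNge => /near_sqd_gt h; apply: (@Lop_near_cst _ _ A _ _ _ (M + Moo)).
move: h; apply: filterS => y ya; have h : r + dl <= sqd o y by apply: le_trans rdl _; exact: ltW.
by rewrite /barrier (bcut_out r2 h) (bcut_out r1) ?mulr1// (le_trans (ltW r2)).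
Qed.

Lemma Lop_barrier_integ : integ mu (Lop A G W).
Proof.
have lg k := (drift_locint p2 ha k).1.
have lL : locint (Lop A G W) by have := Lop_locint ha lg (Ck_barrier 2); exact.
apply: (locint_compact_integ_mu hrho lL (@sqd_compact _ _ o a1)) => x.
exact: Lop_barrier_out.
Qed.

Lemma Lop_barrier_in x : sqd o x < r + dl / 2 ->
  Lop A G W x = M * Lop A G (bcut o r (r + dl / 2)) x.
Proof.
move=> /near_sqd_lt h; rewrite -LopZ; last exact: Ck_bcut.
by apply: Lop_near; move: h; apply: filterS => y /ltW ya;
  rewrite /barrier (bcut_in r2 ya) mulr0 addr0.
Qed.

Lemma barrier_support : \forall x \ae leb, 0 < v x -> sqd o x < r + dl / 2.
Proof.
move: uM uMoo; apply: filterS2 => x h1 h2 v0; rewrite ltNge; apply/negP => hx.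
have W1 : bcut o r (r + dl / 2) x = 1 := bcut_out r1 hx.
have [/h1 h|h] := ltP (sqd o x) (r + dl).
  have : M <= W x by rewrite /barrier W1 mulr1 lerDl mulr_ge0// bcut_ge0.
  by lra.
have : Moo <= W x by rewrite /barrier W1 (bcut_out r2 h) !mulr1 lerDr.
by lra.
Qed.

Lemma u_integ : integ mu u.
Proof.
have [_ Lu _] := hu; have := inL1_integ Lu; congr (integ mu _).
by apply/funext => x; rewrite patchE in_setT.
Qed.

Lemma f_integ : integ mu f.
Proof.
have [Lf _ _] := hu; have := inL1_integ Lf; congr (integ mu _).
by apply/funext => x; rewrite patchE in_setT.
Qed.

Lemma v_measurable : measurable_fun setT v.
Proof.
apply: measurable_funB; first exact: integ_measurable u_integ.
by apply: continuous_measurable_rV; exact: Ck_continuous (Ck_barrier 0).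
Qed.

Definition level (k : R) : set E := [set x | sqd o x < a1 + 1 /\ k <= v x].

Lemma measurable_sqd_lt (a : R) : measurable [set x : E | sqd o x < a].
Proof. by apply: measurable_open_rV; exact: open_sqd_lt. Qed.

Lemma measurable_ge (g : E -> R) (k : R) : measurable_fun setT g ->
  measurable [set x | k <= g x].
Proof.
move=> mg; rewrite -[X in measurable X]setTI.
have -> : [set x | k <= g x] = g @^-1` `[k, +oo[%classic.
  by apply/seteqP; split=> x /=; rewrite in_itv/= andbT.
exact: mg.
Qed.

Lemma measurable_level k : measurable (level k).
Proof.
have -> : level k = [set x | sqd o x < a1 + 1] `&` [set x | k <= v x] by [].
by apply: measurableI; [exact: measurable_sqd_lt|apply: measurable_ge; exact: v_measurable].
Qed.

Lemma approx_sequence (Phi Psi : R -> R) (c : R) : truncation Phi Psi c ->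
  exists z : nat -> E -> R, [/\ forall n, test_fun setT (z n),
    \forall x \ae leb, z n x @[n --> \oo] --> u x &
    forall n, 2^-1 * energy (fun x => z n x - W x) (fun x => Phi (z n x - W x)) <=
      \int[mu]_x ((f x + Lop A G W x) * Phi (z n x - W x)) + 4^-1 ^+ n].
Proof.
move=> hT; have e0 n : 0 < (4^-1 : R) ^+ n by rewrite exprn_gt0 ?invr_gt0.
have /boolp.choice[z hz] := fun n => key_estimate p2 ha hrho hT Ck_barrier barrier_ge0 hu u0 (e0 n).
exists z; split.
- by move=> n; have [] := hz n.
- apply: ae_mu_leb.
    exact: hrho.
  have : \forall x \ae mu, exists N : R, forall n, 2 ^+ n * `|z n x - u x| <= N.
    apply: ae_bounded_summable.
    + by move=> n; apply: integZ; apply: integ_norm; have [] := hz n.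
    + by move=> n x; rewrite mulr_ge0// exprn_ge0.
    + move=> n; have [_ i1 i2 _ _] := hz n; rewrite IntZ; last exact: integ_norm.
      have e : 2^-1 ^+ n = 2 ^+ n * 4^-1 ^+ n :> R by rewrite -exprMn; congr (_ ^+ _); lra.
      by rewrite e ler_wpM2l// exprn_ge0.
  apply: filterS => x [N hN].
  have c0 : N * 2^-1 ^+ n @[n --> \oo] --> (0 : R).
    rewrite -[X in _ --> X](mulr0 N); apply: cvgM; first exact: cvg_cst.
    by apply: cvg_expr; rewrite ger0_norm ?invr_ge0// invf_lt1// ltr1n.
  apply/cvgrPdist_lt => e1 e10; have /cvgrPdist_lt/(_ _ e10)[k _ hk] := c0.
  exists k => // n /hk; rewrite /= sub0r normrN distrC; apply: le_lt_trans.
  apply: le_trans (ler_norm _); rewrite exprVn ler_pdivlMr ?exprn_gt0//.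
  by rewrite mulrC.
- by move=> n; have [] := hz n.
Qed.

Lemma Int_le_ae dT (T : measurableType dT) (nu : {measure set T -> \bar R}) (g h : T -> R) :
  integ nu g -> integ nu h -> (\forall x \ae nu, g x <= h x) ->
  \int[nu]_x g x <= \int[nu]_x h x.
Proof.
move=> ig ih gh; pose h' x := Num.max (g x) (h x).
have mh' : measurable_fun setT h'.
  by apply: measurable_maxr; [exact: integ_measurable ig|exact: integ_measurable ih].
have e : \forall x \ae nu, h x = h' x by apply: filterS gh => x; rewrite /h' => /max_idPr.
have ih' : integ nu h' by exact: integ_ae_eq ih mh' e.
rewrite (Int_ae_eq (integ_measurable ih) mh' e); apply: Int_le => // x.
by rewrite /h' le_max lexx.
Qed.

Lemma Int_le_lin dT (T : measurableType dT) (nu : {measure set T -> \bar R})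
    (a b : R) (g h1 h2 : T -> R) : integ nu g -> integ nu h1 -> integ nu h2 ->
  (forall x, g x <= a * h1 x + b * h2 x) ->
  \int[nu]_x g x <= a * \int[nu]_x h1 x + b * \int[nu]_x h2 x.
Proof.
move=> ig i1 i2 le; rewrite -(IntZ a i1) -(IntZ b i2) -(IntD (integZ a i1) (integZ b i2)).
by apply: Int_le => //; apply: integD; exact: integZ.
Qed.

Lemma Int_le_scale dT (T : measurableType dT) (nu : {measure set T -> \bar R})
    (a : R) (g h : T -> R) : integ nu g -> integ nu h -> (forall x, g x <= a * h x) ->
  \int[nu]_x g x <= a * \int[nu]_x h x.
Proof.
move=> ig ih le; rewrite -(IntZ a ih).
by apply: Int_le => //; exact: integZ.
Qed.

Lemma Int_indic (K S : set E) : compact K -> measurable S -> S `<=` K ->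
  integ leb (\1_S : E -> R) /\ leb S = (\int[leb]_x (\1_S x : R))%:E.
Proof.
move=> cK mS SK; have mK := measurable_compact_rV cK.
have i1 : integ leb (\1_S : E -> R).
  apply: integ_le (integ_cst_compact 1 cK) _; first exact: measurable_indic.
  move=> x; rewrite indicE patchE; have [Sx|nS] := pselect (S x).
    by rewrite !mem_set ?normr1//; exact: SK.
  by rewrite memNset// normr0; case: ifP.
by split => //; rewrite (Int_EFin i1) integral_indic// setIT.
Qed.

(** For u the truncation Phi(u - W) is supported in a ball, but for the approximants it need not be.
    This cutoff localises them for the Faber-Krahn inequality; its gradient lives where Phi(u - W)
    vanishes, so its contribution disappears in the limit. *)
Definition cutoff x : R := 1 - bcut o a1 (a1 + 1) x.
Local Notation chi := cutoff.
Local Notation K1 := [set x : E | sqd o x <= a1 + 1].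

Let a1lt : a1 < a1 + 1. Proof. by rewrite ltrDl. Qed.

Lemma cutoff_test_fun : test_fun setT chi.
Proof. exact: cutoff_test. Qed.

Lemma cutoff01 x : 0 <= chi x <= 1.
Proof. by rewrite /cutoff subr_ge0 bcut_le1 gerBl bcut_ge0. Qed.

Lemma cutoff_out x : a1 + 1 <= sqd o x -> chi x = 0.
Proof. by move=> h; rewrite /cutoff bcut_out// subrr. Qed.

Lemma cutoff_in x : sqd o x <= a1 -> chi x = 1.
Proof. by move=> h; rewrite /cutoff bcut_in// subr0. Qed.

Section one_truncation.
Variables (nu kap ct k l m : R).
Hypothesis nu0 : 0 < nu.
Hypothesis hnu : forall (x xi : E), K1 x -> \sum_i (xi 0 i) ^+ 2 <= nu * dotv (mulv (A x) xi) xi.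
Hypothesis kap0 : 0 < kap.
Hypothesis hkap : forall g, measurable_fun setT g -> (forall x, 0 <= g x) ->
  (forall x, ~ K1 x -> g x = 0) -> integ mu g ->
  integ leb g /\ \int[leb]_x g x <= kap * \int[mu]_x g x.
Hypothesis ct0 : 0 < ct.
Hypothesis hct : forall s, derive1 (@smooth_trunc R) s <= ct.
Hypothesis k0 : 0 <= k.
Hypothesis l0 : 0 < l.
Hypothesis m0 : 0 < m.

Let Phi := trunc_at k l.
Let hT : truncation Phi (trunc_prim_at k l) (ct / l).
Proof. exact: truncation_at. Qed.

(** The product rule gives two terms. The one with the gradient of Phi passes from Lebesgue measure
    to mu at the price [kap], from the Euclidean norm to the form at the price [nu], and to the
    mixed energy at the price ct / l. *)
Lemma cutoff_gradient_le (z : E -> R) i : test_fun setT z ->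
  \int[leb]_x (partial i (fun y => chi y * Phi (z y - W y)) x ^+ 2) <=
  2 * (kap * (nu * (ct / l * energy (fun x => z x - W x) (fun x => Phi (z x - W x))))) +
  2 * \int[leb]_x ((Phi (z x - W x) * partial i chi x) ^+ 2).
Proof.
have alg (y1 y2 : R) : (y1 + y2) ^+ 2 <= 2 * y1 ^+ 2 + 2 * y2 ^+ 2.
  by have := sqr_ge0 (y1 - y2); lra.
move=> tz; have tP := trunc_test Ck_barrier barrier_ge0 (trunc_smooth hT) (trunc_out hT) tz.
have eP := trunc_energy_le ha hrho hT Ck_barrier barrier_ge0 tz.
set phi := fun x => Phi (z x - W x) in tP eP *.
have [cP _ _] := tP; have bP := test_fun_bcs tP.
have tchi := cutoff_test_fun; have [cc _ _] := tchi; have bc := test_fun_bcs tchi.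
have bdc : bcs (partial i chi) by exact: test_fun_bcs (test_fun_partial i tchi).
have bdP : bcs (partial i phi) by exact: test_fun_bcs (test_fun_partial i tP).
have sqb g : bcs g -> bcs (fun x => g x ^+ 2).
  by move=> bg; under eq_fun do rewrite expr2; exact: bcsM.
have b1 : bcs (fun x => (chi x * partial i phi x) ^+ 2) by apply/sqb/bcsM.
have b2 : bcs (fun x => (phi x * partial i chi x) ^+ 2) by apply/sqb/bcsM.
have i1 := bcs_integ b1; have i2 := bcs_integ b2.
have tg : test_fun setT (fun y => chi y * phi y) by exact: test_funM_l.
apply: (@le_trans _ _ (2 * \int[leb]_x ((chi x * partial i phi x) ^+ 2) +
    2 * \int[leb]_x ((phi x * partial i chi x) ^+ 2))).
  have ig : integ leb (fun x => partial i (fun y => chi y * phi y) x ^+ 2).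
    by apply/bcs_integ/sqb; exact: test_fun_bcs (test_fun_partial i tg).
  apply: (Int_le_lin ig i1 i2) => x.
  rewrite partialM; [|exact: cc 1%N|exact: cP 1%N].
  exact: alg.
rewrite lerD2r ler_pM2l//.
have [m1 _ _] := b1; have i1m := bcs_integ_mu hrho b1.
have [_ h] : integ leb (fun x => (chi x * partial i phi x) ^+ 2) /\
    \int[leb]_x ((chi x * partial i phi x) ^+ 2) <=
    kap * \int[mu]_x ((chi x * partial i phi x) ^+ 2).
  apply: (hkap m1 _ _ i1m) => [x|x nK]; first exact: sqr_ge0.
  by rewrite cutoff_out ?mul0r ?expr0n// leNgt; apply/negP => /ltW.
apply: le_trans h _; rewrite ler_pM2l//.
have iphi := form_density_integ ha hrho (cP 1%N) tP.
apply: (@le_trans _ _ (nu * energy phi phi)); last by rewrite ler_pM2l.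
apply: (Int_le_scale i1m iphi) => x.
have F0 := mulv_ge0 ha x (grad phi x).
have [Kx|nK] := pselect (K1 x); last first.
  by rewrite cutoff_out ?mul0r ?expr0n ?mulr_ge0 ?(ltW nu0)// leNgt; apply/negP => /ltW.
apply: le_trans (hnu (grad phi x) Kx); rewrite (bigD1 i)//= [grad _ _ _ _]mxE.
have /andP[c0 c1] := cutoff01 x.
rewrite exprMn -[leLHS]addr0; apply: lerD.
  by rewrite ler_piMl ?sqr_ge0// exprn_ile1.
by apply: sumr_ge0 => j _; exact: sqr_ge0.
Qed.

Lemma cutoff_faber_krahn (z : E -> R) : test_fun setT z ->
  (leb [set x | (sqd o x < a1 + 1)%R /\ (k < z x - W x)%R] <= m%:E)%E ->
  \int[leb]_x ((chi x * Phi (z x - W x)) ^+ 2) <=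
  2 ^+ d.+2 * ((4 * m) `^ (d%:R^-1)) ^+ 2 *
  \sum_(i < d) \int[leb]_x (partial i (fun y => chi y * Phi (z y - W y)) x ^+ 2).
Proof.
move=> tz Dm; have tP := trunc_test Ck_barrier barrier_ge0 (trunc_smooth hT) (trunc_out hT) tz.
have tchi := cutoff_test_fun; have [cP _ _] := tP; have [cc _ _] := tchi.
have tg : test_fun setT (fun y => chi y * Phi (z y - W y)) by exact: test_funM_l.
have [cg _ _] := tg; have [cz _ _] := tz.
have sqb g : bcs g -> integ leb (fun x => g x ^+ 2).
  by move=> bg; apply: bcs_integ; under eq_fun do rewrite expr2; exact: bcsM.
apply: (faber_krahn_box (cg 1%N) _ _ _ _ Dm).
- have -> : [set x | sqd o x < a1 + 1 /\ k < z x - W x] =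
      [set x : E | sqd o x < a1 + 1] `&` [set x | k < z x - W x] by [].
  apply: measurableI; first exact: measurable_sqd_lt.
  apply: measurable_open_rV; rewrite openE => x kx.
  have cv : continuous (fun x => z x - W x).
    by apply: (Ck_continuous (k := 0)); apply: CkB; [exact: cz|exact: Ck_barrier].
  exact: (cvgr_gt _ (cv x)).
- move=> x /not_andP[/negP|/negP]; rewrite -leNgt => h.
    by rewrite cutoff_out// mul0r.
  by rewrite /Phi trunc_at_le ?mulr0.
- by rewrite powR_gt0// mulr_gt0.
(* The side (4 m)^(1/d) is chosen to give the box the volume 4 m. *)
- rewrite -powR_mulrn ?powR_ge0// -powRrM mulVf ?powRr1 ?mulr_ge0 ?(ltW m0)//.
  by rewrite pnatr_eq0 -lt0n.
- by apply: sqb; exact: test_fun_bcs tg.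
- by move=> i; apply: sqb; exact: test_fun_bcs (test_fun_partial i tg).
Qed.

Lemma v_minus_measurable (z : E -> R) : measurable_fun setT z ->
  measurable_fun setT (fun x => z x - W x).
Proof.
move=> mz; apply: measurable_funB => //.
by apply: continuous_measurable_rV; exact: Ck_continuous (Ck_barrier 0).
Qed.

Lemma trunc_measurable (z : E -> R) : measurable_fun setT z ->
  measurable_fun setT (fun x => Phi (z x - W x)).
Proof.
move=> mz; apply: measurableT_comp (v_minus_measurable mz).
exact: continuous_measurable_fun (smooth1_continuous (trunc_smooth hT 0)).
Qed.

(** By dominated convergence the measure of D_n united with level k tends to that of level k,
    because a point with v < k leaves D_n eventually. Points with v = k already belong to [level],
    which uses the weak inequality, and the strict bound by m leaves room for the limit. *)
Lemma level_eventually (z : nat -> E -> R) : (forall n, test_fun setT (z n)) ->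
  (\forall x \ae leb, z n x @[n --> \oo] --> u x) -> (leb (level k) < m%:E)%E ->
  \forall n \near \oo, (leb [set x | (sqd o x < a1 + 1)%R /\ (k < z n x - W x)%R] <= m%:E)%E.
Proof.
move=> tz zu lm; pose D n := [set x | sqd o x < a1 + 1 /\ k < z n x - W x].
have mz n : measurable_fun setT (z n) by have [] := test_fun_bcs (tz n).
have mD n : measurable (D n).
  have -> : D n = [set x : E | sqd o x < a1 + 1] `&` ~` [set x | - k <= - (z n x - W x)].
    by apply/seteqP; split=> x /= [h1 h2]; split=> //; move: h2; rewrite lerN2 ltNge => /negP.
  apply: measurableI; first exact: measurable_sqd_lt.
  apply: measurableC; apply: measurable_ge; apply: measurableT_comp => //.
  exact: v_minus_measurable.
have cK : compact K1 by exact: sqd_compact.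
have subK n : D n `|` level k `<=` K1 by move=> x [[/ltW]|[/ltW]].
have subK' : level k `<=` K1 by move=> x [/ltW].
have mU n : measurable (D n `|` level k) by apply: measurableU => //; exact: measurable_level.
have [iL lE] := Int_indic cK (measurable_level k) subK'.
have iU n := (Int_indic cK (mU n) (subK n)).1; have lU n := (Int_indic cK (mU n) (subK n)).2.
have c : \int[leb]_x (\1_(D n `|` level k) x : R) @[n --> \oo] --> \int[leb]_x (\1_(level k) x : R).
  have iK1 := (Int_indic cK (measurable_compact_rV cK) (fun x h => h)).1.
  apply: (proj2 (Int_dominated_cvg _ _ _ iK1 _)) => [n|||n x].
  - exact: measurable_indic.
  - by apply: measurable_indic; exact: measurable_level.
  - apply: filterS zu => x zx; rewrite indicE.
    have [Lx|nL] := pselect (level k x).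
      apply: cvg_near_cst; apply: nearW => n.
      by rewrite indicE !mem_set//; right.
    rewrite memNset//; have [xa|xa] := ltP (sqd o x) (a1 + 1); last first.
      apply: cvg_near_cst; apply: nearW => n; rewrite indicE memNset//.
      by move=> [[]|//]; rewrite ltNge xa.
    have vk : v x < k by rewrite ltNge; apply/negP => kv; apply: nL.
    have cv : z n x - W x @[n --> \oo] --> v x by apply: cvgB => //; exact: cvg_cst.
    apply: cvg_near_cst; apply: filterS (cvgr_lt _ cv _ vk) => n zk.
    by rewrite indicE memNset// => -[[_]|//]; rewrite ltNge (ltW zk).
  - rewrite !indicE; have [Ux|nU] := pselect ((D n `|` level k) x).
      by rewrite !mem_set ?normr1//; exact: subK Ux.
    by rewrite memNset// normr0.
have lm' : \int[leb]_x (\1_(level k) x : R) < m by move: lm; rewrite lE lte_fin.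
apply: filterS (cvgr_lt _ c _ lm') => n h.
apply: (@le_trans _ _ (leb (D n `|` level k))); last by rewrite lU lee_fin ltW.
by apply: le_measure; rewrite ?inE; [exact: mD|exact: mU|exact: subsetUl].
Qed.

(** Faber-Krahn, the gradient bound and the energy estimate hold for the approximants up to errors
    that vanish; all remaining integrals converge by dominated convergence. *)
Lemma level_limit : (leb (level k) < m%:E)%E ->
  \int[leb]_x ((chi x * Phi (v x)) ^+ 2) <=
  2 ^+ d.+2 * ((4 * m) `^ (d%:R^-1)) ^+ 2 *
  (d%:R * (2 * (kap * (nu * (ct / l * (2 * \int[mu]_x ((f x + Lop A G W x) * Phi (v x)))))))).
Proof.
have sE (y : R) : \sum_(i < d) y = d%:R * y by rewrite sumr_const card_ord mulr_natl.
move=> lm; have [z [tz zu ze]] := approx_sequence hT.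
have cPhi : continuous Phi by exact: smooth1_continuous (trunc_smooth hT 0).
have mz n : measurable_fun setT (z n) by have [] := test_fun_bcs (tz n).
have mu_ : measurable_fun setT u by exact: integ_measurable u_integ.
have tchi := cutoff_test_fun; have [mchi _ _] := test_fun_bcs tchi.
have P01 s : 0 <= Phi s <= 1 by exact: trunc_range hT s.
have Pcvg : \forall x \ae leb, Phi (z n x - W x) @[n --> \oo] --> Phi (v x).
  apply: filterS zu => x zx; apply: (@cvg_comp _ _ _ _ Phi _ _ _ _ (cPhi (v x))).
  by apply: cvgB => //; exact: cvg_cst.
have sq_cvg (g : E -> R) : bcs g ->
    \int[leb]_x ((Phi (z n x - W x) * g x) ^+ 2) @[n --> \oo] -->
    \int[leb]_x ((Phi (v x) * g x) ^+ 2).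
  move=> bg; have [mg _ _] := bg.
  have ig : integ leb (fun x => g x ^+ 2).
    by apply: bcs_integ; under eq_fun do rewrite expr2; exact: bcsM.
  apply: (proj2 (Int_dominated_cvg _ _ _ ig _)) => [n|||n x].
  - by apply: measurable_funX; apply: measurable_funM => //; exact: trunc_measurable.
  - by apply: measurable_funX; apply: measurable_funM => //; exact: trunc_measurable.
  - apply: filterS Pcvg => x px; under eq_fun do rewrite expr2; rewrite expr2.
    by apply: cvgM; apply: cvgM => //; exact: cvg_cst.
  - have /andP[h0 h1] := P01 (z n x - W x).
    rewrite ger0_norm ?sqr_ge0// exprMn ler_piMl ?sqr_ge0//.
    by rewrite exprn_ile1.
have T1 : \int[leb]_x ((chi x * Phi (z n x - W x)) ^+ 2) @[n --> \oo] -->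
    \int[leb]_x ((chi x * Phi (v x)) ^+ 2).
  have := sq_cvg _ (test_fun_bcs tchi).
  by under eq_fun do (under eq_Rintegral do rewrite mulrC); under eq_Rintegral do rewrite mulrC.
have T2 i : \int[leb]_x ((Phi (z n x - W x) * partial i chi x) ^+ 2) @[n --> \oo] --> (0 : R).
  have := sq_cvg _ (test_fun_bcs (test_fun_partial i tchi)).
  have -> : \int[leb]_x ((Phi (v x) * partial i chi x) ^+ 2) = 0; last by [].
  rewrite -[RHS](@Int0 _ _ _ leb); apply: Int_ae_eq => //.
    apply: measurable_funX; apply: measurable_funM; first exact: trunc_measurable.
    by have [] := test_fun_bcs (test_fun_partial i tchi).
  (* Where Phi(v) does not vanish, the point lies inside the ball on which [cutoff] is locally
     constant. *)
  apply: filterS barrier_support => x h; have [v0|/h xr] := leP (v x) 0.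
    by rewrite (trunc_out hT v0) mul0r expr0n.
  have xa : sqd o x < a1 by apply: lt_le_trans xr (le_trans (ltW r2) rdl).
  rewrite (@partial_near_cst _ _ _ _ _ 1) ?mulr0 ?expr0n//.
  by have := near_sqd_lt xa; apply: filterS => y /ltW; exact: cutoff_in.
have iFL : integ mu (fun x => f x + Lop A G W x).
  by apply: integD; [exact: f_integ|exact: Lop_barrier_integ].
have T3 : \int[mu]_x ((f x + Lop A G W x) * Phi (z n x - W x)) @[n --> \oo] -->
    \int[mu]_x ((f x + Lop A G W x) * Phi (v x)).
  apply: (proj2 (Int_dominated_cvg _ _ _ (integ_norm iFL) _)) => [n|||n x].
  - by apply: measurable_funM; [exact: integ_measurable iFL|exact: trunc_measurable].
  - by apply: measurable_funM; [exact: integ_measurable iFL|exact: trunc_measurable].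
  - by apply: (ae_leb_mu hrho); apply: filterS Pcvg => x px; apply: cvgM => //; exact: cvg_cst.
  - by have /andP[h0 h1] := P01 (z n x - W x); rewrite normrM (ger0_norm h0) ler_piMr.
pose I n := \int[mu]_x ((f x + Lop A G W x) * Phi (z n x - W x)).
pose c0 := 2 ^+ d.+2 * ((4 * m) `^ (d%:R^-1)) ^+ 2.
have c00 : 0 <= c0 by rewrite mulr_ge0 ?exprn_ge0// powR_ge0.
pose b n := c0 * (d%:R * (2 * (kap * (nu * (ct / l * (2 * (I n + 4^-1 ^+ n)))))) +
  2 * \sum_(i < d) \int[leb]_x ((Phi (z n x - W x) * partial i chi x) ^+ 2)).
have q0 : (4^-1 : R) ^+ n @[n --> \oo] --> (0 : R).
  by apply: cvg_expr; rewrite ger0_norm ?invr_ge0// invf_lt1// ltr1n.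
have cb : b n @[n --> \oo] --> c0 * (d%:R * (2 * (kap * (nu * (ct / l *
    (2 * (\int[mu]_x ((f x + Lop A G W x) * Phi (v x)) + 0)))))) + 2 * 0).
  have cM (a : R) (g : nat -> R) (y : R) : g n @[n --> \oo] --> y -> a * g n @[n --> \oo] --> a * y.
    by move=> gy; apply: cvgM => //; exact: cvg_cst.
  apply: (cM _ _ _); apply: cvgD; last by apply: (cM _ _ _); apply: cvg_sum0 => i; exact: T2.
  by do 6 apply: (cM _ _ _); exact: cvgD.
rewrite addr0 mulr0 addr0 in cb.
apply: (ler_cvg_to T1 cb); have := level_eventually tz zu lm; apply: filterS => n Dm.
apply: le_trans (cutoff_faber_krahn (tz n) Dm) _; rewrite ler_wpM2l//.
apply: (@le_trans _ _ (\sum_(i < d) (2 * (kap * (nu * (ct / l * (2 * (I n + 4^-1 ^+ n))))) +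
    2 * \int[leb]_x ((Phi (z n x - W x) * partial i chi x) ^+ 2)))).
  apply: ler_sum => i _; apply: le_trans (cutoff_gradient_le i (tz n)) _.
  rewrite lerD2r; do 3 (rewrite ler_pM2l//); rewrite ler_pM2l ?divr_gt0//.
  by have := ze n; rewrite -/(I n) ler_pdivrMl.
by rewrite big_split/= sE -mulr_sumr.
Qed.

End one_truncation.

(** The product of the constants met on the way: Chebyshev's inequality contributes the power of
    [smooth_trunc 1], Faber-Krahn 2^(d+2) and 16, the gradient bound d, [kap'], [nu'] and [ct'], and
    [source_bound] the last factor. *)
Definition level_const (nu' kap' ct' CL' J' : R) : R :=
  (smooth_trunc (1 : R) ^+ 2)^-1 * (2 ^+ d.+2 * 16 * (d%:R * (2 * (kap' * (nu' * (ct' *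
    (2 * (kap' + 1 + 4 * CL' * (kap' + d%:R * (kap' * (1 + J'))))))))))).

Definition level_measure (x : R) : R := \int[leb]_y (\1_(level x) y : R).

Lemma level_measureE (x : R) : leb (level x) = (level_measure x)%:E.
Proof.
by apply: (Int_indic (@sqd_compact _ _ o (a1 + 1)) (measurable_level x) _).2 => y [/ltW].
Qed.

Lemma level_measure_ge0 x : 0 <= level_measure x.
Proof. by apply: Int_ge0 => y; rewrite indicE. Qed.

Lemma level_measure_nd (x y : R) : x <= y -> level_measure y <= level_measure x.
Proof.
move=> xy; rewrite -lee_fin -!level_measureE; apply: le_measure.
- by rewrite inE; exact: measurable_level.
- by rewrite inE; exact: measurable_level.
- by move=> z [h1 h2]; split => //; exact: le_trans h2.
Qed.

Section level_inequality.
Variables (nu kap ct CL J : R).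
Hypothesis nu0 : 0 < nu.
Hypothesis hnu : forall (x xi : E), K1 x -> \sum_i (xi 0 i) ^+ 2 <= nu * dotv (mulv (A x) xi) xi.
Hypothesis kap0 : 0 < kap.
Hypothesis hkap : forall g, measurable_fun setT g -> (forall x, 0 <= g x) ->
  (forall x, ~ K1 x -> g x = 0) ->
  (integ mu g -> integ leb g /\ \int[leb]_x g x <= kap * \int[mu]_x g x) /\
  (integ leb g -> integ mu g /\ \int[mu]_x g x <= kap * \int[leb]_x g x).
Hypothesis ct0 : 0 < ct.
Hypothesis hct : forall s, derive1 (@smooth_trunc R) s <= ct.
Hypothesis CL0 : 0 < CL.
Hypothesis hCL : forall (a b : R) x, a < b -> b - a <= 1 -> sqd o x <= a1 ->
  `|Lop A G (bcut o a b) x| <= CL / (b - a) ^+ 2 * (1 + \sum_i `|G x 0 i|).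
Hypothesis J0 : 0 <= J.
Hypothesis hJ : forall i, integ leb (fun x => `|G x 0 i| `^ q * \1_K1 x) /\
  \int[leb]_x (`|G x 0 i| `^ q * \1_K1 x) <= J.
Hypothesis fq : integ mu (fun x => f x `^ q).
Hypothesis fq1 : \int[mu]_x (f x `^ q) <= 1.
Hypothesis dl1 : dl <= 1.

Section truncated_level.
Variables (k l m : R).
Hypothesis k0 : 0 <= k.
Hypothesis l0 : 0 < l.
Hypothesis m0 : 0 < m.
Hypothesis m1 : m <= 1.
Hypothesis lm : (leb (level k) < m%:E)%E.

Let cL : R := M * (CL / (dl / 2) ^+ 2).
Let cL0 : 0 <= cL.
Proof. by rewrite mulr_ge0// divr_ge0 ?(ltW CL0)// exprn_ge0// divr_ge0// ltW. Qed.

Let hT : truncation (trunc_at k l) (trunc_prim_at k l) (ct / l).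
Proof. exact: truncation_at. Qed.

Lemma source_pointwise : \forall x \ae leb, (f x + Lop A G W x) * trunc_at k l (v x) <=
  f x * \1_(level k) x + cL * (\1_(level k) x + \sum_i `|G x 0 i| * \1_(level k) x).
Proof.
apply: filterS barrier_support => x h.
have S0 : 0 <= \sum_i `|G x 0 i| * \1_(level k) x by rewrite sumr_ge0// => i _; rewrite mulr_ge0// indicE.
have I0 : 0 <= (\1_(level k) x : R) by rewrite indicE.
have [vk|kv] := leP (v x) k.
  rewrite trunc_at_le// mulr0 addr_ge0//; first by rewrite mulr_ge0.
  by rewrite mulr_ge0// addr_ge0.
have v0 : 0 < v x by exact: le_lt_trans kv.
have xr := h v0; have xa : sqd o x < a1 by apply: lt_le_trans xr (le_trans (ltW r2) rdl).
have Lx : level k x by split; [apply: lt_trans xa a1lt|exact: ltW].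
rewrite indicE mem_set//= mulr1; have /andP[P0 P1] := trunc_range hT (v x).
apply: (@le_trans _ _ (f x + `|Lop A G W x|)).
  apply: (@le_trans _ _ ((f x + `|Lop A G W x|) * trunc_at k l (v x))).
    by rewrite ler_wpM2r// lerD2l ler_norm.
  by rewrite ler_piMr// addr_ge0.
rewrite lerD2l (Lop_barrier_in xr) normrM (ger0_norm M0) /cL -mulrA ler_wpM2l//.
under eq_bigr do rewrite mulr1.
have e : r + dl / 2 - r = dl / 2 by rewrite addrC addKr.
have := @hCL r (r + dl / 2) x r1; rewrite e; apply; last exact: ltW.
by apply: le_trans dl1; rewrite ler_pdivrMr// ler_pMr// ler1n.
Qed.

(** Hoelder's inequality in the form [set_hoelder] on the level set, once for [f] under mu and once
    for each component of G under Lebesgue measure; the constant term is covered by m <= m^(1 -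
    1/q), valid for m <= 1. *)
Lemma source_bound : \int[mu]_x ((f x + Lop A G W x) * trunc_at k l (v x)) <=
  (kap + 1 + cL * (kap + d%:R * (kap * (1 + J)))) * m `^ (1 - q^-1).
Proof.
have mL := measurable_level k; have cK : compact K1 by exact: sqd_compact.
have LK : level k `<=` K1 by move=> x [/ltW].
have [iL lE] := Int_indic cK mL LK.
have mLi : measurable_fun setT (\1_(level k) : E -> R) by exact: measurable_indic.
have Lm : \int[leb]_x (\1_(level k) x : R) <= 1 * m.
  by move: lm; rewrite lE lte_fin mul1r => /ltW.
have outK x : ~ K1 x -> (\1_(level k) x : R) = 0 by move=> nK; rewrite indicE memNset// => /LK.
have [iLm Lmm] : integ mu (\1_(level k) : E -> R) /\ \int[mu]_x (\1_(level k) x : R) <= kap * m.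
  have [i h] := (hkap mLi (fun x => ler0n _ _) outK).2 iL; split => //.
  by apply: le_trans h _; rewrite ler_pM2l// -[leRHS]mul1r.
have mf : measurable_fun setT f by exact: integ_measurable f_integ.
have q0 : 0 <= q by exact/ltW/(lt_trans ltr01).
have [iF FB] : integ mu (fun x => f x * \1_(level k) x) /\
    \int[mu]_x (f x * \1_(level k) x) <= (kap + 1) * m `^ (1 - q^-1).
  have i1 : integ mu (fun x => f x `^ q * \1_(level k) x).
    by apply: (integM_bounded (K := 1) fq) => // x; rewrite indicE; case: (_ \in _); rewrite ?normr1 ?normr0.
  apply: (set_hoelder q1 m0 (ltW kap0) mL mf f0 iLm Lmm i1).
  apply: le_trans fq1; apply: Int_le => // x; rewrite indicE ler_piMr ?powR_ge0//.
  by case: (_ \in _).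
have lg i := (drift_locint p2 ha i).1.
have mG i : measurable_fun setT (fun x : E => `|G x 0 i|).
  by apply: measurableT_comp => //; have [] := lg i.
have hG i : integ mu (fun x => `|G x 0 i| * \1_(level k) x) /\
    \int[mu]_x (`|G x 0 i| * \1_(level k) x) <= kap * ((1 + J) * m `^ (1 - q^-1)).
  have [iJ hJi] := hJ i.
  have mGq : measurable_fun setT (fun x : E => `|G x 0 i| `^ q * \1_(level k) x).
    apply: measurable_funM => //; apply: (measurableT_comp (measurable_powR _)) => //.
  have le x : `|G x 0 i| `^ q * \1_(level k) x <= `|G x 0 i| `^ q * \1_K1 x.
    rewrite ler_wpM2l ?powR_ge0// !indicE; have [Lx|nL] := pselect (level k x).
      by rewrite !mem_set//; exact: LK.
    by rewrite memNset.
  have i1 : integ leb (fun x => `|G x 0 i| `^ q * \1_(level k) x).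
    apply: (integ_le mGq iJ) => x; rewrite ger0_norm; first exact: le.
    by rewrite mulr_ge0 ?powR_ge0// indicE.
  have [i2 h2] := set_hoelder q1 m0 ler01 mL (mG i) (fun x => normr_ge0 _) iL Lm i1
    (le_trans (Int_le i1 iJ le) hJi).
  have [i3 h3] : integ mu (fun x => `|G x 0 i| * \1_(level k) x) /\
      \int[mu]_x (`|G x 0 i| * \1_(level k) x) <= kap * \int[leb]_x (`|G x 0 i| * \1_(level k) x).
    apply: (proj2 (hkap _ _ _)) i2 => [|x|x nK].
    - exact: measurable_funM.
    - by rewrite mulr_ge0// indicE.
    - by rewrite outK// mulr0.
  by split => //; apply: le_trans h3 _; rewrite ler_pM2l.
have iGs : integ mu (fun x => \sum_i `|G x 0 i| * \1_(level k) x).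
  by apply: integ_sum => i; exact: (hG i).1.
have iR := integZ cL (integD iLm iGs).
have iI : integ mu (fun x => (f x + Lop A G W x) * trunc_at k l (v x)).
  have iFL := integD f_integ Lop_barrier_integ.
  apply: (integM_bounded (K := 1) iFL).
    apply: measurableT_comp v_measurable.
    exact: continuous_measurable_fun (smooth1_continuous (trunc_smooth hT 0)).
  by move=> x; have /andP[P0 P1] := trunc_range hT (v x); rewrite ger0_norm.
apply: le_trans (Int_le_ae iI (integD iF iR) (ae_leb_mu hrho source_pointwise)) _.
rewrite (IntD iF iR) (IntZ cL (integD iLm iGs)) (IntD iLm iGs) mulrDl; apply: lerD => //.
rewrite -mulrA ler_wpM2l// mulrDl; apply: lerD.
  apply: le_trans Lmm _; rewrite ler_pM2l// -[leLHS](powRr1 (ltW m0)).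
  have -> : m `^ 1 = m `^ (1 - q^-1) * m `^ q^-1.
    by rewrite -powRD ?subrK// (gt_eqF m0) implybT.
  rewrite ler_piMr ?powR_ge0//; have e1 : (1 : R) `^ q^-1 = 1 by rewrite powR1.
  by rewrite -[leRHS]e1; apply: ge0_ler_powR; rewrite ?invr_ge0 ?nnegrE// ltW.
rewrite Int_sum; last by move=> i; exact: (hG i).1.
have sE (y : R) : d%:R * y = \sum_(i < d) y by rewrite sumr_const card_ord mulr_natl.
by rewrite -!mulrA sE; apply: ler_sum => i _; exact: (hG i).2.
Qed.

(** On level (k + l) the truncation is at least [smooth_trunc 1], so Chebyshev bounds its measure by
    the integral in [level_limit]. Faber-Krahn contributes m^(2/d), the source m^(1 - 1/q) and the
    slope of the truncation 1/l. *)
Lemma level_estimate : level_measure (k + l) <=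
  level_const nu kap ct CL J * (1 + M / dl ^+ 2) * m `^ (1 + (2 / d%:R - q^-1)) / l.
Proof.
have alg (x y z : R) : 0 <= z * y -> 0 <= x -> z + x * y <= (z + x) * (1 + y).
  have -> : (z + x) * (1 + y) = (z + x * y) + (z * y + x) by ring.
  by move=> zy x0; rewrite lerDl addr_ge0.
have e16 : (16 : R) = 4 ^+ 2 by rewrite -natrX.
have ring1 (a D N K U T L X W y1 y2 : R) : a * (16 * y1) * (D * (2 * (K * (N * (T / L *
    (2 * ((K + 1 + 4 * U * X) * (1 + W) * y2))))))) =
    a * 16 * (D * (2 * (K * (N * (T * (2 * (K + 1 + 4 * U * X))))))) *
    ((1 + W) * ((y1 * y2) / L)) by ring.
have ring2 (s z w y x : R) : s * z * w * y / x = s * (z * (w * (y / x))) by ring.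
have t1 : 0 < smooth_trunc (1 : R) := smooth_trunc1_gt0.
have cK : compact K1 by exact: sqd_compact.
have LK : level (k + l) `<=` K1 by move=> x [/ltW].
have [iL _] := Int_indic cK (measurable_level (k + l)) LK.
have tchi := cutoff_test_fun; have [mchi _ _] := test_fun_bcs tchi.
have isq : integ leb (fun x => (chi x * trunc_at k l (v x)) ^+ 2).
  have i1 : integ leb (fun x => chi x ^+ 2).
    by apply: bcs_integ; under eq_fun do rewrite expr2; apply: bcsM; exact: test_fun_bcs tchi.
  apply: (integ_le _ i1) => [|x].
    apply: measurable_funX; apply: measurable_funM => //.
    apply: measurableT_comp v_measurable.
    exact: continuous_measurable_fun (smooth1_continuous (trunc_smooth hT 0)).
  have /andP[P0 P1] := trunc_range hT (v x).
  by rewrite ger0_norm ?sqr_ge0// exprMn ler_piMr ?sqr_ge0// exprn_ile1.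
have h1 : smooth_trunc 1 ^+ 2 * level_measure (k + l) <=
    \int[leb]_x ((chi x * trunc_at k l (v x)) ^+ 2).
  rewrite /level_measure -(IntZ _ iL); apply: Int_le_ae => //; first exact: integZ.
  apply: filterS barrier_support => x h; have [Lx|nL] := pselect (level (k + l) x); last first.
    by rewrite indicE memNset// mulr0 sqr_ge0.
  have v0 : 0 < v x by apply: lt_le_trans Lx.2; exact: ltr_wpDl.
  have xa : sqd o x < a1 by apply: lt_le_trans (h v0) (le_trans (ltW r2) rdl).
  rewrite indicE mem_set// mulr1 (cutoff_in (ltW xa)) mul1r.
  rewrite ler_sqr ?nnegrE ?(ltW t1)//; first exact: trunc_at_ge Lx.2.
  by have /andP[] := trunc_range hT (v x).
have h2 := level_limit nu0 hnu kap0 (fun g mg gp gK => (hkap mg gp gK).1) ct0 hct k0 l0 m0 lm.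
have h3 := source_bound.
set I := \int[mu]_x _ in h2 h3.
set X := kap + d%:R * (kap * (1 + J)) in h3.
have X0 : 0 <= X by rewrite addr_ge0 ?mulr_ge0 ?addr_ge0// ltW.
have w0 : 0 <= M / dl ^+ 2 by rewrite divr_ge0// exprn_ge0// ltW.
have y0 : 0 <= 4 * CL * X by rewrite !mulr_ge0// ltW.
have k1 : 0 <= kap + 1 by rewrite addr_ge0// ltW.
have h4 : kap + 1 + cL * X <= (kap + 1 + 4 * CL * X) * (1 + M / dl ^+ 2).
  have -> : cL * X = 4 * CL * X * (M / dl ^+ 2).
    by rewrite /cL; field; rewrite gt_eqF.
  exact: alg (mulr_ge0 k1 w0) y0.
have pm : 0 <= m `^ (1 - q^-1) by exact: powR_ge0.
(* The constant 4^(2/d) is at most 16, because d >= 1. *)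
have h5 : ((4 * m) `^ d%:R^-1) ^+ 2 <= 16 * m `^ (2 / d%:R).
  rewrite -powR_mulrn ?powR_ge0// -powRrM (mulrC _ 2) powRM ?(ltW m0)// ler_wpM2r ?powR_ge0//.
  rewrite e16 -powR_mulrn//.
  by rewrite ler_powR ?ler1n// ler_piMr// invf_le1 ?ltr0n// ler1n.
rewrite /level_const ring2 ler_pdivlMl ?exprn_gt0//.
apply: le_trans h1 (le_trans h2 _).
apply: (@le_trans _ _ (2 ^+ d.+2 * (16 * m `^ (2 / d%:R)) * (d%:R * (2 * (kap * (nu * (ct / l *
    (2 * ((kap + 1 + 4 * CL * X) * (1 + M / dl ^+ 2) * m `^ (1 - q^-1)))))))))).
  have I4 : I <= (kap + 1 + 4 * CL * X) * (1 + M / dl ^+ 2) * m `^ (1 - q^-1).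
    by apply: le_trans h3 _; rewrite ler_wpM2r.
  have p1 : 0 <= (kap + 1 + 4 * CL * X) * (1 + M / dl ^+ 2) * m `^ (1 - q^-1).
    by rewrite mulr_ge0// mulr_ge0// addr_ge0.
  apply: (@le_trans _ _ (2 ^+ d.+2 * ((4 * m) `^ d%:R^-1) ^+ 2 * (d%:R * (2 * (kap * (nu * (ct / l *
    (2 * ((kap + 1 + 4 * CL * X) * (1 + M / dl ^+ 2) * m `^ (1 - q^-1)))))))))).
    have c1 : 0 <= ct / l by rewrite divr_ge0 ?ltW.
    have c2 : 0 <= 2 ^+ d.+2 * ((4 * m) `^ d%:R^-1) ^+ 2 :> R by rewrite mulr_ge0 ?sqr_ge0 ?exprn_ge0.
    exact: (ler_wpM2l c2 (ler_wpM2l (ler0n R d) (ler_wpM2l (ler0n R 2) (ler_wpM2l (ltW kap0)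
      (ler_wpM2l (ltW nu0) (ler_wpM2l c1 (ler_wpM2l (ler0n R 2) I4))))))).
  rewrite ler_wpM2r//; last by rewrite ler_wpM2l// exprn_ge0.
  have c1 : 0 <= ct / l by rewrite divr_ge0 ?ltW.
  exact: (mulr_ge0 (ler0n R d) (mulr_ge0 (ler0n R 2) (mulr_ge0 (ltW kap0) (mulr_ge0 (ltW nu0)
    (mulr_ge0 c1 (mulr_ge0 (ler0n R 2) p1)))))).
rewrite le_eqVlt; apply/orP; left; apply/eqP.
have -> : 1 + (2 / d%:R - q^-1) = 2 / d%:R + (1 - q^-1) by rewrite addrCA.
rewrite (@powRD _ _ (2 / d%:R)); last by rewrite (gt_eqF m0) implybT.
exact: ring1.
Qed.

End truncated_level.

Lemma level_const_gt0 : 0 < level_const nu kap ct CL J.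
Proof.
have t1 : 0 < smooth_trunc (1 : R) := smooth_trunc1_gt0.
have X0 : 0 <= kap + d%:R * (kap * (1 + J)) by rewrite addr_ge0 ?mulr_ge0 ?addr_ge0// ltW.
have Y0 : 0 < kap + 1 + 4 * CL * (kap + d%:R * (kap * (1 + J))).
  by rewrite ltr_wpDr// ?mulr_ge0 ?addr_gt0// ltW.
have D0 : 0 < d%:R :> R by rewrite ltr0n.
have a1' : 0 < (smooth_trunc (1 : R) ^+ 2)^-1 by rewrite invr_gt0 exprn_gt0.
have a2 : 0 < 2 ^+ d.+2 * 16 :> R by rewrite mulr_gt0 ?exprn_gt0.
have a3 : 0 < 2 :> R by [].
exact: (mulr_gt0 a1' (mulr_gt0 a2 (mulr_gt0 D0 (mulr_gt0 a3 (mulr_gt0 kap0 (mulr_gt0 nu0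
  (mulr_gt0 ct0 (mulr_gt0 a3 Y0)))))))).
Qed.

(** Since u has integral at most 1, Markov's inequality makes the level set at height k small; from
    there Stampacchia's lemma empties a level set at a controlled height. On the inner ball the
    barrier vanishes, so this bounds u itself. *)
Lemma one_step (s k : R) : 0 < 2 / d%:R - q^-1 -> 0 < s < 1 ->
  s `^ (2 / d%:R - q^-1) = 2^-1 -> \int[mu]_x u x <= 1 -> 0 < k -> 2 * kap / k <= 1 ->
  \forall x \ae leb, sqd o x < r ->
  u x <= k + 4 * (level_const nu kap ct CL J * (1 + M / dl ^+ 2)) *
    (2 * kap / k) `^ (2 / d%:R - q^-1) / s.
Proof.
move=> eta0 s01 sh u1 k0 km1; set k1 := k + _.
have w0 : 0 <= M / dl ^+ 2 by rewrite divr_ge0// exprn_ge0// ltW.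
have K0 : 0 < level_const nu kap ct CL J * (1 + M / dl ^+ 2).
  by rewrite mulr_gt0 ?level_const_gt0// ltr_wpDr.
have cK : compact K1 by exact: sqd_compact.
have LK y : level y `<=` K1 by move=> x [/ltW].
have mLi : measurable_fun setT (\1_(level k) : E -> R).
  exact: measurable_indic (measurable_level k).
have outK x : ~ K1 x -> (\1_(level k) x : R) = 0 by move=> nK; rewrite indicE memNset// => /LK.
have [iLm Lmm] := (hkap mLi (fun x => ler0n _ _) outK).2 (Int_indic cK (measurable_level k) (LK k)).1.
have hk := ((hkap mLi (fun x => ler0n _ _) outK).1 iLm).2.
have markov : \int[mu]_x (\1_(level k) x : R) <= k^-1.
  have iu := integZ k^-1 u_integ.
  apply: le_trans (Int_le iLm iu _) _ => [x|].
    rewrite ler_pdivlMl// indicE; have [Lx|nL] := pselect (level k x).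
      rewrite mem_set// mulr1; apply: le_trans Lx.2 _.
      by rewrite gerBl; exact: barrier_ge0.
    by rewrite memNset// mulr0.
  by rewrite (IntZ _ u_integ) ler_piMr// invr_ge0 ltW.
(* Markov gives kap / k; doubling it makes the inequality strict, as the iteration requires. *)
have phi0 : level_measure k < 2 * kap / k.
  have kk : 0 < kap / k by rewrite divr_gt0.
  apply: le_lt_trans (le_trans hk (ler_wpM2l (ltW kap0) markov)) _.
  by rewrite -mulrA mulr_natl mulr2n ltrDl.
have m00 : 0 < 2 * kap / k by rewrite divr_gt0// mulr_gt0.
have step h y m : k <= y -> y < h -> level_measure y < m -> m <= 1 ->
    level_measure h <= level_const nu kap ct CL J * (1 + M / dl ^+ 2) *
      m `^ (1 + (2 / d%:R - q^-1)) / (h - y).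
  move=> ky yh ym m1; rewrite -{1}(subrKC y h).
  apply: level_estimate; rewrite ?subr_gt0//.
  - exact: (le_trans (ltW k0) ky).
  - exact: le_lt_trans (level_measure_ge0 y) ym.
  - by rewrite level_measureE lte_fin.
have z := stampacchia K0 eta0 (ltW k0) s01 sh step (fun h y => @level_measure_nd y h)
  level_measure_ge0 phi0 km1.
have N : leb.-negligible (level k1).
  by apply/negligibleP; [exact: measurable_level|exact: (etrans (level_measureE k1) (congr1 EFin z))].
have aeN : \forall x \ae leb, ~ level k1 x.
  by apply: negligibleS N => x /= /contrapT.
apply: filterS aeN => x nL xr; rewrite leNgt; apply/negP => ku; apply: nL; split.
  apply: lt_trans a1lt; apply: lt_le_trans xr _; apply: le_trans rdl.
  by rewrite lerDl ltW.
by rewrite (barrier_in (ltW xr)) subr0 ltW.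
Qed.

End level_inequality.

End one_level.
End level_sets.

Section local_bound.
Context {R : realType} {d : nat}.
Local Notation E := 'rV[R]_d.
Local Notation leb := (@leb R d).
Context {p q : R} {A C : E -> 'M[R]_d} {H : E -> E} {rho : E -> R}
  {mu : {measure set E -> \bar R}}.
Local Notation G := (drift A C H).
Local Notation B := (fun x => G x - log_drift A rho x).
Hypothesis p2 : 2 <= p.
Hypothesis ha : assumption_a p A C H.
Hypothesis hb : assumption_b q G.
Hypothesis hrho : invariant_density p A G rho mu.
Hypothesis q1 : 1 < q.
Hypothesis d1 : (0 < d)%N.
Hypothesis eta0 : 0 < 2 / d%:R - q^-1.

Lemma drift_power_bound (K : set E) : compact K -> exists2 J : R, 0 < J &
  forall i, integ leb (fun x => `|G x 0 i| `^ q * \1_K x) /\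
    \int[leb]_x (`|G x 0 i| `^ q * \1_K x) <= J.
Proof.
move=> cK; apply: (@sum_bounded _ _ (fun i J => integ leb (fun x => `|G x 0 i| `^ q * \1_K x) /\
    \int[leb]_x (`|G x 0 i| `^ q * \1_K x) <= J)).
  by move=> i x y xy [h1 h2]; split => //; exact: le_trans xy.
move=> i; have [_ h] := Lploc_integ (ltW q1) (hb i).
have e : (fun x => `|G x 0 i| `^ q * \1_K x) = (fun x => `|G x 0 i| `^ q) \_ K.
  by apply/funext => x; rewrite patchE indicE; case: ifP; rewrite ?mulr1 ?mulr0.
rewrite e; set I := \int[leb]_x _; exists (`|I| + 1); first by rewrite ltr_wpDl.
by split; [exact: h|rewrite (le_trans (ler_norm I))// lerDl].
Qed.

(* De Giorgi iteration on shrinking balls: at each step the truncation level is chosen so large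
   that the a priori bound on the larger ball is absorbed. *)
Lemma resolvent_locally_bounded (o : E) (a0 : R) : 0 <= a0 -> exists2 c : R, 0 < c &
  forall (f u : E -> R) (Moo : R), resolvent mu A B 1 f u ->
    (forall x, 0 <= f x) -> (forall x, 0 <= u x) -> 0 <= Moo ->
    (\forall x \ae leb, u x <= Moo) ->
    integ mu (fun x => f x `^ q) -> \int[mu]_x (f x `^ q) <= 1 -> \int[mu]_x u x <= 1 ->
    \forall x \ae leb, sqd o x < a0 -> u x <= c.
Proof.
have alg1 (a K M w s z : R) : a + 4 * (K * (1 + M * w)) * z / s =
    a + 4 * K * z / s + 4 * K * (w * z) / s * M by ring.
have alg2 (K z s Y : R) : 0 < K -> 0 < z -> 0 < s -> Y <= s / (32 * K * z) ->
    4 * K * Y / s <= (8 * z)^-1.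
  move=> K0 z0 s0 hY; rewrite ler_pdivrMr//.
  have -> : (8 * z)^-1 * s = 4 * K * (s / (32 * K * z)) by field; rewrite !gt_eqF.
  by rewrite ler_pM2l// mulr_gt0.
have alg3 (K z s Y : R) : 4 * K * (z * Y) / s = z * (4 * K * Y / s) by ring.
have alg4 (z : R) : 0 < z -> 4 * (8 * z)^-1 = (2 * z)^-1.
  by move=> z0; field; rewrite gt_eqF.
have alg6 (K s Y e : R) : 0 <= K -> 0 < s -> 0 <= Y -> 1 <= e ->
    4 * K * (Y / e) / s <= 4 * K * Y / s.
  move=> K0 s0 Y0 e1; apply: ler_wpM2r; first by rewrite invr_ge0 ltW.
  apply: ler_wpM2l; first by rewrite mulr_ge0.
  by rewrite ler_pdivrMr ?(lt_le_trans ltr01)// ler_peMr.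
have alg5 i (Y : R) : (2^-1 ^+ i.+1 ^+ 2)^-1 * (Y / 4 ^+ i) = 4 * Y.
  have e4 : 4 ^+ i = (2 ^+ i) ^+ 2 :> R by rewrite -exprM mulnC exprM; congr (_ ^+ _); rewrite -natrX.
  have y0 : 2 ^+ i != 0 :> R by rewrite expf_neq0.
  by rewrite (exprSr _ i) (exprVn _ i) e4; move: (2 ^+ i) y0 => y y0; field.
move=> a00; have cK : compact [set x : E | sqd o x <= a0 + 1 + 1] by exact: sqd_compact.
have a10 : 0 <= a0 + 1 by rewrite addr_ge0.
have [nu nu0 hnu] := elliptic_compact ha cK.
have [kap kap0 hkap] := mu_leb_compact hrho cK.
have [ct ct0 hct] := @derive1_smooth_trunc_bounded R.
have [CL CL0 hCL] := Lop_bcut_bound ha o a10.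
have [J J0 hJ] := drift_power_bound cK.
have [s s01 sh] := powR_half eta0; have /andP[s0 s1] := s01.
have eta0' := eta0; set eta := 2 / d%:R - q^-1 in eta0' sh.
set Kc := @level_const R d nu kap ct CL J.
have Kc0 : 0 < Kc by exact: (level_const_gt0 d1 nu0 kap0 ct0 CL0 (ltW J0)).
(* With heights L t^i, the eta-th power of the starting measure decays like 4^-i and offsets the
   growth 4^i of the factor dl^-2 caused by the shrinking gaps. *)
pose t : R := 4 `^ eta^-1.
have t0 : 0 < t by rewrite powR_gt0.
have t1 : 1 <= t by rewrite -[leLHS](powRr0 4) ler_powR ?invr_ge0 ?ltW// ltr1n.
have tE : t `^ eta = 4 by rewrite /t -powRrM mulVf ?gt_eqF// powRr1.
(* Choosing y this small makes the coefficient of the bound on the larger ball at most 1/(2 t), as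
   [geometric_absorption] asks. *)
have [y /andP[y0 y1] hy] : exists2 y : R, 0 < y <= 1 & y `^ eta <= s / (32 * Kc * t).
  have w0 : 0 < s / (32 * Kc * t) by exact: divr_gt0 s0 (mulr_gt0 (mulr_gt0 (ltr0Sn R 31) Kc0) t0).
  exists (Num.min 1 ((s / (32 * Kc * t)) `^ eta^-1)).
    by rewrite lt_min ltr01 powR_gt0//= ge_min lexx.
  set z := _ `^ eta^-1; have z0 : 0 < z by rewrite powR_gt0.
  have -> : s / (32 * Kc * t) = z `^ eta by rewrite /z -powRrM mulVf ?gt_eqF// powRr1// ltW.
  apply: ge0_ler_powR; rewrite ?nnegrE ?(ltW eta0') ?(ltW z0)//.
    by rewrite le_min ler01 ltW.
  by rewrite ge_min lexx orbT.
pose L : R := 2 * kap / y.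
have L0 : 0 < L by rewrite divr_gt0 ?mulr_gt0.
exists (2 * (L + 1) + 1); first by rewrite ltr_wpDl// mulr_ge0// addr_ge0// ltW.
move=> f u Moo hu f0 u0 Moo0 uMoo fq fq1 u1.
(* Squared radii growing from a0 towards a0 + 1, with gaps 2^-(i+1). *)
pose rad (i : nat) : R := a0 + 1 - 2^-1 ^+ i.
pose good (i : nat) (M : R) := \forall x \ae leb, sqd o x < rad i -> u x <= M.
have radS i : rad i + 2^-1 ^+ i.+1 = rad i.+1.
  by rewrite /rad exprS -addrA; congr (_ + _); rewrite {1}[2^-1 ^+ i]splitr; ring.
suff h : good 0%N (2 * (L + 1) + 1) by move: h; rewrite /good /rad expr0 addrK.
apply: (@geometric_absorption _ L t Moo) => //; first exact: ltW.
- by move=> i; apply: filterS uMoo.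
- move=> i M M0; rewrite /good -radS => gM.
  have dl0 : 0 < 2^-1 ^+ i.+1 :> R by rewrite exprn_gt0.
  have dl1 : 2^-1 ^+ i.+1 <= 1 :> R by rewrite exprn_ile1// invf_le1// ler1n.
  have rdl : rad i + 2^-1 ^+ i.+1 <= a0 + 1 by rewrite radS /rad gerBl exprn_ge0.
  have ti1 : 1 <= t ^+ i by exact: exprn_ege1.
  have ti0 : 0 < t ^+ i by exact: lt_le_trans ti1.
  have k0 : 0 < L * t ^+ i by rewrite mulr_gt0.
  have kE : 2 * kap / (L * t ^+ i) = y / t ^+ i.
    by rewrite /L; field; rewrite ?gt_eqF// mulr_gt0.
  have k1 : 2 * kap / (L * t ^+ i) <= 1.
    by rewrite kE ler_pdivrMr// mul1r (le_trans y1).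
  have := one_step p2 ha hrho q1 d1 hu f0 u0 dl0 rdl M0 Moo0 gM uMoo nu0 hnu kap0 hkap ct0 hct
    CL0 hCL (ltW J0) hJ fq fq1 dl1 eta0 s01 sh u1 k0 k1.
  apply: filterS => x h xr; apply: le_trans (h xr) _.
  have zE : (2 * kap / (L * t ^+ i)) `^ eta = y `^ eta / 4 ^+ i.
    rewrite kE powRM ?invr_ge0 ?(ltW y0) ?(ltW ti0)//; congr (_ * _).
    by rewrite -(powR_invn _ (ltW t0)) powRAC tE powR_invn.
  rewrite -/eta -/Kc zE alg1 -!(addrA (L * _)) lerD2l.
  set Y := y `^ eta in hy *.
  have Y0 : 0 <= Y by exact: powR_ge0.
  have hY : 4 * Kc * Y / s <= (8 * t)^-1.
    exact: alg2.
  have i40 : 0 < 4 ^+ i :> R by rewrite exprn_gt0.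
  have i41 : 1 <= 4 ^+ i :> R by rewrite exprn_ege1// ler1n.
  have t8 : (8 * t)^-1 <= 1 by rewrite invf_le1 ?mulr_gt0// mulr_ege1// ler1n.
  apply: lerD.
    exact: le_trans (alg6 _ _ _ _ (ltW Kc0) s0 Y0 i41) (le_trans hY t8).
  apply: ler_wpM2r => //.
  rewrite alg5 alg3.
  apply: le_trans (ler_wpM2l (ler0n R 4) hY) _.
  by rewrite alg4.
- by move=> i M M' MM'; apply: filterS => x h /h h'; exact: le_trans MM'.
Qed.

End local_bound.

(** * Potentials of the process *)

Section caratheodory.
Context {R : realType} dT (T : measurableType dT).
Local Notation TR := (measurableTypeR R).

(** Rounding time down to multiples of 1/(n+1) gives functions whose preimages are countable unions
    of rectangles; continuity in time yields the limit. The absolute value extends nonnegative times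
    to the whole line, where Lebesgue measure lives. *)
Lemma measurable_caratheodory (F : R -> T -> R) :
  (forall s, 0 <= s -> measurable_fun setT (F s)) ->
  (forall y (sn : nat -> R) s, (forall n, 0 <= sn n) -> sn n @[n --> \oo] --> s ->
    F (sn n) y @[n --> \oo] --> F s y) ->
  measurable_fun setT (fun z : TR * T => F `|z.1| z.2).
Proof.
move=> mF cF.
pose k (n : nat) (s : R) : nat := Num.trunc (n.+1%:R * `|s|).
pose sn (n : nat) (s : R) : R := (k n s)%:R / n.+1%:R.
apply: (@measurable_fun_cvg _ _ _ setT (fun n (z : TR * T) => F (sn n z.1) z.2)) => [n|z _].
  move=> _ Y mY; rewrite setTI.
  have mk (j : nat) : measurable [set s : TR | k n s = j].
    have -> : [set s : TR | k n s = j] =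
        (fun s : TR => n.+1%:R * `|s|) @^-1` `[j%:R, j.+1%:R[.
      apply/seteqP; split => s /=; rewrite in_itv/=.
        by move=> <-; rewrite truncn_itv ?mulr_ge0.
      by move=> h; exact: truncn_def.
    have mf : measurable_fun setT (fun s : TR => n.+1%:R * `|s| : R).
      by apply: measurable_funM; [exact: measurable_cst|exact: normr_measurable].
    by rewrite -[X in measurable X]setTI; apply: mf => //; exact: measurable_itv.
  have -> : (fun z : TR * T => F (sn n z.1) z.2) @^-1` Y = \bigcup_j
      ([set s : TR | k n s = j] `*` (F (j%:R / n.+1%:R) @^-1` Y)).
    apply/seteqP; split => [z h|z [j _ [h1 h2]]]; first by exists (k n z.1).
    by move: h2 => /=; rewrite /sn -h1.
  apply: bigcupT_measurable => j; apply: measurableX => //.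
  by rewrite -[X in measurable X]setTI; apply: mF => //; rewrite divr_ge0.
apply: cF => [n|]; first by rewrite divr_ge0.
move=> B /= [e /= e0 hB].
have [N _ hN] := near_infty_natSinv_lt (PosNum e0).
exists N => // n /= Nn; apply: hB.
have n0 : 0 < n.+1%:R :> R by rewrite ltr0n.
have /andP[h1 h2] : (k n z.1)%:R <= n.+1%:R * `|z.1| < (k n z.1).+1%:R.
  by rewrite truncn_itv// mulr_ge0.
rewrite /ball/= ger0_norm; last by rewrite subr_ge0 /sn ler_pdivrMr// mulrC.
apply: lt_trans (hN _ Nn); rewrite ltrBlDr /sn.
have -> : n.+1%:R^-1 + (k n z.1)%:R / n.+1%:R = (k n z.1).+1%:R / n.+1%:R :> R.
  by rewrite -(natr1 (k n z.1)) mulrDl mul1r addrC.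
by rewrite ltr_pdivlMr// mulrC.
Qed.

End caratheodory.

(** * Functions and Borel sets on the one-point compactification *)

Section compactification.
Context {R : realType} {d : nat}.
Local Notation E := 'rV[R]_d.
Local Notation ED := (one_point_compactification 'rV[R]_d).

(** Compact support means that the extension vanishes in a neighbourhood of the cemetery point. *)
Lemma ext0_continuous (f : E -> R) : test_fun setT f -> continuous (ext0 f : ED -> R).
Proof.
move=> [cf kf _] [x|] U.
  by move=> hU; have := Ck_continuous (cf 0%N) (x := x); apply.
move=> /= hU; exists (supp f); first by split => //; exact: closed_closure.
by move=> [x|] /=; [case=> [[y ny [<-]]|//]; rewrite /= supp_out//; exact: nbhs_singleton|
  move=> _; exact: nbhs_singleton].
Qed.

Lemma measurable_some (D : set E) : measurable D -> measurable (Some @` D : set ED).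
Proof.
have mT : measurable (Some @` [set: E] : set ED).
  by apply: sub_sigma_algebra; exact: one_point_compactification_open_some openT.
move=> mD; suff : <<s (@open E) >> `<=` [set D | measurable (Some @` D : set ED)] by exact.
apply: smallest_sub => [|U oU]; last first.
  by apply: sub_sigma_algebra; exact: one_point_compactification_open_some.
split => [|U mU|F mF]; first by rewrite /= image_set0.
  rewrite /=; have -> : [set Some x | x in setT `\` U] = Some @` [set: E] `\` Some @` U :> set ED.
    apply/seteqP; split => [_ [x [_ nU] <-]|_ [[x _ <-] nU]].
      by split; [exists x|move=> [y Uy [yx]]; apply: nU; rewrite -yx].
    by exists x => //; split => // Ux; apply: nU; exists x.
  exact: measurableD.
rewrite /= image_bigcup; exact: bigcupT_measurable.
Qed.

End compactification.

(** * Joint measurability of the trajectories *)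

Section trajectories.
Context {R : realType} {d : nat} {dO : measure_display} {Omega : measurableType dO}.
Local Notation E := 'rV[R]_d.
Local Notation ED := (one_point_compactification 'rV[R]_d).
Local Notation TR := (measurableTypeR R).
Context {M : process R d Omega}.
Hypothesis hM : hunt_process M.

Lemma measurable_traj_at (t : R) (D : set ED) : 0 <= t -> measurable D ->
  measurable (traj M t @^-1` D).
Proof. by move=> t0 mD; exact: (filt_measurable hM t0 (traj_adapted hM t0 mD)). Qed.

Lemma ext0_traj_cvg (f : E -> R) (w : Omega) (sn : nat -> R) (s : R) : test_fun setT f ->
  (forall n, 0 <= sn n) -> sn n @[n --> \oo] --> s ->
  ext0 f (traj M (sn n) w) @[n --> \oo] --> ext0 f (traj M s w).
Proof.
move=> tf sn0 sns.
have s0 : 0 <= s.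
  rewrite -(cvg_lim _ sns)//; apply: limr_ge; first by apply: cvgP sns.
  exact: nearW.
have ct : traj M t w @[t --> within [set t : R | 0 <= t] (nbhs s)] --> traj M s w.
  have cw : {within [set t : R | 0 <= t], continuous (fun t => traj M t w)}.
    exact: (traj_continuous hM).
  exact: ((subspace_continuousP _ _).1 cw s s0).
have c2 : ext0 f (traj M t w) @[t --> within [set t : R | 0 <= t] (nbhs s)] --> ext0 f (traj M s w).
  by apply: (cvg_comp _ (ext0 f) ct); exact: ext0_continuous.
apply: (cvg_comp sn (fun t => ext0 f (traj M t w)) _ c2).
move=> B hB; have h : \forall n \near \oo, 0 <= sn n -> B (sn n) by exact: (sns _ hB).
by apply: filterS h => n; apply.
Qed.

Lemma measurable_ext0_test (f : E -> R) : test_fun setT f ->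
  measurable_fun setT (fun z : TR * Omega => ext0 f (traj M `|z.1| z.2)).
Proof.
move=> tf; apply: (measurable_caratheodory (F := fun s w => ext0 f (traj M s w))).
  move=> s s0 _ Y mY; rewrite setTI.
  have -> : (fun w => ext0 f (traj M s w)) @^-1` Y = traj M s @^-1` (ext0 f @^-1` Y) by [].
  apply: measurable_traj_at => //.
  suff : measurable_fun setT (ext0 f : ED -> R) by move=> /(_ measurableT _ mY); rewrite setTI.
  have /continuousP cf := ext0_continuous tf.
  apply: (measurability _ (RGenOpens.measurableE R)) => //.
  move=> _ [_ [a [b ->] <-]]; rewrite setTI; apply: sub_sigma_algebra; apply: cf.
  exact: interval_open.
by move=> w sn s; exact: ext0_traj_cvg.
Qed.

(** For an open set, test functions that are positive exactly on it in the limit reduce the claim to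
    [measurable_ext0_test]; the sets with measurable preimage form a sigma-algebra. *)
Lemma measurable_traj (D : set E) : measurable D ->
  measurable [set z : TR * Omega | (Some @` D) (traj M `|z.1| z.2)].
Proof.
pose pre (D : set E) := [set z : TR * Omega | (Some @` D) (traj M `|z.1| z.2)].
have mo (U : set E) : open U -> measurable (pre U).
  move=> oU; have [phi [tphi p01 pU pN]] := test_fun_approx_open oU.
  have -> : pre U = \bigcup_n ((fun z : TR * Omega => ext0 (phi n) (traj M `|z.1| z.2)) @^-1` `]0, +oo[).
    apply/seteqP; split => [z [x Ux xz]|z [n _]] /=; last first.
      rewrite in_itv/= andbT /ext0 /pre/=; case: (traj M _ _) => [x|]; last by rewrite ltxx.
      move=> px; exists x => //; apply: contrapT => nU.
      by move: px; rewrite pN// ltxx.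
    have : \forall n \near \oo, 0 < phi n x by exact: (cvgr_gt _ (pU x Ux) _ ltr01).
    by move=> [n _ /(_ n (leqnn n)) h]; exists n => //=; rewrite -xz in_itv/= andbT.
  apply: bigcupT_measurable => n; rewrite -[X in measurable X]setTI.
  apply: measurable_ext0_test => //; exact: test_fun_sub (tphi n).
move=> mD; suff : <<s (@open E) >> `<=` [set D | measurable (pre D)] by exact.
apply: smallest_sub => [|U oU]; last exact: mo.
split => [|U mU|F mF].
- rewrite /=; have -> // : pre set0 = set0 by apply/seteqP; split => // z [].
- rewrite /=; have -> : pre (setT `\` U) = pre setT `\` pre U.
    apply/seteqP; split => [z [x [_ nU] xz]|z [[x _ xz] nU]].
      by split; [exists x|rewrite /pre/= -xz => -[y Uy [yx]]; apply: nU; rewrite -yx].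
    by exists x => //; split => // Ux; apply: nU; rewrite /pre/= -xz; exists x.
  by apply: measurableD => //; exact: mo openT.
- rewrite /=; have -> : pre (\bigcup_k F k) = \bigcup_k pre (F k).
    apply/seteqP; split => [z [x [k _ Fx] xz]|z [k _ [x Fx xz]]].
      by exists k => //; exists x.
    by exists x => //; exists k.
  exact: bigcupT_measurable.
Qed.

Definition ext0e (g : E -> \bar R) (y : ED) : \bar R := if y is Some x then g x else 0%E.

Lemma measurable_ext0e (g : E -> \bar R) : measurable_fun setT g ->
  measurable_fun setT (fun z : TR * Omega => ext0e g (traj M `|z.1| z.2)).
Proof.
move=> mg _ Y mY; rewrite setTI.
pose pre (D : set E) := [set z : TR * Omega | (Some @` D) (traj M `|z.1| z.2)].
have mpg : measurable (g @^-1` Y) by rewrite -[X in measurable X]setTI; exact: mg.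
have -> : (fun z : TR * Omega => ext0e g (traj M `|z.1| z.2)) @^-1` Y =
    pre (g @^-1` Y) `|` ((~` pre setT) `&` [set z | Y 0%E]).
  apply/seteqP; split => z /=; rewrite /pre /ext0e/=; case E1: (traj M _ _) => [x|].
  - by move=> Yg; left; exists x.
  - by move=> Y0; right; split => // -[].
  - by case=> [[y Yy [<-]]//|[nx _]]; case: nx; exists x.
  - by case=> [[]//|[]].
apply: measurableU; first exact: measurable_traj.
apply: measurableI; first by apply: measurableC; exact: measurable_traj.
have [Y0|nY] := pselect (Y 0%E); first by have -> : [set _ | Y 0%E] = setT :> set (TR * Omega) by apply/seteqP; split.
by have -> : [set _ | Y 0%E] = set0 :> set (TR * Omega) by apply/seteqP; split.
Qed.

Lemma measurable_ext0e_at (t : R) (g : E -> \bar R) : 0 <= t -> measurable_fun setT g ->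
  measurable_fun setT (fun w => ext0e g (traj M t w)).
Proof.
move=> t0 mg; have mp : measurable_fun setT (fun w : Omega => ((t : TR), w)) by exact: measurable_pair1.
by have := measurableT_comp (measurable_ext0e mg) mp; rewrite /comp/= ger0_norm.
Qed.

End trajectories.

(** * Transition operators on nonnegative functions *)

Section transition.
Context {R : realType} {d : nat} {dO : measure_display} {Omega : measurableType dO}.
Local Notation E := 'rV[R]_d.
Local Notation ED := (one_point_compactification 'rV[R]_d).
Local Notation TR := (measurableTypeR R).
Context {M : process R d Omega} {mu : {measure set E -> \bar R}}
  {S P : R -> (E -> R) -> E -> R}.
Hypothesis hM : hunt_process M.
Hypothesis hP : transition_function M P.
Hypothesis hS : subMarkov_C0_contractions mu S.
Hypothesis hV : continuous_version mu S P.
Local Open Scope ereal_scope.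

(** The operator P_s on functions with values in [0, +oo], written as an expectation so that
    monotone limits are available; [transitionE] links it with [P]. *)
Definition transition (s : R) (g : E -> \bar R) (x : E) : \bar R :=
  \int[law M (Some x)]_w ext0e g (traj M s w).

Lemma ext0e_ge0 (g : E -> \bar R) y : (forall x, 0 <= g x) -> 0 <= ext0e g y.
Proof. by case: y => //=. Qed.

Lemma transition_ge0 s g x : (forall x, 0 <= g x) -> 0 <= transition s g x.
Proof. by move=> g0; apply: integral_ge0 => w _; exact: ext0e_ge0. Qed.

Lemma transitionE s (f : E -> R) x : (0 <= s)%R -> measurable_fun setT f ->
  (exists K : R, forall y, (`|f y| <= K)%R) -> transition s (EFin \o f) x = (P s f x)%:E.
Proof.
move=> s0 mf bf; rewrite -(hP x s0 mf bf) unlock; apply: eq_integral => w _.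
by case: (traj M s w).
Qed.

Lemma transitionD s g h x : (0 <= s)%R -> measurable_fun setT g -> measurable_fun setT h ->
  (forall x, 0 <= g x) -> (forall x, 0 <= h x) ->
  transition s (fun y => g y + h y) x = transition s g x + transition s h x.
Proof.
move=> s0 mg mh g0 h0; rewrite /transition -ge0_integralD//; last 4 first.
- by move=> w _; exact: ext0e_ge0.
- exact: measurable_ext0e_at.
- by move=> w _; exact: ext0e_ge0.
- exact: measurable_ext0e_at.
by apply: eq_integral => w _; case: (traj M s w) => //=; rewrite adde0.
Qed.

Lemma transitionZ s (k : R) g x : (0 <= s)%R -> (0 <= k)%R -> measurable_fun setT g ->
  (forall x, 0 <= g x) -> transition s (fun y => k%:E * g y) x = k%:E * transition s g x.
Proof.
move=> s0 k0 mg g0; rewrite /transition -ge0_integralZl//; last 2 first.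
- exact: measurable_ext0e_at.
- by move=> w _; exact: ext0e_ge0.
by apply: eq_integral => w _; case: (traj M s w) => //=; rewrite mule0.
Qed.

Lemma transition_cvg s (gn : (E -> \bar R)^nat) g x : (0 <= s)%R ->
  (forall n, measurable_fun setT (gn n)) -> (forall n y, 0 <= gn n y) ->
  (forall y, {homo gn^~ y : n m / (n <= m)%N >-> n <= m}) ->
  (forall y, gn n y @[n --> \oo] --> g y) ->
  transition s (gn n) x @[n --> \oo] --> transition s g x.
Proof.
move=> s0 mg g0 nd cg.
have -> : transition s g x = \int[law M (Some x)]_w limn (fun n => ext0e (gn n) (traj M s w)).
  apply: eq_integral => w _; case: (traj M s w) => [y|] /=; first by apply/esym/cvg_lim.
  by rewrite lim_cst.
apply: cvg_monotone_convergence => //.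
- by move=> n; exact: measurable_ext0e_at.
- by move=> n w _; exact: ext0e_ge0.
- by move=> w _ n m nm; case: (traj M s w) => //= y; exact: nd.
Qed.

Lemma transition_indic s D x : (0 <= s)%R -> measurable D ->
  transition s (fun y => (\1_D y)%:E) x = law M (Some x) (traj M s @^-1` (Some @` D)).
Proof.
move=> s0 mD; have mp : measurable (traj M s @^-1` (Some @` D)).
  by apply: (measurable_traj_at hM s0); exact: measurable_some.
transitivity (\int[law M (Some x)]_w (\1_(traj M s @^-1` (Some @` D)) w : R)%:E); last first.
  by rewrite integral_indic// setIT.
apply: eq_integral => w _.
rewrite indicE; case E1 : (traj M s w) => [y|] /=.
  rewrite indicE; congr (_%:R%:E); have [Dy|nD] := pselect (D y).
    by rewrite !mem_set//=; exists y.
  by rewrite !memNset//= E1 => -[z Dz [zy]]; apply: nD; rewrite -zy.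
by rewrite memNset//= E1 => -[].
Qed.

Lemma inLy_bounded (f : E -> R) : measurable_fun setT f -> (exists K : R, forall y, (`|f y| <= K)%R) ->
  inL mu +oo setT f.
Proof.
move=> mf [K hK]; rewrite /inL patch_setT inE; apply/andP; split; rewrite inE//=.
rewrite /finite_norm unlock /Lnorm; case: ifP => // _; apply: (@le_lt_trans _ _ K%:E); last exact: ltry.
by apply/ess_sup_inf.ess_supP; apply: nearW => y; rewrite /= lee_fin.
Qed.

Lemma transition_test_cvg (f : E -> R) x (sn : nat -> R) s : test_fun setT f ->
  (forall n, (0 <= sn n)%R) -> sn n @[n --> \oo] --> s ->
  P (sn n) f x @[n --> \oo] --> P s f x.
Proof.
move=> tf sn0 sns; have [mf bf _] := test_fun_bcs tf; have [K hK] := bf.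
have s0 : (0 <= s)%R.
  rewrite -(cvg_lim _ sns)//; apply: limr_ge; first by apply: cvgP sns.
  exact: nearW.
have PE t : (0 <= t)%R -> (P t f x = \int[law M (Some x)]_w ext0 f (traj M t w))%R.
  move=> t0; have := hP x t0 mf bf; rewrite unlock => /(congr1 fine) /= <-.
  by [].
rewrite PE//; under eq_fun do rewrite PE//.
have mt t : (0 <= t)%R -> measurable_fun setT (fun w => ext0 f (traj M t w)).
  move=> t0; apply/measurable_EFinP.
  have := @measurable_ext0e_at _ _ _ _ _ hM t (EFin \o f) t0 ((measurable_EFinP _ _).2 mf).
  by congr (measurable_fun _ _); apply/funext => w; rewrite /=; case: (traj M t w).
have K0 : (0 <= K)%R by exact: le_trans (normr_ge0 _) (hK x).
apply: (proj2 (@Int_dominated_cvg _ _ _ _ (fun n w => ext0 f (traj M (sn n) w)) _ (fun=> K) _ _ _ _ _)).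
- by move=> n; exact: mt.
- exact: mt.
- by apply: nearW => w; exact: ext0_traj_cvg.
- by apply: finite_measure_integrable_cst.
- by move=> n w; case: (traj M (sn n) w) => //=; rewrite normr0.
Qed.

(** In space P_s f is continuous, being a continuous version for s > 0 and f itself for s = 0; in
    time it is continuous by dominated convergence along the continuous paths. So
    [measurable_caratheodory] applies. *)
Lemma measurable_transition_test (f : E -> R) : test_fun setT f ->
  measurable_fun setT (fun z : TR * E => transition `|z.1|%R (EFin \o f) z.2).
Proof.
move=> tf; have [mf bf _] := test_fun_bcs tf.
under eq_fun do rewrite (transitionE _ _ mf bf)//.
apply/measurable_EFinP; apply: (measurable_caratheodory (F := fun s x => P s f x)).
  move=> s; rewrite le_eqVlt => /predU1P[<-|s0].
    by rewrite (hV.1 f).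
  apply: continuous_measurable_rV; apply: (hV.2 +oo s f _ s0 _).1 => //.
  - by rewrite leey.
  - exact: inLy_bounded.
by move=> y sn s; exact: transition_test_cvg.
Qed.

(** Open sets are limits of test functions; the Dynkin argument then reaches all Borel sets,
    complements being handled by subtraction from the survival probability. *)
Lemma measurable_transition_indic (D : set E) : measurable D ->
  measurable_fun setT (fun z : TR * E => transition `|z.1|%R (fun y => (\1_D y)%:E) z.2).
Proof.
pose Q (D : set E) (z : TR * E) : \bar R :=
  law M (Some z.2) (traj M `|z.1|%R @^-1` (Some @` D)).
have QE U : measurable U -> (fun z : TR * E => transition `|z.1|%R (fun y => (\1_U y)%:E) z.2) = Q U.
  by move=> mU; apply/funext => z; rewrite transition_indic.
have mpre (z : TR * E) U : measurable U -> measurable (traj M `|z.1|%R @^-1` (Some @` U)).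
  by move=> mU; apply: (measurable_traj_at hM) => //; exact: measurable_some.
have mo U : open U -> measurable_fun setT (Q U).
  move=> oU; have mU := measurable_open_rV oU; rewrite -QE//.
  have [phi [tphi p01 pU pN]] := test_fun_approx_open oU.
  apply: (emeasurable_fun_cvg (fun n (z : TR * E) => transition `|z.1|%R (EFin \o phi n) z.2)).
    by move=> n; apply: measurable_transition_test; exact: test_fun_sub (tphi n).
  move=> z _; have mt g : measurable_fun setT g -> measurable_fun setT (fun w => ext0e g (traj M `|z.1|%R w)).
    exact: measurable_ext0e_at.
  have [] := @dominated_convergence _ _ _ (law M (Some z.2)) setT measurableT
    (fun n w => ext0e (EFin \o phi n) (traj M `|z.1|%R w))
    (fun w => ext0e (fun y => (\1_U y)%:E) (traj M `|z.1|%R w)) (fun=> 1%:E).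
  - move=> n; apply: mt; apply/measurable_EFinP.
    by have [] := test_fun_bcs (test_fun_sub (@subsetT _ U) (tphi n)).
  - by apply: mt; apply/measurable_EFinP; exact: measurable_indic.
  - apply: nearW => w _; case: (traj M _ w) => [y|] /=; last exact: cvg_cst.
    apply: cvg_EFin; first exact: nearW.
    rewrite indicE; have [Uy|nU] := pselect (U y).
      by rewrite mem_set//; exact: pU.
    by rewrite memNset//; under eq_fun do rewrite /= pN//; exact: cvg_cst.
  - exact: finite_measure_integrable_cst.
  - apply: nearW => w n _; case: (traj M _ w) => [y|] /=; last by rewrite normr0 lee_fin.
    by have /andP[h1 h2] := p01 n y; rewrite lee_fin ger0_norm.
  by move=> _ _.
move=> mD; rewrite QE//; move: D mD; apply: (@dynkin_induction _ _ (@open E)) => //.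
- by move=> U V oU oV; exact: openI.
- exact: mo openT.
- move=> U mU hU; have -> : Q (~` U) = fun z => Q setT z - Q U z.
    apply/funext => z; have fT : law M (Some z.2) (traj M `|z.1|%R @^-1` (Some @` setT)) < +oo.
      exact: (le_lt_trans (probability_le1 _ (mpre z _ measurableT)) (ltry _)).
    have := measureD (mpre z _ measurableT) (mpre z _ mU) fT.
    rewrite setIidr => [<-|w [y _ yw]]; last by exists y.
    congr (law M _ _); apply/seteqP; split => w /=.
      move=> [y nU yw]; split; first by exists y.
      by rewrite -yw => -[y' Uy [e]]; apply: nU; rewrite -e.
    by move=> [[y _ yw] nU]; exists y => // Uy; apply: nU; exists y.
  by apply: emeasurable_funB => //; exact: mo openT.
- move=> F mF tF hF; have -> : Q (\bigcup_k F k) = fun z => \sum_(k <oo) Q (F k) z.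
    apply/funext => z; rewrite /Q.
    have -> : traj M `|z.1|%R @^-1` (Some @` (\bigcup_k F k)) =
        \bigcup_k (traj M `|z.1|%R @^-1` (Some @` (F k))).
      by rewrite image_bigcup preimage_bigcup.
    have tG : trivIset setT (fun k => traj M `|z.1|%R @^-1` (Some @` (F k))).
      apply/trivIsetP => i j _ _ ij; apply/seteqP; split => // w [[y Fy yw] [y' Fy' yw']].
      move/trivIsetP : tF => /(_ i j Logic.I Logic.I ij) /seteqP[h _]; apply: (h y); split => //.
      by move: yw'; rewrite -yw => -[<-].
    apply: measure_semi_bigcup => // [k|]; first exact: mpre.
    by apply: bigcupT_measurable => k; exact: mpre.
  by apply: ge0_emeasurable_sum.
Qed.


Lemma measurable_transition (g : E -> \bar R) : measurable_fun setT g -> (forall x, 0 <= g x) ->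
  measurable_fun setT (fun z : TR * E => transition `|z.1|%R g z.2).
Proof.
move=> mg g0; move: g mg g0; apply: ge0_measurable_ind.
- exact: measurable_transition_indic.
- move=> k g k0 mg g0 h; under eq_fun do rewrite transitionZ//.
  exact: measurable_funeM.
- move=> g1 g2 m1 m2 p1 p2 h1 h2; under eq_fun do rewrite transitionD//.
  exact: emeasurable_funD.
- move=> gn g mg g0 nd cg h.
  apply: (emeasurable_fun_cvg (fun n (z : TR * E) => transition `|z.1|%R (gn n) z.2)) => //.
  by move=> z _; exact: transition_cvg.
Qed.

Lemma measurable_transition_at (s : R) (g : E -> \bar R) : (0 <= s)%R -> measurable_fun setT g ->
  (forall x, 0 <= g x) -> measurable_fun setT (transition s g).
Proof.
move=> s0 mg g0; have mp : measurable_fun setT (fun x : E => ((s : TR), x)) by exact: measurable_pair1.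
by have := measurableT_comp (measurable_transition mg g0) mp; rewrite /comp/= ger0_norm.
Qed.

(** For indicators this is the strong Markov property at the constant stopping time t; linearity and
    monotone limits do the rest. *)
Lemma transition_semigroup (t s : R) (g : E -> \bar R) x : (0 <= t)%R -> (0 <= s)%R ->
  measurable_fun setT g -> (forall x, 0 <= g x) ->
  transition (t + s) g x = transition t (transition s g) x.
Proof.
move=> t0 s0 mg g0; have ts0 : (0 <= t + s)%R by exact: addr_ge0.
move: g mg g0; apply: ge0_measurable_ind.
- move=> D mD; rewrite transition_indic//.
  have st : stopping_time M (fun=> t%:E).
    split => [w|r r0]; first by rewrite lee_fin.
    have [F0 FD _] := filt_sigma hM r0; have [tr|rt] := leP t r.
      have -> : [set w : Omega | (t%:E <= r%:E)] = setT by apply/seteqP; split => // w _ /=; rewrite lee_fin.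
      by have := FD _ F0; rewrite setD0.
    have -> : [set w : Omega | (t%:E <= r%:E)] = set0; last by [].
    by apply/seteqP; split => // w /=; rewrite lee_fin leNgt rt.
  have sE : stopped_events M (fun=> t%:E) setT.
    by split => // r r0; rewrite setTI; exact: st.2.
  have mSD : measurable (Some @` D : set ED) by exact: measurable_some.
  have := strong_markov hM (Some x) st s0 sE mSD; rewrite !setTI.
  have -> : [set w : Omega | t%:E < +oo /\ (Some @` D) (traj M (fine t%:E + s) w)] =
    traj M (t + s) @^-1` (Some @` D) by apply/seteqP; split => [w []//|w h]; split; rewrite ?ltry.
  have -> : [set w : Omega | t%:E < +oo] = setT by apply/seteqP; split => // w _ /=; rewrite ltry.
  move=> ->; apply: eq_integral => w _ /=; case E1 : (traj M t w) => [y|] /=.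
    by rewrite transition_indic.
  (* the cemetery is absorbing *)
  have m0 : measurable [set w | traj M 0 w = None].
    have -> : [set w | traj M 0 w = None] = ~` (traj M 0 @^-1` (Some @` setT)).
      apply/seteqP; split => v /=; first by move=> -> [].
      by case: (traj M 0 v) => // y; case; exists y.
    by apply: measurableC; apply: (measurable_traj_at hM) => //; exact: measurable_some.
  have ms := measurable_traj_at hM s0 mSD.
  apply/eqP; rewrite eq_le measure_ge0 andbT.
  have n1 := law_start hM None.
  have n2 : law M None (~` [set w | traj M 0 w = None]) = 0 by rewrite probability_setC// n1 subee.
  rewrite -n2; apply: le_measure; rewrite ?inE//; first exact: measurableC.
  by move=> v /= [y Dy yv] v0; move: yv; rewrite (traj_absorbed hM _ s0 v0).
- move=> k g k0 mg g0 h.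
  have e1 := transitionZ x ts0 k0 mg g0.
  have e2 := transitionZ x t0 k0 (measurable_transition_at s0 mg g0) (fun y => transition_ge0 s y g0).
  apply: (etrans e1); rewrite h; apply: (etrans (esym e2)).
  apply: eq_integral => w _; case: (traj M t w) => //= y.
  exact: esym (transitionZ y s0 k0 mg g0).
- move=> g1 g2 m1 m2 p1 p2 h1 h2.
  have e1 := transitionD x ts0 m1 m2 p1 p2.
  have e2 := transitionD x t0 (measurable_transition_at s0 m1 p1) (measurable_transition_at s0 m2 p2)
    (fun y => transition_ge0 s y p1) (fun y => transition_ge0 s y p2).
  apply: (etrans e1); rewrite h1 h2; apply: (etrans (esym e2)).
  apply: eq_integral => w _; case: (traj M t w) => //= y.
  exact: esym (transitionD y s0 m1 m2 p1 p2).
- move=> gn g mg g0 nd cg h.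
  have c1 : transition (t + s) (gn n) x @[n --> \oo] --> transition (t + s) g x by exact: transition_cvg.
  have c2 : transition t (transition s (gn n)) x @[n --> \oo] --> transition t (transition s g) x.
    apply: transition_cvg => //.
    + by move=> n; exact: measurable_transition_at.
    + by move=> n y; exact: transition_ge0.
    + move=> y n m nm; apply: ge0_le_integral => //.
      * by move=> w _; exact: ext0e_ge0.
      * exact: measurable_ext0e_at.
      * exact: measurable_ext0e_at.
      * by move=> w _; case: (traj M s w) => //= z; exact: nd.
    + by move=> y; exact: transition_cvg.
  rewrite -(cvg_lim (@ereal_hausdorff R) c1) -(cvg_lim (@ereal_hausdorff R) c2).
  by congr (lim (_ @ \oo)); apply/funext => n; exact: h.
Qed.

End transition.

Section sigma_finite_density.
Context {R : realType} {d : nat}.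
Local Notation E := 'rV[R]_d.
Context {p : R} {A C : E -> 'M[R]_d} {H : E -> E} {rho : E -> R}
  {mu : {measure set E -> \bar R}}.
Hypothesis hrho : invariant_density p A (drift A C H) rho mu.

Lemma mu_sigma_finite : sigma_finite setT mu.
Proof.
exists (fun n => [set x : E | sqd 0 x <= n%:R]).
  apply/esym/seteqP; split => // x _; exists (Num.trunc (sqd 0 x)).+1 => //=.
  by apply/ltW/truncnS_gt.
move=> n; have cK := @sqd_compact R d 0 n%:R; have mK := measurable_compact_rV cK.
split => //; have [kap _ h] := mu_leb_compact hrho cK.
have mi : measurable_fun setT (\1_[set x : E | sqd 0 x <= n%:R] : E -> R) by exact: measurable_indic.
have [i1 _] := Int_indic cK mK (@subset_refl _ _).
have [i2 _] := (h _ mi (fun x => ler0n _ _) (fun x nK => congr1 (fun b : bool => b%:R) (memNset nK))).2 i1.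
have /integrableP[_] := i2.
under eq_integral do rewrite /= ger0_norm ?indicE//.
by under eq_integral do rewrite -indicE; rewrite integral_indic// setIT.
Qed.

End sigma_finite_density.

Lemma expR_le_quadratic {R : realType} (t : R) : 0 < t -> t <= 2^-1 ->
  expR t <= 1 + t + 2 * t ^+ 2.
Proof.
move=> t0 th; have t1 : 0 < 1 - t by rewrite subr_gt0 (le_lt_trans th)// invf_lt1// ltr1n.
have h := expR_ge1Dx (- t); rewrite expRN in h.
have h2 : expR t <= (1 - t)^-1 by rewrite -[leLHS]invrK lef_pV2// posrE invr_gt0 expR_gt0.
apply: le_trans h2 _; rewrite -[leLHS]mul1r ler_pdivrMr//.
by nra.
Qed.

Lemma expR_sub1_le {R : realType} (t : R) : 0 < t -> t <= 2^-1 -> expR t - 1 <= 2 * t.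
Proof.
have alg (a r : R) : 0 < r -> r <= 2^-1 -> a <= 1 + r + 2 * r ^+ 2 -> a - 1 <= 2 * r by nra.
by move=> t0 th; apply: alg => //; exact: expR_le_quadratic.
Qed.

Lemma expR_slope_le {R : realType} (t : R) : 0 < t -> t <= 2^-1 ->
  t^-1 * (expR t - 1) - 1 <= 2 * t.
Proof.
move=> t0 th; rewrite lerBlDr ler_pdivrMl//.
have alg (a r : R) : a <= 1 + r + 2 * r ^+ 2 -> a - 1 <= r * (2 * r + 1) by lra.
by apply: alg; exact: expR_le_quadratic.
Qed.

Section fubini_sigma_finite.
Context {R : realType} d1 d2 (T1 : measurableType d1) (T2 : measurableType d2).
Variables (m1 : {sigma_finite_measure set T1 -> \bar R}) (m2 : {measure set T2 -> \bar R}).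
Hypothesis m2_sf : sigma_finite setT m2.
Local Open Scope ereal_scope.

(** A local copy of the measure, to which sigma-finiteness can be attached as a structure; mu is
    given only as a measure. *)
Let m2' : set T2 -> \bar R := m2.
HB.instance Definition _ := Measure.on m2'.
HB.instance Definition _ := Measure_isSigmaFinite.Build _ _ _ m2' m2_sf.

Lemma fubini_sigma_finite (h : T1 * T2 -> \bar R) : measurable_fun setT h ->
  (forall z, 0 <= h z) ->
  \int[m1]_s \int[m2]_x h (s, x) = \int[m2]_x \int[m1]_s h (s, x).
Proof. by move=> mh h0; exact: (@fubini_tonelli _ _ _ _ _ m1 m2' h mh h0). Qed.

Lemma measurable_integral_sigma_finite (h : T1 * T2 -> \bar R) : measurable_fun setT h ->
  (forall z, 0 <= h z) -> measurable_fun setT (fun s => \int[m2]_x h (s, x)).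
Proof. by move=> mh h0; exact: (@measurable_fun_fubini_tonelli_F _ _ _ _ _ m2' h mh h0). Qed.

End fubini_sigma_finite.

(** * The potential of a bounded integrable function *)

Section potential.
Context {R : realType} {d : nat} {dO : measure_display} {Omega : measurableType dO}.
Local Notation E := 'rV[R]_d.
Local Notation TR := (measurableTypeR R).
Local Notation leb1 := (@lebesgue_measure R).
Context {M : process R d Omega} {mu : {measure set E -> \bar R}}
  {S P : R -> (E -> R) -> E -> R}.
Hypothesis hM : hunt_process M.
Hypothesis hP : transition_function M P.
Hypothesis hS : subMarkov_C0_contractions mu S.
Hypothesis hV : continuous_version mu S P.
Hypothesis hsf : sigma_finite setT mu.
Local Notation transition := (@transition R d dO Omega M).
Local Open Scope ereal_scope.

Lemma distL1E (f g : E -> R) : distL mu 1 setT f g = \int[mu]_x (`|f x - g x|)%:E.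
Proof.
by rewrite /distL Lnorm1; apply: eq_integral => x _; rewrite /= patch_setT.
Qed.

Lemma inL1P (f : E -> R) : inL mu 1 setT f <-> mu.-integrable setT (EFin \o f).
Proof. by rewrite /inL patch_setT; exact: Lfun1_integrable. Qed.

(** The extension to L^1 provides only some approximating sequence whose images converge to P_s f;
    contractivity of S_s forces that limit to be S_s f. *)
Lemma version_ae (s : R) f : (0 < s)%R -> inL mu 1 setT f ->
  \forall x \ae mu, P s f x = S s f x.
Proof.
move=> s0 Lf; have [_ [_ [LP [fn [Lfn c1 c2]]]]] := hV.2 1 s f (lexx _) s0 Lf.
have LS : inL mu 1 setT (S s f) := S_L1 hS s0 Lf.
have LSn n : inL mu 1 setT (S s (fn n)) := S_L1 hS s0 (Lfn n).1.
have i0 : integ mu (P s f) := (inL1P _).1 LP.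
have i1 : integ mu (S s f) := (inL1P _).1 LS.
have i2 n : integ mu (S s (fn n)) := (inL1P _).1 (LSn n).
have i3 n : integ mu (fn n) := (inL1P _).1 (Lfn n).1.
have i4 : integ mu f := (inL1P _).1 Lf.
have h n : distL mu 1 setT (P s f) (S s f) <= distL mu 1 setT (S s (fn n)) (P s f) + distL mu 1 setT (fn n) f.
  have c : distL mu 1 setT (S s (fn n)) (S s f) <= distL mu 1 setT (fn n) f.
    have Lg : inL mu 1 setT (fun x => fn n x - f x)%R by apply/inL1P; exact: integB.
    have := S_contraction hS s0 Lg; rewrite 2!Lnorm1 2!distL1E; apply: le_trans.
    rewrite le_eqVlt; apply/orP; left; apply/eqP; apply: ae_eq_integral => //.
    - by apply/measurable_EFinP; apply: measurableT_comp => //; exact: integ_measurable (integB (i2 n) i1).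
    - apply: measurableT_comp => //; have /measurable_int := (inL1P _).1 (S_L1 hS s0 Lg).
      by [].
    have := S_linear hS (-1) s0 Lf (Lfn n).1.
    have e : (fun y => -1 * f y + fn n y)%R = (fun x => fn n x - f x)%R.
      by apply/funext => y; rewrite mulN1r addrC.
    by rewrite e; apply: filterS => x e2 _; rewrite /= e2 mulN1r addrC.
  apply: le_trans (leeD2l _ c); rewrite !distL1E -ge0_integralD//; last 2 first.
  - by apply/measurable_EFinP; apply: measurableT_comp => //; exact: integ_measurable (integB (i2 n) i0).
  - by apply/measurable_EFinP; apply: measurableT_comp => //; exact: integ_measurable (integB (i2 n) i1).
  apply: ge0_le_integral => //.
  - by apply/measurable_EFinP; apply: measurableT_comp => //; exact: integ_measurable (integB i0 i1).
  - apply: emeasurable_funD; apply/measurable_EFinP; apply: measurableT_comp => //.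
      exact: integ_measurable (integB (i2 n) i0).
    exact: integ_measurable (integB (i2 n) i1).
  by move=> x _; rewrite -EFinD lee_fin (distrC (S s (fn n) x) (P s f x)) ler_distD.
have d0 : distL mu 1 setT (P s f) (S s f) = 0.
  apply/eqP; rewrite eq_le; apply/andP; split; last by rewrite distL1E integral_ge0.
  have := cvgeD (F := \oo) (isT : 0 +? (0 : \bar R)) c2 c1; rewrite adde0 => c.
  rewrite -(cvg_lim (@ereal_hausdorff R) (c _)); apply: lime_ge; first by apply: cvgP (c _).
  exact: nearW.
have mD : measurable_fun setT (fun x => P s f x - S s f x)%R by exact: integ_measurable (integB i0 i1).
move: d0; rewrite distL1E => d0.
have [+ _] := ae_eq_integral_abs mu measurableT ((measurable_EFinP _ _).2 mD).
by move=> /(_ d0); apply: filterS => x /(_ Logic.I) [] /eqP; rewrite subr_eq0 => /eqP.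
Qed.

Section bounded_function.
Variables (f : E -> R) (K : R).
Hypothesis mf : measurable_fun setT f.
Hypothesis f0 : forall x, (0 <= f x)%R.
Hypothesis fK : forall x, (f x <= K)%R.
Hypothesis f1 : integ mu f.

Let F : E -> \bar R := EFin \o f.
Let F0 x : 0 <= F x. Proof. by rewrite lee_fin. Qed.
Let mF : measurable_fun setT F. Proof. exact/measurable_EFinP. Qed.
Let K0 : (0 <= K)%R. Proof. exact: le_trans (f0 0) (fK 0). Qed.
Let bf : exists c : R, forall y, (`|f y| <= c)%R.
Proof. by exists K => y; rewrite ger0_norm. Qed.
Let Lf : inL mu 1 setT f. Proof. exact/inL1P. Qed.

Let Lp (s : R) : (0 < s)%R -> inL mu 1 setT (P s f).
Proof. by move=> s0; have [_ [_ []]] := hV.2 1 s f (lexx _) s0 Lf. Qed.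

Lemma transition_le s x : (0 <= s)%R -> transition s F x <= K%:E.
Proof.
move=> s0; apply: (@le_trans _ _ (\int[law M (Some x)]_w (cst K%:E w))).
  apply: ge0_le_integral => //.
  - by move=> w _; exact: ext0e_ge0.
  - exact: measurable_ext0e_at.
  - by move=> w _; case: (traj M s w) => [y|] /=; rewrite lee_fin.
rewrite integral_cst// [X in _ * X](_ : _ = 1) ?mule1//; exact: probability_setT.
Qed.

Lemma transition_integral_le (s : R) : (0 < s)%R -> \int[mu]_x transition s F x <= \int[mu]_x F x.
Proof.
move=> s0; have h := version_ae s0 Lf; have := S_contraction hS s0 Lf; rewrite !Lnorm1.
under [X in _ <= X -> _]eq_integral do rewrite /= ger0_norm//.
apply: le_trans; rewrite le_eqVlt; apply/orP; left; apply/eqP; apply: ae_eq_integral => //.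
- exact: (measurable_transition_at hM hP hV (ltW s0) mF F0).
- by apply: measurableT_comp => //; have /measurable_int := (inL1P _).1 (S_L1 hS s0 Lf).
apply: filterS h => x h _; rewrite /F (transitionE hP x (ltW s0) mf bf) /= -h ger0_norm//.
by rewrite -lee_fin -(transitionE hP x (ltW s0) mf bf); exact: transition_ge0.
Qed.

(** Cut to 0 on s <= 0, so that time integrals run over the whole line and translation invariance
    applies to them. *)
Definition decay (s : R) : R := (if 0 < s then expR (- s) else 0)%R.

Lemma decay_ge0 s : (0 <= decay s)%R.
Proof. by rewrite /decay; case: ifP => // _; exact: expR_ge0. Qed.

Lemma measurable_decay : measurable_fun setT (decay : TR -> R).
Proof.
apply: measurable_fun_ifT => //.
  by apply: measurable_fun_ltr.
by apply: measurableT_comp => //; exact: measurable_expR.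
Qed.

Lemma measurable_decayE : measurable_fun setT (fun s : TR => (decay s)%:E).
Proof. by apply/measurable_EFinP; exact: measurable_decay. Qed.

Lemma integral_decay_le : \int[leb1]_s (decay s)%:E <= 1.
Proof.
rewrite -(@integral_exponential_pdf R 1)//; apply: ge0_le_integral => //.
- by move=> s _; rewrite lee_fin decay_ge0.
- exact: measurable_decayE.
- by apply/measurable_EFinP; exact: measurable_exponential_pdf.
- move=> s _; rewrite lee_fin /decay; case: ifP => [s0|_].
    by rewrite (exponential_pdfE 1 (ltW s0)) mul1r mulN1r.
  exact: exponential_pdf_ge0.
Qed.

Definition potential (x : E) : \bar R := \int[leb1]_s ((decay s)%:E * transition `|s|%R F x).

Let mT : measurable_fun setT (fun z : TR * E => transition `|z.1|%R F z.2).
Proof. exact: (measurable_transition hM hP hV mF F0). Qed.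

Let mk : measurable_fun setT (fun z : TR * E => (decay z.1)%:E * transition `|z.1|%R F z.2).
Proof.
apply: emeasurable_funM => //.
by apply: (measurableT_comp measurable_decayE); exact: measurable_fst.
Qed.

Let k0 (z : TR * E) : 0 <= (decay z.1)%:E * transition `|z.1|%R F z.2.
Proof. by rewrite mule_ge0 ?lee_fin ?decay_ge0//; exact: transition_ge0. Qed.

Lemma potential_ge0 x : 0 <= potential x.
Proof. by apply: integral_ge0 => s _; exact: k0 (s, x). Qed.

Lemma potential_le x : potential x <= K%:E.
Proof.
apply: (@le_trans _ _ (\int[leb1]_s ((decay s)%:E * K%:E))).
  apply: ge0_le_integral => //.
  - by move=> s _; exact: k0 (s, x).
  - exact: (measurableT_comp mk (measurable_pair2 x)).
  - by apply/measurable_EFinP; apply: measurable_funM => //; exact: measurable_decay.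
  - by move=> s _; rewrite lee_wpmul2l ?lee_fin ?decay_ge0//; exact: transition_le.
rewrite ge0_integralZr//.
- by rewrite -[leRHS]mul1e lee_wpmul2r ?lee_fin//; exact: integral_decay_le.
- exact: measurable_decayE.
- by move=> s _; rewrite lee_fin decay_ge0.
Qed.

Lemma measurable_potential : measurable_fun setT potential.
Proof.
have := @measurable_fun_fubini_tonelli_G _ _ _ _ _ leb1 _ mk k0.
by [].
Qed.

Lemma potential_integral_le : \int[mu]_x potential x <= \int[mu]_x F x.
Proof.
rewrite /potential -(@fubini_sigma_finite _ _ _ _ _ leb1 mu hsf _ mk k0).
apply: (@le_trans _ _ (\int[leb1]_s ((decay s)%:E * \int[mu]_x F x))).
  apply: ge0_le_integral => //.
  - by move=> s _; apply: integral_ge0 => x _; exact: k0 (s, x).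
  - exact: (measurable_integral_sigma_finite hsf mk k0).
  - by apply: emeasurable_funM => //; exact: measurable_decayE.
  - move=> s _ /=; rewrite /decay; case: ifPn => [s0|_]; last first.
      by under eq_integral do rewrite mul0e; rewrite integral0 mul0e.
    rewrite ge0_integralZl ?lee_fin ?expR_ge0//.
    + by rewrite lee_wpmul2l ?lee_fin ?expR_ge0// gtr0_norm// transition_integral_le.
    + by apply: (measurable_transition_at hM hP hV _ mF F0).
    + by move=> x _; exact: transition_ge0.
have F1 : 0 <= \int[mu]_x F x by exact: integral_ge0.
rewrite ge0_integralZr//.
- by rewrite -[leRHS]mul1e lee_wpmul2r//; exact: integral_decay_le.
- exact: measurable_decayE.
- by move=> s _; rewrite lee_fin decay_ge0.
Qed.

Definition upotential (x : E) : R := fine (potential x).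
Local Notation u := upotential.

Lemma upotentialE x : (u x)%:E = potential x.
Proof.
rewrite fineK// ge0_fin_numE ?potential_ge0//.
exact: le_lt_trans (potential_le x) (ltry _).
Qed.

Lemma upotential_ge0 x : (0 <= u x)%R.
Proof. by rewrite -lee_fin upotentialE potential_ge0. Qed.

Lemma upotential_le x : (u x <= K)%R.
Proof. by rewrite -lee_fin upotentialE potential_le. Qed.

Lemma measurable_upotential : measurable_fun setT (EFin \o u).
Proof.
rewrite (_ : EFin \o u = potential); first exact: measurable_potential.
by apply/funext => x; rewrite /= upotentialE.
Qed.

Lemma integ_upotential : integ mu u.
Proof.
apply/integrableP; split; first exact: measurable_upotential.
under eq_integral do rewrite /= ger0_norm ?upotential_ge0// upotentialE.
apply: le_lt_trans potential_integral_le _.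
have /integrableP[_] := f1; apply: le_lt_trans; apply: ge0_le_integral => //.
  exact: measurableT_comp.
by move=> x _; rewrite lee_fin ler_norm.
Qed.

Lemma Int_upotential_le : (\int[mu]_x u x <= \int[mu]_x f x)%R.
Proof.
rewrite -lee_fin (Int_EFin integ_upotential) (Int_EFin f1).
by under eq_integral do rewrite upotentialE; exact: potential_integral_le.
Qed.

Definition decay_upto (t s : R) : R := (if 0 < s <= t then expR (- s) else 0)%R.

Lemma decay_upto_ge0 t s : (0 <= decay_upto t s)%R.
Proof. by rewrite /decay_upto; case: ifP => // _; exact: expR_ge0. Qed.

Lemma decay_upto_indic t s : decay_upto t s = (expR (- s) * \1_(`]0%R, t]) s)%R.
Proof.
rewrite /decay_upto indicE; case: ifPn => h; first by rewrite mem_set ?mulr1// /= in_itv.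
by rewrite memNset ?mulr0//= in_itv; exact/negP.
Qed.

Lemma measurable_decay_upto t : measurable_fun setT (decay_upto t : TR -> R).
Proof.
have -> : decay_upto t = (fun s => expR (- s) * \1_(`]0%R, t]) s)%R :> (TR -> R).
  by apply/funext => s; exact: decay_upto_indic.
apply: measurable_funM.
  by apply: measurableT_comp => //; exact: measurable_expR.
by apply: measurable_indic; exact: measurable_itv.
Qed.

Definition early (t : R) (x : E) : \bar R :=
  \int[leb1]_s ((decay_upto t s)%:E * transition `|s|%R F x).

(** The value at the cemetery is arbitrary: it is used only multiplied by the indicator of
    survival. *)
Definition point_of (y : one_point_compactification 'rV[R]_d) : E := if y is Some x then x else 0%R.

Lemma measurable_point_of (t : R) : (0 <= t)%R ->
  measurable_fun setT (fun w => point_of (traj M t w)).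
Proof.
move=> t0 _ Y mY; rewrite setTI.
have -> : (fun w => point_of (traj M t w)) @^-1` Y = traj M t @^-1` (Some @` Y) `|`
    (~` (traj M t @^-1` (Some @` setT)) `&` [set w | Y 0%R]).
  apply/seteqP; split => w /=; rewrite /point_of; case E1: (traj M t w) => [x|].
  - by move=> Yx; left; exists x.
  - by move=> Y0; right; split => // -[].
  - by case=> [[y Yy [<-]]//|[nx _]]; case: nx; exists x.
  - by case=> [[]//|[]].
apply: measurableU; first by apply: (measurable_traj_at hM t0); exact: measurable_some.
apply: measurableI.
  by apply: measurableC; apply: (measurable_traj_at hM t0); exact: measurable_some.
have [Y0|nY] := pselect (Y 0%R); first by have -> : [set _ | Y 0%R] = setT :> set Omega by apply/seteqP; split.
by have -> : [set _ | Y 0%R] = set0 :> set Omega by apply/seteqP; split.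
Qed.

(** By the semigroup property and the substitution r = t + s, P_t of the potential is e^t times the
    integral of e^-r P_r f over r > t. The identity is stated additively, so that nothing is
    subtracted in the extended reals. *)
Lemma transition_potential_split (t : R) x : (0 < t)%R ->
  transition t potential x + (expR t)%:E * early t x = (expR t)%:E * potential x.
Proof.
move=> t0; have t0' := ltW t0.
pose alive (w : Omega) : \bar R := ext0e (fun=> 1) (traj M t w).
have ma : measurable_fun setT alive by exact: (measurable_ext0e_at hM).
pose H0 (z : TR * Omega) := transition `|z.1|%R F (point_of (traj M t z.2)) * alive z.2.
have a0 w : 0 <= alive w by rewrite /alive; case: (traj M t w).
have H00 z : 0 <= H0 z by rewrite mule_ge0//; exact: transition_ge0.
have mH0 : measurable_fun setT H0.
  apply: emeasurable_funM; last exact: (measurableT_comp ma measurable_snd).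
  have mp : measurable_fun setT (fun z : TR * Omega => (z.1, point_of (traj M t z.2)) : TR * E).
    apply/measurable_fun_pair => //=; exact: (measurableT_comp (measurable_point_of t0') measurable_snd).
  exact: (measurableT_comp mT mp).
have HE s w : ext0e (transition `|s|%R F) (traj M t w) = H0 (s, w).
  by rewrite /H0 /alive /=; case: (traj M t w) => [y|] /=; rewrite ?mule1 ?mule0.
have mD : measurable_fun setT (fun z : TR * Omega => (decay z.1)%:E).
  exact: (measurableT_comp measurable_decayE measurable_fst).
have mDH : measurable_fun setT (fun z : TR * Omega => (decay z.1)%:E * H0 z).
  exact: emeasurable_funM.
have DH0 z : 0 <= (decay z.1)%:E * H0 z by rewrite mule_ge0// lee_fin decay_ge0.
have e1 : transition t potential x = \int[law M (Some x)]_w \int[leb1]_s ((decay s)%:E * H0 (s, w)).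
  apply: eq_integral => w _; under eq_integral do rewrite -HE.
  case: (traj M t w) => [y|] //=.
  by under eq_integral do rewrite mule0; rewrite integral0.
pose g (r : TR) : \bar R := (if (t < r)%R then expR (t - r) else 0)%R%:E * transition `|r|%R F x.
have mTx : measurable_fun setT (fun r : TR => transition `|r|%R F x).
  exact: (measurableT_comp mT (measurable_pair2 x)).
have mg : measurable_fun setT g.
  apply: emeasurable_funM => //; apply/measurable_EFinP; apply: measurable_fun_ifT => //.
    by apply: measurable_fun_ltr.
  by apply: measurableT_comp => //; apply: measurable_funB.
have g0 r : 0 <= g r.
  by rewrite mule_ge0//; [rewrite lee_fin; case: ifP => // _; exact: expR_ge0|exact: transition_ge0].
have e2 : transition t potential x = \int[leb1]_r g r.
  rewrite e1 -(@fubini_tonelli _ _ _ _ _ leb1 (law M (Some x)) _ mDH DH0).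
  rewrite -(ge0_integral_shift1 t mg g0); apply: eq_integral => s _ /=.
  have mp : measurable_fun setT (fun w : Omega => (s, w)) by exact: measurable_pair1.
  rewrite ge0_integralZl//; last 2 first.
  - exact: (measurableT_comp mH0 mp).
  - by rewrite lee_fin decay_ge0.
  rewrite /g /decay; have [s0|s0] := ltP 0%R s; last first.
    by rewrite ifF ?mul0e//; apply/negbTE; rewrite -leNgt gerDr.
  rewrite ltrDr s0 opprD addrCA subrr addr0 ger0_norm ?addr_ge0 ?ltW//; congr (_ * _).
  rewrite [RHS](_ : _ = transition (t + s) F x); last by rewrite addrC.
  rewrite (transition_semigroup hM hP hV x t0' (ltW s0) mF F0).
  by apply: eq_integral => w _; rewrite -HE gtr0_norm.
have mU : measurable_fun setT (fun r : TR => (decay_upto t r)%:E).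
  by apply/measurable_EFinP; exact: measurable_decay_upto.
rewrite e2 /early /potential -!ge0_integralZl//; last first.
all: rewrite ?lee_fin ?expR_ge0//.
- by move=> s _; rewrite mule_ge0 ?lee_fin ?decay_upto_ge0//; exact: transition_ge0.
- exact: emeasurable_funM.
- by move=> s _; rewrite mule_ge0 ?lee_fin ?decay_ge0//; exact: transition_ge0.
- by apply: emeasurable_funM => //; exact: measurable_decayE.
rewrite -ge0_integralD//; last 2 first.
- move=> s _; rewrite mule_ge0 ?lee_fin ?expR_ge0// mule_ge0 ?lee_fin ?decay_upto_ge0//.
  exact: transition_ge0.
- by apply: emeasurable_funM => //; exact: emeasurable_funM.
apply: eq_integral => r _; rewrite /g !muleA -!EFinM -ge0_muleDl; last 2 first.
- by rewrite lee_fin; case: ifP => // _; exact: expR_ge0.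
- by rewrite lee_fin mulr_ge0 ?expR_ge0 ?decay_upto_ge0.
rewrite -EFinD; congr (_%:E * _); rewrite /decay_upto /decay.
have [tr|rt] := ltP t r.
  by rewrite (lt_trans t0 tr)/= mulr0 addr0 expRD.
by rewrite andbT add0r.
Qed.

Lemma early_le_potential t x : early t x <= potential x.
Proof.
apply: ge0_le_integral => //.
- by move=> s _; rewrite mule_ge0 ?lee_fin ?decay_upto_ge0//; exact: transition_ge0.
- apply: emeasurable_funM; first by apply/measurable_EFinP; exact: measurable_decay_upto.
  exact: (measurableT_comp mT (measurable_pair2 x)).
- exact: (measurableT_comp mk (measurable_pair2 x)).
- move=> s _; rewrite lee_wpmul2r//; first exact: transition_ge0.
  rewrite lee_fin /decay_upto /decay; case: ifP => [/andP[->]//|_].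
  by case: ifP => // _; exact: expR_ge0.
Qed.

Definition uearly (t : R) (x : E) : R := fine (early t x).

Lemma uearlyE t x : (uearly t x)%:E = early t x.
Proof.
rewrite fineK// ge0_fin_numE; last first.
  by apply: integral_ge0 => s _; rewrite mule_ge0 ?lee_fin ?decay_upto_ge0//; exact: transition_ge0.
exact: le_lt_trans (le_trans (early_le_potential t x) (potential_le x)) (ltry _).
Qed.

Lemma Lu : inL mu 1 setT u. Proof. by apply/inL1P; exact: integ_upotential. Qed.

Lemma semigroup_upotential t : (0 < t)%R ->
  \forall x \ae mu, (S t u x = expR t * (u x - uearly t x))%R.
Proof.
move=> t0; apply: filterS (version_ae t0 Lu) => x <-.
have bu : exists c : R, forall y, (`|u y| <= c)%R.
  by exists K => y; rewrite ger0_norm ?upotential_ge0// upotential_le.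
have mu' : measurable_fun setT u by apply/measurable_EFinP; exact: measurable_upotential.
have e1 := transitionE hP x (ltW t0) mu' bu.
have := transition_potential_split x t0.
have -> : potential = EFin \o u by apply/funext => y; rewrite /= upotentialE.
rewrite e1 -uearlyE /= -!EFinM -EFinD => -[].
by rewrite mulrBr => <-; rewrite addrK.
Qed.

Definition dens (s : R) (x : E) : R := fine (transition `|s|%R F x).

Lemma densE s x : (dens s x)%:E = transition `|s|%R F x.
Proof.
rewrite fineK// ge0_fin_numE ?transition_ge0//.
by apply: le_lt_trans (transition_le x _) (ltry _).
Qed.

Lemma dens_ge0 s x : (0 <= dens s x)%R.
Proof. by rewrite -lee_fin densE transition_ge0. Qed.

Lemma dens_le s x : (dens s x <= K)%R.
Proof. by rewrite -lee_fin densE transition_le. Qed.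

Lemma measurable_dens : measurable_fun setT (fun z : TR * E => dens z.1 z.2).
Proof.
apply/measurable_EFinP; rewrite (_ : EFin \o _ = fun z : TR * E => transition `|z.1|%R F z.2)//.
by apply/funext => z; rewrite /= densE.
Qed.

Local Notation I t := (\1_(`]0%R, t]%classic) : TR -> R).

Lemma measurable_itv_indic t : measurable_fun setT (I t).
Proof. by apply: measurable_indic; exact: measurable_itv. Qed.

Lemma integ_itv (t : R) : (0 < t)%R -> integ leb1 (I t) /\ (\int[leb1]_s I t s = t)%R.
Proof.
move=> t0; have L : leb1 (`]0%R, t]%classic : set R) = t%:E.
  by rewrite lebesgue_measure_itv/= lte_fin t0 -EFinB subr0.
have i1 : integ leb1 (I t).
  apply/integrableP; split; first by apply/measurable_EFinP; exact: measurable_itv_indic.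
  under eq_integral do rewrite /= ger0_norm ?indicE//.
  under eq_integral do rewrite -indicE; rewrite integral_indic ?setIT//.
  by apply: (@le_lt_trans _ _ t%:E); [rewrite -L|exact: ltry].
split => //; apply: EFin_inj; rewrite Int_EFin// integral_indic ?setIT//.
Qed.

Definition early_error (t s : R) (x : E) : R := (`|expR (t - s) * dens s x - f x| * I t s)%R.

Lemma measurable_early_error t : measurable_fun setT (fun z : TR * E => early_error t z.1 z.2).
Proof.
apply: measurable_funM; last first.
  exact: (measurableT_comp (measurable_itv_indic t) measurable_fst).
apply: measurableT_comp => //; apply: measurable_funB.
  apply: measurable_funM; last exact: measurable_dens.
  apply: measurableT_comp; first exact: measurable_expR.
  by apply: measurable_funB => //; exact: measurable_fst.
exact: (measurableT_comp mf measurable_snd).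
Qed.

Lemma early_bound t x : (0 < t)%R ->
  integ leb1 (fun s => early_error t s x) /\
  (`|expR t * uearly t x - t * f x| <= \int[leb1]_s early_error t s x)%R.
Proof.
move=> t0; have [iI II] := integ_itv t0.
have I0 s : (0 <= I t s)%R by rewrite indicE.
have i1 : integ leb1 (fun s => expR (t - s) * dens s x * I t s)%R.
  apply: (integ_le _ (integZ (expR t * K) iI)) => [|s].
    apply: measurable_funM; last exact: measurable_itv_indic.
    apply: measurable_funM; last exact: (measurableT_comp measurable_dens (measurable_pair2 x)).
    by apply: measurableT_comp; [exact: measurable_expR|exact: measurable_funB].
  rewrite !normrM (ger0_norm (I0 s)) (ger0_norm (expR_ge0 _)) (ger0_norm (dens_ge0 s x)).
  rewrite indicE; have [h|h] := pselect (`]0%R, t]%classic s); last by rewrite memNset// !mulr0.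
  rewrite mem_set// !mulr1 ler_pM ?expR_ge0 ?dens_ge0 ?dens_le// ler_expR gerBl.
  by move: h; rewrite /= in_itv/= => /andP[/ltW].
have i2 := integZ (f x) iI.
have e1 : (expR t * uearly t x = \int[leb1]_s (expR (t - s) * dens s x * I t s))%R.
  apply: EFin_inj; rewrite (Int_EFin i1) EFinM uearlyE -ge0_integralZl//; last 2 first.
  - apply: emeasurable_funM; first by apply/measurable_EFinP; exact: measurable_decay_upto.
    exact: (measurableT_comp mT (measurable_pair2 x)).
  - by move=> s _; rewrite mule_ge0 ?lee_fin ?decay_upto_ge0//; exact: transition_ge0.
  apply: eq_integral => s _; rewrite -densE -!EFinM decay_upto_indic expRD; congr EFin.
  by ring.
have e2 : (t * f x = \int[leb1]_s (f x * I t s))%R by rewrite (IntZ _ iI) II mulrC.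
have i3 := integB i1 i2.
have e3 : (fun s => `|expR (t - s) * dens s x * I t s - f x * I t s|)%R = early_error t ^~ x.
  by apply/funext => s; rewrite /early_error -mulrBl normrM (ger0_norm (I0 s)).
split; first by rewrite -e3; exact: integ_norm.
by rewrite e1 e2 -(IntB i1 i2) -e3; exact: Int_norm.
Qed.

(** The discount factor lies between 1 and e^t <= 2: it doubles the distance of S_s f to f at most,
    and its own deviation from 1 costs (e^t - 1) times the integral of f. *)
Lemma transition_error_le (t s dl : R) : (0 < s)%R -> (s <= t)%R -> (expR t <= 2)%R ->
  distL mu 1 setT (S s f) f <= dl%:E ->
  \int[mu]_x (`|expR (t - s) * dens s x - f x|)%:E <= (2 * dl + (expR t - 1) * \int[mu]_x f x)%:E.
Proof.
have alg (e a b : R) : (1 <= e -> 0 <= b -> `|e * a - b| <= e * `|a - b| + (e - 1) * b)%R.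
  move=> e1 b0; have -> : (e * a - b = e * (a - b) + (e - 1) * b)%R by ring.
  apply: le_trans (ler_normD _ _) _; rewrite !normrM (ger0_norm (le_trans ler01 e1)) (ger0_norm b0).
  by rewrite (ger0_norm (_ : 0 <= e - 1)%R)// subr_ge0.
move=> s0 st et hd; have iS : integ mu (S s f) by apply/inL1P; exact: (S_L1 hS s0 Lf).
have iF : integ mu (fun x => (expR t - 1) * f x)%R by exact: integZ.
have h := version_ae s0 Lf.
have mds : measurable_fun setT (dens s : E -> R).
  have mp : measurable_fun setT (fun x : E => ((s : TR), x)) by exact: measurable_pair1.
  exact: (measurableT_comp measurable_dens mp).
have ed : \forall x \ae mu, dens s x = S s f x.
  apply: filterS h => x <-; apply: EFin_inj; rewrite densE ger0_norm ?ltW//.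
  exact: (transitionE hP x (ltW s0) mf bf).
have id : integ mu (dens s) by apply: integ_ae_eq iS mds _; apply: filterS ed.
have i1 := integ_norm (integB id f1).
have hd' : (\int[mu]_x `|dens s x - f x| <= dl)%R.
  rewrite -lee_fin (Int_EFin i1); apply: le_trans hd; rewrite distL1E.
  rewrite le_eqVlt; apply/orP; left; apply/eqP; apply: ae_eq_integral => //.
  - exact: measurable_int i1.
  - exact: measurable_int (integ_norm (integB iS f1)).
  - by apply: filterS ed => x e _; rewrite e.
have e1 : (1 <= expR (t - s))%R by rewrite -[leLHS](expR0) ler_expR subr_ge0.
have e2 : (expR (t - s) <= expR t)%R by rewrite ler_expR gerBl ltW.
have i2 := integZ (expR t) i1.
have i3 : integ mu (fun x => `|expR (t - s) * dens s x - f x|)%R.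
  exact: integ_norm (integB (integZ (expR (t - s)) id) f1).
rewrite -(Int_EFin i3) lee_fin; apply: (@le_trans _ _ (expR t * dl + (expR t - 1) * \int[mu]_x f x)%R).
  apply: (@le_trans _ _ (\int[mu]_x (expR t * `|dens s x - f x| + (expR t - 1) * f x))%R).
    apply: (Int_le i3 (integD i2 iF)) => x; apply: le_trans (alg _ _ _ e1 (f0 x)) _.
    apply: lerD; first by rewrite ler_wpM2r.
    by rewrite ler_wpM2r// lerB.
  by rewrite (IntD i2 iF) (IntZ _ i1) (IntZ _ f1) lerD2r ler_wpM2l ?expR_ge0.
have dl0 : (0 <= dl)%R by apply: le_trans hd'; exact: Int_ge0.
by rewrite lerD2r ler_wpM2r.
Qed.

(** By [semigroup_upotential] the difference splits into (t^-1 (e^t - 1) - 1) u, of order t, and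
    t^-1 times the error between e^t [uearly] and t f. The latter is an average over s in ]0, t] of
    distances between discounted P_s f and f, hence small by strong continuity. *)
Lemma generator_distance (t dl : R) : (0 < t)%R -> (t <= 2^-1)%R ->
  (forall s, (0 < s)%R -> (s <= t)%R -> distL mu 1 setT (S s f) f <= dl%:E) ->
  distL mu 1 setT (fun x => t^-1 * (S t u x - u x))%R (fun x => 1 * u x - f x)%R <=
  (4 * t * \int[mu]_x f x + 2 * dl)%:E.
Proof.
have alg (a v w g r : R) : (0 < r -> r^-1 * (a * (v - w) - v) - (1 * v - g) =
    (r^-1 * (a - 1) - 1) * v - r^-1 * (a * w - r * g))%R.
  by move=> r0; field; rewrite gt_eqF.
have alg2 (r J l : R) : (2 * r * J + (2 * l + 2 * r * J) = 4 * r * J + 2 * l)%R by ring.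
move=> t0 th hd.
have J0 : (0 <= \int[mu]_x f x)%R by exact: Int_ge0.
set c := (2 * dl + (expR t - 1) * \int[mu]_x f x)%R.
have et2 : (expR t - 1 <= 2 * t)%R := expR_sub1_le t0 th.
have c_le : (c <= 2 * dl + 2 * t * \int[mu]_x f x)%R by rewrite lerD2l ler_wpM2r.
have hc s : (0 < s)%R -> (s <= t)%R -> \int[mu]_x (early_error t s x)%:E <= c%:E.
  move=> s0 st; have -> : (fun x => (early_error t s x)%:E) = (fun x => (`|expR (t - s) * dens s x - f x|)%:E).
    by apply/funext => x; rewrite /early_error indicE mem_set ?mulr1//= in_itv/= s0.
  apply: transition_error_le => //; last exact: hd.
  by rewrite -lerBlDr (le_trans et2)// (le_trans (ler_wpM2l _ th))// mulfV// lerBrDr.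
pose D x := \int[leb1]_s (early_error t s x)%:E.
have mee : measurable_fun setT (fun z : TR * E => (early_error t z.1 z.2)%:E).
  by apply/measurable_EFinP; exact: measurable_early_error.
have ee0 (z : TR * E) : 0 <= (early_error t z.1 z.2)%:E.
  by rewrite lee_fin mulr_ge0// indicE.
have mD : measurable_fun setT D.
  exact: (@measurable_fun_fubini_tonelli_G _ _ _ _ _ leb1 _ mee ee0).
have D0 x : 0 <= D x by apply: integral_ge0 => s _; exact: ee0 (s, x).
have ID : \int[mu]_x D x <= (t * c)%:E.
  rewrite /D -(fubini_sigma_finite leb1 hsf mee ee0).
  have [iI II] := integ_itv t0.
  have -> : (t * c)%:E = \int[leb1]_s (c * I t s)%:E.
    by rewrite -(Int_EFin (integZ c iI)) (IntZ _ iI) II mulrC.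
  apply: ge0_le_integral => //.
  - by move=> s _; apply: integral_ge0 => x _; exact: ee0 (s, x).
  - exact: (measurable_integral_sigma_finite hsf mee ee0).
  - exact: measurable_int (integZ c iI).
  - move=> s _ /=; have [h|h] := pselect (`]0%R, t]%classic s); last first.
      rewrite indicE memNset// mulr0.
      by under eq_integral do rewrite /early_error indicE memNset// mulr0; rewrite integral0.
    rewrite indicE mem_set// mulr1; apply: hc; by move: h; rewrite /= in_itv/= => /andP[].
rewrite distL1E; apply: (@le_trans _ _ (\int[mu]_x ((2 * t * u x)%:E + (t^-1)%:E * D x))).
  have iSu : integ mu (S t u) by apply/inL1P; exact: (S_L1 hS t0 Lu).
  have iu := integ_upotential.
  apply: ae_ge0_le_integral => //.
  - exact: measurable_int (integ_norm (integB (integZ t^-1 (integB iSu iu)) (integB (integZ 1 iu) f1))).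
  - move=> x _; rewrite adde_ge0 ?lee_fin ?mulr_ge0 ?upotential_ge0 ?(ltW t0)//.
    by rewrite mule_ge0 ?lee_fin ?invr_ge0 ?(ltW t0).
  - apply: emeasurable_funD; first exact: measurable_int (integZ (2 * t) iu).
    exact: measurable_funeM.
  - apply: filterS (semigroup_upotential t0) => x e _.
    have [i1 h] := early_bound x t0.
    rewrite /D -(Int_EFin i1) -EFinM -EFinD lee_fin e (alg _ _ _ _ _ t0).
    apply: le_trans (ler_normB _ _) _; apply: lerD; last first.
      by rewrite normrM ger0_norm ?invr_ge0 ?(ltW t0)// ler_wpM2l ?invr_ge0 ?(ltW t0).
    rewrite normrM (ger0_norm (upotential_ge0 x)) ler_wpM2r ?upotential_ge0//.
    rewrite ger0_norm; last by rewrite subr_ge0 ler_pdivlMl// mulr1 lerBrDl expR_ge1Dx.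
    exact: expR_slope_le.
rewrite ge0_integralD//; last 4 first.
- by move=> x _; rewrite lee_fin !mulr_ge0 ?upotential_ge0 ?(ltW t0).
- exact: measurable_int (integZ (2 * t) integ_upotential).
- by move=> x _; rewrite mule_ge0 ?lee_fin ?invr_ge0 ?(ltW t0).
- exact: measurable_funeM.
rewrite ge0_integralZl// ?lee_fin ?invr_ge0 ?(ltW t0)//.
rewrite -(Int_EFin (integZ (2 * t) integ_upotential)) (IntZ _ integ_upotential) -alg2 EFinD.
apply: leeD; first by rewrite lee_fin ler_wpM2l ?mulr_ge0 ?(ltW t0)// Int_upotential_le.
apply: (@le_trans _ _ ((t^-1)%:E * (t * c)%:E)); first by rewrite lee_wpmul2l ?lee_fin ?invr_ge0 ?(ltW t0).
by rewrite -EFinM mulrA mulVf ?gt_eqF// mul1r lee_fin.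
Qed.

End bounded_function.

End potential.

Lemma cvg_ereal0 {R : realType} {T : Type} (F : set_system T) {FF : Filter F} (h : T -> \bar R) :
  (forall t, (0 <= h t)%E) -> (forall e : R, 0 < e -> \forall t \near F, (h t < e%:E)%E) ->
  h t @[t --> F] --> 0%E.
Proof.
move=> h0 H U; rewrite /= => -[e /= e0 eU].
have he := H e e0; rewrite nbhs_simpl /=; apply: filterS he => t ht.
have hf : (h t \is a fin_num)%E by rewrite ge0_fin_numE// (lt_trans ht) ?ltry.
rewrite /= -(fineK hf); apply: eU; rewrite /ball/= sub0r normrN ger0_norm ?fine_ge0//.
by rewrite -lte_fin fineK.
Qed.

(** * Occupation times as time integrals of transitions *)

Section occupation_transition.
Context {R : realType} {d : nat} {dO : measure_display} {Omega : measurableType dO}.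
Local Notation E := 'rV[R]_d.
Local Notation TR := (measurableTypeR R).
Local Notation leb1 := (@lebesgue_measure R).
Context {M : process R d Omega}.
Hypothesis hM : hunt_process M.
Local Notation transition := (@transition R d dO Omega M).
Local Open Scope ereal_scope.

(** Fubini's theorem; the closed time interval becomes half-open, which changes a null set only and
    matches the indicator compared with the potential. *)
Lemma occupationE (f : E -> R) (t : R) x : measurable_fun setT f -> (forall x, (0 <= f x)%R) ->
  occupation M t f x =
  \int[leb1]_s ((\1_(`]0%R, t]%classic) s : R)%:E * transition `|s|%R (EFin \o f) x).
Proof.
move=> mf f0; have mF : measurable_fun setT (EFin \o f) by exact/measurable_EFinP.
pose I := (\1_(`]0%R, t]%classic) : TR -> R).
have mI : measurable_fun setT (fun s : TR => (I s)%:E).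
  by apply/measurable_EFinP; exact: measurable_itv_indic.
pose h (z : TR * Omega) := ext0e (EFin \o f) (traj M `|z.1|%R z.2).
have mh : measurable_fun setT h := measurable_ext0e hM mF.
have h0 z : 0 <= h z by apply: ext0e_ge0 => y; rewrite lee_fin.
have mH : measurable_fun setT (fun z : TR * Omega => (I z.1)%:E * h z).
  by apply: emeasurable_funM => //; exact: (measurableT_comp mI measurable_fst).
have I0 s : 0 <= (I s)%:E by rewrite lee_fin /I indicE.
have H0 z : 0 <= (I z.1)%:E * h z by rewrite mule_ge0.
have mhw w : measurable_fun setT (fun s : TR => h (s, w)).
  have mp : measurable_fun setT (fun s : TR => (s, w)) by exact: measurable_pair2.
  exact: (measurableT_comp mh mp).
have e1 w : \int[leb1]_(s in `[0%R, t]) (ext0 (fun y => `|f y|%R) (traj M s w))%:E =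
    \int[leb1]_s ((I s)%:E * h (s, w)).
  have -> : \int[leb1]_(s in `[0%R, t]) (ext0 (fun y => `|f y|%R) (traj M s w))%:E =
      \int[leb1]_(s in `[0%R, t]) h (s, w).
    apply: eq_integral => s; rewrite inE/= in_itv/= => /andP[s0 _].
    by rewrite /h/= (ger0_norm s0); case: (traj M s w) => //= y; rewrite ger0_norm.
  rewrite -(@integral_itv_obnd_cbnd R 0%R (BRight t) (fun s => h (s, w))); last first.
    by apply: measurable_funTS; exact: mhw.
  rewrite integral_mkcond; apply: eq_integral => s _.
  by rewrite patchE /I indicE; case: ifP => _; rewrite ?mul1e ?mul0e.
rewrite /occupation; under eq_integral do rewrite e1.
rewrite -(@fubini_tonelli _ _ _ _ _ leb1 (law M (Some x)) _ mH H0).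
apply: eq_integral => s _ /=; rewrite ge0_integralZl//.
have mp : measurable_fun setT (fun w : Omega => (s, w)) by exact: measurable_pair1.
exact: (measurableT_comp mh mp).
Qed.

End occupation_transition.

(** * The potential as a resolvent, at almost every and at every point *)

Section process_resolvent.
Context {R : realType} {d : nat} {dO : measure_display} {Omega : measurableType dO}.
Local Notation E := 'rV[R]_d.
Local Notation TR := (measurableTypeR R).
Local Notation leb1 := (@lebesgue_measure R).
Local Notation leb := (@leb R d).
Context {M : process R d Omega} {mu : {measure set E -> \bar R}}
  {S P : R -> (E -> R) -> E -> R}.
Hypothesis hM : hunt_process M.
Hypothesis hP : transition_function M P.
Hypothesis hS : subMarkov_C0_contractions mu S.
Hypothesis hV : continuous_version mu S P.
Hypothesis hsf : sigma_finite setT mu.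
Local Notation transition := (@transition R d dO Omega M).
Local Notation potential := (@potential R d dO Omega M).
Local Notation upotential := (@upotential R d dO Omega M).
Local Open Scope ereal_scope.
Variables (f : E -> R) (K : R).
Hypothesis mf : measurable_fun setT f.
Hypothesis f0 : forall x, (0 <= f x)%R.
Hypothesis fK : forall x, (f x <= K)%R.
Hypothesis f1 : integ mu f.

Let Lf : inL mu 1 setT f. Proof. exact/inL1P. Qed.
Let bf : exists c : R, forall y, (`|f y| <= c)%R.
Proof. by exists K => y; rewrite ger0_norm. Qed.
Let mF : measurable_fun setT (EFin \o f). Proof. exact/measurable_EFinP. Qed.
Let F0 x : 0 <= (EFin \o f) x. Proof. by rewrite lee_fin. Qed.

(** Strong continuity of S at f makes dl arbitrarily small in [generator_distance], and the other
    error is linear in t. Through [has_resolvent] the potential becomes the resolvent to which the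
    analytic estimate applies. *)
Lemma generator_upotential : generator mu S (upotential f) (fun x => 1 * upotential f x - f x)%R.
Proof.
have alg (r J e : R) : (0 < r -> 0 <= J -> 0 < e -> r * (8 * (J + 1)) < e -> 4 * r * J + 2 * (e / 4) < e)%R.
  by move=> r0 J0 e0; nra.
have iu := integ_upotential hM hP hS hV hsf mf f0 fK f1.
have iSu t : (0 < t)%R -> integ mu (S t (upotential f)).
  by move=> t0; apply/inL1P; apply: (S_L1 hS t0); exact/inL1P.
split; first exact/inL1P.
  by apply/inL1P; exact: (integB (integZ 1 iu) f1).
have J0 : (0 <= \int[mu]_x f x)%R by exact: Int_ge0.
apply: cvg_ereal0 => [t|e e0]; first by rewrite distL1E; exact: integral_ge0.
have e40 : (0 < e / 4)%R by rewrite divr_gt0.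
have : \forall t \near 0^'+, distL mu 1 setT (S t f) f < (e / 4)%:E.
  have hc := S_continuous hS Lf.
  by apply: (hc [set y | y < (e / 4)%:E] (open_ereal_lt' _)); rewrite lte_fin.
case=> r /= r0 hr; exists (Num.min r (Num.min 2^-1 (e / (8 * (\int[mu]_x f x + 1)))))%R.
  by rewrite /= !lt_min r0 invr_gt0 ltr0n/= divr_gt0// mulr_gt0// ltr_wpDl.
move=> t /= + t0; rewrite sub0r normrN gtr0_norm// !lt_min => /and3P[tr th te].
apply: le_lt_trans (generator_distance hM hP hS hV hsf mf f0 fK f1 (dl := e / 4) t0 (ltW th) _) _.
  by move=> s s0 st; apply/ltW/hr => //=; rewrite sub0r normrN gtr0_norm// (le_lt_trans st).
by rewrite lte_fin; apply: alg => //; rewrite -ltr_pdivlMr// mulr_gt0// ltr_wpDl.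
Qed.

Lemma ae_open_exists (U : set E) (Q : E -> Prop) x : open U -> U x ->
  (\forall y \ae leb, Q y) -> exists2 y, U y & Q y.
Proof.
move=> oU Ux [N [mN N0 HN]]; apply: contrapT => h.
have : 0 < leb U by exact: leb_open_gt0 Ux.
apply/negP; rewrite -leNgt -N0; apply: le_measure; rewrite ?inE//.
  exact: measurable_open_rV.
by move=> y Uy; apply: HN => /= Qy; apply: h; exists y.
Qed.

(** Approach x by points where the bound holds. For each s > 0 the integrand converges since P_s f
    is continuous, and Fatou's lemma in s transfers the bound to x. *)
Lemma potential_closed (U : set E) (c : \bar R) : open U ->
  (\forall x \ae leb, U x -> potential f x <= c) -> forall x, U x -> potential f x <= c.
Proof.
move=> oU h x Ux.
have /boolp.choice[xn hxn] (n : nat) : exists y, [/\ ball x n.+1%:R^-1 y, U y & potential f y <= c].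
  have [||y [y1 y2] y3] := @ae_open_exists (ball x n.+1%:R^-1 `&` U) _ x _ _ h.
  - by apply: openI => //; exact: ball_open.
  - by split => //; exact: ballxx.
  - by exists y; split => //; exact: y3.
have cx : xn n @[n --> \oo] --> x.
  apply/cvg_ballP => e e0; have [N _ hN] := near_infty_natSinv_lt (PosNum e0).
  exists N => // n /= Nn; have [b _ _] := hxn n.
  by apply: le_ball b; exact/ltW/hN.
apply: (@fatou_le _ _ _ leb1 (fun n s => (decay s)%:E * transition `|s|%R (EFin \o f) (xn n))
  (fun s => (decay s)%:E * transition `|s|%R (EFin \o f) x) c).
- move=> n; apply: emeasurable_funM; first exact: measurable_decayE.
  have mp : measurable_fun setT (fun s : TR => (s, xn n)) by exact: measurable_pair2.
  exact: (measurableT_comp (measurable_transition hM hP hV mF F0) mp).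
- by move=> n s; rewrite mule_ge0 ?lee_fin ?decay_ge0//; exact: transition_ge0.
- move=> s; rewrite /decay; case: ifPn => [s0|_]; last by under eq_fun do rewrite mul0e; rewrite mul0e; exact: cvg_cst.
  have s0' : (0 <= `|s|)%R by [].
  rewrite (transitionE hP _ s0' mf bf); under eq_fun do rewrite (transitionE hP _ s0' mf bf) -EFinM.
  rewrite -EFinM; apply: cvg_EFin; first exact: nearW.
  apply: cvgZl_tmp; rewrite gtr0_norm//.
  have [cP _] := hV.2 1 s f (lexx _) s0 Lf.
  exact: (cvg_comp _ _ cx (cP x)).
- by move=> n; have [_ _] := hxn n.
Qed.

Lemma occupation_le_potential (t : R) x : (0 < t)%R ->
  occupation M t f x <= (expR t)%:E * potential f x.
Proof.
move=> t0; rewrite (occupationE hM t x mf f0).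
have mp : measurable_fun setT (fun s : TR => (s, x)) by exact: measurable_pair2.
have mTx : measurable_fun setT (fun s : TR => transition `|s|%R (EFin \o f) x).
  exact: (measurableT_comp (measurable_transition hM hP hV mF F0) mp).
have T0 (s : R) : 0 <= transition `|s|%R (EFin \o f) x by exact: transition_ge0.
rewrite /potential -ge0_integralZl//; last 2 first.
- by apply: emeasurable_funM => //; exact: measurable_decayE.
- by move=> s _; rewrite mule_ge0 ?lee_fin ?decay_ge0.
apply: ge0_le_integral => //.
- by move=> s _; rewrite mule_ge0 ?lee_fin ?indicE.
- by apply: emeasurable_funM => //; apply/measurable_EFinP; exact: measurable_itv_indic.
- by apply: measurable_funeM; apply: emeasurable_funM => //; exact: measurable_decayE.
move=> s _; rewrite muleA -EFinM; move: (T0 s); set T := transition _ _ _ => Ts0.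
apply: lee_wpmul2r => //.
rewrite lee_fin indicE /decay; have [h1|h1] := pselect (`]0%R, t]%classic s); last first.
  by rewrite memNset// mulr_ge0 ?expR_ge0//; case: ifP => // _; exact: expR_ge0.
rewrite mem_set//; move: h1; rewrite /= in_itv/= => /andP[s0 st].
by rewrite s0 -expRD -[leLHS]expR0 ler_expR subr_ge0.
Qed.

End process_resolvent.

(** * The occupation bound for bounded functions of small norm *)

Section pivot.
Context {R : realType} {d : nat} {dO : measure_display} {Omega : measurableType dO}.
Local Notation E := 'rV[R]_d.
Local Notation leb := (@leb R d).
Context {p q : R} {A C : E -> 'M[R]_d} {H : E -> E} {rho : E -> R}
  {M : process R d Omega} {mu : {measure set E -> \bar R}}
  {S P : R -> (E -> R) -> E -> R}.
Local Notation G := (drift A C H).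
Hypothesis p2 : 2 <= p.
Hypothesis ha : assumption_a p A C H.
Hypothesis hb : assumption_b q G.
Hypothesis hrho : invariant_density p A G rho mu.
Hypothesis q1 : 1 < q.
Hypothesis d1 : (0 < d)%N.
Hypothesis eta0 : 0 < 2 / d%:R - q^-1.
Hypothesis hM : hunt_process M.
Hypothesis hP : transition_function M P.
Hypothesis hS : subMarkov_C0_contractions mu S.
Hypothesis hR : has_resolvent mu A (fun x => G x - log_drift A rho x) S.
Hypothesis hV : continuous_version mu S P.

(** The a priori bound required by the iteration is K, which also bounds the potential because the
    discount has mass at most 1; the constant c is fixed before f and K. *)
Lemma occupation_locally_bounded (o : E) (a0 : R) : 0 <= a0 -> exists2 c : R, 0 < c &
  forall (f : E -> R) (K : R), measurable_fun setT f -> (forall x, 0 <= f x) ->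
    (forall x, f x <= K) -> integ mu f -> \int[mu]_x f x <= 1 ->
    integ mu (fun x => f x `^ q) -> \int[mu]_x (f x `^ q) <= 1 ->
    forall t x, 0 < t -> sqd o x < a0 -> (occupation M t f x <= (expR t * c)%:E)%E.
Proof.
move=> a00; have [c c0 hc] := resolvent_locally_bounded p2 ha hb hrho q1 d1 eta0 o a00.
exists c => // f K mf f0 fK f1 If1 fq Ifq t x t0 xo.
have hsf := mu_sigma_finite hrho.
have mF : measurable_fun setT (EFin \o f) by exact/measurable_EFinP.
have gU := generator_upotential hM hP hS hV hsf mf f0 fK f1.
have Lf : inL mu 1 setT f by exact/inL1P.
have [Lu _ _] := gU.
have hres := (hR ltr01 Lf Lu).2 gU.
have K0 : 0 <= K by exact: le_trans (f0 0) (fK 0).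
have u0 := upotential_ge0 hM hP hV mf f0 fK.
have uK := upotential_le hM hP hV mf f0 fK.
have Iu := le_trans (Int_upotential_le hM hP hS hV hsf mf f0 fK f1) If1.
have ub : \forall y \ae leb, sqd o y < a0 -> @upotential _ _ _ _ M f y <= c.
  exact: (hc f _ K hres f0 u0 K0 (nearW _ uK) fq Ifq Iu).
apply: (@le_trans _ _ ((expR t)%:E * @potential _ _ _ _ M f x)%E).
  exact: (occupation_le_potential hM hP hV mf f0 x t0).
rewrite EFinM lee_wpmul2l ?lee_fin ?expR_ge0//.
apply: (potential_closed hM hP hV mf f0 fK f1 (U := [set y | sqd o y < a0])) => //.
  exact: open_sqd_lt.
by apply: filterS ub => y h /h; rewrite -lee_fin (upotentialE hM hP hV mf f0 fK).
Qed.

End pivot.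

(** * Occupation times *)

(** Above height 1 a value is at most each of its powers with exponent at least 1, so one bound on
    the q-th power controls the L^1 and the L^q norm together. *)
Definition large_part {R : realType} {T : Type} (g : T -> R) (x : T) : R :=
  if 1 < `|g x| then `|g x| else 0.

Section large_part.
Context {R : realType} {dT : measure_display} {T : measurableType dT}.
Implicit Types g : T -> R.

Lemma large_part_ge0 g x : 0 <= large_part g x.
Proof. by rewrite /large_part; case: ifP. Qed.

Lemma measurable_large_part g : measurable_fun setT g -> measurable_fun setT (large_part g).
Proof.
move=> mg; have mn : measurable_fun setT (fun x => `|g x|) by exact: measurableT_comp.
by apply: measurable_fun_ifT => //; exact: measurable_fun_ltr.
Qed.

Lemma norm_le_large_part g x : `|g x| <= 1 + large_part g x.
Proof.
rewrite /large_part; have [h|h] := ltP 1 `|g x|; first by rewrite lerDr.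
by rewrite addr0.
Qed.

Lemma large_part_le_powR g (q : R) x : 1 <= q -> large_part g x <= large_part g x `^ q.
Proof.
rewrite /large_part => q1; case: ifPn => h; last exact: powR_ge0.
by rewrite -[leLHS]powRr1// ler_powR// ltW.
Qed.

(** Values above 1 allow the exponent q to be raised to r. The scaling then contributes n^-r and
    k^-r, and k^-r <= k^-1 since k >= 1. *)
Lemma large_part_powR_le g (k n q r : R) x : 0 < k -> 0 < n -> 1 <= k -> 1 <= q -> q <= r ->
  large_part (fun y => (n * k)^-1 * g y) x `^ q <= k^-1 * (n `^ (- r) * `|g x| `^ r).
Proof.
move=> k0 n0 k1 q1 qr; rewrite /large_part; set a := `|_ * g x|; case: ifPn => h; last first.
  rewrite powR0 ?gt_eqF ?(lt_le_trans ltr01)//.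
  by rewrite mulr_ge0 ?mulr_ge0 ?powR_ge0// invr_ge0 ltW.
apply: (@le_trans _ _ (a `^ r)); first by rewrite ler_powR// ltW.
rewrite /a normrM ger0_norm ?invr_ge0 ?mulr_ge0 ?(ltW k0) ?(ltW n0)// invfM.
rewrite !powRM ?mulr_ge0 ?invr_ge0 ?(ltW k0) ?(ltW n0)//.
rewrite [X in X * _]mulrC -mulrA; apply: ler_pM; rewrite ?powR_ge0 ?mulr_ge0 ?powR_ge0//.
  by apply: ge1r_powR; rewrite ?invr_gt0 ?k0 ?invf_le1 ?k1// (le_trans q1).
have e : n^-1 `^ r = n `^ (- r) by rewrite -(powR_inv1 (ltW n0)) -powRrM mulN1r.
by rewrite e.
Qed.

(** The norm is taken for [m1] and the conclusion holds for [m2], which [kap] dominates on functions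
    vanishing where f does; this covers mu itself and Lebesgue measure at once. Scaling by the
    maximum of 1 and [kap] makes the domination constant disappear. *)
Lemma large_part_norm (m1 m2 : {measure set T -> \bar R}) (kap n q : R) (r : \bar R) (f : T -> R) :
  0 < kap -> 0 < n -> 1 <= q -> (q%:E <= r)%E -> measurable_fun setT f ->
  (forall h : T -> \bar R, measurable_fun setT h -> (forall x, 0 <= h x)%E ->
    (forall x, f x = 0%R -> h x = 0%E) -> \int[m2]_x h x <= kap%:E * \int[m1]_x h x)%E ->
  ('N[m1]_r[EFin \o f] <= n%:E)%E ->
  (\int[m2]_x (large_part (fun y => (n * Num.max 1 kap)^-1 * f y) x `^ q)%:E <= 1)%E.
Proof.
move=> kap0 n0 q1 qr mf hm hn; set k := Num.max 1 kap; set g := fun y => _ * f y.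
have k1 : 1 <= k by rewrite le_max lexx.
have k0 : 0 < k by exact: lt_le_trans k1.
have q0 : 0 < q by exact: lt_le_trans q1.
have mg : measurable_fun setT g by exact: measurable_funM.
have mh : measurable_fun setT (fun x => (large_part g x `^ q)%:E).
  by apply/measurable_EFinP; apply: (measurableT_comp (measurable_powR q)); exact: measurable_large_part.
have h0 x : (0 <= (large_part g x `^ q)%:E)%E by rewrite lee_fin powR_ge0.
apply: le_trans (hm _ mh h0 _) _.
  by move=> x fx; rewrite /large_part /g fx mulr0 normr0 ltr10 powR0// gt_eqF.
suff : (\int[m1]_x (large_part g x `^ q)%:E <= (k^-1)%:E)%E.
  move=> h; apply: le_trans (lee_wpmul2l _ h) _; first by rewrite lee_fin ltW.
  by rewrite -EFinM lee_fin ler_pdivrMr// mul1r le_max lexx orbT.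
case: r qr hn => [r||] //; rewrite ?lee_fin => qr hn; last first.
  have ae0 : \forall x \ae m1, (large_part g x `^ q)%:E = 0%E.
    (* For r = +oo the norm is an essential supremum only when the total mass is positive; the null
       measure is a separate case. *)
    have hb : \forall x \ae m1, (`|(f x)%:E| <= n%:E)%E \/ m1 setT = 0%E.
      move: hn; rewrite unlock /Lnorm; case: ifPn => [m0|]; last first.
        by rewrite -leNgt measure_le0 => /eqP m0 _; apply: nearW => x; right.
      by move/ess_sup_inf.ess_supP; apply: filterS => x; left.
    have [m0|m0] := eqVneq (m1 setT) 0%E.
      by exists setT; split => //.
    apply: filterS hb => x [h|h]; last by rewrite h eqxx in m0.
    rewrite /large_part ifF ?powR0 ?gt_eqF//; apply/negbTE; rewrite -leNgt /g normrM.
    rewrite ger0_norm ?invr_ge0 ?mulr_ge0 ?(ltW n0) ?(ltW k0)// ler_pdivrMl ?mulr_gt0// mulr1.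
    by move: h; rewrite lee_fin => /le_trans; apply; rewrite ler_peMr// ltW.
  rewrite (ae_eq_integral (cst 0%E))//; first by rewrite integral0 lee_fin invr_ge0 ltW.
  by apply: filterS ae0 => x -> _.
have r0 : 0 < r by exact: lt_le_trans qr.
have hi : (\int[m1]_x (`|f x| `^ r)%:E <= (n `^ r)%:E)%E.
  have -> : (\int[m1]_x (`|f x| `^ r)%:E = 'N[m1]_r%:E[EFin \o f] `^ r)%E.
    by rewrite poweR_Lnorm ?gt_eqF//; apply: eq_integral.
  rewrite -poweR_EFin; apply: gt0_ler_poweR => //; first exact: ltW.
  - by rewrite in_itv/= Lnorm_ge0 leey.
  - by rewrite in_itv/= lee_fin ltW//= leey.
apply: (@le_trans _ _ (\int[m1]_x ((k^-1 * n `^ (- r))%:E * (`|f x| `^ r)%:E))%E).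
  apply: ge0_le_integral => //.
  - apply: measurable_funeM; apply/measurable_EFinP.
    by apply: (measurableT_comp (measurable_powR r)); exact: measurableT_comp.
  - by move=> x _; rewrite -EFinM lee_fin -mulrA; apply: large_part_powR_le.
rewrite ge0_integralZl//; last 2 first.
- by apply/measurable_EFinP; apply: (measurableT_comp (measurable_powR r)); exact: measurableT_comp.
- by rewrite lee_fin mulr_ge0 ?powR_ge0// invr_ge0 ltW.
apply: (@le_trans _ _ ((k^-1 * n `^ (- r))%:E * (n `^ r)%:E)%E).
  by rewrite lee_wpmul2l// lee_fin mulr_ge0 ?powR_ge0// invr_ge0 ltW.
by rewrite -EFinM -mulrA powRN mulVf ?mulr1// gt_eqF// powR_gt0.
Qed.

End large_part.

(** * Monotonicity, scaling and monotone limits of occupation times *)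

Section occupation_bounds.
Context {R : realType} {d : nat} {dO : measure_display} {Omega : measurableType dO}.
Local Notation E := 'rV[R]_d.
Local Notation TR := (measurableTypeR R).
Local Notation leb1 := (@lebesgue_measure R).
Context {M : process R d Omega} {mu : {measure set E -> \bar R}}
  {S P : R -> (E -> R) -> E -> R}.
Hypothesis hM : hunt_process M.
Hypothesis hP : transition_function M P.
Hypothesis hV : continuous_version mu S P.
Local Notation transition := (@transition R d dO Omega M).
Local Open Scope ereal_scope.
Implicit Types f g : E -> R.

Local Notation ind t := (\1_(`]0%R, t]%classic) : R -> R).

Lemma occupation_integrand (t : R) g x : measurable_fun setT g -> (forall y, (0 <= g y)%R) ->
  measurable_fun setT (fun s : TR => (ind t s)%:E * transition `|s|%R (EFin \o g) x) /\
  forall s, 0 <= (ind t s)%:E * transition `|s|%R (EFin \o g) x.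
Proof.
move=> mg g0; split=> [|s].
  have mp : measurable_fun setT (fun s : TR => (s, x)) by exact: measurable_pair2.
  apply: emeasurable_funM; first by apply/measurable_EFinP; exact: measurable_itv_indic.
  have mG : measurable_fun setT (EFin \o g) by exact/measurable_EFinP.
  have h := measurable_transition hM hP hV mG (fun y => g0 y : 0 <= (EFin \o g) y).
  exact: (measurableT_comp h mp).
by rewrite mule_ge0 ?lee_fin ?indicE//; apply: transition_ge0 => y; rewrite lee_fin.
Qed.

Lemma occupation_norm (t : R) g x : occupation M t (fun y => `|g y|%R) x = occupation M t g x.
Proof.
have e : (fun y => Num.norm (Num.norm (g y)))%R = (fun y => `|g y|)%R by apply/funext => y; rewrite normr_id.
by rewrite /occupation e.
Qed.

Lemma occupation_mono (t : R) f g x : measurable_fun setT f -> measurable_fun setT g ->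
  (forall y, 0 <= f y <= g y)%R -> occupation M t f x <= occupation M t g x.
Proof.
move=> mf mg fg; have f0 y : (0 <= f y)%R by case/andP: (fg y).
have g0 y : (0 <= g y)%R by case/andP: (fg y) => /le_trans; exact.
rewrite !(occupationE hM t x)//.
have [m1 p1] := occupation_integrand t x mf f0; have [m2 p2] := occupation_integrand t x mg g0.
apply: ge0_le_integral => // s _; apply: lee_wpmul2l; first by rewrite lee_fin indicE.
apply: ge0_le_integral => //.
- by move=> w _; apply: ext0e_ge0 => y; rewrite lee_fin.
- by apply: (measurable_ext0e_at hM) => //; exact/measurable_EFinP.
- by apply: (measurable_ext0e_at hM) => //; exact/measurable_EFinP.
- by move=> w _; case: (traj M _ w) => [y|] //=; rewrite lee_fin; case/andP: (fg y).
Qed.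

Lemma occupationZ (t k : R) g x : (0 <= k)%R -> measurable_fun setT g -> (forall y, (0 <= g y)%R) ->
  occupation M t (fun y => k * g y)%R x = k%:E * occupation M t g x.
Proof.
move=> k0 mg g0; have mG : measurable_fun setT (EFin \o g) by exact/measurable_EFinP.
have [m1 p1] := occupation_integrand t x mg g0.
rewrite !(occupationE hM t x)//; last first.
  by move=> y; rewrite mulr_ge0.
  exact: measurable_funM.
rewrite -ge0_integralZl//; apply: eq_integral => s _; rewrite muleCA; congr (_ * _).
by rewrite -(transitionZ hM x _ k0 mG)// => y; rewrite lee_fin.
Qed.

Lemma occupation1D (t : R) g x : (0 < t)%R -> measurable_fun setT g -> (forall y, (0 <= g y)%R) ->
  occupation M t (fun y => 1 + g y)%R x <= t%:E + occupation M t g x.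
Proof.
move=> t0 mg g0; have mG : measurable_fun setT (EFin \o g) by exact/measurable_EFinP.
have m1 : measurable_fun setT (fun _ : E => 1%R : R) by exact: measurable_cst.
have [mi1 p1] := occupation_integrand t x m1 (fun=> ler01).
have [mi2 p2] := occupation_integrand t x mg g0.
rewrite !(occupationE hM t x)//; last first.
  by move=> y; rewrite addr_ge0.
  exact: measurable_funD.
have [iI II] := integ_itv t0.
apply: (@le_trans _ _ (\int[leb1]_s ((ind t s)%:E * transition `|s|%R (fun=> 1%:E) x) +
    \int[leb1]_s ((ind t s)%:E * transition `|s|%R (EFin \o g) x))).
  rewrite -ge0_integralD// le_eqVlt; apply/orP; left; apply/eqP; apply: eq_integral => s _.
  rewrite -ge0_muleDr; last 2 first.
  - by apply: transition_ge0 => y; rewrite lee_fin.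
  - by apply: transition_ge0 => y; rewrite lee_fin.
  by congr (_ * _); rewrite -(transitionD hM x).
have tI : t%:E = \int[leb1]_s (ind t s)%:E by rewrite -(Int_EFin iI) II.
apply: leeD => //; rewrite [leRHS]tI; apply: ge0_le_integral => //.
- exact: measurable_int iI.
- move=> s _; rewrite -[leRHS]mule1; apply: lee_wpmul2l; first by rewrite lee_fin indicE.
  exact: (transition_le hM (f := fun=> 1%R) m1 (fun=> ler01) (fun=> lexx _) x).
Qed.

Lemma occupation_liminf (t : R) (gn : nat -> E -> R) g x (c : \bar R) :
  (forall n, measurable_fun setT (gn n)) -> (forall n y, (0 <= gn n y)%R) ->
  measurable_fun setT g -> (forall y, (0 <= g y)%R) ->
  (forall y, {homo gn^~ y : n m / (n <= m)%N >-> (n <= m)%R}) ->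
  (forall y, gn n y @[n --> \oo] --> g y) ->
  (forall n, occupation M t (gn n) x <= c) -> occupation M t g x <= c.
Proof.
move=> mgn gn0 mg g0 nd cg h; rewrite (occupationE hM t x)//.
apply: (@fatou_le _ _ _ leb1 (fun n s => (ind t s)%:E * transition `|s|%R (EFin \o gn n) x)).
- by move=> n; have [] := occupation_integrand t x (mgn n) (gn0 n).
- by move=> n; have [] := occupation_integrand t x (mgn n) (gn0 n).
- move=> s; apply: cvgeZl => //; apply: (transition_cvg hM) => //.
  + by move=> n; exact/measurable_EFinP.
  + by move=> y; apply: cvg_EFin; [exact: nearW|exact: cg].
- by move=> n; rewrite -(occupationE hM t x).
Qed.

End occupation_bounds.

(** * Occupation bounds in L^r *)

Section occupation_Lr.
Context {R : realType} {d : nat} {dO : measure_display} {Omega : measurableType dO}.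
Local Notation E := 'rV[R]_d.
Local Notation leb := (@leb R d).
Context {p q : R} {A C : E -> 'M[R]_d} {H : E -> E} {rho : E -> R}
  {M : process R d Omega} {mu : {measure set E -> \bar R}}
  {S P : R -> (E -> R) -> E -> R}.
Local Notation G := (drift A C H).
Hypothesis p2 : 2 <= p.
Hypothesis ha : assumption_a p A C H.
Hypothesis hb : assumption_b q G.
Hypothesis hrho : invariant_density p A G rho mu.
Hypothesis q1 : 1 < q.
Hypothesis d1 : (0 < d)%N.
Hypothesis eta0 : 0 < 2 / d%:R - q^-1.
Hypothesis hM : hunt_process M.
Hypothesis hP : transition_function M P.
Hypothesis hS : subMarkov_C0_contractions mu S.
Hypothesis hR : has_resolvent mu A (fun x => G x - log_drift A rho x) S.
Hypothesis hV : continuous_version mu S P.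

(** Decompose |g| <= 1 + large part. The constant 1 is occupied for at most time t <= e^t, which
    adds 1 to the constant; the large part is cut at height n to make it bounded and recovered by a
    monotone limit. *)
Lemma occupation_large_part (o : E) (a0 : R) : 0 <= a0 -> exists2 c : R, 0 < c &
  forall (g : E -> R), measurable_fun setT g ->
    (\int[mu]_x (large_part g x `^ q)%:E <= 1)%E ->
    forall t x, 0 < t -> sqd o x < a0 -> (occupation M t g x <= (expR t * c)%:E)%E.
Proof.
have powR0q : 0 `^ q = 0 :> R by rewrite powR0// gt_eqF// (lt_trans ltr01).
move=> a00; have [c c0 hc] := occupation_locally_bounded p2 ha hb hrho q1 d1 eta0 hM hP hS hR hV o a00.
exists (1 + c); first by rewrite addr_gt0.
move=> g mg gi t x t0 xo; rewrite -occupation_norm.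
have mn : measurable_fun setT (fun y => `|g y|) by exact: measurableT_comp.
have ml := measurable_large_part mg; have l0 := large_part_ge0 g.
pose gn (n : nat) y := Num.min (large_part g y) n%:R.
have mgn n : measurable_fun setT (gn n) by apply: measurable_minr => //; exact: measurable_cst.
have gn0 n y : 0 <= gn n y by rewrite le_min l0 ler0n.
have gnl n y : gn n y <= large_part g y by rewrite ge_min lexx.
have q0 : 0 <= q by rewrite ltW// (lt_trans ltr01).
have mpw (h : E -> R) : measurable_fun setT h -> measurable_fun setT (fun y => h y `^ q).
  by move=> mh; apply: (measurableT_comp (measurable_powR q)).
have i2 : integ mu (fun y => large_part g y `^ q).
  apply/integrableP; split; first by apply/measurable_EFinP; exact: mpw.
  under eq_integral do rewrite /= ger0_norm ?powR_ge0//.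
  exact: le_lt_trans gi (ltry _).
have I2 : \int[mu]_y (large_part g y `^ q) <= 1 by rewrite -lee_fin (Int_EFin i2).
have gq n y : gn n y `^ q <= large_part g y `^ q by apply: ge0_ler_powR; rewrite ?nnegrE.
have gl n y : gn n y <= large_part g y `^ q.
  by apply: le_trans (gnl n y) _; exact: large_part_le_powR (ltW q1).
have i3 n : integ mu (gn n).
  by apply: (integ_le (mgn n) i2) => y; rewrite ger0_norm.
have i4 n : integ mu (fun y => gn n y `^ q).
  by apply: (integ_le (mpw _ (mgn n)) i2) => y; rewrite ger0_norm ?powR_ge0.
have gnK n y : gn n y <= n%:R by rewrite ge_min lexx orbT.
have J1 n : \int[mu]_y gn n y <= 1 by exact: le_trans (Int_le (i3 n) i2 (gl n)) I2.
have J2 n : \int[mu]_y (gn n y `^ q) <= 1 by exact: le_trans (Int_le (i4 n) i2 (gq n)) I2.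
have occn n : (occupation M t (gn n) x <= (expR t * c)%:E)%E.
  exact: (hc (gn n) n%:R (mgn n) (gn0 n) (gnK n) (i3 n) (J1 n) (i4 n) (J2 n) t x t0 xo).
have occl : (occupation M t (large_part g) x <= (expR t * c)%:E)%E.
  apply: (occupation_liminf hM hP hV (gn := gn)) => //.
    by move=> y n m nm; rewrite le_min !ge_min lexx/= ler_nat nm orbT.
  move=> y; apply: cvg_near_cst; exists (Num.trunc (large_part g y)).+1 => // n /= Hn.
  apply/min_idPl; apply: ltW; apply: lt_le_trans (truncnS_gt _) _.
  by rewrite ler_nat.
apply: (@le_trans _ _ (occupation M t (fun y => 1 + large_part g y)%R x)).
  apply: (occupation_mono hM hP hV) => //; first exact: measurable_funD.
  by move=> y; rewrite normr_ge0 norm_le_large_part.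
apply: (le_trans (occupation1D hM hP hV x t0 ml l0)).
rewrite mulrDr mulr1 EFinD; apply: leeD => //; rewrite lee_fin.
by apply: le_trans (expR_ge1Dx t); rewrite lerDr.
Qed.

(** Homogeneity: the unit bound is applied to f / (n k) for any positive n at least as large as the
    norm. *)
Lemma occupation_Lr_bound (o : E) (a0 : R) : 0 <= a0 -> exists2 c : R, 0 < c &
  forall (r : \bar R) (m1 : {measure set E -> \bar R}) (kap : R) (f : E -> R),
  0 < kap -> (q%:E <= r)%E -> f \in Lfun m1 r ->
  (forall h : E -> \bar R, measurable_fun setT h -> (forall x, 0 <= h x)%E ->
    (forall x, f x = 0%R -> h x = 0%E) -> \int[mu]_x h x <= kap%:E * \int[m1]_x h x)%E ->
  forall t x, 0 < t -> sqd o x < a0 ->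
  (occupation M t f x <= (expR t * c * Num.max 1 kap)%:E * 'N[m1]_r[EFin \o f])%E.
Proof.
have alg (n e k : R) : n * (e * k) = n * k * e by ring.
move=> a00; have [c c0 hc] := occupation_large_part o a00.
exists c => // r m1 kap f kap0 qr Lf hm t x t0 xo; set k := Num.max 1 kap.
have k1 : 1 <= k by rewrite le_max lexx.
have k0 : 0 < k by exact: lt_le_trans k1.
have mf : measurable_fun setT f by move: Lf; rewrite inE => /andP[/[!inE]/=].
have Nf : ('N[m1]_r[EFin \o f] < +oo)%E by move: Lf; rewrite inE => /andP[_] /[!inE]/=.
have N0 := Lnorm_ge0 m1 r (EFin \o f).
have bound n : 0 < n -> ('N[m1]_r[EFin \o f] <= n%:E)%E ->
    (occupation M t f x <= (n * (expR t * c * k))%:E)%E.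
  move=> n0 hn; have nk : 0 < n * k by rewrite mulr_gt0.
  have hl := large_part_norm kap0 n0 (ltW q1) qr mf hm hn.
  have mg : measurable_fun setT (fun y => (n * k)^-1 * f y) by exact: measurable_funM.
  have h1 := hc _ mg hl t x t0 xo.
  have mng : measurable_fun setT (fun y => `|(n * k)^-1 * f y|) by exact: measurableT_comp.
  rewrite -occupation_norm in h1; rewrite -occupation_norm.
  have -> : (fun y => `|f y|) = (fun y => n * k * `|(n * k)^-1 * f y|).
    apply/funext => y; rewrite normrM ger0_norm ?invr_ge0 ?ltW// mulrA mulfV ?mul1r//.
    by rewrite gt_eqF.
  rewrite (occupationZ hM hP hV t x (ltW nk) mng)//.
  rewrite alg.
  by rewrite (EFinM (n * k) (expR t * c)); apply: lee_wpmul2l => //; rewrite lee_fin ltW.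
have b0 : 0 <= expR t * c * k by rewrite !mulr_ge0 ?expR_ge0 ?ltW.
move: N0 Nf bound; case: ('N[m1]_r[EFin \o f])%E => [nu| |]//; rewrite lee_fin => nu0 _ bound.
(* The norm may be 0, so f is scaled by slightly more than the norm and the excess is sent to 0. *)
apply/lee_addgt0Pr => e e0; rewrite -EFinM.
have e'0 : 0 < e / (expR t * c * k + 1) by rewrite divr_gt0// ltr_wpDl.
apply: (le_trans (bound (nu + e / (expR t * c * k + 1)) _ _)).
- by rewrite ltr_wpDl.
- by rewrite lee_fin lerDl ltW.
rewrite -EFinD lee_fin mulrDl mulrC lerD2l mulrAC ler_pdivrMr ?ltr_wpDl//.
by rewrite mulrDr mulr1 lerDl ltW.
Qed.

End occupation_Lr.

(** * Vanishing outside the essential support *)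

Section ess_support.
Context {R : realType} {d : nat}.
Local Notation E := 'rV[R]_d.
Local Notation leb := (@leb R d).

(** Each point outside has a neighbourhood where f vanishes almost everywhere, and it contains a
    rational cube around the point; countably many such cubes contribute countably many null
    sets. *)
Lemma ae_ess_support (f : E -> R) : \forall y \ae leb, ~ ess_support f y -> f y = 0.
Proof.
pose cub (k : nat) : set E := if (unpickle k : option ('rV[rat]_d * nat)) is Some c then
  cube (\row_i ratr (c.1 0 i)) c.2.+1%:R^-1 else set0.
have h k : \forall y \ae leb, (\forall z \ae leb, cub k z -> f z = 0) -> cub k y -> f y = 0.
  have [H|nH] := pselect (\forall z \ae leb, cub k z -> f z = 0); last by apply: nearW => y.
  by apply: filterS H => y h _.
apply: filterS (ae_foralln h) => y hy ny; apply: contrapT => fy; apply: ny => U Uy hU.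
have Uy' : U^° y by exact: Uy.
have [c [n [cU yc]]] := open_cube (@open_interior _ U) Uy'.
have ce : cub (pickle (c, n)) = cube (\row_i ratr (c 0 i)) n.+1%:R^-1.
  by rewrite /cub pickleK.
apply: fy; apply: (hy (pickle (c, n))); rewrite ce.
  apply: filterS hU => z hz cz; apply: hz; exact: (interior_subset (cU _ cz)).
by move=> i; exact/ltW.
Qed.

End ess_support.

(** * Comparison of mu with Lebesgue measure *)

Section comparison.
Context {R : realType} {d : nat}.
Local Notation E := 'rV[R]_d.
Local Notation leb := (@leb R d).
Context {p : R} {A C : E -> 'M[R]_d} {H : E -> E} {rho : E -> R}
  {mu : {measure set E -> \bar R}}.
Hypothesis hrho : invariant_density p A (drift A C H) rho mu.

Lemma eball_sqd (z : E) (b : R) : eball z b = [set x | sqd z x < b ^+ 2].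
Proof. by []. Qed.

(** The margin 1 places the closed ball in an open one, where the bound on the occupation time is
    available at every point. *)
Lemma closure_eball (z : E) (b : R) x : closure (eball z b) x -> sqd z x < b ^+ 2 + 1.
Proof.
move=> cx; apply: (@le_lt_trans _ _ (b ^+ 2)); last by rewrite ltrDl.
have cl : closed [set y : E | sqd z y <= b ^+ 2].
  by apply: compact_closed; [exact: norm_hausdorff|exact: sqd_compact].
apply: (cl x); move: cx; apply: closure_subset => y; rewrite eball_sqd /=; exact: ltW.
Qed.

Lemma ess_bound (V : set E) (k : R) : measurable V ->
  ('N[leb]_+oo[EFin \o (rho \_ V)] = k%:E)%E -> \forall x \ae leb, V x -> rho x <= k.
Proof.
move=> mV; rewrite unlock /Lnorm; case: ifPn => [_ hk|n0 _].
  have : (ess_sup_inf.ess_sup leb (abse \o (EFin \o (rho \_ V))) <= k%:E)%E by rewrite hk.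
  move/ess_sup_inf.ess_supP; apply: filterS => x + Vx.
  by rewrite /= patchE mem_set// lee_fin; apply: le_trans; exact: ler_norm.
have : (0 < leb setT)%E by apply: (@leb_open_gt0 R d setT 0) => //; exact: openT.
by rewrite (negbTE n0).
Qed.

(** Where rho is not bounded by k, f and with it h vanishes almost everywhere, so the density may be
    replaced by k. *)
Lemma mu_le_leb (V : set E) (f : E -> R) (k : R) : 0 <= k ->
  (\forall x \ae leb, V x -> rho x <= k) -> (\forall x \ae leb, ~ V x -> f x = 0) ->
  forall h : E -> \bar R, measurable_fun setT h -> (forall x, 0 <= h x)%E ->
    (forall x, f x = 0%R -> h x = 0%E) -> (\int[mu]_x h x <= k%:E * \int[leb]_x h x)%E.
Proof.
move=> k0 hV hf h mh h0 hz.
have mr := rho_measurable hrho.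
have r0 x : 0 <= rho x by exact: ltW (rho_gt0 hrho x).
rewrite (ge0_integral_density mr r0 (mu_density hrho) mh h0).
rewrite -ge0_integralZl//; apply: ae_ge0_le_integral => //.
- by move=> x _; rewrite mule_ge0// lee_fin.
- by apply: emeasurable_funM => //; exact/measurable_EFinP.
- by move=> x _; rewrite mule_ge0.
- exact: measurable_funeM.
- apply: filterS2 hV hf => x h1 h2 _; have [Vx|nV] := pselect (V x).
    by rewrite muleC; apply: lee_wpmul2r => //; rewrite lee_fin h1.
  by rewrite (hz x (h2 nV)) mul0e mule0.
Qed.

Lemma ess_bound_gt0 (z : E) (b k : R) : 0 < b ->
  (\forall x \ae leb, eball z b x -> rho x <= k) -> 0 < k.
Proof.
move=> b0 h; have [||y Vy hy] := @ae_open_exists R d (eball z b) _ z _ _ h.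
- by rewrite eball_sqd; exact: open_sqd_lt.
- by rewrite eball_sqd /= sqdE big1 ?exprn_gt0// => i _; rewrite subrr expr0n.
- by apply: lt_le_trans (hy Vy); exact: (rho_gt0 hrho).
Qed.

Lemma Lnorm_restrict_ball (z : E) (b : R) : 0 < b ->
  exists2 k : R, 0 < k & ('N[leb]_+oo[EFin \o (rho \_ (eball z b))] = k%:E)%E.
Proof.
move=> b0; set N := ('N[leb]_+oo[_])%E.
have cr : continuous rho by exact: (rho_continuous hrho).
have [K K0 hK] := compact_bounded_cont (@sqd_compact R d z (b ^+ 2)) cr.
have mV : measurable (eball z b) by apply: measurable_open_rV; rewrite eball_sqd; exact: open_sqd_lt.
have NK : (N <= K%:E)%E.
  rewrite /N unlock /Lnorm; case: ifPn => // _; last by rewrite lee_fin ltW.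
  apply/ess_sup_inf.ess_supP; apply: nearW => x; rewrite /= patchE lee_fin.
  case: ifPn => [|_]; first by rewrite inE eball_sqd => /ltW; exact: hK.
  by have -> : (point : R) = 0 by []; rewrite normr0 ltW.
have N0 : (0 <= N)%E by exact: Lnorm_ge0.
have Nf : (N \is a fin_num)%E by rewrite ge0_fin_numE// (le_lt_trans NK (ltry _)).
exists (fine N); last by rewrite fineK.
by apply: (ess_bound_gt0 (z := z) b0); apply: ess_bound => //; rewrite -/N fineK.
Qed.

End comparison.

Lemma exponent_ge2 {R : realType} (d : nat) (p : R) : (2 <= d)%N -> d%:R < p -> 2 <= p.
Proof. by move=> d2 dp; apply: le_trans (ltW dp); rewrite ler_nat. Qed.

Lemma sobolev_exponent_gt1 {R : realType} (d : nat) (p : R) : (2 <= d)%N -> d%:R < p ->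
  1 < p * d%:R / (p + d%:R).
Proof.
have alg (e a : R) : 2 <= e -> e < a -> a + e < a * e by nra.
move=> d2 dp; have e2 : 2 <= d%:R :> R by rewrite ler_nat.
have e0 : 0 < d%:R :> R by exact: lt_le_trans e2.
have h : 0 < p + d%:R by rewrite addr_gt0// (lt_trans e0).
by rewrite ltr_pdivlMr// mul1r alg.
Qed.

(** Here 1/q = 1/d + 1/p, so the difference is 1/d - 1/p. *)
Lemma sobolev_exponent_gain {R : realType} (d : nat) (p : R) : (2 <= d)%N -> d%:R < p ->
  0 < 2 / d%:R - (p * d%:R / (p + d%:R))^-1.
Proof.
move=> d2 dp; have d0 : 0 < d%:R :> R by rewrite ltr0n (leq_trans _ d2).
have p0 : 0 < p by exact: lt_trans dp.
have -> : 2 / d%:R - (p * d%:R / (p + d%:R))^-1 = d%:R^-1 - p^-1.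
  by move: (d%:R) d0 => e e0; field; rewrite !gt_eqF// addr_gt0.
by rewrite subr_gt0 ltf_pV2.
Qed.

Unset Implicit Arguments.
Set Strict Implicit.

Theorem theorem3p14 (R : realType) (d : nat) (p q : R)
  (A C : 'rV[R]_d -> 'M[R]_d) (H : 'rV[R]_d -> 'rV[R]_d)
  (rho : 'rV[R]_d -> R) (mu : {measure set 'rV[R]_d -> \bar R})
  (Tbar P : R -> ('rV[R]_d -> R) -> 'rV[R]_d -> R)
  (dO : measure_display) (Omega : measurableType dO)
  (M : process R d Omega) :
  let G := drift A C H in
  (2 <= d)%N -> d%:R < p -> q = p * d%:R / (p + d%:R) ->
  assumption_a p A C H ->
  assumption_b q G ->
  invariant_density p A G rho mu ->
  subMarkov_C0_contractions mu Tbar ->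
  has_resolvent mu A (fun x => G x - log_drift A rho x) Tbar ->
  continuous_version mu Tbar P ->
  hunt_process M ->
  transition_function M P ->
  forall (z : 'rV[R]_d) (b : R), 0 < b ->
  let B := eball z b in
  (forall r : \bar R, (q%:E <= r)%E ->
     exists2 c : R, occupation_constant M mu B r c &
       rho \in Lfun (@leb R d) +oo%E ->
       forall (t : R) f, 0 < t -> f \in Lfun (@leb R d) r ->
       (sup_occupation M B t f <=
        (expR t * c)%:E * 'N[@leb R d]_+oo[EFin \o rho] *
        'N[@leb R d]_r[EFin \o f])%E) /\
  (forall (z' : 'rV[R]_d) (b' : R), 0 < b' ->
     let V := eball z' b' in
     exists2 c : R, occupation_constant M mu B q%:E c &
       forall (t : R) f, 0 < t -> f \in Lfun (@leb R d) q%:E ->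
       ess_support f `<=` V ->
       (sup_occupation M B t f <=
        (expR t * c)%:E * 'N[@leb R d]_+oo[EFin \o (rho \_ V)] *
        'N[@leb R d]_(q%:E)[EFin \o f])%E).
Proof.
have alg (e a k l : R) : l != 0 -> e * a * k = e * (a * (k / l)) * l.
  by move=> l0; field.
move=> G d2 dp qE ha hb hrho hS hR hV hM hP z b b0 B.
have p2 := exponent_ge2 d2 dp.
have q1 : 1 < q by rewrite qE; exact: sobolev_exponent_gt1.
have eta0 : 0 < 2 / d%:R - q^-1 by rewrite qE; exact: sobolev_exponent_gain.
have d1 : (0 < d)%N by exact: leq_trans d2.
have a00 : 0 <= b ^+ 2 + 1 by rewrite addr_ge0// sqr_ge0.
have [c c0 hc] := occupation_Lr_bound p2 ha hb hrho q1 d1 eta0 hM hP hS hR hV z a00.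
have sup_le (r : \bar R) (m1 : {measure set 'rV[R]_d -> \bar R}) (kap : R) (f : 'rV[R]_d -> R) :
    0 < kap -> (q%:E <= r)%E -> f \in Lfun m1 r ->
    (forall h : 'rV[R]_d -> \bar R, measurable_fun setT h -> (forall x, 0 <= h x)%E ->
      (forall x, f x = 0%R -> h x = 0%E) -> \int[mu]_x h x <= kap%:E * \int[m1]_x h x)%E ->
    forall t, 0 < t ->
    (sup_occupation M B t f <= (expR t * c * Num.max 1 kap)%:E * 'N[m1]_r[EFin \o f])%E.
  move=> k0 qr Lf hk t t0; apply: ge_ereal_sup => _ [x Bx <-].
  exact: (hc r m1 kap f k0 qr Lf hk t x t0 (closure_eball Bx)).
have occ (c' : R) r : c <= c' -> (q%:E <= r)%E -> occupation_constant M mu B r c'.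
  move=> cc qr; split=> [|t f t0 Lf]; first exact: lt_le_trans cc.
  apply: le_trans (sup_le r mu 1 f ltr01 qr Lf _ t t0) _ => [h _ _ _|]; first by rewrite mul1e.
  rewrite maxxx mulr1; apply: lee_wpmul2r; first exact: Lnorm_ge0.
  by rewrite lee_fin ler_wpM2l ?expR_ge0.
(* The bound obtained carries max(1, k), whereas the claim asks for a factor k. The quotient goes
   into the constant, and being at least 1 it leaves the enlarged constant valid for mu as well. *)
have larger k : 0 < k -> c <= c * (Num.max 1 k / k).
  by move=> k0; rewrite ler_peMr ?(ltW c0)// ler_pdivlMr// mul1r le_max lexx orbT.
have conclude (V : set 'rV[R]_d) (r : \bar R) (k : R) (f : 'rV[R]_d -> R) (t : R) : 0 < k ->
    (\forall x \ae @leb R d, V x -> rho x <= k) -> (\forall x \ae @leb R d, ~ V x -> f x = 0) ->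
    (q%:E <= r)%E -> f \in Lfun (@leb R d) r -> 0 < t ->
    (sup_occupation M B t f <=
      (expR t * (c * (Num.max 1 k / k)))%:E * k%:E * 'N[@leb R d]_r[EFin \o f])%E.
  move=> k0 hV' hf qr Lf t0; rewrite -EFinM -alg ?gt_eqF//.
  exact: (sup_le r (@leb R d) k f k0 qr Lf (mu_le_leb hrho (ltW k0) hV' hf) t t0).
split=> [r qr|z' b' b'0 V].
  (* The constant may depend on rho: if rho is not essentially bounded, the Lebesgue bound is void
     and c itself serves. *)
  have [Lr|nL] := pselect (rho \in Lfun (@leb R d) +oo%E); last by exists c; [exact: occ|].
  set N := ('N[@leb R d]_+oo[EFin \o rho])%E.
  have Nf : (N \is a fin_num)%E.
    by rewrite ge0_fin_numE ?Lnorm_ge0//; move: Lr; rewrite inE => /andP[_] /[!inE]/=.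
  have Ne : ('N[@leb R d]_+oo[EFin \o (rho \_ setT)] = (fine N)%:E)%E by rewrite patch_setT fineK.
  have hk : \forall x \ae @leb R d, setT x -> rho x <= fine N := ess_bound measurableT Ne.
  have k0 : 0 < fine N.
    by apply: (ess_bound_gt0 hrho (z := z) b0); apply: filterS hk => x h _; exact: h.
  exists (c * (Num.max 1 (fine N) / fine N)); first by apply: occ => //; exact: larger.
  move=> _ t f t0 Lf; rewrite -(fineK Nf).
  by apply: (conclude setT) => //; apply: nearW => x /(_ Logic.I).
have [k k0 Nk] := Lnorm_restrict_ball hrho z' b'0.
have mV : measurable V by apply: measurable_open_rV; exact: open_sqd_lt.
exists (c * (Num.max 1 k / k)); first by apply: occ => //; exact: larger.
move=> t f t0 Lf sf; rewrite Nk; apply: (conclude V) => //; first exact: ess_bound mV Nk.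
by apply: filterS (ae_ess_support f) => x h nV; apply: h => /sf.
Qed.
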